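(* Assume (A1), (A2), (A3), (A4) and the conditions (C-i), (C-ii) (see context), and let $\xi\in L^2_{\mathscr F_0}$. Let $(Y,P,Q,R,u)\in(\mathcal S^2_{\mathscr F}\times\mathcal S^2_{\mathscr F}\times\mathcal M^2_{\mathscr F}\times\mathcal K^2_{\mathscr F,\lambda}\times\mathcal M^2_{\mathscr F})(0,T)$ be the (unique) solution of the system (FBSDE) of the context. Then $u\in\mathcal M^2_{\mathscr F}(0,T)$ is the unique optimal control for the mean field type control problem $$(\mathbf P^{0,\xi}):\qquad\inf_{v\in\mathcal M^2_{\mathscr F}(0,T)}J(v),\qquad J(v)=\mathbb E\Big[\int_0^Tf(t,X^v_t,\mathcal L(X^v_t),v_t)dt+g(X^v_T,\mathcal L(X^v_T))\Big],$$ where $X^v_t=\xi+\int_0^tb(s,X^v_s,\mathcal L(X^v_s),v_s)ds+\int_0^t\sigma(s,X^v_s,\mathcal L(X^v_s),v_s)dB_s+\int_0^t\int_E\gamma(s,X^v_{s-},\mathcal L(X^v_{s-}),v_s,e)\mathring N(de,ds)$, $t\in[0,T]$.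
   Context: Setting and notation. $T>0$. $(\Omega,\mathscr F,\{\mathscr F_t\}_{0\le t\le T},\mathbb P)$ is a complete filtered probability space, the filtration being augmented by the $\mathbb P$-null sets, carrying two independent $\mathscr F_t$-adapted processes whose increments after time $t$ are independent of $\mathscr F_t$ for each $t\in[0,T)$: an $n$-dimensional Brownian motion $B=(B^1,\dots,B^n)$ and a right-continuous Poisson random measure $N$ on $E=\mathbb R^{\kappa}\setminus\{0\}$ with intensity $\lambda(de)dt$, where $\lambda$ is a $\sigma$-finite measure on $(E,\mathcal B(E))$ with $\lambda(E)<\infty$ and $\int_E(1+|e|^2)\lambda(de)<\infty$; $\mathring N(de,dt)=N(de,dt)-\lambda(de)dt$. $\mathcal L(\xi)$ is the law of $\xi$, $\|\xi\|_2$ its $L^2(\Omega)$-norm, $L^2_{\mathscr F_t}$ the set of square-integrable $\mathscr F_t$-measurable $\mathbb R^n$-valued random vectors. With values in the appropriate Euclidean space ($\mathbb R^d$ for controls, $\mathbb R^{n\times n}$ for $Q$ with columns $Q^j$, $\mathbb R^n$ for $Y,P,R$): $\mathcal M^2_{\mathscr F}(0,T)$ = predictable processes with $\mathbb E\int_0^T|\alpha_r|^2dr<\infty$; $\mathcal S^2_{\mathscr F}(0,T)$ = adapted càdlàg processes with $\mathbb E\sup_r|\alpha_r|^2<\infty$; $L^2_\lambda(E)$ = measurable $h$ on $E$ with $\|h\|^2_{L^2_\lambda}=\int_E|h|^2d\lambda<\infty$; $\mathcal K^2_{\mathscr F,\lambda}(0,T)$ = predictable fields $k(r,e)$ (measurable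 w.r.t. predictable $\sigma$-field $\otimes\,\mathcal B(E)$) with $\mathbb E\int_0^T\|k(r,\cdot)\|^2_{L^2_\lambda}dr<\infty$. $\mathcal P_2(\mathbb R^n)$: probability measures with finite second moment, with the 2-Wasserstein metric $W_2$; $|m|_1=\int|x|m(dx)$, $|m|_2=(\int|x|^2m(dx))^{1/2}$. The linear functional-derivative of $k:\mathcal P_2(\mathbb R^n)\to\mathbb R$ is a jointly continuous $(m,y)\mapsto\frac{dk}{d\nu}(m)(y)$ with $\int|\frac{dk}{d\nu}(m)(y)|^2m(dy)\le c(m)$ ($c$ bounded on bounded sets) and $\lim_{\epsilon\to0}\epsilon^{-1}[k((1-\epsilon)m+\epsilon m')-k(m)]=\int\frac{dk}{d\nu}(m)(y)(m'-m)(dy)$ for all $m'$; $D_y$ is the gradient in $y$. Hats denote a (joint) independent copy, $\widehat{\mathbb E}$ the expectation over the copy only. Coefficients: $b:[0,T]\times\mathbb R^n\times\mathcal P_2(\mathbb R^n)\times\mathbb R^d\to\mathbb R^n$, $\sigma=(\sigma^1,\dots,\sigma^n)$ with values in $\mathbb R^{n\times n}$ (columns $\sigma^j$), $\gamma$ with values in $\mathbb R^n$ and additional argument $e\in E$, $f$ with values in $\mathbb R$, $g:\mathbb R^n\times\mathcal P_2(\mathbb R^n)\to\mathbb R$. $L>0$ is a constant. Lagrangian: $\Lambda(t,x,m,v,p,q,r)=f(t,x,m,v)+b(t,x,m,v)^\top p+\sum_{j=1}^n\sigma^j(t,x,m,v)^\top q^j+\int_E\gamma(t,x,m,v,e)^\top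 r(e)\lambda(de)$. (FBSDE) With $\theta_t=(Y_t,\mathcal L(Y_t),u_t)$, $\theta_{t-}=(Y_{t-},\mathcal L(Y_{t-}),u_t)$, $\widehat{\theta_t}=(\widehat{Y_t},\mathcal L(Y_t),\widehat{u_t})$, for $t\in[0,T]$: $Y_t=\xi+\int_0^tb(s,\theta_s)ds+\int_0^t\sigma(s,\theta_s)dB_s+\int_0^t\int_E\gamma(s,\theta_{s-},e)\mathring N(de,ds)$; $P_t=g_x(Y_T,\mathcal L(Y_T))+\widehat{\mathbb E}[D_y\frac{dg}{d\nu}(\widehat{Y_T},\mathcal L(Y_T))(Y_T)]+\int_t^T\{\Lambda_x(s,\theta_s,P_s,Q_s,R_s)+\widehat{\mathbb E}[D_y\frac{d\Lambda}{d\nu}(s,\widehat{\theta_s},\widehat{P_s},\widehat{Q_s},\widehat{R_s})(Y_s)]\}ds-\int_t^TQ_sdB_s-\int_t^T\int_ER_s(e)\mathring N(de,ds)$; $\Lambda_v(t,\theta_{t-},P_{t-},Q_t,R_t)=0$. Assumptions. (A1) $b,\sigma,\gamma$ are continuous with $|b|,|\sigma^j|,\|\gamma(t,x,m,v,\cdot)\|_{L^2_\lambda}\le L(1+|x|+|m|_2+|v|)$, differentiable in $(x,v)$ and linearly functional-differentiable in $m$; the derivatives $\phi_x,\phi_v,D_y\frac{d\phi}{d\nu}$, $\phi=b,\sigma,\gamma$, are continuous and bounded in norm by $L$ ($L^2_\lambda$-norm for $\gamma$). (A2) $f,g$ are continuous with quadratic growth in $(x,m,v)$, differentiable in $(x,v)$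 and linearly functional-differentiable in $m$, with $|(f_x,f_v)|\le L(1+|x|+|m|_2+|v|)$, $|g_x|\le L(1+|x|+|m|_2)$, $|D_y\frac{df}{d\nu}(t,x,m,v)(y)|\le L(1+|x|+|m|_2+|v|+|y|)$, $|D_y\frac{dg}{d\nu}(x,m)(y)|\le L(1+|x|+|m|_2+|y|)$, these derivatives being $L$-Lipschitz in $(x,m,v,y)$. (A3) $d=\sum_{j=0}^nd_j$ with integers $d_0>0$, $d_1,\dots,d_n\ge0$; $v=(v^0,\dots,v^n)$, $v^j\in\mathbb R^{d_j}$; $J=\{0\}\cup\{1\le j\le n:d_j>0\}$; $l$ is the number of $j\in\{1,\dots,n\}$ with $d_j>0$. There are maps $A^j:[0,T]\times\mathbb R^n\times\mathcal P_2(\mathbb R^n)\times\mathbb R^{d_j}\to\mathbb R^n$, $j\in J$, with $b(t,x,m,v)=A^0(t,x,m,v^0)$ and $\sigma^j(t,x,m,v)=A^j(t,x,m,v^j)$ for $j\in J$, $j\ge1$, each satisfying the requirements of (A1), and constants $0\le L_0,L_1,L_2\le L$, $\lambda_0>0$ such that for all $j\in J$ and all arguments, with $\Delta_j:=1+|x|\vee|x'|+|m|_1\vee|m'|_1+|v^j|\vee|v'^j|$: $|A^j_x(t,x',m',v'^j)-A^j_x(t,x,m,v^j)|\le\Delta_j^{-1}(L_0|x'-x|+L_0W_2(m,m')+L_1|v'^j-v^j|)$; $|D_y\frac{dA^j}{d\nu}(t,x',m',v'^j)(y')-D_y\frac{dA^j}{d\nu}(t,x,m,v^j)(y)|\le\Delta_j^{-1}(L_0|x'-x|+L_0W_2(m,m')+L_0|y'-y|+L_1|v'^j-v^j|)$;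 $|A^j_{v^j}(t,x',m',v'^j)-A^j_{v^j}(t,x,m,v^j)|\le\Delta_j^{-1}(L_1|x'-x|+L_1W_2(m,m')+L_2|v'^j-v^j|)$; $A^j_{v^j}(A^j_{v^j})^\top(t,x,m,v^j)\ge\lambda_0I_n$. For $1\le j\le n$ with $d_j=0$: $\sigma^j(t,x,m)=\sigma^j_0(t)+\sigma^j_1(t)x+\sigma^j_2(t)\int y\,m(dy)$ with deterministic coefficients bounded in norm by $L$. $\gamma(t,x,m,e)=\gamma_0(t,e)+\gamma_1(t,e)x+\gamma_2(t,e)\int y\,m(dy)$ (independent of $v$) with $\|\gamma_i(t,\cdot)\|_{L^2_\lambda}\le L$. $f(t,x,m,v)=\sum_{j=0}^nf^j(t,x,m,v^j)$ with $|(f^j_x,f^j_{v^j})|\le L(1+|x|+|m|_1+|v^j|)$, $|D_y\frac{df^j}{d\nu}(t,x,m,v^j)(y)|\le L(1+|x|+|m|_1+|v^j|+|y|)$, these derivatives being $L$-Lipschitz in $(x,m,v^j,y)$. (A4) There are $\lambda_v>0$ and $\lambda_x,\lambda_m$ with $\lambda_x+\lambda_m>0$ such that for all $t\in[0,T]$, $x,x'\in\mathbb R^n$, $v,v'\in\mathbb R^d$, $\xi,\xi'\in L^2(\Omega,\mathscr F,\mathbb P;\mathbb R^n)$: $f(t,x',\mathcal L(\xi'),v')-f(t,x,\mathcal L(\xi),v)\ge f_x(t,x,\mathcal L(\xi),v)^\top(x'-x)+f_v(t,x,\mathcal L(\xi),v)^\top(v'-v)+\mathbb E[(D_y\frac{df}{d\nu}(t,x,\mathcal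 L(\xi),v)(\xi))^\top(\xi'-\xi)]+\lambda_v|v'-v|^2+\lambda_x|x'-x|^2+\lambda_m\|\xi'-\xi\|_2^2$; $g(x',\mathcal L(\xi'))-g(x,\mathcal L(\xi))\ge g_x(x,\mathcal L(\xi))^\top(x'-x)+\mathbb E[(D_y\frac{dg}{d\nu}(x,\mathcal L(\xi))(\xi))^\top(\xi'-\xi)]$; and for $m\in\mathcal P_2(\mathbb R^n)$, $y,y'\in\mathbb R^n$: $\frac{df}{d\nu}(t,x,m,v)(y')-\frac{df}{d\nu}(t,x,m,v)(y)\ge(D_y\frac{df}{d\nu}(t,x,m,v)(y))^\top(y'-y)$ and $\frac{dg}{d\nu}(x,m)(y')-\frac{dg}{d\nu}(x,m)(y)\ge(D_y\frac{dg}{d\nu}(x,m)(y))^\top(y'-y)$. (C-i) $2\lambda_v>\frac{L^2L_2}{\lambda_0}$. (C-ii) $\big(2\lambda_v-\frac{L^2L_2}{\lambda_0}\big)\big[2\lambda_x+2\lambda_m-\frac{5(l+1)L^2L_0}{\lambda_0}\big]>\frac{4(l+1)L^4L_1^2}{\lambda_0^2}$. *)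

(* Defs.v *)
From HB Require Import structures.
From mathcomp Require Import all_boot all_order all_algebra.
From mathcomp Require Import all_classical all_reals all_analysis.
From mathcomp Require Import measurable_realfun.
Set Implicit Arguments.
Unset Strict Implicit.
Unset Printing Implicit Defensive.
Import Order.TTheory GRing.Theory Num.Theory.
Import numFieldNormedType.Exports.
Local Open Scope classical_set_scope.
Local Open Scope ring_scope.

(* R^n is 'cV[R]_n.  The library norm on matrices is the max norm (only the
   topology matters for limits and differentiability), so the Euclidean norm
   [enorm] and the induced operator norm [opnorm] are defined here. *)

Definition mx_display (d : measure_display) : measure_display.
Proof. exact: d. Qed.

(* Borel sets of a matrix space, generated by the coordinate maps. *)
Section mx_measurable.
Context {d} {T : measurableType d} (m n : nat).

Definition mx_cylinders : set (set 'M[T]_(m, n)) :=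
  [set C | exists i j U, measurable U /\ C = [set A : 'M[T]_(m, n) | U (A i j)]].

Let mx_set0 : <<s mx_cylinders >> set0.
Proof. exact: sigma_algebra0. Qed.

Let mx_setC A : <<s mx_cylinders >> A -> <<s mx_cylinders >> (~` A).
Proof. exact: sigma_algebraC. Qed.

Let mx_bigcup (F : (set 'M[T]_(m, n))^nat) :
  (forall i, <<s mx_cylinders >> (F i)) -> <<s mx_cylinders >> (\bigcup_i F i).
Proof. exact: sigma_algebra_bigcup. Qed.

HB.instance Definition _ := @isMeasurable.Build (mx_display d)
  'M[T]_(m, n) <<s mx_cylinders >> mx_set0 mx_setC mx_bigcup.

End mx_measurable.

Section euclid.
Context {R : realType}.

Definition sqn m n (A : 'M[R]_(m, n)) : R := \sum_i \sum_j A i j ^+ 2.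
Definition enorm n (x : 'cV[R]_n) : R := Num.sqrt (sqn x).
Definition dot n (x y : 'cV[R]_n) : R := (x^T *m y) 0 0.
Definition opnorm m n (A : 'M[R]_(m, n)) : R :=
  sup [set enorm (A *m z) | z in [set z : 'cV[R]_n | enorm z <= 1]].

Definition grad n (h : 'cV[R]_n -> R) (x : 'cV[R]_n) : 'cV[R]_n :=
  \col_j 'D_(delta_mx j 0) h x.
Definition jac n k (h : 'cV[R]_n -> 'cV[R]_k) (x : 'cV[R]_n) : 'M[R]_(k, n) :=
  \matrix_(i, j) 'D_(delta_mx j 0) (fun z => h z i 0) x.

Definition vint d (S : measurableType d) (mu : {measure set S -> \bar R})
    (D : set S) n (h : S -> 'cV[R]_n) : 'cV[R]_n :=
  \col_i \int[mu]_(s in D) h s i 0.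

Lemma measurable_coord n (i : 'I_n) :
  measurable_fun setT (fun x : 'cV[R]_n => x i 0).
Proof.
move=> _ U mU; rewrite setTI; apply: sub_sigma_algebra.
by exists i, 0, U; split.
Qed.

Lemma measurable_sqn n : measurable_fun setT (fun x : 'cV[R]_n => sqn x).
Proof.
rewrite /sqn; apply: measurable_sum => i; apply: measurable_sum => j.
by apply: measurable_funX; rewrite (ord1 j); exact: measurable_coord.
Qed.

End euclid.

Section wasserstein.
Context {R : realType} (n : nat).

Record P2 := MkP2 {
  P2_prob :> probability 'cV[R]_n R;
  P2_finite : (\int[P2_prob]_x (sqn x)%:E < +oo)%E }.

Definition mom1 (m : P2) : R := \int[m]_x enorm x.
Definition mom2 (m : P2) : R := Num.sqrt (\int[m]_x sqn x).
Definition mean (m : P2) : 'cV[R]_n := vint m setT id.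

Definition coupling (m m' : P2) : set (probability ('cV[R]_n * 'cV[R]_n)%type R) :=
  [set c | forall A, measurable A ->
    c (A `*` setT) = m A /\ c (setT `*` A) = m' A].

Definition W2 (m m' : P2) : R :=
  Num.sqrt (fine (ereal_inf
    [set (\int[c]_z (sqn (z.1 - z.2))%:E)%E | c in coupling m m'])).

(* Joint continuity on D x P2, by sequences; X is only ever a finite product of
   Euclidean spaces, where this is continuity for the product topology. *)
Definition P2continuous (X W : topologicalType) (D : set X) (h : X -> P2 -> W) :=
  forall (xs : nat -> X) (ms : nat -> P2) x m,
    (forall k, D (xs k)) -> D x ->
    xs k @[k --> \oo] --> x -> W2 (ms k) m @[k --> \oo] --> 0 ->
    h (xs k) (ms k) @[k --> \oo] --> h x m.

Definition mixture (e : R) (m m' me : P2) :=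
  forall A, measurable A -> me A = ((1 - e)%:E * m A + e%:E * m' A)%E.

(* [c] is bounded on the bounded sets of P2; W2(m, delta_0) = |m|_2 *)
Definition bounded_on_bounded (c : P2 -> R) :=
  forall K, exists C, forall m, mom2 m <= K -> c m <= C.

(* [dk] is a linear functional-derivative of [k] *)
Definition is_lfd (k : P2 -> R) (dk : P2 -> 'cV[R]_n -> R) :=
  [/\ P2continuous setT (fun (y : 'cV[R]_n) m => dk m y : R^o),
      exists2 c, bounded_on_bounded c &
        forall m : P2, (\int[m]_y ((dk m y) ^+ 2)%:E <= (c m)%:E)%E &
      forall (m m' : P2) (es : nat -> R) (ms : nat -> P2),
        (forall i, 0 < es i <= 1) -> es i @[i --> \oo] --> 0 ->
        (forall i, mixture (es i) m m' (ms i)) ->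
        (es i)^-1 * (k (ms i) - k m) @[i --> \oo] -->
          (\int[m']_y dk m y) - (\int[m]_y dk m y)].

Definition is_lfdv l (k : P2 -> 'cV[R]_l) (dk : P2 -> 'cV[R]_n -> 'cV[R]_l) :=
  forall i, is_lfd (fun m => k m i 0) (fun m y => dk m y i 0).

End wasserstein.
Arguments P2 R n : clear implicits.

Section law.
Context {R : realType} {d : measure_display} {Omega : measurableType d}.
Context (P : probability Omega R) (n : nat).

Definition sq_integrable (X : Omega -> 'cV[R]_n) :=
  measurable_fun setT X /\ (\int[P]_w (sqn (X w))%:E < +oo)%E.

Definition to_mfun (X : Omega -> 'cV[R]_n) (mX : measurable_fun setT X) :
  {mfun Omega >-> 'cV[R]_n} := mfun_Sub (mem_set mX).

Lemma P2_law_finite X (hX : sq_integrable X) :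
  (\int[distribution P (to_mfun hX.1)]_x (sqn x)%:E < +oo)%E.
Proof.
rewrite ge0_integral_distribution//; first exact: hX.2.
- by apply/measurable_EFinP; exact: measurable_sqn.
- move=> y; rewrite lee_fin; apply: sumr_ge0 => i _; apply: sumr_ge0 => j _.
  exact: sqr_ge0.
Qed.

Lemma sq_integrable0 : sq_integrable (fun=> 0).
Proof.
split; first exact: measurable_cst.
rewrite (_ : (fun _ => _) = cst 0%E) ?integral0 ?ltry//.
apply/funext => w; congr EFin; rewrite /sqn big1 // => i _.
by rewrite big1 // => j _; rewrite mxE expr0n.
Qed.

(* The law of X in P2, with the dirac mass at 0 as junk value when X is not a
   square-integrable random vector. *)
Definition law (X : Omega -> 'cV[R]_n) : P2 R n :=
  match pselect (sq_integrable X) with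
  | left hX => MkP2 (P2_law_finite hX)
  | right _ => MkP2 (P2_law_finite sq_integrable0)
  end.

End law.

Section coefficients.
Context {R : realType} (T L : R) (n k : nat).
Local Notation X := 'cV[R]_n.
Local Notation V := 'cV[R]_k.

Definition timeU (U : Type) : set (R * U) := [set z | 0 <= z.1 <= T].

Record A1_coef (phi : R -> X -> P2 R n -> V -> X)
    (dphi : R -> X -> P2 R n -> V -> X -> X) : Prop := {
  A1_cont : P2continuous (@timeU (X * V))
    (fun z m => phi z.1 z.2.1 m z.2.2);
  A1_growth : forall t x m v, 0 <= t <= T ->
    enorm (phi t x m v) <= L * (1 + enorm x + mom2 m + enorm v);
  A1_diff : forall t x m v, 0 <= t <= T ->
    differentiable (fun z : X * V => phi t z.1 m z.2) (x, v);
  A1_lfd : forall t x v, 0 <= t <= T ->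
    is_lfdv (fun m => phi t x m v) (fun m => dphi t x m v);
  A1_diffy : forall t x m v y, 0 <= t <= T -> differentiable (dphi t x m v) y;
  A1_contx : P2continuous (@timeU (X * V))
    (fun z m => jac (fun x => phi z.1 x m z.2.2) z.2.1);
  A1_contv : P2continuous (@timeU (X * V))
    (fun z m => jac (phi z.1 z.2.1 m) z.2.2);
  A1_conty : P2continuous (@timeU (X * V * X))
    (fun z m => jac (dphi z.1 z.2.1.1 m z.2.1.2) z.2.2);
  A1_bndx : forall t x m v, 0 <= t <= T ->
    opnorm (jac (fun x => phi t x m v) x) <= L;
  A1_bndv : forall t x m v, 0 <= t <= T -> opnorm (jac (phi t x m) v) <= L;
  A1_bndy : forall t x m v y, 0 <= t <= T ->
    opnorm (jac (dphi t x m v) y) <= L }.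

Definition jumpE (kappa : nat) : set 'cV[R]_kappa := [set e | e != 0].

(* The regularity of the jump coefficient is understood for each mark e, the
   bounds in the norm of L^2_lambda(E). *)
Record A1_jump (kappa : nat) (lam : {measure set 'cV[R]_kappa -> \bar R})
    (gamma : R -> X -> P2 R n -> V -> 'cV[R]_kappa -> X)
    (dgamma : R -> X -> P2 R n -> V -> X -> 'cV[R]_kappa -> X) : Prop := {
  A1j_meas : forall t x m v, 0 <= t <= T ->
    measurable_fun (@jumpE kappa) (gamma t x m v);
  A1j_dmeas : forall t x m v y, 0 <= t <= T ->
    measurable_fun (@jumpE kappa) (dgamma t x m v y);
  A1j_cont : forall e, jumpE e -> P2continuous (@timeU (X * V))
    (fun z m => gamma z.1 z.2.1 m z.2.2 e);
  A1j_growth : forall t x m v, 0 <= t <= T ->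
    (\int[lam]_(e in @jumpE kappa) (sqn (gamma t x m v e))%:E
      <= ((L * (1 + enorm x + mom2 m + enorm v)) ^+ 2)%:E)%E;
  A1j_diff : forall t x m v e, 0 <= t <= T -> jumpE e ->
    differentiable (fun z : X * V => gamma t z.1 m z.2 e) (x, v);
  A1j_lfd : forall t x v e, 0 <= t <= T -> jumpE e ->
    is_lfdv (fun m => gamma t x m v e) (fun m y => dgamma t x m v y e);
  A1j_lfd2 : forall t x v, 0 <= t <= T ->
    exists2 c, @bounded_on_bounded R n c & forall m : P2 R n,
      (\int[m]_y \int[lam]_(e in @jumpE kappa) (sqn (dgamma t x m v y e))%:E
        <= (c m)%:E)%E;
  A1j_diffy : forall t x m v y e, 0 <= t <= T -> jumpE e ->
    differentiable (fun y => dgamma t x m v y e) y;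
  A1j_contx : forall e, jumpE e -> P2continuous (@timeU (X * V))
    (fun z m => jac (fun x => gamma z.1 x m z.2.2 e) z.2.1);
  A1j_contv : forall e, jumpE e -> P2continuous (@timeU (X * V))
    (fun z m => jac (fun v => gamma z.1 z.2.1 m v e) z.2.2);
  A1j_conty : forall e, jumpE e -> P2continuous (@timeU (X * V * X))
    (fun z m => jac (fun y => dgamma z.1 z.2.1.1 m z.2.1.2 y e) z.2.2);
  A1j_bndx : forall t x m v, 0 <= t <= T ->
    (\int[lam]_(e in @jumpE kappa)
      (opnorm (jac (fun x => gamma t x m v e) x) ^+ 2)%:E <= (L ^+ 2)%:E)%E;
  A1j_bndv : forall t x m v, 0 <= t <= T ->
    (\int[lam]_(e in @jumpE kappa)
      (opnorm (jac (fun v => gamma t x m v e) v) ^+ 2)%:E <= (L ^+ 2)%:E)%E;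
  A1j_bndy : forall t x m v y, 0 <= t <= T ->
    (\int[lam]_(e in @jumpE kappa)
      (opnorm (jac (fun y => dgamma t x m v y e) y) ^+ 2)%:E
      <= (L ^+ 2)%:E)%E }.

Definition assumption_A1 (kappa : nat)
    (lam : {measure set 'cV[R]_kappa -> \bar R})
    (b : R -> X -> P2 R n -> V -> X) (db : R -> X -> P2 R n -> V -> X -> X)
    (sigma : R -> X -> P2 R n -> V -> 'M[R]_n)
    (dsigma : R -> X -> P2 R n -> V -> X -> 'M[R]_n)
    (gamma : R -> X -> P2 R n -> V -> 'cV[R]_kappa -> X)
    (dgamma : R -> X -> P2 R n -> V -> X -> 'cV[R]_kappa -> X) : Prop :=
  [/\ A1_coef b db,
      forall j : 'I_n, A1_coef (fun t x m v => col j (sigma t x m v))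
        (fun t x m v y => col j (dsigma t x m v y)) &
      A1_jump lam gamma dgamma].

Record assumption_A2
    (f : R -> X -> P2 R n -> V -> R) (df : R -> X -> P2 R n -> V -> X -> R)
    (g : X -> P2 R n -> R) (dg : X -> P2 R n -> X -> R) : Prop := {
  A2_cont : P2continuous (@timeU (X * V))
    (fun z m => f z.1 z.2.1 m z.2.2 : R^o);
  A2_contg : P2continuous setT (fun x m => g x m : R^o);
  A2_growth : exists C, forall t x m v, 0 <= t <= T ->
    `|f t x m v| <= C * (1 + sqn x + mom2 m ^+ 2 + sqn v);
  A2_growthg : exists C, forall x m,
    `|g x m| <= C * (1 + sqn x + mom2 m ^+ 2);
  A2_diff : forall t x m v, 0 <= t <= T ->
    differentiable (fun z : X * V => f t z.1 m z.2 : R^o) (x, v);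
  A2_diffg : forall x m, differentiable (fun x => g x m : R^o) x;
  A2_lfd : forall t x v, 0 <= t <= T ->
    is_lfd (fun m => f t x m v) (fun m => df t x m v);
  A2_lfdg : forall x, is_lfd (g x) (dg x);
  A2_diffy : forall t x m v y, 0 <= t <= T ->
    differentiable (df t x m v : X -> R^o) y;
  A2_diffgy : forall x m y, differentiable (dg x m : X -> R^o) y;
  A2_bndxv : forall t x m v, 0 <= t <= T ->
    Num.sqrt (sqn (grad (fun x => f t x m v) x) + sqn (grad (f t x m) v))
      <= L * (1 + enorm x + mom2 m + enorm v);
  A2_bndg : forall x m,
    enorm (grad (fun x => g x m) x) <= L * (1 + enorm x + mom2 m);
  A2_bndy : forall t x m v y, 0 <= t <= T ->
    enorm (grad (df t x m v) y)
      <= L * (1 + enorm x + mom2 m + enorm v + enorm y);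
  A2_bndgy : forall x m y,
    enorm (grad (dg x m) y) <= L * (1 + enorm x + mom2 m + enorm y);
  A2_lipx : forall t x x' m m' v v', 0 <= t <= T ->
    enorm (grad (fun x => f t x m' v') x' - grad (fun x => f t x m v) x)
      <= L * (enorm (x' - x) + W2 m m' + enorm (v' - v));
  A2_lipv : forall t x x' m m' v v', 0 <= t <= T ->
    enorm (grad (f t x' m') v' - grad (f t x m) v)
      <= L * (enorm (x' - x) + W2 m m' + enorm (v' - v));
  A2_lipg : forall x x' m m',
    enorm (grad (fun x => g x m') x' - grad (fun x => g x m) x)
      <= L * (enorm (x' - x) + W2 m m');
  A2_lipy : forall t x x' m m' v v' y y', 0 <= t <= T ->
    enorm (grad (df t x' m' v') y' - grad (df t x m v) y)
      <= L * (enorm (x' - x) + W2 m m' + enorm (v' - v) + enorm (y' - y));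
  A2_lipgy : forall x x' m m' y y',
    enorm (grad (dg x' m') y' - grad (dg x m) y)
      <= L * (enorm (x' - x) + W2 m m' + enorm (y' - y)) }.

End coefficients.
Arguments jumpE R kappa : clear implicits.

(* Control v in R^d with d = d_0 + ... + d_n; the block v^j is [submxcol v j].
   The index j = 1..n of the columns of sigma is [lift ord0 j], j : 'I_n, and
   since d_0 > 0 the set J is the set of j with d_j > 0. *)
Section structure.
Context {R : realType} (T L L0 L1 L2 lam0 : R) (n : nat).
Context (dj : 'I_n.+1 -> nat).
Local Notation X := 'cV[R]_n.
Local Notation V := 'cV[R]_(\sum_j dj j).

Definition nctrl : nat := #|[set j : 'I_n | (0 < dj (lift ord0 j))%N]|.

Definition Delta k (x x' : X) (m m' : P2 R n) (v v' : 'cV[R]_k) : R :=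
  1 + Num.max (enorm x) (enorm x') + Num.max (mom1 m) (mom1 m')
    + Num.max (enorm v) (enorm v').

Record A3_coef k (A : R -> X -> P2 R n -> 'cV[R]_k -> X)
    (dA : R -> X -> P2 R n -> 'cV[R]_k -> X -> X) : Prop := {
  A3_A1 : A1_coef T L A dA;
  A3_x : forall t x x' m m' v v', 0 <= t <= T ->
    opnorm (jac (fun x => A t x m' v') x' - jac (fun x => A t x m v) x)
      <= (Delta x x' m m' v v')^-1 *
         (L0 * enorm (x' - x) + L0 * W2 m m' + L1 * enorm (v' - v));
  A3_y : forall t x x' m m' v v' y y', 0 <= t <= T ->
    opnorm (jac (dA t x' m' v') y' - jac (dA t x m v) y)
      <= (Delta x x' m m' v v')^-1 *
         (L0 * enorm (x' - x) + L0 * W2 m m' + L0 * enorm (y' - y)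
            + L1 * enorm (v' - v));
  A3_v : forall t x x' m m' v v', 0 <= t <= T ->
    opnorm (jac (A t x' m') v' - jac (A t x m) v)
      <= (Delta x x' m m' v v')^-1 *
         (L1 * enorm (x' - x) + L1 * W2 m m' + L2 * enorm (v' - v));
  A3_coercive : forall t x m v (z : X), 0 <= t <= T ->
    lam0 * sqn z <= dot z (jac (A t x m) v *m (jac (A t x m) v)^T *m z) }.

Record A3_cost k (h : R -> X -> P2 R n -> 'cV[R]_k -> R)
    (dh : R -> X -> P2 R n -> 'cV[R]_k -> X -> R) : Prop := {
  A3f_diff : forall t x m v, 0 <= t <= T ->
    differentiable (fun z : X * 'cV[R]_k => h t z.1 m z.2 : R^o) (x, v);
  A3f_lfd : forall t x v, 0 <= t <= T ->
    is_lfd (fun m => h t x m v) (fun m => dh t x m v);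
  A3f_diffy : forall t x m v y, 0 <= t <= T ->
    differentiable (dh t x m v : X -> R^o) y;
  A3f_bndxv : forall t x m v, 0 <= t <= T ->
    Num.sqrt (sqn (grad (fun x => h t x m v) x) + sqn (grad (h t x m) v))
      <= L * (1 + enorm x + mom1 m + enorm v);
  A3f_bndy : forall t x m v y, 0 <= t <= T ->
    enorm (grad (dh t x m v) y)
      <= L * (1 + enorm x + mom1 m + enorm v + enorm y);
  A3f_lipx : forall t x x' m m' v v', 0 <= t <= T ->
    enorm (grad (fun x => h t x m' v') x' - grad (fun x => h t x m v) x)
      <= L * (enorm (x' - x) + W2 m m' + enorm (v' - v));
  A3f_lipv : forall t x x' m m' v v', 0 <= t <= T ->
    enorm (grad (h t x' m') v' - grad (h t x m) v)
      <= L * (enorm (x' - x) + W2 m m' + enorm (v' - v));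
  A3f_lipy : forall t x x' m m' v v' y y', 0 <= t <= T ->
    enorm (grad (dh t x' m' v') y' - grad (dh t x m v) y)
      <= L * (enorm (x' - x) + W2 m m' + enorm (v' - v) + enorm (y' - y)) }.

Record assumption_A3 (kappa : nat)
    (lam : {measure set 'cV[R]_kappa -> \bar R})
    (b : R -> X -> P2 R n -> V -> X)
    (sigma : R -> X -> P2 R n -> V -> 'M[R]_n)
    (gamma : R -> X -> P2 R n -> V -> 'cV[R]_kappa -> X)
    (f : R -> X -> P2 R n -> V -> R) : Prop := {
  A3_d0 : (0 < dj ord0)%N;
  A3_L0 : 0 <= L0 <= L;
  A3_L1 : 0 <= L1 <= L;
  A3_L2 : 0 <= L2 <= L;
  A3_lam0 : 0 < lam0;
  A3_controlled : exists (A : forall j, R -> X -> P2 R n -> 'cV[R]_(dj j) -> X)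
      (dA : forall j, R -> X -> P2 R n -> 'cV[R]_(dj j) -> X -> X),
    [/\ forall j, (0 < dj j)%N -> A3_coef (A j) (dA j),
        forall t x m v, 0 <= t <= T ->
          b t x m v = A ord0 t x m (submxcol v ord0) &
        forall (j : 'I_n) t x m v, (0 < dj (lift ord0 j))%N -> 0 <= t <= T ->
          col j (sigma t x m v)
            = A (lift ord0 j) t x m (submxcol v (lift ord0 j))];
  A3_uncontrolled : forall j : 'I_n, dj (lift ord0 j) = 0%N ->
    exists (s0 : R -> X) (s1 s2 : R -> 'M[R]_n),
      forall t, 0 <= t <= T ->
      [/\ enorm (s0 t) <= L, opnorm (s1 t) <= L, opnorm (s2 t) <= L &
          forall x m v, col j (sigma t x m v)
            = s0 t + s1 t *m x + s2 t *m mean m];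
  A3_gamma : exists (g0 : R -> 'cV[R]_kappa -> X)
      (g1 g2 : R -> 'cV[R]_kappa -> 'M[R]_n),
    forall t, 0 <= t <= T ->
    [/\ [/\ measurable_fun (jumpE R kappa) (g0 t),
            measurable_fun (jumpE R kappa) (g1 t) &
            measurable_fun (jumpE R kappa) (g2 t)],
        (\int[lam]_(e in jumpE R kappa) (sqn (g0 t e))%:E <= (L ^+ 2)%:E)%E,
        (\int[lam]_(e in jumpE R kappa) (opnorm (g1 t e) ^+ 2)%:E
          <= (L ^+ 2)%:E)%E,
        (\int[lam]_(e in jumpE R kappa) (opnorm (g2 t e) ^+ 2)%:E
          <= (L ^+ 2)%:E)%E &
        forall x m v e, jumpE R kappa e -> gamma t x m v e
          = g0 t e + g1 t e *m x + g2 t e *m mean m];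
  A3_f : exists (fj : forall j, R -> X -> P2 R n -> 'cV[R]_(dj j) -> R)
      (dfj : forall j, R -> X -> P2 R n -> 'cV[R]_(dj j) -> X -> R),
    (forall j, A3_cost (fj j) (dfj j)) /\
    forall t x m v, 0 <= t <= T ->
      f t x m v = \sum_j fj j t x m (submxcol v j) }.

End structure.

Section convexity.
Context {R : realType} {d : measure_display} {Omega : measurableType d}.
Context (P : probability Omega R) (T : R) (n k : nat).
Local Notation X := 'cV[R]_n.
Local Notation V := 'cV[R]_k.

Record assumption_A4 (lamv lamx lamm : R)
    (f : R -> X -> P2 R n -> V -> R) (df : R -> X -> P2 R n -> V -> X -> R)
    (g : X -> P2 R n -> R) (dg : X -> P2 R n -> X -> R) : Prop := {
  A4_lamv : 0 < lamv;
  A4_lamxm : 0 < lamx + lamm;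
  A4_f : forall t x x' v v' (xi xi' : Omega -> X), 0 <= t <= T ->
    sq_integrable P xi -> sq_integrable P xi' ->
    f t x' (law P xi') v' - f t x (law P xi) v >=
      dot (grad (fun x => f t x (law P xi) v) x) (x' - x)
      + dot (grad (f t x (law P xi)) v) (v' - v)
      + (\int[P]_w dot (grad (df t x (law P xi) v) (xi w)) (xi' w - xi w))
      + lamv * sqn (v' - v) + lamx * sqn (x' - x)
      + lamm * \int[P]_w sqn (xi' w - xi w);
  A4_g : forall x x' (xi xi' : Omega -> X),
    sq_integrable P xi -> sq_integrable P xi' ->
    g x' (law P xi') - g x (law P xi) >=
      dot (grad (fun x => g x (law P xi)) x) (x' - x)
      + (\int[P]_w dot (grad (dg x (law P xi)) (xi w)) (xi' w - xi w));
  A4_df : forall t x m v y y', 0 <= t <= T ->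
    df t x m v y' - df t x m v y >= dot (grad (df t x m v) y) (y' - y);
  A4_dg : forall x m y y',
    dg x m y' - dg x m y >= dot (grad (dg x m) y) (y' - y) }.

End convexity.

Section noise.
Context {R : realType} {d : measure_display} {Omega : measurableType d}.
Context (P : probability Omega R) (T : R) (F : R -> set (set Omega)).

Definition meas_wrt (G : set (set Omega)) d' (U : measurableType d')
    (h : Omega -> U) := forall C, measurable C -> G (h @^-1` C).

Definition indep (G H : set (set Omega)) :=
  forall A B, G A -> H B -> P (A `&` B) = (P A * P B)%E.

Record augmented_filtration : Prop := {
  filt_complete : measure_is_complete P;
  filt_sigma : forall t, 0 <= t <= T -> sigma_algebra setT (F t);
  filt_sub : forall t, 0 <= t <= T -> F t `<=` measurable;
  filt_mono : forall s t, 0 <= s -> s <= t -> t <= T -> F s `<=` F t;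
  filt_null : forall t, 0 <= t <= T -> P.-negligible `<=` F t }.

Context (n kappa : nat).
Context (B : R -> Omega -> 'cV[R]_n).
Context (lam : {sigma_finite_measure set 'cV[R]_kappa -> \bar R}).
Context (N : Omega -> {measure set (R * 'cV[R]_kappa)%type -> \bar R}).

Record brownian_motion : Prop := {
  bm_adapted : forall t, 0 <= t <= T -> meas_wrt (F t) (B t);
  bm_start : {ae P, forall w, B 0 w = 0};
  bm_cont : {ae P, forall w, {within `[0, T], continuous (B ^~ w)}};
  bm_gauss : forall s t (U : 'I_n -> set R), 0 <= s -> s < t -> t <= T ->
    (forall i, measurable (U i)) ->
    P [set w | forall i, U i ((B t w - B s w) i 0)]
      = (\prod_(i < n) normal_prob 0 (Num.sqrt (t - s)) (U i))%E }.

(* Borel subsets of (s, t] x E *)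
Definition jump_window (s t : R) : set (set (R * 'cV[R]_kappa)%type) :=
  [set C | measurable C /\ C `<=` `]s, t] `*` jumpE R kappa].

Definition intensity (C : set (R * 'cV[R]_kappa)%type) : R :=
  fine ((lebesgue_measure \x lam)%E C).

(* N is used on (0, T] x E only.  Each N w being a measure, t |-> N((0, t] x C)
   is right-continuous.  The product formula gives both the Poisson laws and the
   independence over disjoint sets (the library's poisson_pmf has a junk value
   at rate 0). *)
Record poisson_measure : Prop := {
  prm_adapted : forall t C, 0 <= t <= T -> jump_window 0 t C ->
    meas_wrt (F t) (fun w => N w C);
  prm_law : forall (k : nat) (C : 'I_k -> set (R * 'cV[R]_kappa)%type)
      (a : 'I_k -> nat),
    (forall i, jump_window 0 T (C i)) -> trivIset setT C ->
    P [set w | forall i, N w (C i) = ((a i)%:R)%:E]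
      = (\prod_(i < k) (intensity (C i) ^+ (a i) / ((a i)`!)%:R
           * expR (- intensity (C i))))%:E }.

Definition history_B : set (set Omega) :=
  <<s [set D | exists t U,
         [/\ 0 <= t <= T, measurable U & D = B t @^-1` U] ] >>.

Definition history_N : set (set Omega) :=
  <<s [set D | exists C U, [/\ jump_window 0 T C, measurable U &
         D = (fun w => N w C) @^-1` U] ] >>.

Definition future (t : R) : set (set Omega) :=
  <<s [set D | exists r U, [/\ t <= r <= T, measurable U &
         D = (fun w => B r w - B t w) @^-1` U] ] `|`
      [set D | exists C U, [/\ jump_window t T C, measurable U &
         D = (fun w => N w C) @^-1` U] ] >>.

Record noise_setting : Prop := {
  ns_filtration : augmented_filtration;
  ns_brownian : brownian_motion;
  ns_finite : (lam (jumpE R kappa) < +oo)%E;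
  ns_moment : (\int[lam]_(e in jumpE R kappa) (1 + sqn e)%:E < +oo)%E;
  ns_poisson : poisson_measure;
  ns_indep : indep history_B history_N;
  ns_future : forall t, 0 <= t -> t < T -> indep (F t) (future t) }.

Definition predictable_rect : set (set (R * Omega)%type) :=
  [set D | (exists2 A, F 0 A & D = [set 0] `*` A) \/
     (exists s t A, [/\ 0 <= s, s < t, t <= T, F s A & D = `]s, t] `*` A])].

Definition predictable_sets : set (set (R * Omega)%type) :=
  <<s `[0, T] `*` setT, predictable_rect >>.

Definition predictable_field_sets :
    set (set ((R * Omega) * 'cV[R]_kappa)%type) :=
  <<s (`[0, T] `*` setT) `*` jumpE R kappa,
    [set D | exists A C, [/\ predictable_sets A, measurable C,
      C `<=` jumpE R kappa & D = A `*` C] ] >>.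

Definition M2 k l (a : R -> Omega -> 'M[R]_(k, l)) :=
  (forall U, measurable U -> predictable_sets
    ((`[0, T] `*` setT) `&` (fun z => a z.1 z.2) @^-1` U)) /\
  (\int[P]_w \int[lebesgue_measure]_(t in `[0%R, T]) (sqn (a t w))%:E < +oo)%E.

Definition K2 k (h : R -> Omega -> 'cV[R]_kappa -> 'cV[R]_k) :=
  (forall U, measurable U -> predictable_field_sets
    (((`[0, T] `*` setT) `*` jumpE R kappa) `&`
      (fun z => h z.1.1 z.1.2 z.2) @^-1` U)) /\
  (\int[P]_w \int[lebesgue_measure]_(t in `[0%R, T])
     \int[lam]_(e in jumpE R kappa) (sqn (h t w e))%:E < +oo)%E.

Definition S2 k (a : R -> Omega -> 'cV[R]_k) :=
  [/\ forall t, 0 <= t <= T -> meas_wrt (F t) (a t),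
      forall w t, 0 <= t -> t < T -> a s w @[s --> t^'+] --> a t w,
      forall w t, 0 < t -> t <= T -> cvg (a s w @[s --> t^'-]) &
      (\int[P]_w ereal_sup [set (sqn (a t w))%:E | t in `[0%R, T]] < +oo)%E].

Definition leftlim k (a : R -> Omega -> 'cV[R]_k) (t : R) (w : Omega) :
    'cV[R]_k :=
  if 0 < t then lim (a s w @[s --> t^'-]) else a 0 w.

(* Stochastic integrals over (s0, t0] as L^2 limits of the integrals of simple
   predictable integrands: [I] is a version of the integral. *)

Definition clamp (a b t : R) : R := Num.min b (Num.max a t).

(* (s, t, h) stands for h(w) 1_{(s, t]}(r) *)
Definition simple := seq (R * R * (Omega -> 'M[R]_n)).

Definition simple_ok (H : simple) :=
  forall i, (i < size H)%N ->
    let: (s, t, h) := nth (0, 0, fun=> 0) H i in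
    [/\ 0 <= s, s < t, t <= T, meas_wrt (F s) h &
        exists K, forall w, sqn (h w) <= K].

Definition simple_val (H : simple) (r : R) (w : Omega) : 'M[R]_n :=
  \sum_(c <- H) (if c.1.1 < r <= c.1.2 then c.2 w else 0).

Definition simple_int (H : simple) (s0 t0 : R) (w : Omega) : 'cV[R]_n :=
  \sum_(c <- H)
    c.2 w *m (B (clamp s0 t0 c.1.2) w - B (clamp s0 t0 c.1.1) w).

Definition ito_integral (Q : R -> Omega -> 'M[R]_n) (s0 t0 : R)
    (I : Omega -> 'cV[R]_n) :=
  [/\ measurable_fun (`[0, T] `*` setT) (fun z : R * Omega => Q z.1 z.2),
      measurable_fun setT I &
      exists H : nat -> simple,
      [/\ forall i, simple_ok (H i),
          (\int[P]_w \int[lebesgue_measure]_(r in `[0%R, T])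
             (sqn (simple_val (H i) r w - Q r w))%:E)%E @[i --> \oo] --> 0%E &
          (\int[P]_w (sqn (simple_int (H i) s0 t0 w - I w))%:E)%E
             @[i --> \oo] --> 0%E]].

(* (s, t, C, h) stands for h(w) 1_{(s, t]}(r) 1_C(e) *)
Definition jsimple := seq (R * R * set 'cV[R]_kappa * (Omega -> 'cV[R]_n)).

Definition jsimple_ok (H : jsimple) :=
  forall i, (i < size H)%N ->
    let: (s, t, C, h) := nth (0, 0, set0, fun=> 0) H i in
    [/\ [/\ 0 <= s, s < t & t <= T], measurable C, C `<=` jumpE R kappa,
        meas_wrt (F s) h & exists K, forall w, sqn (h w) <= K].

Definition jsimple_val (H : jsimple) (r : R) (w : Omega) (e : 'cV[R]_kappa) :
    'cV[R]_n :=
  \sum_(c <- H)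
    (if (c.1.1.1 < r <= c.1.1.2) && (e \in c.1.2) then c.2 w else 0).

Definition compensated (s t : R) (C : set 'cV[R]_kappa) (w : Omega) : R :=
  fine (N w (`]s, t] `*` C)) - fine (lam C) * (t - s).

Definition jsimple_int (H : jsimple) (s0 t0 : R) (w : Omega) : 'cV[R]_n :=
  \sum_(c <- H) compensated (clamp s0 t0 c.1.1.1) (clamp s0 t0 c.1.1.2)
    c.1.2 w *: c.2 w.

Definition jump_integral (K : R -> Omega -> 'cV[R]_kappa -> 'cV[R]_n)
    (s0 t0 : R) (I : Omega -> 'cV[R]_n) :=
  [/\ measurable_fun ((`[0, T] `*` setT) `*` jumpE R kappa)
        (fun z : (R * Omega) * 'cV[R]_kappa => K z.1.1 z.1.2 z.2),
      measurable_fun setT I &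
      exists H : nat -> jsimple,
      [/\ forall i, jsimple_ok (H i),
          (\int[P]_w \int[lebesgue_measure]_(r in `[0%R, T])
             \int[lam]_(e in jumpE R kappa)
               (sqn (jsimple_val (H i) r w e - K r w e))%:E)%E
             @[i --> \oo] --> 0%E &
          (\int[P]_w (sqn (jsimple_int (H i) s0 t0 w - I w))%:E)%E
             @[i --> \oo] --> 0%E]].

Context (k : nat).
Local Notation X := 'cV[R]_n.
Local Notation V := 'cV[R]_k.
Context (b : R -> X -> P2 R n -> V -> X) (db : R -> X -> P2 R n -> V -> X -> X).
Context (sigma : R -> X -> P2 R n -> V -> 'M[R]_n)
  (dsigma : R -> X -> P2 R n -> V -> X -> 'M[R]_n).
Context (gamma : R -> X -> P2 R n -> V -> 'cV[R]_kappa -> X)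
  (dgamma : R -> X -> P2 R n -> V -> X -> 'cV[R]_kappa -> X).
Context (f : R -> X -> P2 R n -> V -> R) (df : R -> X -> P2 R n -> V -> X -> R).
Context (g : X -> P2 R n -> R) (dg : X -> P2 R n -> X -> R).
Context (xi : Omega -> X).

Definition Lagrangian (t : R) (x : X) (m : P2 R n) (v : V) (p : X)
    (q : 'M[R]_n) (r : 'cV[R]_kappa -> X) : R :=
  f t x m v + dot (b t x m v) p
  + \sum_j dot (col j (sigma t x m v)) (col j q)
  + \int[lam]_(e in jumpE R kappa) dot (gamma t x m v e) (r e).

(* linear functional-derivative of the Lagrangian *)
Definition dLagrangian (t : R) (x : X) (m : P2 R n) (v : V) (p : X)
    (q : 'M[R]_n) (r : 'cV[R]_kappa -> X) (y : X) : R :=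
  df t x m v y + dot (db t x m v y) p
  + \sum_j dot (col j (dsigma t x m v y)) (col j q)
  + \int[lam]_(e in jumpE R kappa) dot (dgamma t x m v y e) (r e).

Definition state_process (v : R -> Omega -> V) (Y : R -> Omega -> X) :=
  S2 Y /\ forall t, 0 <= t <= T -> exists I K,
  [/\ ito_integral
        (fun s w => sigma s (Y s w) (law P (Y s)) (v s w)) 0 t I,
      jump_integral (fun s w e => gamma s (leftlim Y s w)
        (law P (leftlim Y s)) (v s w) e) 0 t K &
      {ae P, forall w, Y t w = xi w
        + vint lebesgue_measure `[0, t]
            (fun s => b s (Y s w) (law P (Y s)) (v s w))
        + I w + K w}].

Definition forward_equation (Y : R -> Omega -> X) (u : R -> Omega -> V) :=
  forall t, 0 <= t <= T -> exists I K,
  [/\ ito_integral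
        (fun s w => sigma s (Y s w) (law P (Y s)) (u s w)) 0 t I,
      jump_integral (fun s w e => gamma s (leftlim Y s w)
        (law P (Y s)) (u s w) e) 0 t K &
      {ae P, forall w, Y t w = xi w
        + vint lebesgue_measure `[0, t]
            (fun s => b s (Y s w) (law P (Y s)) (u s w))
        + I w + K w}].

(* [vint P setT (fun w' => _)] is the expectation over the independent copy *)
Definition backward_equation (Y p : R -> Omega -> X) (q : R -> Omega -> 'M[R]_n)
    (r : R -> Omega -> 'cV[R]_kappa -> X) (u : R -> Omega -> V) :=
  forall t, 0 <= t <= T -> exists I K,
  [/\ ito_integral q t T I,
      jump_integral r t T K &
      {ae P, forall w, p t w =
        grad (fun x => g x (law P (Y T))) (Y T w)
        + vint P setT (fun w' => grad (dg (Y T w') (law P (Y T))) (Y T w))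
        + vint lebesgue_measure `[t, T] (fun s =>
            grad (fun x => Lagrangian s x (law P (Y s)) (u s w)
                    (p s w) (q s w) (r s w)) (Y s w)
            + vint P setT (fun w' =>
                grad (dLagrangian s (Y s w') (law P (Y s)) (u s w')
                        (p s w') (q s w') (r s w')) (Y s w)))
        - I w - K w}].

(* q, r and u being defined up to dt x dP-null sets, so is this condition *)
Definition first_order_condition (Y p : R -> Omega -> X)
    (q : R -> Omega -> 'M[R]_n) (r : R -> Omega -> 'cV[R]_kappa -> X)
    (u : R -> Omega -> V) :=
  {ae (lebesgue_measure \x P)%E, forall z : R * Omega, 0 <= z.1 <= T ->
    grad (fun v => Lagrangian z.1 (leftlim Y z.1 z.2) (law P (Y z.1)) v
            (leftlim p z.1 z.2) (q z.1 z.2) (r z.1 z.2)) (u z.1 z.2) = 0}.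

Record FBSDE_solution (Y p : R -> Omega -> X) (q : R -> Omega -> 'M[R]_n)
    (r : R -> Omega -> 'cV[R]_kappa -> X) (u : R -> Omega -> V) : Prop := {
  sol_Y : S2 Y;
  sol_p : S2 p;
  sol_q : M2 q;
  sol_r : K2 r;
  sol_u : M2 u;
  sol_forward : forward_equation Y u;
  sol_backward : backward_equation Y p q r u;
  sol_first_order : first_order_condition Y p q r u }.

(* J(v) for a control v with state process Y *)
Definition cost (Y : R -> Omega -> X) (v : R -> Omega -> V) : \bar R :=
  (\int[P]_w (\int[lebesgue_measure]_(t in `[0%R, T])
       (f t (Y t w) (law P (Y t)) (v t w))%:E
     + (g (Y T w) (law P (Y T)))%:E))%E.

Definition optimal_control (u : R -> Omega -> V) :=
  M2 u /\ exists2 Y, state_process u Y &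
    forall v Z, M2 v -> state_process v Z -> (cost Y u <= cost Z v)%E.

End noise.

(* Main.v *)
From HB Require Import structures.
Require Import Defs.
From mathcomp Require Import all_boot all_order all_algebra.
From mathcomp Require Import all_classical all_reals all_analysis.
From mathcomp Require Import measurable_realfun ring lra.
Set Implicit Arguments.
Unset Strict Implicit.
Unset Printing Implicit Defensive.
Import Order.TTheory GRing.Theory Num.Theory.
Import numFieldNormedType.Exports.
Local Open Scope classical_set_scope.
Local Open Scope ring_scope.

(** The adjoint process [p] is paired with [X = Z - Y], where [Z] is the state of
    a competing control [v]: by the product rule, [E[p_T X_T]] is the integral of
    the increments of the coefficients against [(p, q, r)] minus that of the
    adjoint driver against [X].  With the convexity of the costs this bounds
    [J v - J u] below by the quadratic terms of the convexity assumption plus the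
    second-order remainders of the coefficients along [(p, q)].  The first-order
    condition and the coercivity of [A^j_v (A^j_v)^T] give
    [|adj_j| <= L^2 / lam0 * (1 + |x| + |m|_1 + |u^j|)], where [adj_0 = p] and
    [adj_j = q^j]; this growth is cancelled by the factor [Delta_j^-1] in the
    Lipschitz bounds of the derivatives of [A^j], so that the remainders are
    quadratic forms in [(X, v - u)] with constant coefficients.  (C-i) and (C-ii)
    provide a Young weight [eta] for which the total stays nonnegative and
    controls [|v - u|^2], whence optimality and uniqueness. *)

(** * Square-integrable functions *)

(** The adjoint pair is unbounded, so convexity of [f] alone cannot absorb the curvature of the
    coefficients along it. Two further obstacles shape the proof. A linear functional-derivative
    only describes variations along mixtures of laws, whereas the laws of [xi + t (xi' - xi)] do not
    form a mixture segment: the expansion is made on short steps, with a mixture segment inside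
    each, and the steps are summed. Stochastic integrals are given, for each fixed time, as
    L2-limits of simple sums, so the product rule is proved in expectation only, from the isometry,
    orthogonality to the past and a time grid; the fields along the processes must also be shown
    jointly measurable. The constants of (C-ii): [l + 1] counts the controlled blocks;
    [2 w u <= u^2 + w^2] turns [u^2 + 2 w u + 2 w^2] into [2 u^2 + 3 w^2], and [2 + 3 = 5] because
    [u = |X|] and [w = ||X||_2] have equal square integrals; the weighted Young inequality for the
    [L1]-terms gives [2 (u^2 + w^2) / eta], hence the factor [4]. *)

Lemma quadratic_CS (R : realDomainType) (A B c : R) : 0 <= A -> 0 <= B ->
  (forall a b, 0 <= a ^+ 2 * A + 2 * (a * b) * c + b ^+ 2 * B) ->
  c ^+ 2 <= A * B.
Proof.
(* Discriminant argument: [(a, b) = (B, - c)] if [B] is nonzero; for [B = 0] the choice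
   [(c, - (A + 1))] forces [c = 0]. *)
move=> A0 B0 key; have [B00|Bn0] := eqVneq B 0; last first.
  have Bp : 0 < B by rewrite lt_neqAle eq_sym Bn0.
  have h := key B (- c); rewrite -(@ler_pM2l _ B)//; nra.
rewrite B00 mulr0; have := key c (- (A + 1)); rewrite B00 mulr0 addr0 => h.
have := sqr_ge0 c; nra.
Qed.

Section L2.
Context {R : realType} {d : measure_display} {T : measurableType d}.
Variable mu : {measure set T -> \bar R}.
Implicit Types f g : T -> R.

(** All integrals are taken over the whole space; restrictions to time windows or to sets of marks
    are carried by indicator factors in the integrand. *)
Definition intg f := mu.-integrable setT (EFin \o f).
Definition L2f f := measurable_fun setT f /\ intg (fun x => f x ^+ 2).

Lemma intg_meas f : intg f -> measurable_fun setT f.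
Proof. by move=> /measurable_int /measurable_EFinP. Qed.

Lemma intg_lty f : measurable_fun setT f -> (forall x, 0 <= f x) ->
  (\int[mu]_x (f x)%:E < +oo)%E -> intg f.
Proof.
move=> mf f0 foo; apply/integrableP; split; first exact/measurable_EFinP.
by under eq_integral do rewrite /= ger0_norm//.
Qed.

Lemma intg_le f g : measurable_fun setT f -> (forall x, `|f x| <= g x) ->
  intg g -> intg f.
Proof.
move=> mf fg ig; apply: le_integrable ig => //; first exact/measurable_EFinP.
move=> x _ /=; rewrite lee_fin (le_trans (fg x))//; exact: ler_norm.
Qed.

Lemma intgD f g : intg f -> intg g -> intg (fun x => f x + g x).
Proof. by move=> hf hg; exact: (@integrableD _ _ _ mu setT measurableT _ _ hf hg). Qed.

Lemma intgB f g : intg f -> intg g -> intg (fun x => f x - g x).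
Proof. by move=> hf hg; exact: (@integrableB _ _ _ mu setT measurableT _ _ hf hg). Qed.

Lemma intgZ c f : intg f -> intg (fun x => c * f x).
Proof. by move=> hf; exact: (@integrableZl _ _ _ mu setT measurableT c _ hf). Qed.

Lemma intg0 : intg (fun=> 0).
Proof. exact: integrable0. Qed.

Lemma intg_norm f : intg f -> intg (fun x => `|f x|).
Proof. exact: integrable_norm. Qed.

Lemma eq_intg f g : f =1 g -> intg f -> intg g.
Proof. by move=> /funext ->. Qed.

Lemma intg_sum (I : Type) (s : seq I) (F : I -> T -> R) :
  (forall i, intg (F i)) -> intg (fun x => \sum_(i <- s) F i x).
Proof.
move=> hF; elim: s => [|i s ih].
  by apply: eq_intg intg0 => x; rewrite big_nil.
by apply: eq_intg (intgD (hF i) ih) => x; rewrite big_cons.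
Qed.

Lemma RintD f g : intg f -> intg g ->
  \int[mu]_x (f x + g x) = \int[mu]_x f x + \int[mu]_x g x.
Proof. by move=> hf hg; rewrite RintegralD. Qed.

Lemma RintB f g : intg f -> intg g ->
  \int[mu]_x (f x - g x) = \int[mu]_x f x - \int[mu]_x g x.
Proof. by move=> hf hg; rewrite RintegralB. Qed.

Lemma RintZ c f : intg f -> \int[mu]_x (c * f x) = c * \int[mu]_x f x.
Proof. by move=> hf; rewrite RintegralZl. Qed.

Lemma RintN f : intg f -> \int[mu]_x (- f x) = - \int[mu]_x f x.
Proof.
move=> hf; rewrite -mulN1r -RintZ//; apply: eq_Rintegral => x _.
by rewrite mulN1r.
Qed.

Lemma Rint0 : \int[mu]_x (0 : R) = 0.
Proof. by rewrite /Rintegral integral0. Qed.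

Lemma Rint_sum (I : Type) (s : seq I) (F : I -> T -> R) :
  (forall i, intg (F i)) ->
  \int[mu]_x (\sum_(i <- s) F i x) = \sum_(i <- s) \int[mu]_x F i x.
Proof.
move=> hF; elim: s => [|i s ih].
  by rewrite big_nil -[RHS]Rint0; apply: eq_Rintegral => x _; rewrite big_nil.
rewrite big_cons -ih -RintD//; last exact: intg_sum.
by apply: eq_Rintegral => x _; rewrite big_cons.
Qed.

Lemma Rint_le f g : intg f -> intg g -> (forall x, f x <= g x) ->
  \int[mu]_x f x <= \int[mu]_x g x.
Proof. by move=> hf hg fg; apply: le_Rintegral. Qed.

Lemma Rint_ae_eq f g : measurable_fun setT f -> measurable_fun setT g ->
  {ae mu, forall x, f x = g x} -> \int[mu]_x f x = \int[mu]_x g x.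
Proof.
move=> mf mg fg; congr fine; apply: ae_eq_integral => //.
- exact/measurable_EFinP.
- exact/measurable_EFinP.
- by move: fg; apply: filterS => x /= -> _.
Qed.

(** With [max f g] in place of [g] the inequality holds everywhere, and the two functions agree
    almost everywhere. *)
Lemma Rint_ae_le f g : intg f -> intg g -> {ae mu, forall x, f x <= g x} ->
  \int[mu]_x f x <= \int[mu]_x g x.
Proof.
move=> hf hg fg.
have mm : measurable_fun setT (fun x => Num.max (f x) (g x)).
  by apply: measurable_maxr; exact: intg_meas.
have ig : intg (fun x => Num.max (f x) (g x)).
  apply: (intg_le mm) (intgD (intg_norm hf) (intg_norm hg)) => x.
  by rewrite /Num.max; case: ifP => _; rewrite ?lerDl ?lerDr.
rewrite [leRHS](@Rint_ae_eq _ (fun x => Num.max (f x) (g x))) //.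
- by apply: Rint_le => // x; rewrite le_max lexx.
- exact: intg_meas.
- by move: fg; apply: filterS => x ?; rewrite max_r.
Qed.

Lemma le_norm_Rint f : intg f -> `|\int[mu]_x f x| <= \int[mu]_x `|f x|.
Proof. by move=> hf; exact: le_normr_Rintegral. Qed.

Lemma EFin_Rint f : intg f -> (\int[mu]_x f x)%:E = (\int[mu]_x (f x)%:E)%E.
Proof. by move=> hf; rewrite fineK//; exact: integrable_fin_num. Qed.

Lemma Rint_ge0 f : (forall x, 0 <= f x) -> 0 <= \int[mu]_x f x.
Proof. by move=> h; exact: Rintegral_ge0. Qed.

Lemma L2f_mul f g : L2f f -> L2f g -> intg (fun x => f x * g x).
Proof.
move=> [mf hf] [mg hg]; apply: (intg_le _ _ (intgD hf hg)).
  exact: measurable_funM.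
move=> x; rewrite normrM -(real_normK (num_real (f x))) -(real_normK (num_real (g x))).
have := sqr_ge0 (`|f x| - `|g x|); have := normr_ge0 (f x); have := normr_ge0 (g x).
by move: `|f x| `|g x| => a b ? ? ?; nra.
Qed.

Lemma L2f_le f g : measurable_fun setT f -> (forall x, `|f x| <= `|g x|) ->
  L2f g -> L2f f.
Proof.
move=> mf fg [mg hg]; split => //; apply: intg_le hg.
  exact: measurable_funX.
by move=> x; rewrite normrX -(real_normK (num_real (g x))) lerXn2r// ?nnegrE ?normr_ge0//.
Qed.

Lemma L2fZ c f : L2f f -> L2f (fun x => c * f x).
Proof.
move=> [mf hf]; split; first exact: measurable_funM.
by apply: eq_intg (intgZ (c ^+ 2) hf) => x; rewrite exprMn.
Qed.

Lemma L2fD f g : L2f f -> L2f g -> L2f (fun x => f x + g x).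
Proof.
move=> hf hg; split; first by apply: measurable_funD; [exact: hf.1|exact: hg.1].
have h := intgD (intgD hf.2 hg.2) (intgZ 2 (L2f_mul hf hg)).
by apply: eq_intg h => x; ring.
Qed.

Lemma L2fN f : L2f f -> L2f (fun x => - f x).
Proof.
move=> /(L2fZ (-1)); congr L2f; apply/funext => x; exact: mulN1r.
Qed.

Lemma L2fB f g : L2f f -> L2f g -> L2f (fun x => f x - g x).
Proof. by move=> hf /L2fN; exact: L2fD. Qed.

Lemma L2f0 : L2f (fun=> 0).
Proof. by split=> //; apply: eq_intg intg0 => x; rewrite expr0n. Qed.

Lemma L2f_sum (I : Type) (s : seq I) (F : I -> T -> R) :
  (forall i, L2f (F i)) -> L2f (fun x => \sum_(i <- s) F i x).
Proof.
move=> hF; elim: s => [|i s ih].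
  by rewrite (_ : (fun _ => _) = fun=> 0); [exact: L2f0|apply/funext => x; rewrite big_nil].
rewrite (_ : (fun _ => _) = fun x => F i x + \sum_(j <- s) F j x); first exact: L2fD.
by apply/funext => x; rewrite big_cons.
Qed.

Definition n2 f := \int[mu]_x (f x ^+ 2).

Lemma n2_ge0 f : 0 <= n2 f.
Proof. by apply: Rint_ge0 => x; exact: sqr_ge0. Qed.

Lemma CS_Rint f g : L2f f -> L2f g ->
  (\int[mu]_x (f x * g x)) ^+ 2 <= n2 f * n2 g.
Proof.
move=> hf hg.
apply: quadratic_CS (n2_ge0 f) (n2_ge0 g) _ => a b.
have hfg := L2f_mul hf hg.
rewrite -!RintZ//; [|exact: hg.2|exact: hf.2].
rewrite -!RintD//.
- by apply: Rint_ge0 => x; have := sqr_ge0 (a * f x + b * g x); nra.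
- by apply: intgD; apply: intgZ => //; exact: hf.2.
- by apply: intgZ; exact: hg.2.
- by apply: intgZ; exact: hf.2.
- exact: intgZ.
Qed.

Lemma n2D f g : L2f f -> L2f g -> n2 (fun x => f x + g x) <= 2 * n2 f + 2 * n2 g.
Proof.
move=> hf hg; rewrite -!RintZ -?RintD//; [|by apply: intgZ; case: hf|by apply: intgZ; case: hg|by case: hg|by case: hf].
apply: Rint_le; [by case: (L2fD hf hg)|by apply: intgD; apply: intgZ; [case: hf|case: hg]|].
by move=> x; have := sqr_ge0 (f x - g x); nra.
Qed.

Lemma n2_le f g : L2f f -> L2f g -> (forall x, `|f x| <= `|g x|) -> n2 f <= n2 g.
Proof.
move=> hf hg fg; apply: Rint_le; [by case: hf|by case: hg|].
by move=> x; rewrite -(real_normK (num_real (f x))) -(real_normK (num_real (g x))) lerXn2r// ?nnegrE ?normr_ge0//.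
Qed.

(** Around the limits the product leaves one product of errors and two terms with a single error,
    each of which tends to 0 by Cauchy-Schwarz. *)
Lemma ip_cvg (fn gn : nat -> T -> R) f g :
  (forall k, L2f (fn k)) -> (forall k, L2f (gn k)) -> L2f f -> L2f g ->
  n2 (fun x => fn k x - f x) @[k --> \oo] --> 0 ->
  n2 (fun x => gn k x - g x) @[k --> \oo] --> 0 ->
  \int[mu]_x (fn k x * gn k x) @[k --> \oo] --> \int[mu]_x (f x * g x).
Proof.
move=> hfn hgn hf hg cf cg.
have sq0 (u : nat -> R) : u k ^+ 2 @[k --> \oo] --> 0 -> u k @[k --> \oo] --> 0.
  move=> h; apply: norm_cvg0.
  have := cvg_comp _ _ h (@sqrt_continuous R 0); rewrite sqrtr0.
  rewrite (_ : (fun k => `|u k|) = Num.sqrt \o (fun k => u k ^+ 2))//.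
  by apply/funext => k /=; rewrite sqrtr_sqr.
have E k : \int[mu]_x (fn k x * gn k x) = \int[mu]_x (f x * g x) +
   \int[mu]_x ((fn k x - f x) * (gn k x - g x)) +
   \int[mu]_x ((fn k x - f x) * g x) + \int[mu]_x (f x * (gn k x - g x)).
  have h1 := L2fB (hfn k) hf; have h2 := L2fB (hgn k) hg.
  have i1 := L2f_mul hf hg; have i2 := L2f_mul h1 h2.
  have i3 := L2f_mul h1 hg; have i4 := L2f_mul hf h2.
  rewrite -(RintD i1 i2) -(RintD (intgD i1 i2) i3) -(RintD (intgD (intgD i1 i2) i3) i4).
  by apply: eq_Rintegral => x _; ring.
rewrite (funext E).
set I := \int[mu]_x (f x * g x).
suff : (fun k => I + \int[mu]_x ((fn k x - f x) * (gn k x - g x)) +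
   \int[mu]_x ((fn k x - f x) * g x) + \int[mu]_x (f x * (gn k x - g x)))
   @ \oo --> I + 0 + 0 + 0 by rewrite !addr0.
apply: cvgD; [apply: cvgD; [apply: cvgD; first exact: cvg_cst|]|]; apply: sq0.
- apply: (@squeeze_cvgr _ _ _ _ (fun=> 0) (fun k => n2 (fun x => fn k x - f x) * n2 (fun x => gn k x - g x))).
  + by apply: nearW => k; rewrite sqr_ge0/=; apply: CS_Rint; exact: L2fB.
  + exact: cvg_cst.
  + by rewrite -[X in _ --> X](mulr0 0); exact: cvgM.
- apply: (@squeeze_cvgr _ _ _ _ (fun=> 0) (fun k => n2 (fun x => fn k x - f x) * n2 g)).
  + by apply: nearW => k; rewrite sqr_ge0/=; apply: CS_Rint => //; exact: L2fB.
  + exact: cvg_cst.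
  + by rewrite -[X in _ --> X](mul0r (n2 g)); apply: cvgM => //; exact: cvg_cst.
- apply: (@squeeze_cvgr _ _ _ _ (fun=> 0) (fun k => n2 f * n2 (fun x => gn k x - g x))).
  + by apply: nearW => k; rewrite sqr_ge0/=; apply: CS_Rint => //; exact: L2fB.
  + exact: cvg_cst.
  + by rewrite -[X in _ --> X](mulr0 (n2 f)); apply: cvgM => //; exact: cvg_cst.
Qed.

Lemma n2_eq0 f : L2f f -> n2 f = 0 -> {ae mu, forall x, f x = 0}.
Proof.
move=> [mf hf] f0.
have : (\int[mu]_x `|((f x) ^+ 2)%:E| = 0)%E.
  rewrite -[RHS]/(0%:E) -f0 /n2 EFin_Rint//; apply: eq_integral => x _ /=.
  by rewrite ger0_norm ?sqr_ge0.
have mh : measurable_fun setT (fun x => ((f x) ^+ 2)%:E).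
  by apply/measurable_EFinP; exact: measurable_funX.
move/(ae_eq_integral_abs mu measurableT mh) => h.
move: h; apply: filterS => x /= /(_ I) [] /eqP.
by rewrite sqrf_eq0 => /eqP.
Qed.

End L2.

(** * Euclidean vectors and matrices *)

Section euclid_lemmas.
Context {R : realType}.

Lemma sqn_ge0 m n (A : 'M[R]_(m, n)) : 0 <= sqn A.
Proof. by apply: sumr_ge0 => i _; apply: sumr_ge0 => j _; exact: sqr_ge0. Qed.

Lemma sqnE n (x : 'cV[R]_n) : sqn x = \sum_i x i 0 ^+ 2.
Proof. by apply: eq_bigr => i _; rewrite big_ord1. Qed.

Lemma dotE n (x y : 'cV[R]_n) : dot x y = \sum_i x i 0 * y i 0.
Proof. by rewrite /dot mxE; apply: eq_bigr => i _; rewrite mxE. Qed.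

Lemma dotxx n (x : 'cV[R]_n) : dot x x = sqn x.
Proof. by rewrite dotE sqnE; apply: eq_bigr => i _; rewrite expr2. Qed.

Lemma dotC n (x y : 'cV[R]_n) : dot x y = dot y x.
Proof. by rewrite !dotE; apply: eq_bigr => i _; rewrite mulrC. Qed.

Lemma dotDl n (x y z : 'cV[R]_n) : dot (x + y) z = dot x z + dot y z.
Proof. by rewrite /dot linearD/= mulmxDl mxE. Qed.

Lemma dotDr n (x y z : 'cV[R]_n) : dot z (x + y) = dot z x + dot z y.
Proof. by rewrite /dot mulmxDr mxE. Qed.

Lemma dotNl n (x z : 'cV[R]_n) : dot (- x) z = - dot x z.
Proof. by rewrite /dot linearN/= mulNmx mxE. Qed.

Lemma dotNr n (x z : 'cV[R]_n) : dot z (- x) = - dot z x.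
Proof. by rewrite dotC dotNl dotC. Qed.

Lemma dotBl n (x y z : 'cV[R]_n) : dot (x - y) z = dot x z - dot y z.
Proof. by rewrite dotDl dotNl. Qed.

Lemma dotBr n (x y z : 'cV[R]_n) : dot z (x - y) = dot z x - dot z y.
Proof. by rewrite dotDr dotNr. Qed.

Lemma dotZl n c (x z : 'cV[R]_n) : dot (c *: x) z = c * dot x z.
Proof. by rewrite /dot linearZ/= -scalemxAl mxE. Qed.

Lemma dotZr n c (x z : 'cV[R]_n) : dot z (c *: x) = c * dot z x.
Proof. by rewrite dotC dotZl dotC. Qed.

Lemma dot0l n (z : 'cV[R]_n) : dot 0 z = 0.
Proof. by rewrite /dot linear0/= mul0mx mxE. Qed.

Lemma dot_mulmx m n (A : 'M[R]_(m, n)) x y : dot x (A *m y) = dot (A^T *m x) y.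
Proof. by rewrite /dot trmx_mul trmxK mulmxA. Qed.

Lemma dot_suml n (I : Type) (s : seq I) (F : I -> 'cV[R]_n) z :
  dot (\sum_(i <- s) F i) z = \sum_(i <- s) dot (F i) z.
Proof. by elim/big_rec2: _ => [|i a b _ <-]; rewrite ?dot0l ?dotDl. Qed.

Lemma sqnZ n c (x : 'cV[R]_n) : sqn (c *: x) = c ^+ 2 * sqn x.
Proof. by rewrite -!dotxx dotZl dotZr; ring. Qed.

Lemma sqnN n (x : 'cV[R]_n) : sqn (- x) = sqn x.
Proof. by rewrite -!dotxx dotNl dotNr opprK. Qed.

Lemma sqnD n (x y : 'cV[R]_n) : sqn (x + y) = sqn x + 2 * dot x y + sqn y.
Proof. by rewrite -!dotxx dotDl !dotDr (dotC y x); ring. Qed.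

Lemma sqnD_le n (x y : 'cV[R]_n) : sqn (x + y) <= 2 * sqn x + 2 * sqn y.
Proof.
have := sqn_ge0 (x - y); rewrite !sqnD sqnN dotNr.
by move: (sqn x) (sqn y) (dot x y) => a b c; nra.
Qed.

Lemma sqnB_le n (x y : 'cV[R]_n) : sqn (x - y) <= 2 * sqn x + 2 * sqn y.
Proof. by rewrite (le_trans (sqnD_le _ _))// sqnN. Qed.

Lemma sqn0 m n : sqn (0 : 'M[R]_(m, n)) = 0.
Proof. by apply: big1 => i _; apply: big1 => j _; rewrite mxE expr0n. Qed.

Lemma sqn_eq0 n (x : 'cV[R]_n) : sqn x = 0 -> x = 0.
Proof.
rewrite sqnE => /eqP; rewrite psumr_eq0 => [/allP h|i _]; last exact: sqr_ge0.
apply/matrixP => i j; rewrite ord1 mxE; apply/eqP.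
by rewrite -sqrf_eq0; apply: h; rewrite mem_index_enum.
Qed.

Lemma dot_sqr n (x y : 'cV[R]_n) : dot x y ^+ 2 <= sqn x * sqn y.
Proof.
apply: quadratic_CS (sqn_ge0 x) (sqn_ge0 y) _ => a b.
have := sqn_ge0 (a *: x + b *: y); rewrite sqnD !sqnZ dotZl dotZr.
by move: (sqn x) (sqn y) (dot x y) => A B c; nra.
Qed.

Lemma enorm_ge0 n (x : 'cV[R]_n) : 0 <= enorm x.
Proof. exact: sqrtr_ge0. Qed.

Lemma enorm_sqr n (x : 'cV[R]_n) : enorm x ^+ 2 = sqn x.
Proof. by rewrite sqr_sqrtr// sqn_ge0. Qed.

Lemma enorm_le n (x : 'cV[R]_n) a : 0 <= a -> sqn x <= a ^+ 2 -> enorm x <= a.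
Proof. by move=> a0 h; rewrite -(ger0_norm a0) -sqrtr_sqr ler_wsqrtr. Qed.

Lemma norm_dot n (x y : 'cV[R]_n) : `|dot x y| <= enorm x * enorm y.
Proof.
rewrite -(@ler_pXn2r _ 2) ?nnegrE ?mulr_ge0 ?enorm_ge0//.
by rewrite real_normK ?num_real// exprMn !enorm_sqr dot_sqr.
Qed.

Lemma enorm0 n : enorm (0 : 'cV[R]_n) = 0.
Proof. by rewrite /enorm sqn0 sqrtr0. Qed.

Lemma enormN n (x : 'cV[R]_n) : enorm (- x) = enorm x.
Proof. by rewrite /enorm sqnN. Qed.

Lemma enormZ n c (x : 'cV[R]_n) : enorm (c *: x) = `|c| * enorm x.
Proof. by rewrite /enorm sqnZ sqrtrM ?sqr_ge0// sqrtr_sqr. Qed.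

Lemma coord_sqr_le n (x : 'cV[R]_n) i : x i 0 ^+ 2 <= sqn x.
Proof.
rewrite sqnE (bigD1 i)//= lerDl; apply: sumr_ge0 => j _; exact: sqr_ge0.
Qed.

Lemma coord_le n (x : 'cV[R]_n) i : `|x i 0| <= enorm x.
Proof.
rewrite -(@ler_pXn2r _ 2) ?nnegrE ?enorm_ge0//.
by rewrite real_normK ?num_real// enorm_sqr coord_sqr_le.
Qed.

Lemma sqn_mulmx_le m n (A : 'M[R]_(m, n)) (z : 'cV[R]_n) :
  sqn (A *m z) <= sqn A * sqn z.
Proof.
rewrite sqnE {1}/sqn mulr_suml; apply: ler_sum => i _.
have := dot_sqr (row i A)^T z; rewrite sqnE /dot trmxK.
rewrite (_ : (row i A *m z) 0 0 = (A *m z) i 0); last first.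
  by rewrite -row_mul mxE.
by move/le_trans; apply; rewrite ler_wpM2r ?sqn_ge0//; apply: ler_sum => j _; rewrite !mxE.
Qed.

Lemma opnorm_has_sup m n (A : 'M[R]_(m, n)) :
  has_sup [set enorm (A *m z) | z in [set z : 'cV[R]_n | enorm z <= 1]].
Proof.
split; first by exists (enorm (A *m 0)), 0 => //=; rewrite enorm0.
exists (Num.sqrt (sqn A)) => _ [z /= z1 <-].
apply: enorm_le; first exact: sqrtr_ge0.
rewrite sqr_sqrtr ?sqn_ge0// (le_trans (sqn_mulmx_le _ _))//.
by rewrite ler_piMr ?sqn_ge0// -enorm_sqr expr_le1// enorm_ge0.
Qed.

Lemma opnorm_ge0 m n (A : 'M[R]_(m, n)) : 0 <= opnorm A.
Proof.
apply: (@le_trans _ _ (enorm (A *m 0))); first exact: enorm_ge0.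
apply: ub_le_sup; first exact: (opnorm_has_sup A).2.
by exists 0 => //=; rewrite enorm0.
Qed.

Lemma opnorm_mulmx m n (A : 'M[R]_(m, n)) z : enorm (A *m z) <= opnorm A * enorm z.
Proof.
have [z0|z0] := eqVneq (enorm z) 0.
  have -> : z = 0 by apply: sqn_eq0; rewrite -enorm_sqr z0 expr0n.
  by rewrite mulmx0 !enorm0 mulr0.
have zp : 0 < enorm z by rewrite lt_neqAle eq_sym z0 enorm_ge0.
rewrite -ler_pdivrMr// mulrC -(ger0_norm (ltW zp)) -normfV -enormZ scalemxAr.
apply: ub_le_sup; first exact: (opnorm_has_sup A).2.
by exists ((enorm z)^-1 *: z) => //=; rewrite enormZ normfV ger0_norm ?mulVf// ltW.
Qed.

Lemma dot_opnorm m n (A : 'M[R]_(m, n)) x y :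
  `|dot x (A *m y)| <= opnorm A * enorm x * enorm y.
Proof.
rewrite (le_trans (norm_dot _ _))// mulrAC mulrC.
by rewrite ler_wpM2r ?enorm_ge0 ?opnorm_mulmx.
Qed.

Lemma entry_opnorm m n (A : 'M[R]_(m, n)) i j : `|A i j| <= opnorm A.
Proof.
have := opnorm_mulmx A (delta_mx j 0).
have -> : enorm (delta_mx j 0 : 'cV[R]_n) = 1.
  rewrite /enorm sqnE (bigD1 j)//= big1 ?mxE ?eqxx ?addr0 ?expr1n ?sqrtr1// => k kj.
  by rewrite mxE (negbTE kj) expr0n.
rewrite mulr1; apply: le_trans; apply: le_trans (coord_le _ i).
by rewrite -colE mxE.
Qed.

(** From [|A^T z|^2 = z . A (A^T z) <= opnorm A |z| |A^T z|], divided by [|A^T z|]; the norm of the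
    transpose is thus never computed. *)
Lemma opnorm_tr_mulmx m n (A : 'M[R]_(m, n)) z :
  enorm (A^T *m z) <= opnorm A * enorm z.
Proof.
have [z0|z0] := eqVneq (enorm (A^T *m z)) 0.
  by rewrite z0 mulr_ge0// ?opnorm_ge0 ?enorm_ge0.
have zp : 0 < enorm (A^T *m z) by rewrite lt_neqAle eq_sym z0 enorm_ge0.
rewrite -(ler_pM2r zp) -expr2 enorm_sqr -dotxx -dot_mulmx.
exact: le_trans (ler_norm _) (dot_opnorm _ _ _).
Qed.

Lemma cvg_sumR (I T : Type) (s : seq I) (Fl : set_system T) {FF : Filter Fl}
    (f : I -> T -> R) (l : I -> R) :
  (forall i, f i x @[x --> Fl] --> l i) ->
  (\sum_(i <- s) f i x) @[x --> Fl] --> \sum_(i <- s) l i.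
Proof.
move=> h; elim: s => [|i s ih].
  rewrite big_nil (_ : (fun _ => _) = fun=> 0); first exact: cvg_cst.
  by apply/funext => x; rewrite big_nil.
rewrite big_cons (_ : (fun _ => _) = fun x => f i x + \sum_(j <- s) f j x).
  exact: cvgD.
by apply/funext => x; rewrite big_cons.
Qed.

Lemma cvg_coord n (xs : nat -> 'cV[R]_n) (x : 'cV[R]_n) :
  (forall i, xs k i 0 @[k --> \oo] --> x i 0) -> xs k @[k --> \oo] --> x.
Proof.
move=> h; apply/cvgrPdist_lt => e e0.
have : \forall k \near \oo, forall i, `|x i 0 - xs k i 0| < e.
  by apply: filter_forall => i; move/cvgrPdist_lt : (h i) => /(_ _ e0).
apply: filterS => k hk; rewrite /Num.norm/= mx_normrE.
apply/bigmax_ltP; split=> // -[i j] _; rewrite !mxE (ord1 j); exact: hk.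
Qed.

Lemma coord_cvg m n (T : Type) (Fl : set_system T) {FF : Filter Fl} (xs : T -> 'M[R]_(m, n)) (x : 'M[R]_(m, n)) i j :
  xs k @[k --> Fl] --> x -> xs k i j @[k --> Fl] --> x i j.
Proof.
move=> h; apply/cvgrPdist_lt => e e0.
move/cvgrPdist_lt : h => /(_ _ e0); apply: filterS => k.
apply: le_lt_trans; rewrite [leRHS]/Num.norm/= mx_normrE.
by apply: le_trans (le_bigmax _ _ (i, j)) => /=; rewrite !mxE.
Qed.

Lemma sqn_cvg0 n (xs : nat -> 'cV[R]_n) (x : 'cV[R]_n) :
  xs k @[k --> \oo] --> x -> sqn (xs k - x) @[k --> \oo] --> 0.
Proof.
move=> h.
have E k : sqn (xs k - x) = \sum_i (xs k i 0 - x i 0) ^+ 2.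
  by rewrite sqnE; apply: eq_bigr => i _; rewrite !mxE.
rewrite (funext E).
suff : \sum_i (xs k i 0 - x i 0) ^+ 2 @[k --> \oo] --> \sum_(i < n) (0 : R).
  by rewrite big1.
apply: cvg_sumR => i.
have : (xs k i 0 - x i 0) @[k --> \oo] --> 0.
  by rewrite -(subrr (x i 0)); apply: cvgB; [exact: coord_cvg|exact: cvg_cst].
move=> h0; rewrite -(mulr0 0) (_ : (fun k => _) = fun k => (xs k i 0 - x i 0) * (xs k i 0 - x i 0)); last first.
  by apply/funext => k; rewrite expr2.
exact: cvgM.
Qed.

End euclid_lemmas.

(** * Derivatives along lines, gradients and Jacobians *)

Section line_derivatives.
Context {R : realType}.

Lemma is_derive_line (V : normedModType R) (h : V -> R^o) (x e : V) (t : R) :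
  differentiable h (x + t *: e) ->
  is_derive t 1 (fun s : R => h (x + s *: e)) ('d h (x + t *: e) e).
Proof.
move=> dh; have D := @diff_derivable _ _ _ _ _ e dh.
have E : (fun s : R => s^-1 *: (((fun s : R => h (x + s *: e)) \o shift t) (s *: 1) - h (x + t *: e))) =
         (fun s : R => s^-1 *: ((h \o shift (x + t *: e)) (s *: e) - h (x + t *: e))).
  apply/funext => s /=; congr (_ *: (h _ - _)).
  by rewrite [s *: 1]mulr1 scalerDl addrCA.
split; first by rewrite /derivable E.
by rewrite -deriveE// /derive E.
Qed.

Lemma diff_grad n (h : 'cV[R]_n -> R) (x e : 'cV[R]_n) :
  differentiable (h : _ -> R^o) x -> 'd (h : _ -> R^o) x e = dot (grad h x) e.
Proof.
move=> dh; rewrite {1}(matrix_sum_delta e) dotE linear_sum; apply: eq_bigr => i _.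
by rewrite big_ord1 linearZ/= mxE deriveE// mulrC.
Qed.

Lemma is_derive_grad n (h : 'cV[R]_n -> R) (x e : 'cV[R]_n) (t : R) :
  differentiable (h : _ -> R^o) (x + t *: e) ->
  is_derive t 1 (fun s : R => h (x + s *: e)) (dot (grad h (x + t *: e)) e).
Proof. by move=> dh; rewrite -diff_grad//; exact: is_derive_line. Qed.

Lemma differentiable_pair1 (U V : normedModType R) (W : normedModType R) (h : U * V -> W) x v :
  differentiable h (x, v) -> differentiable (fun x => h (x, v)) x /\
   forall e, 'd (fun x => h (x, v)) x e = 'd h (x, v) (e, 0).
Proof.
move=> dh.
have dp : differentiable (fun x : U => (x, v)) x by exact: differentiable_pair.
split; first exact: (differentiable_comp dp dh).
move=> e; rewrite -!deriveE//; last exact: (differentiable_comp dp dh).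
suff E : (fun s : R => s^-1 *: (((fun x => h (x, v)) \o shift x) (s *: e) - h (x, v))) =
    (fun s : R => s^-1 *: ((h \o shift (x, v)) (s *: ((e, 0) : U * V)) - h (x, v))) by rewrite /derive E.
apply/funext => s /=; congr (_ *: (h _ - _)).
by congr pair => /=; rewrite scaler0 add0r.
Qed.

Lemma differentiable_pair2 (U V : normedModType R) (W : normedModType R) (h : U * V -> W) x v :
  differentiable h (x, v) -> differentiable (fun v => h (x, v)) v /\
   forall e, 'd (fun v => h (x, v)) v e = 'd h (x, v) (0, e).
Proof.
move=> dh.
have dp : differentiable (fun v : V => (x, v)) v by exact: differentiable_pair.
split; first exact: (differentiable_comp dp dh).
move=> e; rewrite -!deriveE//; last exact: (differentiable_comp dp dh).
suff E : (fun s : R => s^-1 *: (((fun v => h (x, v)) \o shift v) (s *: e) - h (x, v))) =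
    (fun s : R => s^-1 *: ((h \o shift (x, v)) (s *: ((0, e) : U * V)) - h (x, v))) by rewrite /derive E.
apply/funext => s /=; congr (_ *: (h _ - _)).
by congr pair => /=; rewrite scaler0 add0r.
Qed.

(** The total differential at the direction [(e, f)] splits as [(e, 0) + (0, f)], and each part is a
    partial gradient. *)
Lemma is_derive_grad2 n k (h : 'cV[R]_n -> 'cV[R]_k -> R) x e v f (t : R) :
  differentiable (fun z : 'cV[R]_n * 'cV[R]_k => h z.1 z.2 : R^o) (x + t *: e, v + t *: f) ->
  is_derive t 1 (fun s : R => h (x + s *: e) (v + s *: f))
    (dot (grad (fun x => h x (v + t *: f)) (x + t *: e)) e
     + dot (grad (h (x + t *: e)) (v + t *: f)) f).
Proof.
move=> dh; have [d1 e1] := differentiable_pair1 dh; have [d2 e2] := differentiable_pair2 dh.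
rewrite -!diff_grad// (e1 e) (e2 f) -linearD/=.
have -> : ((e, 0) + (0, f) : 'cV[R]_n * 'cV[R]_k) = (e, f).
  by congr pair => /=; rewrite ?addr0 ?add0r.
exact: (@is_derive_line _ (fun z : 'cV[R]_n * 'cV[R]_k => h z.1 z.2 : R^o) (x, v) (e, f) t).
Qed.

Lemma differentiable_entry (V : normedModType R) n (h : V -> 'cV[R]_n) x i :
  differentiable h x -> differentiable (fun z => h z i 0 : R^o) x.
Proof.
move=> dh.
have -> : (fun z => h z i 0) = (fun M : 'cV[R]_n => M i 0 : R^o) \o h by [].
apply: differentiable_comp => //; exact: differentiable_coord.
Qed.

Lemma differentiable_sumR (V : normedModType R) (I : Type) (s : seq I) (h : I -> V -> R^o) x :
  (forall i, differentiable (h i) x) -> differentiable (fun z => \sum_(i <- s) h i z : R^o) x.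
Proof.
move=> dh; elim: s => [|i s ih].
  rewrite (_ : (fun _ => _) = fun=> 0)//; apply/funext => z; by rewrite big_nil.
rewrite (_ : (fun _ => _) = fun z => h i z + \sum_(j <- s) h j z : R^o).
  exact: differentiableD.
by apply/funext => z; rewrite big_cons.
Qed.

Lemma differentiable_dotl (V : normedModType R) n (h : V -> 'cV[R]_n) x p :
  differentiable h x -> differentiable (fun z => dot (h z) p : R^o) x.
Proof.
move=> dh; rewrite (_ : (fun z => _) = fun z => \sum_i h z i 0 * p i 0).
  apply: differentiable_sumR => i.
  by apply: differentiableM => //; exact: differentiable_entry.
by apply/funext => z; rewrite dotE.
Qed.

Lemma gradD n (h k : 'cV[R]_n -> R) x : differentiable (h : _ -> R^o) x ->
  differentiable (k : _ -> R^o) x -> grad (fun z => h z + k z) x = grad h x + grad k x.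
Proof.
move=> dh dk; apply/matrixP => i j; rewrite !mxE deriveD//; exact: diff_derivable.
Qed.

Lemma grad_sum n (I : Type) (s : seq I) (h : I -> 'cV[R]_n -> R) x :
  (forall i, differentiable (h i : _ -> R^o) x) ->
  grad (fun z => \sum_(i <- s) h i z) x = \sum_(i <- s) grad (h i) x.
Proof.
move=> dh; elim: s => [|i s ih].
  rewrite big_nil (_ : (fun _ => _) = fun=> 0); last by apply/funext => z; rewrite big_nil.
  by apply/matrixP => a b; rewrite !mxE derive_cst.
rewrite big_cons -ih -gradD//; last exact: differentiable_sumR.
by congr grad; apply/funext => z; rewrite big_cons.
Qed.

Lemma grad_cst n c (x : 'cV[R]_n) : grad (fun=> c) x = 0.
Proof. by apply/matrixP => a b; rewrite !mxE derive_cst. Qed.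

Lemma grad_dotl n k (h : 'cV[R]_n -> 'cV[R]_k) x p : differentiable h x ->
  grad (fun z => dot (h z) p) x = (jac h x)^T *m p.
Proof.
move=> dh; apply/matrixP => a b; rewrite (ord1 b) !mxE.
rewrite (_ : (fun z => _) = fun z => \sum_i (h z i 0 * p i 0 : R^o)); last first.
  by apply/funext => z; rewrite dotE.
have di i : differentiable (fun z => h z i 0 : R^o) x by exact: differentiable_entry.
have D i : derivable (fun z => h z i 0 * p i 0 : R^o) x (delta_mx a 0).
  by apply: diff_derivable; apply: differentiableM.
have -> : (fun z => \sum_i (h z i 0 * p i 0 : R^o)) = \sum_i (fun z => h z i 0 * p i 0 : R^o).
  by apply/funext => z; rewrite fct_sumE.
rewrite derive_sum//; apply: eq_bigr => i _; rewrite !mxE.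
rewrite deriveM//; last exact: diff_derivable.
by rewrite derive_cst scaler0 add0r mulrC.
Qed.

Lemma grad_affine n c (a : 'cV[R]_n) x :
  differentiable (fun z => c + dot a z : R^o) x /\ grad (fun z => c + dot a z) x = a.
Proof.
have di : differentiable (fun z : 'cV[R]_n => dot a z : R^o) x.
  rewrite (_ : (fun z => _) = fun z => dot z a); last by apply/funext => z; rewrite dotC.
  exact: (@differentiable_dotl _ _ id).
split; first exact: differentiableD.
rewrite gradD// grad_cst add0r.
apply/matrixP => i j; rewrite (ord1 j) mxE /derive; apply: cvg_lim => //.
apply: cvg_near_cst; apply: filterS (nbhs_dnbhs_neq (0 : R)) => s s0 /=.
rewrite dotDr dotZr addrK [_ *: _]mulrA mulVf// mul1r dotE (bigD1 i)//=.
rewrite big1 ?mxE ?eqxx ?mulr1 ?addr0// => k ki.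
by rewrite mxE (negbTE ki) mulr0.
Qed.

Lemma is_derive_MVT (h dh : R -> R) : (forall t : R, 0 <= t <= 1 -> is_derive t 1 h (dh t)) ->
  exists2 c, 0 < c < 1 & h 1 - h 0 = dh c.
Proof.
move=> H; have [||c] := @MVT R h dh 0 1 ltr01.
- by move=> x; rewrite in_itv/= => /andP[x0 x1]; apply: H; rewrite !ltW.
- apply: derivable_within_continuous => x; rewrite in_itv/= => x01.
  exact: (@ex_derive _ _ _ _ _ _ _ (H _ x01)).
by rewrite in_itv/= => c01 ->; exists c => //; rewrite subr0 mulr1.
Qed.

End line_derivatives.

(** * Countably valued maps and dyadic rounding *)

Section countable_valued.
Context {d : measure_display} {S : measurableType d}.

(** A map with countably many values and measurable fibres, encoded by a code in [nat] so that [U]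
    carries no sigma-algebra. Substituting such a map into a function that is measurable for each
    fixed second argument keeps measurability ([ctb_meas]); with dyadic rounding this is the source
    of all the Caratheodory-type statements below. *)
Definition ctb (U : Type) (psi : S -> U) :=
  exists (c : S -> nat) (F : nat -> U),
    (forall j, measurable (c @^-1` [set j])) /\ psi =1 F \o c.

Lemma ctb_cT (K : countType) (U : Type) (c : S -> K) (F : K -> U) :
  (forall j, measurable (c @^-1` [set j])) -> ctb (F \o c).
Proof.
move=> mc; have [[s]|nS] := pselect (inhabited S); last first.
  exists (fun=> 0%N), (fun _ => F (c (match nS (inhabits point) with end))); split.
    by move=> j; exfalso; apply: nS; exact: (inhabits point).
  by move=> s; exfalso; apply: nS; exact: (inhabits s).
exists (pickle \o c), (fun j => if unpickle j is Some k then F k else F (c s)); split.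
  move=> j; case E : (@pickle_inv K j) => [k|].
    rewrite (_ : _ @^-1` _ = c @^-1` [set k])//; apply/seteqP; split => x /=.
      by move=> xj; move: E; rewrite -xj pickleK_inv => -[].
    by move=> ->; have := @pickle_invK K j; rewrite /oapp E.
  rewrite (_ : _ @^-1` _ = set0)//; apply/seteqP; split => x //= xj.
  by move: E; rewrite -xj pickleK_inv.
by move=> x /=; rewrite pickleK.
Qed.

Lemma ctb_comp (U W : Type) (g : U -> W) (psi : S -> U) : ctb psi -> ctb (g \o psi).
Proof.
by move=> [c [F [mc E]]]; exists c, (g \o F); split => // x /=; rewrite E.
Qed.

Lemma eq_ctb (U : Type) (psi psi' : S -> U) : psi =1 psi' -> ctb psi -> ctb psi'.
Proof. by move=> /funext ->. Qed.

Lemma ctb_col (R : realType) n (psi : 'I_n -> S -> R) :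
  (forall i, ctb (psi i)) -> ctb (fun s => \col_i psi i s).
Proof.
move=> /choice[c /choice[F H]].
apply: (@eq_ctb _ ((fun z : {ffun 'I_n -> nat} => \col_i F i (z i)) \o (fun s => [ffun i => c i s]))).
  by move=> s /=; apply/matrixP => i j; rewrite !mxE ffunE (H i).2.
apply: ctb_cT => z.
rewrite (_ : _ @^-1` _ = \bigcap_(i in [set: 'I_n]) (c i @^-1` [set z i])).
  apply: fin_bigcap_measurable => [|i _]; [exact: finite_finset|exact: (H i).1].
apply/seteqP; split => x /=.
  by move=> <- i _ /=; rewrite ffunE.
by move=> h; apply/ffunP => i; rewrite ffunE; exact: h.
Qed.

Lemma ctb_meas (R : realType) (U : Type) (h : S -> U -> R) (D : set S) psi :
  ctb psi -> (forall u, measurable_fun D (h^~ u)) ->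
  measurable_fun D (fun s => h s (psi s)).
Proof.
move=> [c [F [mc E]]] mh mD Y mY.
rewrite (_ : _ `&` _ = \bigcup_j ((c @^-1` [set j]) `&` (D `&` (h^~ (F j)) @^-1` Y))).
  by apply: bigcup_measurable => j _; apply: measurableI => //; exact: mh.
apply/seteqP; split => x /=.
  by move=> [Dx]; rewrite E /= => yx; exists (c x).
by move=> [j _ /= [<- []]]; rewrite E.
Qed.

Context {R : realType}.

Definition dya (k : nat) (x : R) : R := (Num.floor (x * 2 ^+ k))%:~R / 2 ^+ k.

Lemma dya_itv k x : dya k x <= x < dya k x + 2 ^- k.
Proof.
have p : 0 < (2 : R) ^+ k by rewrite exprn_gt0.
have := floor_itv (x * 2 ^+ k); rewrite intrD /dya => /andP[h1 h2].
by rewrite ler_pdivrMr// h1/= -(ltr_pM2r p) mulrDl divfK ?mulVf ?gt_eqF.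
Qed.

Lemma cvg_geom2 : (2 : R) ^- k @[k --> \oo] --> 0.
Proof.
rewrite (_ : (fun k => _) = fun k => (2^-1 : R) ^+ k); last first.
  by apply/funext => k; rewrite exprVn.
by apply: cvg_expr; rewrite ger0_norm// invf_lt1// ltr1n.
Qed.

Lemma cvg_dya x : dya k x @[k --> \oo] --> x.
Proof.
apply: (@squeeze_cvgr _ _ _ _ (fun k => x - 2 ^- k) (fun=> x)).
- apply: nearW => k; have /andP[h1 h2] := dya_itv k x.
  by rewrite h1 andbT lerBlDr ltW.
- by rewrite -[X in _ --> X]subr0; apply: cvgB; [exact: cvg_cst|exact: cvg_geom2].
- exact: cvg_cst.
Qed.

Lemma ctb_floor k (f : S -> R) : measurable_fun setT f ->
  ctb (fun s => Num.floor (f s * 2 ^+ k)).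
Proof.
move=> mf; apply: (@ctb_cT _ _ (fun s => Num.floor (f s * 2 ^+ k)) id) => j.
have p : 0 < (2 : R) ^+ k by rewrite exprn_gt0.
rewrite (_ : _ @^-1` _ = f @^-1` [set` `[j%:~R / 2 ^+ k, (j + 1)%:~R / 2 ^+ k[ ]).
  by rewrite -[X in measurable X]setTI; apply: mf.
apply/seteqP; split => x /=; rewrite in_itv/= ler_pdivrMr// ltr_pdivlMr//.
  by move=> <-; exact: floor_itv.
exact: floor_def.
Qed.

Lemma ctb_dya k (f : S -> R) : measurable_fun setT f -> ctb (fun s => dya k (f s)).
Proof.
by move=> mf; exact: (ctb_comp (fun z : int => z%:~R / 2 ^+ k) (ctb_floor k mf)).
Qed.

Definition dyav n (k : nat) (x : 'cV[R]_n) : 'cV[R]_n := \col_i dya k (x i 0).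

Lemma cvg_dyav n (x : 'cV[R]_n) : dyav k x @[k --> \oo] --> x.
Proof.
apply: cvg_coord => i.
by rewrite (_ : (fun k => _) = dya ^~ (x i 0)); [exact: cvg_dya|apply/funext => k; rewrite mxE].
Qed.

Lemma ctb_dyav n k (f : S -> 'cV[R]_n) : measurable_fun setT f -> ctb (fun s => dyav k (f s)).
Proof.
move=> mf; apply: ctb_col => i; apply: (@ctb_dya k (fun s => f s i 0)).
exact: (measurableT_comp (measurable_coord i) mf).
Qed.

End countable_valued.

Section seqcont.
Context {R : realType}.

(** [h] is the pointwise limit of its values at dyadic roundings of the argument, and these are
    measurable because the roundings are countably valued. The coordinate sigma-algebra is thus
    never compared with the topology. *)
Lemma seqcont_measurable n (h : 'cV[R]_n -> R) :
  (forall (xs : nat -> 'cV[R]_n) x, xs k @[k --> \oo] --> x -> h (xs k) @[k --> \oo] --> h x) ->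
  measurable_fun setT h.
Proof.
move=> ch; apply: (measurable_fun_cvg (h := fun k x => h (dyav k x))) => [k|x _].
  apply: (@ctb_meas _ _ _ _ (fun=> h) _ (dyav k)) => //.
  exact: (@ctb_dyav _ _ _ _ k id).
apply: ch; exact: cvg_dyav.
Qed.

Lemma measurable_mx d (S : measurableType d) m n (D : set S) (f : S -> 'M[R]_(m, n)) : 
  (forall i j, measurable_fun D (fun s => f s i j)) -> measurable_fun D f.
Proof.
move=> mf mD; apply: (measurability (@mx_cylinders _ R m n)) => //.
move=> _ [_ [i [j [V [mV ->]]]] <-]; exact: mf.
Qed.

Lemma measurable_entry m n i j : measurable_fun setT (fun x : 'M[R]_(m, n) => x i j).
Proof. by move=> _ U mU; rewrite setTI; apply: sub_sigma_algebra; exists i, j, U. Qed.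

End seqcont.

(** * Mixtures of laws and the Wasserstein distance *)

(** Truncation to the unit interval, so that the mixture below is a probability for every real
    weight and may be differentiated with respect to it. *)
Definition clamp01 {R : realType} (s : R) : R := Num.max 0 (Num.min 1 s).

Lemma clamp01_ge0 {R : realType} (s : R) : 0 <= clamp01 s.
Proof. by rewrite /clamp01 le_max lexx. Qed.

Lemma clamp01_le1 {R : realType} (s : R) : 0 <= 1 - clamp01 s.
Proof. by rewrite subr_ge0 /clamp01 ge_max ler01/= ge_min lexx. Qed.

Lemma clamp01E {R : realType} (s : R) : 0 <= s <= 1 -> clamp01 s = s.
Proof. by move=> /andP[s0 s1]; rewrite /clamp01 min_r// max_r. Qed.

Section mixture_measure.
Context {R : realType} {d : measure_display} {T : measurableType d}.
Variables (s : R) (m m' : probability T R).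

Definition mixm := measure_add (mscale (NngNum (clamp01_le1 s)) m)
  (mscale (NngNum (clamp01_ge0 s)) m').

HB.instance Definition _ := Measure.on mixm.

Lemma mixmE A : mixm A = ((1 - clamp01 s)%:E * m A + (clamp01 s)%:E * m' A)%E.
Proof. by rewrite /mixm/= /measure_add/= /msum/= !big_ord_recr big_ord0/= add0e. Qed.

Let mixmT : mixm setT = 1%E.
Proof. by rewrite mixmE !probability_setT !mule1 -EFinD subrK. Qed.

HB.instance Definition _ := Measure_isProbability.Build _ _ _ mixm mixmT.

Lemma ge0_integral_mixm (h : T -> \bar R) : measurable_fun setT h ->
  (forall x, 0 <= h x)%E ->
  (\int[mixm]_x h x = (1 - clamp01 s)%:E * \int[m]_x h x + (clamp01 s)%:E * \int[m']_x h x)%E.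
Proof.
by move=> mh h0; rewrite ge0_integral_measure_add// !ge0_integral_mscale.
Qed.

Lemma intg_mixm (h : T -> R) : intg m h -> intg m' h -> intg mixm h.
Proof.
move=> h1 h2; apply/integrableP; split; first exact: measurable_int h1.
rewrite ge0_integral_mixm//; last first.
  by apply: measurableT_comp => //; exact: measurable_int h1.
move/integrableP : h1 => [_ h1]; move/integrableP : h2 => [_ h2].
by apply: lte_add_pinfty; apply: lte_mul_pinfty; rewrite ?lee_fin ?clamp01_ge0 ?clamp01_le1//=.
Qed.

Lemma Rint_mixm (h : T -> R) : intg m h -> intg m' h ->
  \int[mixm]_x h x = (1 - clamp01 s) * \int[m]_x h x + clamp01 s * \int[m']_x h x.
Proof.
move=> h1 h2; have := intg_mixm h1 h2; move=> h12.
apply: EFin_inj; rewrite EFinD !EFinM !EFin_Rint// integralE.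
have mh : measurable_fun setT (fun x => (h x)%:E) := measurable_int _ h1.
rewrite !ge0_integral_mixm//; last 2 first.
- exact: measurable_funeneg.
- exact: measurable_funepos.
rewrite [in RHS](integralE m) [in RHS](integralE m').
have p1 := integrable_pos_fin_num measurableT h1; have p2 := integrable_pos_fin_num measurableT h2.
have q1 := integrable_neg_fin_num measurableT h1; have q2 := integrable_neg_fin_num measurableT h2.
rewrite /comp in p1 p2 q1 q2.
rewrite -(fineK p1) -(fineK p2) -(fineK q1) -(fineK q2).
by rewrite -!EFinM -!EFinD; congr EFin; rewrite /=; ring.
Qed.

End mixture_measure.

Section product_probability.
Context {R : realType} {d1 d2 : measure_display}.
Context {T1 : measurableType d1} {T2 : measurableType d2}.
Variables (m : probability T1 R) (m' : probability T2 R).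

Lemma prod_prob1 A : measurable A -> (m \x m')%E (A `*` setT) = m A.
Proof. by move=> mA; rewrite product_measure1E// -[RHS]mule1; congr (_ * _)%E; exact: probability_setT. Qed.

Lemma prod_prob2 A : measurable A -> (m \x m')%E (setT `*` A) = m' A.
Proof. by move=> mA; rewrite product_measure1E// -[RHS]mul1e; congr (_ * _)%E; exact: probability_setT. Qed.

Lemma intg_prod1 (h : T1 -> R) : intg m h -> intg (m \x m')%E (fun z => h z.1).
Proof.
move=> hh; apply/(integrable12ltyP m m') => /=.
  by apply/measurable_EFinP; apply: (measurableT_comp (intg_meas hh) measurable_fst).
rewrite (eq_integral (fun x => `|(h x)%:E|)%E); first by case/integrableP : hh.
by move=> x _ /=; rewrite integral_cst// -[RHS]mule1; congr (_ * _)%E; exact: probability_setT.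
Qed.

Lemma intg_prod2 (h : T2 -> R) : intg m' h -> intg (m \x m')%E (fun z => h z.2).
Proof.
move=> hh; apply/(integrable21ltyP m m') => /=.
  by apply/measurable_EFinP; apply: (measurableT_comp (intg_meas hh) measurable_snd).
rewrite (eq_integral (fun x => `|(h x)%:E|)%E); first by case/integrableP : hh.
by move=> x _ /=; rewrite integral_cst// -[RHS]mule1; congr (_ * _)%E; exact: probability_setT.
Qed.

End product_probability.

Section P2_tools.
Context {R : realType} {n : nat}.
Local Notation X := 'cV[R]_n.
Implicit Types m : P2 R n.

Lemma measurable_sqnE : measurable_fun setT (fun x : X => (sqn x)%:E).
Proof. by apply/measurable_EFinP; exact: measurable_sqn. Qed.

Lemma P2_intg m : intg m (fun x : X => sqn x).
Proof. exact: intg_lty (@measurable_sqn _ _) (@sqn_ge0 _ _ _) (P2_finite m). Qed.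

Lemma mixP2_finite s m m' : (\int[mixm s m m']_x (sqn x)%:E < +oo)%E.
Proof.
exact: integrable_lty (@intg_mixm _ _ _ s _ _ _ (P2_intg m) (P2_intg m')).
Qed.

Definition mixP2 s m m' : P2 R n := MkP2 (mixP2_finite s m m').

Lemma mixP2E s m m' A : 0 <= s <= 1 ->
  mixP2 s m m' A = ((1 - s)%:E * m A + s%:E * m' A)%E.
Proof. by move=> s01; rewrite /= mixmE clamp01E. Qed.

Lemma mixture_mixP2 s m m' : 0 <= s <= 1 -> mixture s m m' (mixP2 s m m').
Proof. by move=> s01 A mA; rewrite mixP2E. Qed.

Lemma diracP2_finite (y : X) : (\int[dirac y]_x (sqn x)%:E < +oo)%E.
Proof. by rewrite integral_dirac//= ?diracT ?mul1e ?ltry//; exact: measurable_sqnE. Qed.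

Definition diracP2 y : P2 R n := @MkP2 R n (dirac y) (diracP2_finite y).

Lemma Rint_diracP2 y (h : X -> R) : measurable_fun setT h ->
  \int[diracP2 y]_x h x = h y.
Proof.
move=> mh; have mh' : measurable_fun setT (fun x => (h x)%:E) by exact/measurable_EFinP.
by rewrite /Rintegral (integral_dirac y measurableT mh') diracT mul1e.
Qed.

Lemma W2_ge0 m m' : 0 <= W2 m m'.
Proof. exact: sqrtr_ge0. Qed.

Definition costm (c : probability (X * X)%type R) := (\int[c]_z (sqn (z.1 - z.2))%:E)%E.

Lemma measurable_cost : measurable_fun setT (fun z : X * X => (sqn (z.1 - z.2))%:E).
Proof.
apply/measurable_EFinP; apply: (measurableT_comp (@measurable_sqn R n)).
apply: measurable_mx => i j.
rewrite (_ : (fun z => _) = fun z : X * X => z.1 i j - z.2 i j); last first.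
  by apply/funext => z; rewrite !mxE.
apply: measurable_funB.
- exact: (measurableT_comp (measurable_entry i j) measurable_fst).
- exact: (measurableT_comp (measurable_entry i j) measurable_snd).
Qed.

Lemma W2_le m m' c K : coupling m m' c -> (costm c <= K%:E)%E -> 0 <= K ->
  W2 m m' <= Num.sqrt K.
Proof.
move=> hc cK K0; apply: ler_wsqrtr.
set S := (X in ereal_inf X).
have l0 : (0 <= ereal_inf S)%E.
  by apply: le_ereal_inf_tmp => _ [z _ <-]; apply: integral_ge0 => x _; rewrite lee_fin sqn_ge0.
have lK : (ereal_inf S <= K%:E)%E.
  by apply: le_trans cK; apply: ereal_inf_lbound; exists c.
by rewrite -lee_fin fineK// ge0_fin_numE// (le_lt_trans lK)// ltry.
Qed.

Lemma W2_sym m m' : W2 m m' = W2 m' m.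
Proof.
suff H m1 m2 : [set costm c | c in coupling m1 m2] `<=` [set costm c | c in coupling m2 m1].
  by rewrite /W2; congr (Num.sqrt (fine (ereal_inf _))); apply/seteqP; split; exact: H.
move=> _ [c hc <-].
pose sw : {mfun (X * X)%type >-> (X * X)%type} := mfun_Sub (mem_set (@measurable_swap _ _ X X)).
exists (distribution c sw).
- move=> A mA; have [h1 h2] := hc A mA; split.
  + rewrite -h2; congr (c _); apply/seteqP; split => -[x y] /=; tauto.
  + rewrite -h1; congr (c _); apply/seteqP; split => -[x y] /=; tauto.
- rewrite /costm (ge0_integral_distribution _ measurable_cost).
    apply: eq_integral => -[x y] _ /=; congr EFin.
    by rewrite -sqnN opprB.
  by move=> z; rewrite lee_fin sqn_ge0.
Qed.

(* moving a fraction tau of the mass of m to m' *)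
Lemma W2_mixture tau m m' m1 c K : 0 <= tau <= 1 -> coupling m m' c ->
  (costm c <= K%:E)%E -> 0 <= K -> mixture tau m m' m1 ->
  W2 m m1 <= Num.sqrt (tau * K).
Proof.
move=> t01 hc cK K0 hm.
have md : measurable_fun setT (fun x : X => (x, x)) by exact: measurable_fun_pair.
pose dg : {mfun X >-> (X * X)%type} := mfun_Sub (mem_set md).
have t0 : 0 <= tau by case/andP : t01.
(* The coupling leaves the fraction [1 - tau] on the diagonal, at no cost, and moves the rest along
   [c]. *)
apply: (@W2_le _ _ (mixm tau (distribution m dg) c)); last exact: mulr_ge0.
  move=> A mA; have [h1 h2] := hc A mA.
  split; rewrite /= mixmE clamp01E//.
  - transitivity ((1 - tau)%:E * m A + tau%:E * m A)%E.
      congr (_ * _ + _ * _)%E; last exact: h1.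
      by congr (P2_prob m _); apply/seteqP; split => x /= //; tauto.
    rewrite -ge0_muleDl ?lee_fin ?subr_ge0//; last by case/andP : t01.
    by rewrite -EFinD subrK mul1e.
  - transitivity ((1 - tau)%:E * m A + tau%:E * m' A)%E; last by rewrite hm.
    congr (_ * _ + _ * _)%E; last exact: h2.
    by congr (P2_prob m _); apply/seteqP; split => x /= //; tauto.
rewrite /costm ge0_integral_mixm; last 2 first.
- exact: measurable_cost.
- by move=> z; rewrite lee_fin sqn_ge0.
rewrite clamp01E// (ge0_integral_distribution _ measurable_cost); last first.
  by move=> z; rewrite lee_fin sqn_ge0.
rewrite (_ : (\int[m]_x _ = 0)%E); last first.
  by rewrite (eq_integral (cst 0%E)) ?integral0// => x _ /=; rewrite subrr sqn0.
by rewrite mule0 add0e EFinM lee_wpmul2l// lee_fin.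
Qed.

Lemma coupling_prod m m' : coupling m m' (m \x m')%E.
Proof.
move=> A mA; split.
- exact: prod_prob1.
- exact: prod_prob2.
Qed.

Lemma cost_prod_lty m m' : (costm (m \x m')%E < +oo)%E.
Proof.
have h : intg (m \x m')%E (fun z : X * X => 2 * sqn z.1 + 2 * sqn z.2).
  apply: intgD; apply: intgZ.
  - exact: (@intg_prod1 _ _ _ _ _ m m' _ (P2_intg m)).
  - exact: (@intg_prod2 _ _ _ _ _ m m' _ (P2_intg m')).
apply: le_lt_trans (integrable_lty measurableT h).
apply: ge0_le_integral => //.
- by move=> z _; rewrite lee_fin sqn_ge0.
- exact: measurable_cost.
- exact: measurable_int h.
- by move=> z _ /=; rewrite lee_fin sqnB_le.
Qed.

(** The product coupling has some finite cost [K], and moving the fraction [ts i] of the mass along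
    it costs [ts i * K]. *)
Lemma W2_mixture_cvg m m' (ts : nat -> R) (ms : nat -> P2 R n) :
  (forall i, 0 <= ts i <= 1) -> ts i @[i --> \oo] --> 0 ->
  (forall i, mixture (ts i) m m' (ms i)) -> W2 (ms i) m @[i --> \oo] --> 0.
Proof.
move=> t01 t0 hm; set K := fine (costm (m \x m')%E).
have cK : costm (m \x m')%E = K%:E.
  rewrite fineK// ge0_fin_numE ?cost_prod_lty//.
  by apply: integral_ge0 => z _; rewrite lee_fin sqn_ge0.
have K0 : 0 <= K by apply/fine_ge0/integral_ge0 => z _; rewrite lee_fin sqn_ge0.
apply: (@squeeze_cvgr _ _ _ _ (fun=> 0) (fun i => Num.sqrt (ts i * K))).
- apply: nearW => i; rewrite W2_ge0 W2_sym/=.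
  by apply: W2_mixture (coupling_prod m m') _ K0 (hm i) => //; rewrite cK.
- exact: cvg_cst.
- have h : ts i * K @[i --> \oo] --> 0.
    by rewrite -[X in _ --> X](mul0r K); apply: cvgM => //; exact: cvg_cst.
  by have := cvg_comp _ _ h (@sqrt_continuous R 0); rewrite sqrtr0.
Qed.

(** [m] is its own mixture of weight 0, so the constant sequence [W2 m m] tends to 0. *)
Lemma W2_refl m : W2 m m = 0.
Proof.
have : W2 m m @[_ --> \oo] --> 0.
  apply: (@W2_mixture_cvg m m (fun=> 0) (fun=> m)) => //.
  - by move=> i; rewrite lexx ler01.
  - exact: cvg_cst.
  - by move=> i A mA; rewrite subr0 mul1e mul0e adde0.
by move/(cvg_lim (@Rhausdorff R)); rewrite lim_cst.
Qed.

End P2_tools.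

(** * Linear functional-derivatives along mixtures *)

Section lfd.
Context {R : realType} {n : nat}.
Local Notation X := 'cV[R]_n.
Variables (k : P2 R n -> R) (dk : P2 R n -> X -> R).
Hypothesis hl : is_lfd k dk.

Definition W2continuous (k : P2 R n -> R) := forall (ms : nat -> P2 R n) m,
  W2 (ms i) m @[i --> \oo] --> 0 -> k (ms i) @[i --> \oo] --> k m.

Lemma lfd_measurable m : measurable_fun setT (dk m).
Proof.
apply: seqcont_measurable => xs x cx; case: hl => c _ _.
apply: (c xs (fun=> m) x m) => //.
by rewrite W2_refl; exact: cvg_cst.
Qed.

(** Perturbation towards a Dirac mass recovers the derivative pointwise, up to its mean. This yields
    uniqueness up to a constant, and later measurability in the remaining arguments. *)
Lemma lfd_diracP2 m y : (fun i : nat => (@harmonic R i)^-1 * (k (mixP2 (harmonic i) m (diracP2 y)) - k m))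
  @ \oo --> dk m y - \int[m]_y dk m y.
Proof.
case: hl => _ _ lim.
have h01 i : 0 <= @harmonic R i <= 1 by rewrite harmonic_ge0/= invf_le1// ler1n.
have := lim m (diracP2 y) (@harmonic R) (fun i => mixP2 (harmonic i) m (diracP2 y)).
rewrite Rint_diracP2; last exact: lfd_measurable.
apply.
- by move=> i; rewrite harmonic_gt0 (andP (h01 i)).2.
- exact: cvg_harmonic.
- by move=> i; exact: mixture_mixP2.
Qed.

Hypothesis kc : W2continuous k.

(** Elements of [P2] that agree on measurable sets need not be equal as records, for instance [m]
    and its mixture of weight 0. They are at distance 0, and the continuity of [k] identifies their
    values. *)
Lemma W2continuous_ext (m m1 : P2 R n) : (forall A, measurable A -> m1 A = m A) -> k m1 = k m.
Proof.
move=> E.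
have h : W2 m1 m @[_ --> \oo] --> 0.
  apply: (@W2_mixture_cvg _ _ m m (fun=> 0) (fun=> m1)) => //.
  - by move=> i; rewrite lexx ler01.
  - exact: cvg_cst.
  - by move=> i A mA; rewrite subr0 mul1e mul0e adde0 E.
have := @kc (fun=> m1) m h.
by move/(cvg_lim (@Rhausdorff R)); rewrite lim_cst.
Qed.

Variables (m m' : P2 R n).
Hypothesis dkint : forall mu, intg m (dk mu) /\ intg m' (dk mu).
Let phi s := k (mixP2 s m m').
Let D s := \int[m']_y dk (mixP2 s m m') y - \int[m]_y dk (mixP2 s m m') y.

(** The definition only differentiates at the beginning of a segment. At an interior point [s] of
    the segment from [m] to [m'], heading for [nu = m'] moves the weight at speed [sg = 1 - s], and
    heading for [nu = m] at speed [sg = - s]; division by [sg] turns these two limits into the right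
    and the left derivative. *)
Lemma lfd_dir (s sg : R) (nu : P2 R n) (u : nat -> R) : 0 < s < 1 -> sg != 0 ->
  (forall e, 0 < e <= 1 -> mixture e (mixP2 s m m') nu (mixP2 (s + sg * e) m m')) ->
  \int[nu]_y dk (mixP2 s m m') y - \int[mixP2 s m m']_y dk (mixP2 s m m') y = sg * D s ->
  (forall i, 0 < u i / sg) -> u i @[i --> \oo] --> 0 ->
  (u i)^-1 *: (phi (u i *: (1 : R) + s) - phi s) @[i --> \oo] --> D s.
Proof.
move=> s01 sg0 hm hD up u0.
(* The definition accepts weights in []0, 1]] only; the truncation is eventually inactive. *)
pose es i := Num.min (u i / sg) 1.
have es0 : es i @[i --> \oo] --> 0.
  apply: (@squeeze_cvgr _ _ _ _ (fun=> 0) (fun i => u i / sg)).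
  - by apply: nearW => i; rewrite le_min ltW//= ler01/= ge_min lexx.
  - exact: cvg_cst.
  - by rewrite -[X in _ --> X](mul0r sg^-1); apply: cvgM => //; exact: cvg_cst.
have esp i : 0 < es i <= 1 by rewrite lt_min up ltr01/= ge_min lexx orbT.
case: hl => _ _ /(_ (mixP2 s m m') nu es (fun i => mixP2 (s + sg * es i) m m') esp es0).
rewrite hD => /(_ (fun i => hm _ (esp i))) lim.
have : sg^-1 * ((es i)^-1 * (k (mixP2 (s + sg * es i) m m') - k (mixP2 s m m'))) @[i --> \oo] --> D s.
  rewrite -[X in _ --> X](mulKf sg0); apply: cvgM => //; exact: cvg_cst.
apply: cvg_trans; apply: near_eq_cvg.
have : \forall i \near \oo, u i / sg < 1.
  have : u i / sg @[i --> \oo] --> 0.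
    by rewrite -[X in _ --> X](mul0r sg^-1); apply: cvgM => //; exact: cvg_cst.
  by move/cvgr_lt; apply; exact: ltr01.
apply: filterS => i ui; rewrite /es min_l; last exact: ltW.
rewrite [u i *: 1]mulr1 mulrC; rewrite [sg * _]mulrC divfK// invfM invrK (addrC s).
by rewrite mulrAC mulfK.
Qed.

Lemma mixP2_mixr s e : 0 <= s <= 1 -> 0 < e <= 1 ->
  mixture e (mixP2 s m m') m' (mixP2 (s + (1 - s) * e) m m').
Proof.
move=> /andP[s0 s1] /andP[e0 e1] A mA.
have h : 0 <= s + (1 - s) * e <= 1 by apply/andP; split; nra.
rewrite !mixP2E ?s0//.
rewrite -(fineK (fin_num_measure m A mA)) -(fineK (fin_num_measure m' A mA)).
by rewrite -!EFinM -!EFinD; congr EFin; rewrite /=; ring.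
Qed.

Lemma mixP2_mixl s e : 0 <= s <= 1 -> 0 < e <= 1 ->
  mixture e (mixP2 s m m') m (mixP2 (s + (- s) * e) m m').
Proof.
move=> /andP[s0 s1] /andP[e0 e1] A mA.
have h : 0 <= s + (- s) * e <= 1 by apply/andP; split; nra.
rewrite !mixP2E ?s0//.
rewrite -(fineK (fin_num_measure m A mA)) -(fineK (fin_num_measure m' A mA)).
by rewrite -!EFinM -!EFinD; congr EFin; rewrite /=; ring.
Qed.

Lemma lfd_is_derive (s : R) : 0 < s < 1 -> is_derive s 1 phi (D s).
Proof.
move=> /andP[s0 s1].
have s01 : 0 <= s <= 1 by rewrite !ltW.
have E : \int[mixP2 s m m']_y dk (mixP2 s m m') y =
   (1 - s) * \int[m]_y dk (mixP2 s m m') y + s * \int[m']_y dk (mixP2 s m m') y.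
  by have [i1 i2] := dkint (mixP2 s m m'); rewrite /= Rint_mixm// clamp01E.
have C : (fun h : R => h^-1 *: ((phi \o shift s) (h *: 1) - phi s)) @ 0^' --> D s.
  apply: (@cvg_at_right_left_dnbhs R R^o (fun h : R => h^-1 *: ((phi \o shift s) (h *: 1) - phi s)) 0 (D s)).
  - apply/cvg_at_rightP => u [u0 uc].
    apply: (@lfd_dir s (1 - s) m') => //.
    + by rewrite s0.
    + by rewrite subr_eq0 gt_eqF.
    + by move=> e e01; exact: mixP2_mixr.
    + by rewrite E /D; ring.
    + by move=> i; rewrite divr_gt0// subr_gt0.
  - apply/cvg_at_leftP => u [u0 uc].
    apply: (@lfd_dir s (- s) m) => //.
    + by rewrite s0.
    + by rewrite oppr_eq0 gt_eqF.
    + by move=> e e01; exact: mixP2_mixl.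
    + by rewrite E /D; ring.
    + by move=> i; rewrite invrN mulrN -mulNr divr_gt0// oppr_gt0.
split; first by apply/cvg_ex; exists (D s).
exact: (cvg_lim (@Rhausdorff R) C).
Qed.

Lemma clamp01_le (u : R) : 0 <= u -> clamp01 u <= u.
Proof. by move=> u0; rewrite /clamp01 ge_max u0 ge_min lexx orbT. Qed.

Lemma clamp01_ge (u : R) : u <= 1 -> 1 - clamp01 u <= 1 - u.
Proof. by move=> u1; rewrite lerD2l lerN2 /clamp01 le_max le_min lexx u1 orbT. Qed.

Lemma lfd_continuous : {within `[0, 1], continuous phi}.
Proof.
apply/(continuous_within_itvP _ ltr01); split.
- move=> s; rewrite in_itv/= => s01; apply: differentiable_continuous.
  by apply/derivable1_diffP; have := lfd_is_derive s01; case.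
- apply/cvg_at_rightP => u [u0 uc]; apply: kc.
  apply: (@W2_mixture_cvg _ _ _ m' (clamp01 \o u)) => /=.
  + by move=> i; rewrite clamp01_ge0 -subr_ge0 clamp01_le1.
  + apply: (@squeeze_cvgr _ _ _ _ (fun=> 0) u) => //; last exact: cvg_cst.
    by apply: nearW => i; rewrite clamp01_ge0 clamp01_le// ltW.
  + by move=> i A mA; rewrite /= !mixmE (@clamp01E _ 0) ?lexx ?ler01// subr0 mul1e mul0e adde0.
- apply/cvg_at_leftP => u [u0 uc]; apply: kc.
  apply: (@W2_mixture_cvg _ _ _ m (fun i => 1 - clamp01 (u i))) => /=.
  + by move=> i; rewrite clamp01_le1/= gerBl clamp01_ge0.
  + apply: (@squeeze_cvgr _ _ _ _ (fun=> 0) (fun i => 1 - u i)) => //.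
    * by apply: nearW => i; rewrite clamp01_le1 clamp01_ge// ltW.
    * exact: cvg_cst.
    * by rewrite -(subrr 1); apply: cvgB => //; exact: cvg_cst.
  + move=> i A mA; rewrite /= !mixmE (@clamp01E _ 1) ?lexx ?ler01// subrr mul0e add0e mul1e.
    by rewrite subKr addeC.
Qed.

Lemma lfd_MVT : exists2 c, 0 < c < 1 & k m' - k m = D c.
Proof.
have [||c] := @MVT R phi D 0 1 ltr01.
- by move=> x; rewrite in_itv/= => x01; exact: lfd_is_derive.
- exact: lfd_continuous.
rewrite in_itv/= => c01; rewrite subr0 mulr1 => E; exists c => //.
rewrite -E /phi; congr (_ - _); apply: W2continuous_ext => A mA; rewrite mixP2E ?lexx ?ler01//.
  by rewrite subrr mul0e add0e mul1e.
by rewrite subr0 mul1e mul0e adde0.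
Qed.

End lfd.

(** Both derivatives, centred at their means, are the limit of the same Dirac quotients. Gradients
    in [y] therefore do not depend on the version chosen, which allows the derivative of a
    coefficient to be exchanged for that of its representation in (A3). *)
Lemma lfd_unique (R : realType) n (k k' : P2 R n -> R) dk dk' :
  is_lfd k dk -> is_lfd k' dk' -> k =1 k' ->
  forall m, exists c, forall y, dk m y = dk' m y + c.
Proof.
move=> h h' /funext E m; subst k'.
exists (\int[m]_y dk m y - \int[m]_y dk' m y) => y.
have c1 := @lfd_diracP2 _ _ _ _ h m y; have c2 := @lfd_diracP2 _ _ _ _ h' m y.
have := cvg_unique _ c1 c2; move=> /(_ (@Rhausdorff R)) e.
by rewrite -[LHS](subrK (\int[m]_y dk m y)) e; ring.
Qed.

(** * Second-order expansion in state, law and control *)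

(* Taylor with a Lipschitz derivative, when the first-order expansion is only
   known from the left end of each interval. *)
Lemma telescoping_expansion (R : realType) (phi G : R -> R) (C Q : R) :
  (forall s t, 0 <= s -> s <= t -> t <= 1 ->
     `|phi t - phi s - (t - s) * G s| <= C * (t - s) ^+ 2) ->
  (forall s, 0 <= s -> s <= 1 -> `|G s - G 0| <= Q * s) ->
  `|phi 1 - phi 0 - G 0| <= Q / 2.
Proof.
move=> h1 h2.
have C0 : 0 <= C by have := h1 0 1 (lexx _) ler01 (lexx _); have := normr_ge0 (phi 1 - phi 0 - (1 - 0) * G 0); rewrite subr0 expr1n mulr1; exact: le_trans.
have Q0 : 0 <= Q by have := h2 1 ler01 (lexx _); rewrite mulr1; apply: le_trans.
(* Induction along the grid of mesh [h = 1 / (K + 1)]: each step adds the local error [C h^2] and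
   the drift of [G], at most [h Q (i h)], and [i^2 / 2 + i <= (i + 1)^2 / 2]. At the last point this
   gives [Q / 2 + C h], so [C] disappears with the mesh. *)
have key (K : nat) (h : R) (i : nat) : h = K.+1%:R^-1 -> (i <= K.+1)%N ->
   `|phi (i%:R * h) - phi 0 - (i%:R * h) * G 0| <= Q * h ^+ 2 * (i%:R ^+ 2 / 2) + C * h ^+ 2 * i%:R.
  move=> hE; have hp : 0 < h by rewrite hE invr_gt0.
  elim: i => [|i ih] iK.
    by rewrite !mul0r subrr subr0 normr0 expr0n/= mul0r !mulr0 addr0.
  have := ih (ltnW iK).
  have i1 : i%:R * h <= 1 by rewrite hE ler_pdivrMr ?mul1r ?ler_nat// ltnW.
  have i2 : i.+1%:R * h <= 1 by rewrite hE ler_pdivrMr ?mul1r ?ler_nat// ltnW.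
  have i0 : 0 <= i%:R * h by rewrite mulr_ge0// ltW.
  have ii : i%:R * h <= i.+1%:R * h by rewrite ler_pM2r// ler_nat.
  have E : i.+1%:R * h - i%:R * h = h by rewrite -mulrBl -natrB// subSnn mul1r.
  have a1 := h1 _ _ i0 ii i2; have a2 := h2 _ i0 i1.
  rewrite E in a1.
  have -> : phi (i.+1%:R * h) - phi 0 - i.+1%:R * h * G 0 =
    (phi (i%:R * h) - phi 0 - i%:R * h * G 0) +
    (phi (i.+1%:R * h) - phi (i%:R * h) - h * G (i%:R * h)) +
    h * (G (i%:R * h) - G 0) by rewrite -natr1; ring.
  move=> a3.
  apply: le_trans (ler_normD _ _) _; apply: le_trans (lerD (ler_normD _ _) (lexx _)) _.
  rewrite (normrM h) (gtr0_norm hp).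
  apply: le_trans (lerD (lerD a3 a1) (ler_wpM2l (ltW hp) a2)) _.
  rewrite -(@natr1 _ i); have : 0 <= Q * h ^+ 2 / 2 by rewrite divr_ge0// mulr_ge0// sqr_ge0.
  move: (i%:R) => x; nra.
apply/ler_addgt0Pr => e e0.
have [K hK] : exists K : nat, C * K.+1%:R^-1 <= e.
  exists (Num.truncn (C / e)); rewrite ler_pdivrMr// mulrC -ler_pdivrMr//.
  by rewrite ltW// truncnS_gt.
have := key K _ K.+1 erefl (leqnn _); rewrite /= divff ?pnatr_eq0// mul1r => h.
apply: le_trans h _; rewrite -!mulrA.
have h0 : (K.+1%:R : R) != 0 by rewrite pnatr_eq0.
by rewrite !(mulKf h0) mulVf// mulr1 lerD2l.
Qed.

Section laws.
Context {R : realType} {d : measure_display} {Omega : measurableType d}.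
Context (P : probability Omega R) {n : nat}.
Local Notation X := 'cV[R]_n.
Implicit Types xi : Omega -> X.

Lemma sqi_intg xi : sq_integrable P xi -> intg P (fun w => sqn (xi w)).
Proof.
move=> [mx hx]; apply: intg_lty => //; last by move=> w; exact: sqn_ge0.
exact: (measurableT_comp (@measurable_sqn _ _) mx).
Qed.

Lemma intg_sqi xi : measurable_fun setT xi -> intg P (fun w => sqn (xi w)) -> sq_integrable P xi.
Proof. by move=> mx hx; split => //; exact: integrable_lty hx. Qed.

Lemma sqi_L2f xi i : sq_integrable P xi -> L2f P (fun w => xi w i 0).
Proof.
move=> hx; have mx : measurable_fun setT (fun w => xi w i 0).
  exact: (measurableT_comp (measurable_coord i) hx.1).
split => //; apply: (intg_le _ _ (sqi_intg hx)); first exact: measurable_funX.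
by move=> w; rewrite ger0_norm ?sqr_ge0// coord_sqr_le.
Qed.

Lemma L2f_sqi xi : (forall i, L2f P (fun w => xi w i 0)) -> sq_integrable P xi.
Proof.
move=> h; apply: intg_sqi.
  by apply: measurable_mx => i j; rewrite (ord1 j); case: (h i).
have : intg P (fun w => \sum_i xi w i 0 ^+ 2) by apply: intg_sum => i; case: (h i).
by apply: eq_intg => w; rewrite sqnE.
Qed.

Lemma measurable_enorm xi : measurable_fun setT xi -> measurable_fun setT (fun w => enorm (xi w)).
Proof.
move=> mx; apply: (measurableT_comp (continuous_measurable_fun (@sqrt_continuous R))).
exact: (measurableT_comp (@measurable_sqn _ _) mx).
Qed.

Lemma sqi_L2f_enorm xi : sq_integrable P xi -> L2f P (fun w => enorm (xi w)).
Proof.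
move=> hx; split; first exact: (measurable_enorm hx.1).
by apply: eq_intg (sqi_intg hx) => w; rewrite enorm_sqr.
Qed.

Lemma sqi_enorm xi (f : Omega -> R) : measurable_fun setT xi -> L2f P f ->
  (forall w, enorm (xi w) <= f w) -> sq_integrable P xi.
Proof.
move=> mx hf le; apply: L2f_sqi => i; apply: L2f_le hf.
  exact: (measurableT_comp (measurable_coord i) mx).
move=> w; apply: le_trans (coord_le _ _) _; apply: le_trans (le w) (ler_norm _).
Qed.

Lemma sqiD xi xi' : sq_integrable P xi -> sq_integrable P xi' ->
  sq_integrable P (fun w => xi w + xi' w).
Proof.
move=> h h'; apply: L2f_sqi => i.
rewrite (_ : (fun w => _) = fun w => xi w i 0 + xi' w i 0); last by apply/funext => w; rewrite mxE.
by apply: L2fD; exact: sqi_L2f.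
Qed.

Lemma sqiZ c xi : sq_integrable P xi -> sq_integrable P (fun w => c *: xi w).
Proof.
move=> h; apply: L2f_sqi => i.
rewrite (_ : (fun w => _) = fun w => c * xi w i 0); last by apply/funext => w; rewrite mxE.
by apply: L2fZ; exact: sqi_L2f.
Qed.

Lemma sqiB xi xi' : sq_integrable P xi -> sq_integrable P xi' ->
  sq_integrable P (fun w => xi w - xi' w).
Proof.
move=> h /(sqiZ (-1)) h'; rewrite (_ : (fun w => _) = fun w => xi w + -1 *: xi' w).
  exact: sqiD.
by apply/funext => w; rewrite scaleN1r.
Qed.

Lemma lawE xi A : sq_integrable P xi -> law P xi A = P (xi @^-1` A).
Proof. by move=> hx; rewrite /law; case: pselect. Qed.

Lemma law_ge0_integral xi (h : X -> \bar R) : sq_integrable P xi ->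
  measurable_fun setT h -> (forall x, 0 <= h x)%E ->
  (\int[law P xi]_x h x = \int[P]_w h (xi w))%E.
Proof.
move=> hx mh h0; rewrite /law; case: pselect => // hx' /=.
by rewrite ge0_integral_distribution.
Qed.

Lemma law_intg xi (h : X -> R) : sq_integrable P xi -> measurable_fun setT h ->
  intg P (fun w => h (xi w)) -> intg (law P xi) h.
Proof.
move=> hx mh /integrableP[_ hi]; apply/integrableP; split; first exact/measurable_EFinP.
rewrite law_ge0_integral//; apply: measurableT_comp => //; exact/measurable_EFinP.
Qed.

Lemma law_Rint xi (h : X -> R) : sq_integrable P xi -> measurable_fun setT h ->
  intg P (fun w => h (xi w)) -> \int[law P xi]_x h x = \int[P]_w h (xi w).
Proof.
move=> hx mh hi; rewrite /law; case: pselect => // hx' /=; congr fine.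
rewrite /distribution integral_pushforward//; exact/measurable_EFinP.
Qed.

Definition nrmL2 xi : R := Num.sqrt (\int[P]_w sqn (xi w)).

Lemma nrmL2_ge0 xi : 0 <= nrmL2 xi. Proof. exact: sqrtr_ge0. Qed.

Lemma nrmL2_sqr xi : nrmL2 xi ^+ 2 = \int[P]_w sqn (xi w).
Proof. by rewrite sqr_sqrtr// Rint_ge0// => w; exact: sqn_ge0. Qed.

Lemma joint_coupling xi xi' : sq_integrable P xi -> sq_integrable P xi' ->
  exists2 c, coupling (law P xi) (law P xi') c &
     (costm c <= (\int[P]_w sqn (xi w - xi' w))%:E)%E.
Proof.
move=> hx hx'; have mj : measurable_fun setT (fun w => (xi w, xi' w)).
  by apply: measurable_fun_pair; [exact: hx.1|exact: hx'.1].
pose j : {mfun Omega >-> (X * X)%type} := mfun_Sub (mem_set mj).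
exists (distribution P j).
  move=> A mA; rewrite !lawE//; split; congr (P _); apply/seteqP; split => w /= //; tauto.
rewrite /costm (ge0_integral_distribution _ (@measurable_cost _ _)); last first.
  by move=> z; rewrite lee_fin sqn_ge0.
rewrite EFin_Rint//; exact: sqi_intg (sqiB hx hx').
Qed.

Lemma W2_law xi xi' : sq_integrable P xi -> sq_integrable P xi' ->
  W2 (law P xi) (law P xi') <= nrmL2 (fun w => xi w - xi' w).
Proof.
move=> hx hx'; have [c hc cc] := joint_coupling hx hx'.
by apply: W2_le hc cc _; apply: Rint_ge0 => w; exact: sqn_ge0.
Qed.

Lemma Rint_enorm_le xi : sq_integrable P xi -> \int[P]_w enorm (xi w) <= nrmL2 xi.
Proof.
move=> hx; have hL := sqi_L2f_enorm hx.
rewrite -(ger0_norm (nrmL2_ge0 _)) -[leLHS]ger0_norm; last by apply: Rint_ge0 => w; exact: enorm_ge0.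
rewrite -(@ler_pXn2r _ 2) ?nnegrE// !real_normK ?num_real// nrmL2_sqr.
have h1 : L2f P (fun=> 1).
  split => //; apply: finite_measure_integrable_cst => //.
have := CS_Rint hL h1.
rewrite (_ : \int[P]_x (enorm (xi x) * 1) = \int[P]_x enorm (xi x)); last first.
  by apply: eq_Rintegral => w _; rewrite mulr1.
move/le_trans; apply; rewrite /n2 [X in _ * X](_ : _ = 1).
  rewrite mulr1 le_eqVlt; apply/orP; left; apply/eqP.
  by apply: eq_Rintegral => w _; rewrite enorm_sqr.
rewrite /Rintegral (_ : (\int[P]_x _)%E = 1%E)//.
by rewrite expr1n integral_cst// mul1e; exact: probability_setT.
Qed.

End laws.

(** * The remainder for a function of state, law and control *)

Section second_order_remainder.
Context {R : realType} {d : measure_display} {Omega : measurableType d}.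
Context (P : probability Omega R) {n l : nat}.
Local Notation X := 'cV[R]_n.
Local Notation V := 'cV[R]_l.
Variables (K : X -> P2 R n -> V -> R) (dK : X -> P2 R n -> V -> X -> R).
Hypothesis Kd : forall x m v, differentiable (fun z : X * V => K z.1 m z.2 : R^o) (x, v).
Hypothesis Kl : forall x v, is_lfd (fun m => K x m v) (fun m => dK x m v).
Hypothesis Kc : forall x v, W2continuous (fun m => K x m v).
Hypothesis Kdy : forall x m v y, differentiable (dK x m v : X -> R^o) y.

Let Gx x m v := grad (fun x => K x m v) x.
Let Gv x m v := grad (K x m) v.
Let Gy x m v y := grad (dK x m v) y.

Variables (M C : R).
Hypothesis KM : forall x m v y, enorm (Gy x m v y) <= M.
Hypothesis C0 : 0 <= C.
Hypothesis Lx : forall x x' m m' v v', enorm (Gx x' m' v' - Gx x m v)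
  <= C * (enorm (x' - x) + W2 m m' + enorm (v' - v)).
Hypothesis Lv : forall x x' m m' v v', enorm (Gv x' m' v' - Gv x m v)
  <= C * (enorm (x' - x) + W2 m m' + enorm (v' - v)).
Hypothesis Ly : forall x x' m m' v v' y y', enorm (Gy x' m' v' y' - Gy x m v y)
  <= C * (enorm (x' - x) + W2 m m' + enorm (v' - v) + enorm (y' - y)).

Lemma Gy_measurable x m v i : measurable_fun setT (fun y => Gy x m v y i 0).
Proof.
apply: seqcont_measurable => ys y cy; apply/cvgrPdist_le => e e0.
have : C * enorm (ys k - y) @[k --> \oo] --> 0.
  rewrite -[X in _ --> X](mulr0 C); apply: cvgM; first exact: cvg_cst.
  have := cvg_comp _ _ (sqn_cvg0 cy) (@sqrt_continuous R 0); rewrite sqrtr0; exact.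
move/cvgrPdist_le => /(_ _ e0); apply: filterS => k; rewrite sub0r normrN ger0_norm; last first.
  by rewrite mulr_ge0// enorm_ge0.
apply: le_trans; rewrite distrC; have := coord_le (Gy x m v (ys k) - Gy x m v y) i.
rewrite !mxE => /le_trans; apply; apply: le_trans (Ly _ _ _ _ _ _ _ _) _.
by rewrite !subrr W2_refl !enorm0 !add0r.
Qed.

Lemma dK_line x m v y y' : exists2 c, 0 < c < 1 &
  dK x m v y' - dK x m v y = dot (Gy x m v (y + c *: (y' - y))) (y' - y).
Proof.
have := @is_derive_MVT _ (fun t : R => dK x m v (y + t *: (y' - y)))
  (fun t => dot (Gy x m v (y + t *: (y' - y))) (y' - y)).
rewrite scale1r scale0r addr0 (addrC y) subrK; apply => t _.
exact: is_derive_grad.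
Qed.

Lemma dK_growth x m v y : `|dK x m v y| <= `|dK x m v 0| + M * enorm y.
Proof.
have [c _] := dK_line x m v 0 y; rewrite subr0 => E.
rewrite -{1}(subrK (dK x m v 0) (dK x m v y)) E addrC.
apply: le_trans (ler_normD _ _) _; rewrite lerD2l.
by apply: le_trans (norm_dot _ _) _; rewrite ler_wpM2r ?enorm_ge0.
Qed.

Lemma dK_intg x m v xi : sq_integrable P xi -> intg (law P xi) (dK x m v).
Proof.
move=> hx; have mk := lfd_measurable (Kl x v) m.
apply: law_intg => //; apply: (@intg_le _ _ _ _ _ (fun w => `|dK x m v 0| + M * enorm (xi w))).
- exact: (measurableT_comp mk hx.1).
- by move=> w; exact: dK_growth.
- apply: intgD; first exact: finite_measure_integrable_cst.
  apply: intgZ; have := L2f_mul (sqi_L2f_enorm hx) (_ : L2f P (fun=> 1)).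
  rewrite (_ : (fun w => enorm (xi w) * 1) = fun w => enorm (xi w)); last by apply/funext => w; rewrite mulr1.
  by apply; split => //; exact: finite_measure_integrable_cst.
Qed.

Variables (x0 x1 : X) (v0 v1 : V) (xi xi' : Omega -> X).
Hypothesis (hxi : sq_integrable P xi) (hxi' : sq_integrable P xi').
Variables (wt L0 L1 L2 : R).
Hypothesis (wt0 : 0 <= wt) (L00 : 0 <= L0) (L10 : 0 <= L1) (L20 : 0 <= L2).
Let m0 := law P xi.
Hypothesis Bx : forall x m v, enorm (Gx x m v - Gx x0 m0 v0)
  <= wt * (L0 * enorm (x - x0) + L0 * W2 m0 m + L1 * enorm (v - v0)).
Hypothesis Bv : forall x m v, enorm (Gv x m v - Gv x0 m0 v0)
  <= wt * (L1 * enorm (x - x0) + L1 * W2 m0 m + L2 * enorm (v - v0)).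
Hypothesis By : forall x m v y y', enorm (Gy x m v y' - Gy x0 m0 v0 y)
  <= wt * (L0 * enorm (x - x0) + L0 * W2 m0 m + L0 * enorm (y' - y) + L1 * enorm (v - v0)).

Let dx := x1 - x0.
Let dv := v1 - v0.
Let dxi w := xi' w - xi w.
Let xt (t : R) := x0 + t *: dx.
Let vt (t : R) := v0 + t *: dv.
Let xit (t : R) w := xi w + t *: dxi w.
Let a := nrmL2 P dxi.

Let hdxi : sq_integrable P dxi. Proof. exact: sqiB. Qed.
Let hxit t : sq_integrable P (xit t). Proof. exact: sqiD (sqiZ _ _). Qed.
Let a0 : 0 <= a. Proof. exact: nrmL2_ge0. Qed.

Let W2_xit s t : W2 (law P (xit s)) (law P (xit t)) <= `|t - s| * a.
Proof.
apply: le_trans (W2_law (hxit s) (hxit t)) _; rewrite /a /nrmL2 -sqrtr_sqr -sqrtrM ?sqr_ge0//.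
rewrite -RintZ; last exact: sqi_intg.
apply: ler_wsqrtr; rewrite le_eqVlt; apply/orP; left; apply/eqP; apply: eq_Rintegral => w _.
rewrite -sqnZ -sqnN; congr sqn; rewrite /xit scalerBl opprB.
by rewrite opprD addrACA subrr add0r.
Qed.

Let Gyw_intg x m v (f : Omega -> X) : measurable_fun setT f ->
  intg P (fun w => dot (Gy x m v (f w)) (dxi w)).
Proof.
move=> mf; apply: (@intg_le _ _ _ _ _ (fun w => M * enorm (dxi w))).
- rewrite (_ : (fun w => _) = fun w => \sum_i Gy x m v (f w) i 0 * dxi w i 0); last first.
    by apply/funext => w; rewrite dotE.
  apply: measurable_sum => i; apply: measurable_funM.
    exact: (measurableT_comp (Gy_measurable x m v i) mf).
  exact: (measurableT_comp (measurable_coord i) hdxi.1).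
- move=> w; apply: le_trans (norm_dot _ _) _; by rewrite ler_wpM2r ?enorm_ge0.
- apply: intgZ; have := L2f_mul (sqi_L2f_enorm hdxi) (_ : L2f P (fun=> 1)).
  rewrite (_ : (fun w => enorm (dxi w) * 1) = fun w => enorm (dxi w)); last by apply/funext => w; rewrite mulr1.
  by apply; split => //; exact: finite_measure_integrable_cst.
Qed.

Let ienorm : intg P (fun w => enorm (dxi w)).
Proof.
have := L2f_mul (sqi_L2f_enorm hdxi) (_ : L2f P (fun=> 1)).
rewrite (_ : (fun w => enorm (dxi w) * 1) = fun w => enorm (dxi w)); last by apply/funext => w; rewrite mulr1.
by apply; split => //; exact: finite_measure_integrable_cst.
Qed.

Let phi t := K (xt t) (law P (xit t)) (vt t).
Let Et t := \int[P]_w dot (Gy (xt t) (law P (xit t)) (vt t) (xit t w)) (dxi w).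
Let G t := dot (Gx (xt t) (law P (xit t)) (vt t)) dx +
  dot (Gv (xt t) (law P (xit t)) (vt t)) dv + Et t.

Let e1 := \int[P]_w enorm (dxi w).
Let e1a : e1 <= a. Proof. exact: Rint_enorm_le. Qed.
Let e10 : 0 <= e1. Proof. by apply: Rint_ge0 => w; exact: enorm_ge0. Qed.

Let Rint_lin_quad (A B : R) : intg P (fun w => (A + B * enorm (dxi w)) * enorm (dxi w)) /\
  \int[P]_w ((A + B * enorm (dxi w)) * enorm (dxi w)) = A * e1 + B * a ^+ 2.
Proof.
have E w : (A + B * enorm (dxi w)) * enorm (dxi w) = A * enorm (dxi w) + B * sqn (dxi w).
  by rewrite -enorm_sqr; ring.
have i1 := intgZ A ienorm; have i2 := intgZ B (sqi_intg hdxi).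
rewrite (funext E); split; first exact: intgD.
by rewrite RintD// !RintZ// /a ?nrmL2_sqr//; exact: sqi_intg.
Qed.

(** Only the law moves here. The mean value theorem on the mixture segment between the two laws
    produces the derivative at an intermediate mixture [mc]; its integrals against the two laws are
    read on [Omega], and a second mean value theorem, in [y], is applied for each [w]. The result
    refers to the left end [s] because [mc] does not lie on the curve of laws. *)
Let step_m s t : 0 <= s -> s <= t -> t <= 1 ->
  `|phi t - K (xt t) (law P (xit s)) (vt t) - (t - s) * Et s| <=
  C * (enorm dx + a + enorm dv + a) * a * (t - s) ^+ 2.
Proof.
move=> s0 st t1; set h := t - s; have h0 : 0 <= h by rewrite subr_ge0.
have h1 : h <= 1 by rewrite /h; lra.
have [|c /andP[c0 c1]] := @lfd_MVT _ _ _ _ (Kl (xt t) (vt t)) (@Kc (xt t) (vt t)) (law P (xit s)) (law P (xit t)).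
  by move=> mu; split; exact: dK_intg.
set mc := mixP2 _ _ _ => E; rewrite /phi E.
have mk := lfd_measurable (Kl (xt t) (vt t)) mc.
have ik r : intg P (fun w => dK (xt t) mc (vt t) (xit r w)).
  have := dK_intg (xt t) mc (vt t) (hxit r).
  move=> /integrableP[_]; rewrite law_ge0_integral//; last first.
    by apply: measurableT_comp => //; exact/measurable_EFinP.
  move=> fin; apply/integrableP; split => //.
  by apply/measurable_EFinP; exact: (measurableT_comp mk (hxit r).1).
rewrite !law_Rint// -RintB// -RintZ; last exact: Gyw_intg (hxit s).1.
have i1 := Gyw_intg (xt s) (law P (xit s)) (vt s) (hxit s).1.
rewrite -RintB; [|exact: intgB|exact: intgZ].
(* [mc] is reached from the law at time [s] by moving a fraction [c] of the mass along the joint law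
   of [xit s] and [xit t]. *)
have hW : W2 (law P (xit s)) mc <= h * a.
  have [c' hc' cc'] := joint_coupling (hxit s) (hxit t).
  have c01 : 0 <= c <= 1 by rewrite !ltW.
  apply: le_trans (W2_mixture c01 hc' cc' _ (mixture_mixP2 _ _ c01)) _.
    by apply: Rint_ge0 => w; exact: sqn_ge0.
  apply: (@le_trans _ _ (Num.sqrt (\int[P]_w sqn (xit s w - xit t w)))).
    by apply: ler_wsqrtr; rewrite ler_piMl ?(ltW c1)//; apply: Rint_ge0 => w; exact: sqn_ge0.
  rewrite -(ger0_norm h0) /a /nrmL2 -sqrtr_sqr -sqrtrM ?sqr_ge0// -RintZ; last exact: sqi_intg.
  apply: ler_wsqrtr; rewrite le_eqVlt; apply/orP; left; apply/eqP; apply: eq_Rintegral => w _.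
  rewrite -sqnZ -sqnN; congr sqn; rewrite /xit /h scalerBl opprB.
  by rewrite opprD addrACA subrr add0r.
apply: le_trans (le_norm_Rint _) _; first by apply: intgB; [exact: intgB|exact: intgZ].
have [iq Eq] := Rint_lin_quad (C * h ^+ 2 * (enorm dx + a + enorm dv)) (C * h ^+ 2).
apply: (@le_trans _ _ (\int[P]_w ((C * h ^+ 2 * (enorm dx + a + enorm dv) + C * h ^+ 2 * enorm (dxi w)) * enorm (dxi w)))); last first.
  rewrite Eq; have : 0 <= C * h ^+ 2 by rewrite mulr_ge0// sqr_ge0.
  move: (enorm_ge0 dx) (enorm_ge0 dv) a0 e1a e10 => *.
  have : C * h ^+ 2 * (enorm dx + a + enorm dv) * e1 <= C * h ^+ 2 * (enorm dx + a + enorm dv) * a.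
    by rewrite ler_wpM2l// mulr_ge0// !addr_ge0.
  move=> hh; apply: le_trans (lerD hh (lexx _)) _; rewrite le_eqVlt; apply/orP; left; apply/eqP; ring.
apply: Rint_le => //; first by apply: intg_norm; apply: intgB; [exact: intgB|exact: intgZ].
move=> w; have [r /andP[r0 r1] ->] := dK_line (xt t) mc (vt t) (xit s w) (xit t w).
have -> : xit t w - xit s w = h *: dxi w.
  by rewrite /xit /h scalerBl opprD addrACA subrr add0r.
rewrite dotZr -mulrBr -dotBl normrM (ger0_norm h0).
have hy : enorm (xit s w + r *: (h *: dxi w) - xit s w) <= h * enorm (dxi w).
  rewrite addrAC subrr add0r !enormZ (ger0_norm h0) (gtr0_norm r0).
  by rewrite ler_piMl ?(ltW r1)// mulr_ge0// enorm_ge0.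
have hx : enorm (xt t - xt s) = h * enorm dx.
  by rewrite /xt opprD addrACA subrr add0r -scalerBl enormZ -/h ger0_norm.
have hv : enorm (vt t - vt s) = h * enorm dv.
  by rewrite /vt opprD addrACA subrr add0r -scalerBl enormZ -/h ger0_norm.
have B : enorm (Gy (xt t) mc (vt t) (xit s w + r *: (h *: dxi w)) - Gy (xt s) (law P (xit s)) (vt s) (xit s w))
   <= C * (h * enorm dx + h * a + h * enorm dv + h * enorm (dxi w)).
  apply: le_trans (Ly _ _ _ _ _ _ _ _) _; rewrite hx hv ler_wpM2l// lerD// lerD2r// lerD2l//.
apply: le_trans (ler_wpM2l h0 (norm_dot _ _)) _.
apply: le_trans (ler_wpM2l h0 (ler_wpM2r (enorm_ge0 _) B)) _.
by rewrite le_eqVlt; apply/orP; left; apply/eqP; ring.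
Qed.

(** The law is frozen at its value at [s], so this is the ordinary mean value theorem in state and
    control. *)
Let step_xv s t : 0 <= s -> s <= t -> t <= 1 ->
  `|K (xt t) (law P (xit s)) (vt t) - phi s - (t - s) * (dot (Gx (xt s) (law P (xit s)) (vt s)) dx +
  dot (Gv (xt s) (law P (xit s)) (vt s)) dv)| <=
  C * (enorm dx + enorm dv) ^+ 2 * (t - s) ^+ 2.
Proof.
move=> s0 st t1; set h := t - s; have h0 : 0 <= h by rewrite subr_ge0.
set ms := law P (xit s).
have xtE r : xt r = xt s + (r - s) *: dx by rewrite /xt -addrA -scalerDl (addrC s) subrK.
have vtE r : vt r = vt s + (r - s) *: dv by rewrite /vt -addrA -scalerDl (addrC s) subrK.
have [|c /andP[c0 c1]] := @is_derive_MVT _ (fun r : R => K (xt s + r *: (h *: dx)) ms (vt s + r *: (h *: dv)))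
  (fun r : R => dot (Gx (xt s + r *: (h *: dx)) ms (vt s + r *: (h *: dv))) (h *: dx) +
     dot (Gv (xt s + r *: (h *: dx)) ms (vt s + r *: (h *: dv))) (h *: dv)).
  move=> r _; apply: (@is_derive_grad2 _ _ _ (fun x v => K x ms v)); exact: Kd.
rewrite !scale1r !scale0r !addr0 -xtE -vtE => ->.
rewrite !dotZr -mulrDr -mulrBr normrM (ger0_norm h0).
rewrite (_ : forall p q r u : R, p + q - (r + u) = (p - r) + (q - u)); last by move=> *; ring.
rewrite -!dotBl.
have B1 : enorm (xt s + c *: (h *: dx) - xt s) + W2 ms ms + enorm (vt s + c *: (h *: dv) - vt s) <= h * (enorm dx + enorm dv).
  have aK k (p z : 'cV[R]_k) : p + z - p = z by rewrite addrAC subrr add0r.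
  rewrite !aK W2_refl addr0 !enormZ (ger0_norm h0) (gtr0_norm c0).
  rewrite -mulrDr -mulrDr ler_piMl ?(ltW c1)// mulr_ge0// addr_ge0// enorm_ge0//.
have Bx1 := le_trans (Lx _ _ _ _ _ _) (ler_wpM2l C0 B1).
have Bv1 := le_trans (Lv _ _ _ _ _ _) (ler_wpM2l C0 B1).
apply: le_trans (ler_wpM2l h0 (ler_normD _ _)) _.
apply: le_trans (ler_wpM2l h0 (lerD (norm_dot _ _) (norm_dot _ _))) _.
apply: le_trans (ler_wpM2l h0 (lerD (ler_wpM2r (enorm_ge0 _) Bx1) (ler_wpM2r (enorm_ge0 _) Bv1))) _.
by rewrite le_eqVlt; apply/orP; left; apply/eqP; ring.
Qed.

(** Two kinds of Lipschitz bounds are used. The global ones, with constant [C], only make the local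
    errors of order [(t - s)^2] and vanish in the telescoping; the weighted ones compare with the
    base point only, and they alone enter the bound. The derivative in [y] varies both with the law
    and with its argument, hence the two copies of [a^2] behind [L0]. *)
Lemma second_order_remainder :
  `|K x1 (law P xi') v1 - K x0 (law P xi) v0 - dot (Gx x0 m0 v0) dx - dot (Gv x0 m0 v0) dv
    - \int[P]_w dot (Gy x0 m0 v0 (xi w)) (dxi w)| <=
  wt / 2 * (L0 * (sqn dx + 2 * a * enorm dx + 2 * a ^+ 2)
    + L1 * (2 * enorm dx * enorm dv + 2 * a * enorm dv) + L2 * sqn dv).
Proof.
have xt0 : xt 0 = x0 by rewrite /xt scale0r addr0.
have vt0 : vt 0 = v0 by rewrite /vt scale0r addr0.
have xi0 : xit 0 = xi by apply/funext => w; rewrite /xit scale0r addr0.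
have xt1 : xt 1 = x1 by rewrite /xt scale1r addrC subrK.
have vt1 : vt 1 = v1 by rewrite /vt scale1r addrC subrK.
have xi1 : xit 1 = xi' by apply/funext => w; rewrite /xit scale1r addrC subrK.
set Q := wt * (L0 * (sqn dx + 2 * a * enorm dx + 2 * a ^+ 2)
    + L1 * (2 * enorm dx * enorm dv + 2 * a * enorm dv) + L2 * sqn dv).
suff T : `|phi 1 - phi 0 - G 0| <= Q / 2.
  have E1 : phi 1 = K x1 (law P xi') v1 by rewrite /phi xt1 vt1 xi1.
  have E0 : phi 0 = K x0 m0 v0 by rewrite /phi xt0 vt0 xi0.
  have EG : G 0 = dot (Gx x0 m0 v0) dx + dot (Gv x0 m0 v0) dv +
    \int[P]_w dot (Gy x0 m0 v0 (xi w)) (dxi w) by rewrite /G /Et xt0 vt0 xi0.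
  rewrite E1 E0 EG in T; rewrite [leRHS](_ : _ = Q / 2); last by rewrite /Q; ring.
  by apply: le_trans T; rewrite le_eqVlt; apply/orP; left; apply/eqP; congr (`|_|); ring.
apply: (@telescoping_expansion _ phi G
  (C * (enorm dx + a + enorm dv + a) * a + C * (enorm dx + enorm dv) ^+ 2) Q).
- move=> s t s0 st t1.
  have A := step_m s0 st t1; have B := step_xv s0 st t1.
  rewrite [leRHS]mulrDl; apply: le_trans (lerD A B).
  apply: le_trans (ler_normD _ _).
  rewrite le_eqVlt; apply/orP; left; apply/eqP; congr (`|_|); rewrite /G; ring.
- move=> s s0 s1.
  rewrite {2}/G /Et xt0 vt0 xi0 -/m0 /G.
  set Gxs := Gx (xt s) _ _; set Gvs := Gv (xt s) _ _.
  have hx : enorm (xt s - x0) = s * enorm dx.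
    by rewrite /xt addrAC subrr add0r enormZ ger0_norm.
  have hv : enorm (vt s - v0) = s * enorm dv.
    by rewrite /vt addrAC subrr add0r enormZ ger0_norm.
  have hW : W2 m0 (law P (xit s)) <= s * a.
    by have := W2_xit 0 s; rewrite xi0 subr0 ger0_norm.
  have bx : enorm (Gxs - Gx x0 m0 v0) <= wt * (L0 * (s * enorm dx) + L0 * (s * a) + L1 * (s * enorm dv)).
    apply: le_trans (Bx _ _ _) _; rewrite hx hv ler_wpM2l// lerD2r lerD2l ler_wpM2l//.
  have bv : enorm (Gvs - Gv x0 m0 v0) <= wt * (L1 * (s * enorm dx) + L1 * (s * a) + L2 * (s * enorm dv)).
    apply: le_trans (Bv _ _ _) _; rewrite hx hv ler_wpM2l// lerD2r lerD2l ler_wpM2l//.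
  have i1 := Gyw_intg (xt s) (law P (xit s)) (vt s) (hxit s).1.
  have i0 := Gyw_intg x0 m0 v0 hxi.1.
  have be : `|\int[P]_w dot (Gy (xt s) (law P (xit s)) (vt s) (xit s w)) (dxi w) -
     \int[P]_w dot (Gy x0 m0 v0 (xi w)) (dxi w)| <=
     wt * s * ((L0 * enorm dx + L0 * a + L1 * enorm dv) * e1 + L0 * a ^+ 2).
    rewrite -RintB//; apply: le_trans (le_norm_Rint (intgB i1 i0)) _.
    have [iq Eq] := Rint_lin_quad (wt * s * (L0 * enorm dx + L0 * a + L1 * enorm dv)) (wt * s * L0).
    rewrite [leRHS](_ : _ = \int[P]_w ((wt * s * (L0 * enorm dx + L0 * a + L1 * enorm dv) + wt * s * L0 * enorm (dxi w)) * enorm (dxi w))); last first.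
      by rewrite Eq; ring.
    apply: Rint_le => //; first by apply: intg_norm; exact: intgB.
    move=> w; rewrite -dotBl; apply: le_trans (norm_dot _ _) _; rewrite ler_wpM2r ?enorm_ge0//.
    apply: le_trans (By _ _ _ _ _) _; rewrite hx hv.
    have -> : enorm (xit s w - xi w) = s * enorm (dxi w).
      by rewrite /xit addrAC subrr add0r enormZ ger0_norm.
    rewrite [leRHS](_ : _ = wt * (L0 * (s * enorm dx) + L0 * (s * a) +
      L0 * (s * enorm (dxi w)) + L1 * (s * enorm dv))); last by ring.
    by rewrite ler_wpM2l// !lerD2r lerD2l ler_wpM2l.
  rewrite /Et; move: be; set I1 := \int[P]_w dot (Gy (xt s) _ _ _) _.
  set I0 := \int[P]_w dot (Gy x0 _ _ _) _; move: I1 I0 => I1 I0 be.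
  rewrite [X in `|X|](_ : _ = dot (Gxs - Gx x0 m0 v0) dx + dot (Gvs - Gv x0 m0 v0) dv +
    (I1 - I0)); last by rewrite !dotBl; ring.
  apply: le_trans (ler_normD _ _) _.
  apply: le_trans (lerD (ler_normD _ _) be) _.
  have b1 := le_trans (norm_dot (Gxs - Gx x0 m0 v0) dx) (ler_wpM2r (enorm_ge0 _) bx).
  have b2 := le_trans (norm_dot (Gvs - Gv x0 m0 v0) dv) (ler_wpM2r (enorm_ge0 _) bv).
  apply: le_trans (lerD (lerD b1 b2) (lexx _)) _.
  rewrite /Q -!enorm_sqr.
  have c0 : 0 <= wt * s by rewrite mulr_ge0.
  have : wt * s * ((L0 * enorm dx + L0 * a + L1 * enorm dv) * e1) <= wt * s * ((L0 * enorm dx + L0 * a + L1 * enorm dv) * a).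
    by rewrite ler_wpM2l// ler_wpM2l// !addr_ge0// mulr_ge0// enorm_ge0.
  move: (enorm dx) (enorm dv) => p q; lra.
Qed.

End second_order_remainder.

(** * Increments of the noises *)

Section product_integral.
Context {R : realType} {d1 d2 : measure_display}.
Context {T1 : measurableType d1} {T2 : measurableType d2}.
Variables (m : {sigma_finite_measure set T1 -> \bar R}) (m' : {sigma_finite_measure set T2 -> \bar R}).

Lemma intg_prod_mul (f : T1 -> R) (g : T2 -> R) : intg m f -> intg m' g ->
  intg (m \x m')%E (fun z => f z.1 * g z.2) /\
  \int[(m \x m')%E]_z (f z.1 * g z.2) = \int[m]_x f x * \int[m']_y g y.
Proof.
move=> hf hg; have mf := intg_meas hf; have mg := intg_meas hg.
have mm : measurable_fun setT (fun z : T1 * T2 => f z.1 * g z.2).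
  by apply: measurable_funM; [exact: (measurableT_comp mf measurable_fst)|exact: (measurableT_comp mg measurable_snd)].
have i : intg (m \x m')%E (fun z => f z.1 * g z.2).
  apply/(integrable12ltyP m m') => /=; first exact/measurable_EFinP.
  rewrite (eq_integral (fun x : T1 => `|f x|%:E * \int[m']_y `|g y|%:E)%E); last first.
    move=> x _; rewrite -ge0_integralZl//=; last first.
      by apply/measurable_EFinP; exact: measurableT_comp.
    by apply: eq_integral => y _; rewrite -EFinM normrM.
  have iag := intg_norm hg; have iaf := intg_norm hf.
  rewrite ge0_integralZr//=; [|by apply/measurable_EFinP; exact: measurableT_comp|exact: integral_ge0].
  by rewrite -(EFin_Rint iaf) -(EFin_Rint iag) -EFinM ltry.
split => //; apply: EFin_inj; rewrite EFin_Rint// -(@integral12_prod_meas1 _ _ _ _ _ m m')//.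
rewrite EFinM (EFin_Rint hf) -integralZr//.
apply: eq_integral => x _; rewrite /fubini_F/= (EFin_Rint hg) -integralZl//.
Qed.

End product_integral.

Section sub_sigma_algebra.
Context {R : realType} {d : measure_display} {Omega : measurableType d}.
Implicit Types G H : set (set Omega).

Lemma meas_wrtP G d' (U : measurableType d') (h : Omega -> U) : sigma_algebra setT G ->
  meas_wrt G h <-> measurable_fun setT (h : g_sigma_algebraType G -> U).
Proof.
move=> sG; split => [hh _ Y mY|hh Y mY].
  by rewrite setTI; apply: sub_sigma_algebra; exact: hh.
have := hh measurableT Y mY; rewrite setTI.
by rewrite /measurable/= (sigma_algebra_id sG).
Qed.

Lemma meas_wrt_comp G d' (U : measurableType d') d'' (U' : measurableType d'')
  (f : U -> U') (h : Omega -> U) : measurable_fun setT f -> meas_wrt G h -> meas_wrt G (f \o h).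
Proof. by move=> mf mh Y mY; have := mf measurableT Y mY; rewrite setTI => /mh. Qed.

Lemma meas_wrtM G (f g : Omega -> R) : sigma_algebra setT G ->
  meas_wrt G f -> meas_wrt G g -> meas_wrt G (fun w => f w * g w).
Proof.
by move=> sG /(meas_wrtP _ sG) mf /(meas_wrtP _ sG) mg; apply/meas_wrtP => //; exact: measurable_funM.
Qed.

Lemma meas_wrt_sub G H d' (U : measurableType d') (h : Omega -> U) : G `<=` H ->
  meas_wrt G h -> meas_wrt H h.
Proof. by move=> GH hh Y mY; apply/GH/hh. Qed.

Lemma meas_wrt_measurable G d' (U : measurableType d') (h : Omega -> U) : G `<=` measurable ->
  meas_wrt G h -> measurable_fun setT h.
Proof. by move=> GH hh _ Y mY; rewrite setTI; apply/GH/hh. Qed.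

Variable P : probability Omega R.

(** On rectangles the joint law of [f] and [g] is the product of their laws, hence everywhere by
    uniqueness of product measures; Fubini does the rest. *)
Lemma indep_expectation G H (f g : Omega -> R) : indep P G H ->
  meas_wrt G f -> meas_wrt H g -> intg P f -> intg P g ->
  intg P (fun w => f w * g w) /\
  \int[P]_w (f w * g w) = \int[P]_w f w * \int[P]_w g w.
Proof.
move=> GH fG gH hf hg; have mf := intg_meas hf; have mg := intg_meas hg.
pose X : {mfun Omega >-> R} := mfun_Sub (mem_set mf).
pose Y : {mfun Omega >-> R} := mfun_Sub (mem_set mg).
have mXY : measurable_fun setT (fun w => (f w, g w)) by exact: measurable_fun_pair.
pose XY : {mfun Omega >-> (R * R)%type} := mfun_Sub (mem_set mXY).
have E A : measurable A -> (distribution P X \x distribution P Y)%E A = distribution P XY A.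
  apply: product_measure_unique => C D mC mD.
  by rewrite -[RHS](GH (f @^-1` C) (g @^-1` D)); [|exact: fG|exact: gH].
have iX : intg (distribution P X) id.
  by apply: integrable_pushforward => //; exact/measurable_EFinP.
have iY : intg (distribution P Y) id.
  by apply: integrable_pushforward => //; exact/measurable_EFinP.
have EX : \int[distribution P X]_x x = \int[P]_w f w.
  by congr fine; rewrite /distribution integral_pushforward//; exact/measurable_EFinP.
have EY : \int[distribution P Y]_x x = \int[P]_w g w.
  by congr fine; rewrite /distribution integral_pushforward//; exact/measurable_EFinP.
have mm : measurable_fun setT (fun z : R * R => z.1 * z.2) by exact: measurable_funM.
have [iXY EXY] := intg_prod_mul iX iY.
have Em (h : R * R -> \bar R) : (\int[distribution P X \x distribution P Y]_z h z =
    \int[distribution P XY]_z h z)%E.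
  by apply: eq_measure_integral => A mA _; exact: E.
have iXY' : intg (distribution P XY) (fun z => z.1 * z.2).
  move/integrableP : iXY => [m1 m2]; apply/integrableP; split => //.
  by rewrite -Em.
have ifg : intg P (fun w => f w * g w).
  move/integrableP : iXY' => [m1]; rewrite /distribution ge0_integral_pushforward//; last first.
    by apply: measurableT_comp => //; exact/measurable_EFinP.
  move=> m2; apply/integrableP; split => //.
  by apply/measurable_EFinP; exact: measurable_funM.
split => //.
rewrite -EX -EY.
transitivity (\int[distribution P XY]_z (z.1 * z.2)).
  by congr fine; rewrite /distribution integral_pushforward//; exact/measurable_EFinP.
transitivity (\int[(distribution P X \x distribution P Y)%E]_z (z.1 * z.2)).
  by congr fine; exact/esym/Em.
exact: EXY.
Qed.

End sub_sigma_algebra.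

(** * Expectations through densities; normal and Poisson moments *)

Section density.
Context {R : realType} {d : measure_display} {T : measurableType d}.
Variables (mu nu : {measure set T -> \bar R}) (p : T -> R).
Hypothesis (p0 : forall x, 0 <= p x) (mp : measurable_fun setT p).
Hypothesis nuE : forall A, measurable A -> nu A = (\int[mu]_(x in A) (p x)%:E)%E.

Import HBNNSimple.

Let density_nnsfun (h : {nnsfun T >-> R}) :
  (\int[nu]_x (h x)%:E = \int[mu]_x ((h x)%:E * (p x)%:E))%E.
Proof.
rewrite integralT_nnsfun sintegralE.
rewrite [RHS](eq_integral (fun x => \sum_(r \in range h) (r * \1_(h @^-1` [set r]) x)%:E * (p x)%:E)%E); last first.
  by move=> x _; rewrite [in LHS]fimfunE -fsumEFin// ge0_mule_fsuml// => r; rewrite EFinM nnfun_muleindic_ge0.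
rewrite ge0_integral_fsum//; last 2 first.
- move=> r; apply/emeasurable_funM; last exact/measurable_EFinP.
  by apply/measurable_EFinP; exact: measurableT_comp.
- by move=> r x _; rewrite mule_ge0 ?lee_fin// -?lee_fin ?EFinM ?nnfun_muleindic_ge0.
apply: eq_fsbigr => r _; have [r0|r0] := leP 0 r.
- rewrite nuE// integral_mkcond/= -ge0_integralZl//.
  + apply: eq_integral => x _; rewrite /patch indicE; case: ifPn => _; rewrite ?mulr1 ?mulr0 ?mule0 ?mul0e//.
  + apply/(measurable_restrictT _ _).1 => //; apply/measurable_funTS; exact/measurable_EFinP.
  + by move=> x _; rewrite /patch; case: ifPn => _ //; rewrite lee_fin.
- rewrite preimage_nnfun0// measure0 mule0; apply/esym; apply: integral0_eq => x _.
  by rewrite indic0 mulr0 mul0e.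
Qed.

Lemma ge0_integral_density (f : T -> \bar R) : measurable_fun setT f -> (forall x, 0 <= f x)%E ->
  (\int[nu]_x f x = \int[mu]_x (f x * (p x)%:E))%E.
Proof.
move=> mf f0; pose f_ := nnsfun_approx measurableT mf.
transitivity (lim (\int[nu]_x (f_ n x)%:E @[n --> \oo])%E).
  rewrite -monotone_convergence//=.
  - by apply: eq_integral => ? _; apply/esym/cvg_lim => //; exact: cvg_nnsfun_approx.
  - by move=> n; exact/measurable_EFinP.
  - by move=> n ? _; rewrite lee_fin.
  - by move=> ? _ ? ? mn; rewrite lee_fin; exact/lefP/nd_nnsfun_approx.
transitivity (lim (\int[mu]_x ((f_ n x)%:E * (p x)%:E) @[n --> \oo])%E).
  by congr (limn _); apply/funext => n; exact: density_nnsfun.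
rewrite -monotone_convergence//=.
- apply: eq_integral => x _; apply: cvg_lim => //.
  by apply: cvgeZr => //; exact: cvg_nnsfun_approx.
- by move=> n; apply: emeasurable_funM; exact/measurable_EFinP.
- by move=> n x _; rewrite mule_ge0 ?lee_fin.
- by move=> x _ a b ab; rewrite lee_wpmul2r ?lee_fin//; exact/lefP/nd_nnsfun_approx.
Qed.

End density.

Lemma ge0_expectation_density {R : realType} {d : measure_display} {T : measurableType d}
  {d' : measure_display} {Omega : measurableType d'}
  (P : probability Omega R) (W : Omega -> T) (mu : {measure set T -> \bar R}) (p : T -> R) :
  measurable_fun setT W -> (forall x, 0 <= p x) -> measurable_fun setT p ->
  (forall A, measurable A -> P (W @^-1` A) = (\int[mu]_(x in A) (p x)%:E)%E) ->
  forall f : T -> R, measurable_fun setT f -> (forall x, 0 <= f x) ->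
  (\int[P]_w (f (W w))%:E = \int[mu]_x (f x * p x)%:E)%E.
Proof.
move=> mW p0 mp WE f mf f0; pose V : {mfun Omega >-> T} := mfun_Sub (mem_set mW).
rewrite -(@ge0_integral_distribution _ _ _ _ _ P V (EFin \o f))//; last exact/measurable_EFinP.
rewrite (@ge0_integral_density _ _ _ mu (distribution P V) p p0 mp WE (EFin \o f))//.
exact/measurable_EFinP.
Qed.

Section normal_moments.
Context {R : realType}.
Variable s : R.
Hypothesis s0 : 0 < s.
Local Notation mu := (@lebesgue_measure R).
Let c : R := (2 * s ^+ 2)^-1.
Let k : R := normal_peak s.
Let pdf (x : R) : R := normal_pdf 0 s x.

Let c0 : 0 < c. Proof. by rewrite invr_gt0 mulr_gt0// exprn_gt0. Qed.
Let k0 : 0 < k. Proof. by rewrite normal_peak_gt0// gt_eqF. Qed.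
Let pdfE x : pdf x = k * expR (- (c * x ^+ 2)).
Proof.
rewrite /pdf normal_pdfE ?gt_eqF// /normal_fun subr0; congr (_ * expR _).
by rewrite mulNr mulrC /c mulr_natl.
Qed.
Let cs : 2 * c * s ^+ 2 = 1.
Proof. by rewrite /c invfM; field; rewrite gt_eqF. Qed.

Let dexp (x : R) : is_derive x 1 (fun x : R => expR (- (c * x ^+ 2))) (expR (- (c * x ^+ 2)) * (- (c * (2 * x)))).
Proof.
have h : is_derive x 1 (fun x : R => - (c * x ^+ 2)) (- (c * (2 * x))).
  by apply: is_derive_eq; rewrite scaler1 -[_ *: _]/(_ * _) /=; ring.
exact: (@is_derive1_comp _ expR _ x _ _ (is_derive_expR _) h).
Qed.

(** Integration by parts for the second moment: the derivative of [F] is [x^2 pdf - s^2 pdf], so the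
    moment on an interval is [s^2] times the mass plus a boundary term. *)
Let F (x : R) : R := - (s ^+ 2 * x) * pdf x.
Let dF (x : R) : is_derive x 1 F (x ^+ 2 * pdf x - s ^+ 2 * pdf x).
Proof.
have -> : F = (fun x => (- (s ^+ 2 * k)) * (x * expR (- (c * x ^+ 2)))).
  by apply/funext => y; rewrite /F pdfE; ring.
have h := @is_deriveM _ _ (fun x : R^o => x : R^o) _ _ _ _ _ (is_derive_id x 1) (dexp x).
have h2 := is_deriveZ (- (s ^+ 2 * k)) h.
apply: (is_derive_eq h2); rewrite -![_ *: _]/(_ * _) !pdfE.
have -> : x ^+ 2 = 2 * c * s ^+ 2 * x ^+ 2 by rewrite cs mul1r.
have E : expR (- (c * (2 * c * s ^+ 2 * x ^+ 2))) = expR (- (c * x ^+ 2)) by rewrite cs mul1r.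
rewrite E; ring.
Qed.

(** An even antiderivative of [x pdf]: its increments over symmetric intervals vanish. *)
Let G (x : R) : R := - s ^+ 2 * pdf x.
Let dG (x : R) : is_derive x 1 G (x * pdf x).
Proof.
have -> : G = (fun x => (- (s ^+ 2 * k)) * expR (- (c * x ^+ 2))).
  by apply/funext => y; rewrite /G pdfE; ring.
have h2 := is_deriveZ (- (s ^+ 2 * k)) (dexp x).
apply: (is_derive_eq h2); rewrite -![_ *: _]/(_ * _) !pdfE.
transitivity (x * (k * expR (- (c * x ^+ 2))) * (2 * c * s ^+ 2)); last by rewrite cs mulr1.
ring.
Qed.

Let cpdf : continuous pdf.
Proof. by apply: continuous_normal_pdf; rewrite gt_eqF. Qed.

Let FTC (H h : R -> R) (n : nat) : (forall x : R, is_derive x 1 H (h x)) -> continuous h ->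
  \int[mu]_(x in `[- n.+1%:R, n.+1%:R]) h x = H n.+1%:R - H (- n.+1%:R).
Proof.
move=> dH ch; have n0 : - n.+1%:R < n.+1%:R :> R by rewrite -subr_gt0 opprK addr_gt0.
have cH x : {for x, continuous H}.
  by apply: differentiable_continuous; apply/derivable1_diffP; have := dH x; case.
rewrite /Rintegral (@continuous_FTC2 _ h H)//.
- by apply: continuous_subspaceT.
- split.
  + by move=> x _; have := dH x; case.
  + by apply: cvg_at_right_filter; exact: cH.
  + by apply: cvg_at_left_filter; exact: cH.
- by move=> x _; rewrite derive1E; have := dH x; case.
Qed.

Let itvn (n : nat) : set R := `[- n.+1%:R, n.+1%:R].
Let itvU : \bigcup_n itvn n = setT.
Proof.
apply/seteqP; split => // x _; exists (Num.truncn `|x|) => //.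
by rewrite /itvn/= in_itv/= -ler_norml ltW// truncnS_gt.
Qed.
Let itv_homo : {homo itvn : n m / (n <= m)%N >-> (n <= m)%O}.
Proof.
move=> n m nm; apply/subsetPset => x; rewrite /itvn/= !in_itv/= => /andP[h1 h2].
have : n.+1%:R <= m.+1%:R :> R by rewrite ler_nat.
by move=> h; rewrite (le_trans _ h1) ?lerN2// (le_trans h2).
Qed.

Let cvg_itvn (h : R -> R) : measurable_fun setT h -> (forall x, 0 <= h x) ->
  (\int[mu]_(x in itvn n) (h x)%:E)%E @[n --> \oo] --> (\int[mu]_x (h x)%:E)%E.
Proof.
move=> mh h0; rewrite -itvU; apply: ge0_nondecreasing_set_cvg_integral => //.
- by move=> n; exact: measurable_itv.
- by move=> n; apply/measurable_funTS/measurable_EFinP.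
- by move=> n x _; rewrite lee_fin.
Qed.

Let mpdf : measurable_fun setT pdf. Proof. exact: measurable_normal_pdf. Qed.
Let pdf0 x : 0 <= pdf x. Proof. exact: normal_pdf_ge0. Qed.

Let csq : continuous (fun x : R => x ^+ 2 * pdf x).
Proof. move=> x; apply: cvgM; [exact: exprn_continuous|exact: cpdf]. Qed.
Let cx : continuous (fun x : R => x * pdf x).
Proof. move=> x; apply: cvgM; [exact: cvg_id|exact: cpdf]. Qed.

Let iitv (h : R -> R) n : continuous h -> mu.-integrable (itvn n) (EFin \o h).
Proof.
move=> ch; apply: continuous_compact_integrable; first exact: segment_compact.
exact: continuous_subspaceT.
Qed.

Lemma normal_second_moment : (\int[mu]_x (x ^+ 2 * pdf x)%:E = (s ^+ 2)%:E)%E.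
Proof.
have mh : measurable_fun setT (fun x : R => x ^+ 2 * pdf x) by apply: measurable_funM => //; exact: measurable_funX.
have C1 := cvg_itvn mh (fun x => mulr_ge0 (sqr_ge0 x) (pdf0 x)).
have C2 := cvg_itvn mpdf pdf0.
rewrite integral_normal_pdf in C2.
have E n : (\int[mu]_(x in itvn n) (x ^+ 2 * pdf x)%:E = (s ^+ 2)%:E * \int[mu]_(x in itvn n) (pdf x)%:E + (F n.+1%:R - F (- n.+1%:R))%:E)%E.
  rewrite -(fineK (integrable_fin_num _ (iitv n csq))); last exact: measurable_itv.
  rewrite -(fineK (integrable_fin_num _ (iitv n cpdf))); last exact: measurable_itv.
  rewrite -EFinM -EFinD; congr EFin.
  have cd : continuous (fun x : R => x ^+ 2 * pdf x - s ^+ 2 * pdf x).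
    by move=> x; apply: cvgB; [exact: csq|apply: cvgM; [exact: cvg_cst|exact: cpdf]].
  rewrite -(FTC n dF cd).
  have mi : measurable (itvn n) by exact: measurable_itv.
  have cz : continuous (fun x : R => s ^+ 2 * pdf x).
    by move=> x; apply: cvgM; [exact: cvg_cst|exact: cpdf].
  have i1 := iitv n csq; have i2 := iitv n cz; have i3 := iitv n cpdf.
  have e1 := @RintegralB _ _ _ mu (itvn n) _ _ mi i1 i2.
  have e2 := @RintegralZl _ _ _ mu (itvn n) _ (s ^+ 2) mi i3.
  by rewrite e2 in e1; rewrite [X in _ = _ + X]e1 /Rintegral addrC subrK.
(* The boundary term is [- 2 s^2 N pdf(N)] with [N = n + 1]; since [exp(c N^2) >= c N^2], it is
   bounded by a constant times [1 / N]. *)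
have C3 : (F n.+1%:R - F (- n.+1%:R))%:E @[n --> \oo] --> 0%E.
  apply/fine_cvgP; split; first by apply: nearW.
  have EF n : F n.+1%:R - F (- n.+1%:R) = - (2 * s ^+ 2 * (n.+1%:R * pdf n.+1%:R)).
    by rewrite /F !pdfE sqrrN; ring.
  have cc : (2 * s ^+ 2 * (k / c)) * @harmonic R n @[n --> \oo] --> 0.
    by rewrite -[X in _ --> X](mulr0 (2 * s ^+ 2 * (k / c))); apply: cvgM; [exact: cvg_cst|exact: cvg_harmonic].
  rewrite (_ : fine \o _ = (fun n => - (2 * s ^+ 2 * (n.+1%:R * pdf n.+1%:R)))); last first.
    by apply/funext => n /=; rewrite EF.
  rewrite -oppr0; apply: cvgN; apply: (squeeze_cvgr _ _ cc); last exact: cvg_cst.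
  apply: nearW => n; have n0 : 0 < n.+1%:R :> R by [].
  have c2 : 0 <= 2 * s ^+ 2 by rewrite mulr_ge0// sqr_ge0.
  apply/andP; split; first by apply: mulr_ge0 => //; apply: mulr_ge0.
  rewrite -[leRHS]mulrA ler_wpM2l// pdfE expRN.
  have cN : 0 < c * n.+1%:R ^+ 2 by rewrite mulr_gt0// exprn_gt0.
  have hE : (expR (c * n.+1%:R ^+ 2))^-1 <= (c * n.+1%:R ^+ 2)^-1.
    rewrite lef_pV2 ?posrE ?expR_gt0//.
    by apply: le_trans (expR_ge1Dx _); rewrite lerDr.
  apply: (@le_trans _ _ (n.+1%:R * (k * (c * n.+1%:R ^+ 2)^-1))).
    by rewrite ler_wpM2l ?(ltW n0)// ler_wpM2l// ltW.
  rewrite le_eqVlt; apply/orP; left; apply/eqP.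
  rewrite -[@harmonic R n]/(n.+1%:R^-1 : R); move: n0; move: (n.+1%:R : R) => x x0.
  by field; rewrite !gt_eqF.
have C4 : (fun n => (s ^+ 2)%:E * (\int[mu]_(x in itvn n) (pdf x)%:E) +
   (F n.+1%:R - F (- n.+1%:R))%:E)%E @ \oo --> ((s ^+ 2)%:E * 1 + 0)%E.
  by apply: cvgeD => //; exact: cvgeZl.
rewrite mule1 adde0 -(funext E) in C4.
exact: cvg_unique C1 C4.
Qed.

Lemma normal_first_moment : mu.-integrable setT (fun x => (x * pdf x)%:E) /\ \int[mu]_x (x * pdf x) = 0.
Proof.
have i2 : intg mu (fun x => x ^+ 2 * pdf x).
  apply: intg_lty.
  - by apply: measurable_funM => //; exact: measurable_funX.
  - by move=> x; rewrite mulr_ge0 ?sqr_ge0.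
  - by rewrite normal_second_moment ltry.
have i0 : intg mu pdf by exact: integrable_normal_pdf.
have mx : measurable_fun setT (fun x : R => x * pdf x) by exact: measurable_funM.
have le x : `|x * pdf x| <= pdf x + x ^+ 2 * pdf x.
  rewrite normrM (ger0_norm (pdf0 x)) -{2}[pdf x]mul1r -mulrDl ler_wpM2r//.
  by rewrite -(real_normK (num_real x)); have := sqr_ge0 (`|x| - 1); have := normr_ge0 x; nra.
have i1 : intg mu (fun x => x * pdf x) by apply: (@intg_le _ _ _ mu _ (fun x : R => pdf x + x ^+ 2 * pdf x)) => //; exact: intgD.
split => //.
(* Truncation to symmetric intervals, dominated by [(1 + x^2) pdf]; each truncated integral is zero
   by evenness of [G]. *)
have C : (fun n => \int[mu]_x (((fun x => (x * pdf x)%:E) \_ (itvn n)) x)%E)%E @ \oo --> (\int[mu]_x (x * pdf x)%:E)%E.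
  apply: (@dominated_cvg _ _ _ mu setT measurableT _ _ (fun x => (pdf x + x ^+ 2 * pdf x)%:E)).
  - move=> n; apply/(measurable_restrictT _ _).1; first exact: measurable_itv.
    by apply/measurable_funTS/measurable_EFinP.
  - move=> x _; apply: cvg_near_cst; exists (Num.truncn `|x|) => // n /= hn.
    rewrite patchE mem_set// /itvn/= in_itv/= -ler_norml ltW//.
    by apply: lt_le_trans (truncnS_gt _) _; rewrite ler_nat.
  - by [].
  - exact: intgD.
  - move=> n x _; rewrite patchE; case: ifPn => _; first by rewrite /= lee_fin le.
    by rewrite abse0 lee_fin addr_ge0// mulr_ge0// sqr_ge0.
have Z n : (\int[mu]_x (((fun x => (x * pdf x)%:E) \_ (itvn n)) x))%E = 0%E.
  rewrite -integral_mkcond -(fineK (integrable_fin_num _ (iitv n cx))); last exact: measurable_itv.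
  congr EFin; rewrite -[LHS]/(Rintegral mu _ _) (FTC n dG cx).
  by rewrite /G !pdfE sqrrN subrr.
rewrite (funext Z) in C.
by have := cvg_unique _ C (cvg_cst _) => /(_ (@ereal_hausdorff _)); rewrite /Rintegral => ->.
Qed.

End normal_moments.

Section poisson_moments.
Context {R : realType} {d : measure_display} {Omega : measurableType d}.
Variables (P : probability Omega R) (Z : Omega -> \bar R) (nu : R).
Hypothesis mZ : measurable_fun setT Z.
Let pmf (a : nat) : R := nu ^+ a / a`!%:R * expR (- nu).
Hypothesis nu0 : 0 <= nu.
Hypothesis ZE : forall a : nat, P [set w | Z w = (a%:R)%:E] = (pmf a)%:E.

Let pmf0 a : 0 <= pmf a.
Proof. by rewrite mulr_ge0 ?expR_ge0// mulr_ge0// exprn_ge0. Qed.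

Let series_pmf : (\sum_(a <oo) (pmf a)%:E = 1)%E.
Proof.
have E (n : nat) : (\sum_(0 <= a < n) (pmf a)%:E = (series (exp_coeff nu) n * expR (- nu))%:E)%E.
  by rewrite sumEFin; congr EFin; rewrite /series/= mulr_suml.
rewrite (_ : (fun n => _) = (fun n => (series (exp_coeff nu) n * expR (- nu))%:E)); last first.
  by apply/funext => n; exact: E.
apply/cvg_lim => //; apply/fine_cvgP; split; first exact: nearW.
rewrite -(expRxMexpNx_1 nu); apply: cvgM; last exact: cvg_cst.
exact: is_cvg_series_exp_coeff.
Qed.

Let A (a : nat) := [set w | Z w = (a%:R)%:E].

Let mA a : measurable (A a).
Proof. by have := mZ measurableT (emeasurable_set1 (a%:R)%:E); rewrite setTI. Qed.

Let tA : trivIset setT A.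
Proof.
move=> a b _ _ [w [/= h1 h2]].
by move: h1; rewrite /A/= h2 => -[] /eqP; rewrite eqr_nat => /eqP.
Qed.

Let PA : P (\bigcup_a A a) = 1%E.
Proof.
rewrite measure_bigcup// -series_pmf.
rewrite (@eq_eseriesl _ _ xpredT) => [|x]; last by rewrite in_setT.
by apply: eq_eseriesr => a _; exact: ZE.
Qed.

Let aeA : {ae P, forall w, (\bigcup_a A a) w}.
Proof.
exists (~` \bigcup_a A a); split => //.
- by apply: measurableC; apply: bigcup_measurable.
- rewrite probability_setC ?PA ?subee//; exact: bigcup_measurable.
Qed.

(** The Poisson weights sum to one, so almost surely [Z] is one of the natural numbers. *)
Lemma poisson_ae_fin : {ae P, forall w, Z w \is a fin_num}.
Proof. by move: aeA; apply: filterS => w [a _ /= ->]. Qed.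

Let mz : measurable_fun setT (fun w => fine (Z w)).
Proof. exact: measurableT_comp. Qed.

Lemma poisson_ge0_expectation (h : R -> R) : measurable_fun setT h -> (forall x, 0 <= h x) ->
  (\int[P]_w (h (fine (Z w)))%:E = \sum_(a <oo) (h a%:R * pmf a)%:E)%E.
Proof.
move=> mh h0; have mU : measurable (\bigcup_a A a) by exact: bigcup_measurable.
have mhz : measurable_fun setT (fun w => (h (fine (Z w)))%:E).
  by apply/measurable_EFinP; exact: (measurableT_comp mh mz).
transitivity (\int[P]_(w in \bigcup_a A a) (h (fine (Z w)))%:E)%E.
  rewrite [RHS]integral_mkcond; apply: ae_eq_integral => //.
  - by apply/(measurable_restrictT _ _).1 => //; exact: measurable_funTS.
  - by move: aeA; apply: filterS => w hw _; rewrite patchE mem_set.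
rewrite ge0_integral_bigcup//; last 2 first.
- exact: measurable_funTS.
- by move=> w _; rewrite lee_fin.
apply: eq_eseriesr => a _.
rewrite (eq_integral (cst (h a%:R)%:E)); last first.
  by move=> w /set_mem /= ->.
by rewrite integral_cst// EFinM; congr (_ * _)%E; exact: ZE.
Qed.

(** Factorial moments: the terms with [a < j] vanish, and the shift by [j] turns the others into
    [nu^j] times the total mass. The orders 1 and 2 give the moments, as [a^2 = a (a - 1) + a]. *)
Let fact_sum (j : nat) : (\sum_(a <oo) ((a ^_ j)%:R * pmf a)%:E = (nu ^+ j)%:E)%E.
Proof.
rewrite (@nneseries_split _ _ 0 j); last by move=> k _; rewrite lee_fin mulr_ge0.
rewrite add0n big1_seq ?add0e; last first.
  by move=> i /=; rewrite mem_index_iota => /andP[_ ij]; rewrite ffact_small// mul0r.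
rewrite -nneseries_addn; last by move=> i; rewrite lee_fin mulr_ge0.
rewrite (@eq_eseriesr _ _ (fun a => (nu ^+ j)%:E * (pmf a)%:E)%E); last first.
  move=> a _; rewrite -EFinM; congr EFin; rewrite /pmf exprD.
  have h := @ffact_factd (a + j) j (leq_addl _ _); rewrite addnK in h.
  have f0 k : (k`!%:R : R) != 0 by rewrite pnatr_eq0 -lt0n fact_gt0.
  have -> : ((a + j) ^_ j)%:R = (a + j)`!%:R / a`!%:R :> R.
    by rewrite -(ffact_fact (leq_addl a j)) addnK natrM mulfK.
  by field; rewrite !f0.
transitivity ((nu ^+ j)%:E * \sum_(a <oo) (pmf a)%:E)%E; last by rewrite series_pmf mule1.
by apply: nneseriesZl => i _; rewrite lee_fin.
Qed.

Let z w := fine (Z w).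

Lemma poisson_moments : [/\ L2f P z, \int[P]_w z w = nu & \int[P]_w (z w ^+ 2) = nu ^+ 2 + nu].
Proof.
have E1 : (\int[P]_w (`|z w|)%:E = nu%:E)%E.
  rewrite (@poisson_ge0_expectation (fun x => `|x|))//.
  rewrite -[nu in RHS]expr1 -(fact_sum 1); apply: eq_eseriesr => a _.
  by rewrite ger0_norm// ffactn1.
have E2 : (\int[P]_w (z w ^+ 2)%:E = (nu ^+ 2 + nu)%:E)%E.
  rewrite (@poisson_ge0_expectation (fun x => x ^+ 2))//; last by move=> x; exact: sqr_ge0.
  rewrite EFinD -(fact_sum 2) -[nu in RHS]expr1 -(fact_sum 1) -nneseriesD; last 2 first.
  - by move=> i _ _; rewrite lee_fin mulr_ge0.
  - by move=> i _ _; rewrite lee_fin mulr_ge0.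
  apply: eq_eseriesr => a _; rewrite -EFinD; congr EFin; rewrite -mulrDl; congr (_ * _).
  rewrite -natrD -natrX; congr (_%:R); rewrite ffactn1 ffactnS ffactn1.
  by case: a => //= a; rewrite expnS expn1 mulnS addnC.
have L : L2f P z.
  split => //; apply: intg_lty; first exact: measurable_funX.
  - by move=> w; exact: sqr_ge0.
  - by rewrite E2 ltry.
split => //; last by rewrite /Rintegral E2.
transitivity (\int[P]_w `|z w|); last by rewrite /Rintegral E1.
apply: Rint_ae_eq => //; first exact: measurableT_comp.
by move: aeA; apply: filterS => w [a _ /= h]; rewrite /z h ger0_norm.
Qed.

End poisson_moments.

Lemma measurable_jumpE (R : realType) kappa : measurable (jumpE R kappa).
Proof.
rewrite (_ : jumpE R kappa = ~` ((@sqn R kappa 1) @^-1` [set 0])).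
  by apply: measurableC; rewrite -[X in measurable X]setTI; apply: (@measurable_sqn R kappa).
apply/seteqP; split => e /=; rewrite /jumpE/=.
  by move=> e0 /sqn_eq0 E; rewrite E eqxx in e0.
by move=> h; apply/eqP => E; apply: h; rewrite E sqn0.
Qed.

(** * Moments and independence of the noise increments *)

Section noise_increments.
Context {R : realType} {d : measure_display} {Omega : measurableType d}.
Context (P : probability Omega R) (T : R) (F : R -> set (set Omega)).
Context {n kappa : nat} (B : R -> Omega -> 'cV[R]_n).
Context (lam : {sigma_finite_measure set 'cV[R]_kappa -> \bar R}).
Context (N : Omega -> {measure set (R * 'cV[R]_kappa)%type -> \bar R}).
Hypothesis hn : noise_setting P T F B lam N.
Local Notation E := (jumpE R kappa).

(* the Brownian coordinates, and the jumps with mark in a given set *)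
Definition idx := ('I_n + set 'cV[R]_kappa)%type.

Definition valid (i : idx) : Prop :=
  match i with inl _ => True | inr C => measurable C /\ C `<=` E end.

Definition incr (i : idx) (s t : R) (w : Omega) : R :=
  match i with
  | inl k => B t w k 0 - B s w k 0
  | inr C => compensated lam N s t C w
  end.

(** Covariance of two noises per unit of time: Brownian coordinates are orthonormal, jump noises
    share the intensity of their common marks, and the two families are uncorrelated. *)
Definition kap (i j : idx) : R :=
  match i, j with
  | inl k, inl l => (k == l)%:R
  | inr C, inr D => fine (lam (C `&` D))
  | _, _ => 0
  end.

Let F_sigma t : 0 <= t <= T -> sigma_algebra setT (F t).
Proof. by case: (ns_filtration hn) => _ h _ _ _; exact: h. Qed.

Let F_sub t : 0 <= t <= T -> F t `<=` measurable.
Proof. by case: (ns_filtration hn) => _ _ h _ _; exact: h. Qed.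

Lemma F_mono s t : 0 <= s -> s <= t -> t <= T -> F s `<=` F t.
Proof. by case: (ns_filtration hn) => _ _ _ h _; exact: h. Qed.

Lemma meas_F_measurable t d' (U : measurableType d') (h : Omega -> U) : 0 <= t <= T ->
  meas_wrt (F t) h -> measurable_fun setT h.
Proof. by move=> t0T; apply: meas_wrt_measurable; exact: F_sub. Qed.

Lemma window_jump s t C : 0 <= s -> t <= T -> valid (inr C) ->
  jump_window s t (`]s, t] `*` C) /\ jump_window 0 t (`]s, t] `*` C) /\ jump_window 0 T (`]s, t] `*` C).
Proof.
move=> s0 tT [mC CE]; have m : measurable (`]s, t] `*` C) by apply: measurableX => //; exact: measurable_itv.
split; [|split]; split => // -[r e] [/= rst Ce]; split => //=; try exact: CE.
- by move: rst; rewrite /= !in_itv/= => /andP[a ->]; rewrite (le_lt_trans s0 a).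
- by move: rst; rewrite /= !in_itv/= => /andP[a b]; rewrite (le_lt_trans s0 a) (le_trans b tT).
Qed.

Lemma incr_meas i s t : valid i -> 0 <= s -> s <= t -> t <= T -> meas_wrt (F t) (incr i s t).
Proof.
move=> vi s0 st tT; have t0T : 0 <= t <= T by rewrite (le_trans s0 st) tT.
have s0T : 0 <= s <= T by rewrite s0 (le_trans st tT).
case: i vi => [k _|C vC] /=.
  have hB := bm_adapted (ns_brownian hn).
  have b1 : meas_wrt (F t) (fun w => B t w k 0).
    exact: (meas_wrt_comp (measurable_coord k) (hB _ t0T)).
  have b2 : meas_wrt (F t) (fun w => B s w k 0).
    apply: (meas_wrt_comp (measurable_coord k)); apply: meas_wrt_sub (hB _ s0T); exact: F_mono.
  apply/meas_wrtP; first exact: F_sigma.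
  move/meas_wrtP : b1 => b1; move/meas_wrtP : b2 => b2.
  by apply: measurable_funB; [exact: b1 (F_sigma t0T)|exact: b2 (F_sigma t0T)].
have [_ [w0 _]] := window_jump s0 tT vC.
have := prm_adapted (ns_poisson hn) t0T w0.
apply: (@meas_wrt_comp _ _ (F t) _ _ _ _ (fun z : \bar R => fine z - fine (lam C) * (t - s))).
by apply: measurable_funB.
Qed.

Lemma incr_future i s t : valid i -> 0 <= s -> s <= t -> t <= T ->
  meas_wrt (future T B N s) (incr i s t).
Proof.
move=> vi s0 st tT Y mY; apply: sub_sigma_algebra; case: i vi => [k _|C vC] /=; [left|right].
  exists t, ((fun x : 'cV[R]_n => x k 0) @^-1` Y); rewrite st tT; split => //.
    by rewrite -[X in measurable X]setTI; apply: (measurable_coord k).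
  by apply/seteqP; split => w /=; rewrite !mxE.
have [w1 [_ _]] := window_jump s0 tT vC.
exists (`]s, t] `*` C), ((fun z : \bar R => fine z - fine (lam C) * (t - s)) @^-1` Y); split => //.
- by case: w1 => m h; split => // -[r e] /h [/= a b]; split => //=; move: a; rewrite /= !in_itv/= => /andP[-> b']; rewrite (le_trans b' tT).
- by rewrite -[X in measurable X]setTI; apply: measurable_funB.
Qed.

Lemma incr0 i s w : incr i s s w = 0.
Proof.
case: i => [k|C] /=; first by rewrite subrr.
rewrite /compensated subrr mulr0 subr0 (_ : _ `*` _ = set0) ?measure0//.
by apply/seteqP; split => // -[r e] [/= + _]; rewrite in_itv/= => /andP[a b]; have := lt_le_trans a b; rewrite ltxx.
Qed.

Let lamC_fin C : valid (inr C) -> lam C \is a fin_num.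
Proof.
move=> [mC CE]; rewrite ge0_fin_numE ?measure_ge0//; apply: le_lt_trans (ns_finite hn).
by apply: le_measure; rewrite ?inE//; exact: measurable_jumpE.
Qed.

Let leb_itv (s t : R) : s <= t -> lebesgue_measure `]s, t] = (t - s)%:E.
Proof.
move=> st; rewrite lebesgue_measure_itv/= lte_fin; case: ltP => // ts.
by rewrite (_ : s = t) ?subrr//; apply/eqP; rewrite eq_le st ts.
Qed.

Let intensityE s t C : s <= t -> valid (inr C) ->
  intensity lam (`]s, t] `*` C) = fine (lam C) * (t - s).
Proof.
move=> st vC; rewrite /intensity product_measure1E//; last exact: (vC : _ /\ _).1.
transitivity (fine ((t - s)%:E * lam C)%E).
  by congr (fine (_ * _)%E); exact: leb_itv.
by rewrite -(fineK (lamC_fin vC)) -EFinM/= mulrC.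
Qed.

Let poisson_window s t C : 0 <= s -> s <= t -> t <= T -> valid (inr C) ->
  let Z w := N w (`]s, t] `*` C) in let nu := fine (lam C) * (t - s) in
  [/\ {ae P, forall w, Z w \is a fin_num}, L2f P (fun w => fine (Z w)),
     \int[P]_w fine (Z w) = nu & \int[P]_w (fine (Z w) ^+ 2) = nu ^+ 2 + nu].
Proof.
move=> s0 st tT vC Z nu; have [_ [_ w0]] := window_jump s0 tT vC.
have T0T : 0 <= T <= T by rewrite (le_trans s0 (le_trans st tT)) lexx.
have mZ : measurable_fun setT Z by apply: (meas_F_measurable T0T); exact: (prm_adapted (ns_poisson hn) T0T w0).
have nu0 : 0 <= nu by rewrite mulr_ge0 ?subr_ge0// fine_ge0.
have ZE a : P [set w | Z w = (a%:R)%:E] = (nu ^+ a / a`!%:R * expR (- nu))%:E.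
  have := @prm_law _ _ _ _ _ _ _ _ _ (ns_poisson hn) 1%N (fun=> `]s, t] `*` C) (fun=> a) (fun=> w0).
  rewrite big_ord1 intensityE// => <-.
    by congr (P _); apply/seteqP; split => w /= h // ; exact: (h ord0).
  by move=> i j _ _ _; rewrite (ord1 i) (ord1 j).
have [h1 h2 h3] := poisson_moments mZ nu0 ZE.
by split => //; exact: (poisson_ae_fin mZ ZE).
Qed.

Let cstL2 (c : R) : L2f P (fun=> c).
Proof. by split => //; exact: finite_measure_integrable_cst. Qed.

Let Rint_cst (c : R) : \int[P]_w c = c.
Proof.
rewrite Rintegral_cst// -[RHS]mulr1; congr (_ * _).
by rewrite -[RHS]/(fine 1%:E); congr fine; exact: probability_setT.
Qed.

Let incr_gauss k s t : 0 <= s -> s < t -> t <= T ->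
  L2f P (incr (inl k) s t) /\ \int[P]_w incr (inl k) s t w = 0 /\
  \int[P]_w (incr (inl k) s t w ^+ 2) = t - s.
Proof.
move=> s0 st tT; set sg := Num.sqrt (t - s).
have sg0 : 0 < sg by rewrite sqrtr_gt0 subr_gt0.
have mW : measurable_fun setT (incr (inl k) s t).
  apply: (@meas_F_measurable t); first by rewrite (le_trans s0 (ltW st)) tT.
  by apply: incr_meas => //; exact: ltW.
have EW A : measurable A -> P (incr (inl k) s t @^-1` A) = (\int[lebesgue_measure]_(x in A) (normal_pdf 0 sg x)%:E)%E.
  move=> mA; have := @bm_gauss _ _ _ _ _ _ _ _ (ns_brownian hn) s t (fun i => if i == k then A else setT) s0 st tT.
  move=> /(_ (fun i => ltac:(by case: ifP))).
  rewrite (bigD1 k)//= eqxx big1 ?mule1; last first.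
    by move=> i ik; rewrite (negbTE ik); exact: (@probability_setT _ _ _ (normal_prob 0 sg)).
  move=> H; apply: etrans H; congr (P _); apply/seteqP; split => w /=.
    by move=> h i; case: ifPn => // /eqP ->; rewrite !mxE.
  by move=> /(_ k); rewrite eqxx !mxE.
have p0 x : 0 <= normal_pdf 0 sg x by exact: normal_pdf_ge0.
have mp : measurable_fun setT (normal_pdf 0 sg) by exact: measurable_normal_pdf.
have D (f : R -> R) : measurable_fun setT f -> (forall x, 0 <= f x) ->
   (\int[P]_w (f (incr (inl k) s t w))%:E = \int[lebesgue_measure]_x (f x * normal_pdf 0 sg x)%:E)%E.
  move=> mf f0.
  apply: (@ge0_expectation_density R _ (measurableTypeR R) d Omega P (incr (inl k) s t) lebesgue_measure (normal_pdf 0 sg)) => //.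
have [n1 n1'] := normal_first_moment sg0.
have n2 := normal_second_moment sg0.
have sg2 : sg ^+ 2 = t - s by rewrite sqr_sqrtr// subr_ge0 ltW.
have E2 : (\int[P]_w (incr (inl k) s t w ^+ 2)%:E = (t - s)%:E)%E.
  rewrite (D (fun x => x ^+ 2)); last 2 first.
  - exact: measurable_funX.
  - by move=> x; exact: sqr_ge0.
  by rewrite n2 sg2.
have L : L2f P (incr (inl k) s t).
  split => //; apply: intg_lty; first exact: measurable_funX.
  - by move=> w; exact: sqr_ge0.
  - by rewrite E2 ltry.
split => //; split; last by rewrite /Rintegral E2.
have iW : intg P (incr (inl k) s t).
  by have := L2f_mul L (cstL2 1); apply: eq_intg => w; rewrite mulr1.
(* The density formula is available for nonnegative functions, so the mean is computed through the
   positive and negative parts. *)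
pose fp (x : R) := Num.max x 0; pose fn (x : R) := Num.max (- x) 0.
have mfp : measurable_fun setT fp by apply: measurable_maxr.
have mfn : measurable_fun setT fn by apply: measurable_maxr => //; exact: measurable_funN.
have fp0 x : 0 <= fp x by rewrite le_max lexx orbT.
have fn0 x : 0 <= fn x by rewrite le_max lexx orbT.
have fpn x : x = fp x - fn x.
  rewrite /fp /fn; case: (leP 0 x) => h.
    by rewrite (max_r (_ : - x <= 0)) ?oppr_le0// subr0.
  by rewrite (max_l (_ : 0 <= - x)) ?oppr_ge0 ?(ltW h)// sub0r opprK.
have fple x : `|fp x| <= `|x| by rewrite /fp; case: (leP 0 x) => h; rewrite ?(max_l h) ?(max_r (ltW h))// normr0.
have fnle x : `|fn x| <= `|x| by rewrite /fn; case: (leP 0 (- x)) => h; rewrite ?(max_l h) ?(max_r (ltW h)) ?normrN// normr0.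
have ip : intg P (fun w => fp (incr (inl k) s t w)).
  apply: (intg_le _ _ (intg_norm iW)) => [|w]; [exact: measurableT_comp|exact: fple].
have iN : intg P (fun w => fn (incr (inl k) s t w)).
  apply: (intg_le _ _ (intg_norm iW)) => [|w]; [exact: measurableT_comp|exact: fnle].
transitivity (\int[P]_w (fp (incr (inl k) s t w) - fn (incr (inl k) s t w))); first by apply: eq_Rintegral => w _; exact: fpn.
rewrite RintB// /Rintegral !D//.
have ia : intg lebesgue_measure (fun x => `|x * normal_pdf 0 sg x|) by exact: intg_norm.
have jp : intg lebesgue_measure (fun x => fp x * normal_pdf 0 sg x).
  apply: (intg_le _ _ ia) => [|x]; first exact: measurable_funM.
  by rewrite !normrM ler_wpM2r.
have jn : intg lebesgue_measure (fun x => fn x * normal_pdf 0 sg x).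
  apply: (intg_le _ _ ia) => [|x]; first exact: measurable_funM.
  by rewrite !normrM ler_wpM2r.
rewrite -!/(Rintegral _ _ _) -RintB// -[RHS]n1'; apply: eq_Rintegral => x _.
by rewrite -mulrBl -fpn.
Qed.

Lemma incr_L2_mean i s t : valid i -> 0 <= s -> s <= t -> t <= T ->
  L2f P (incr i s t) /\ \int[P]_w incr i s t w = 0.
Proof.
move=> vi s0; rewrite le_eqVlt => /orP[/eqP <- _|st tT].
  rewrite (_ : incr i s s = fun=> 0); last by apply/funext => w; exact: incr0.
  by split; [exact: cstL2|exact: Rint0].
case: i vi => [k _|C vC]; first by have [h [h' _]] := incr_gauss k s0 st tT.
have [_ h2 h3 _] := poisson_window s0 (ltW st) tT vC.
rewrite /= /compensated; split; first exact: L2fB.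
rewrite RintB ?Rint_cst ?h3 ?subrr//.
- by have := L2f_mul h2 (cstL2 1); apply: eq_intg => w; rewrite mulr1.
- exact: finite_measure_integrable_cst.
Qed.

Let incr_jump_var C s t : valid (inr C) -> 0 <= s -> s <= t -> t <= T ->
  \int[P]_w (incr (inr C) s t w ^+ 2) = fine (lam C) * (t - s).
Proof.
move=> vC s0 st tT; have [_ h2 h3 h4] := poisson_window s0 st tT vC.
move: h2 h3 h4; set nu := fine (lam C) * (t - s); set z := fun w => fine _ => h2 h3 h4.
have iz : intg P z by have := L2f_mul h2 (cstL2 1); apply: eq_intg => w; rewrite mulr1.
transitivity (\int[P]_w (z w ^+ 2 - (2 * nu) * z w + nu ^+ 2)).
  by apply: eq_Rintegral => w _; rewrite /= /compensated -/(z w) -/nu; ring.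
rewrite RintD; [|apply: intgB; [exact: h2.2|exact: intgZ]|exact: finite_measure_integrable_cst].
rewrite RintB; [|exact: h2.2|exact: intgZ].
by rewrite RintZ// Rint_cst h3 h4; ring.
Qed.

(** Only almost sure: [fine] is additive where the two counts are finite. *)
Lemma incr_add i s r t : valid i -> 0 <= s -> s <= r -> r <= t -> t <= T ->
  {ae P, forall w, incr i s t w = incr i s r w + incr i r t w}.
Proof.
move=> vi s0 sr rt tT; have rT := le_trans rt tT; have r0 := le_trans s0 sr.
case: i vi => [k _|C vC] /=; first by apply: aeW => w; ring.
have [h1 _ _ _] := poisson_window s0 sr rT vC; have [h2 _ _ _] := poisson_window r0 rt tT vC.
have m1 := (window_jump s0 rT vC).1.1; have m2 := (window_jump r0 tT vC).1.1.
move: h1 h2; apply: filterS2 => w /= h1 h2; rewrite /compensated.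
have -> : `]s, t] `*` C = (`]s, r] `*` C) `|` (`]r, t] `*` C).
  apply/seteqP; split => -[x e] /=.
    rewrite !in_itv/= => -[/andP[a b] c]; case: (leP x r) => h; [left|right]; rewrite ?a ?b//.
  by rewrite !in_itv/= => -[[/andP[a b] c]|[/andP[a b] c]]; rewrite ?a ?b ?(le_trans b rt) ?(le_lt_trans sr a)//.
rewrite measureU//; last first.
  apply/seteqP; split => // -[x e] [[/= + _] [/= + _]]; rewrite !in_itv/= => /andP[_ a] /andP[b _].
  by have := le_lt_trans a b; rewrite ltxx.
by rewrite fineD//; ring.
Qed.

Let incr_markU C D s t : valid (inr C) -> valid (inr D) -> [disjoint C & D] -> 0 <= s -> s <= t -> t <= T ->
  {ae P, forall w, incr (inr (C `|` D)) s t w = incr (inr C) s t w + incr (inr D) s t w}.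
Proof.
move=> vC vD /disj_setPS CD s0 st tT.
have [h1 _ _ _] := poisson_window s0 st tT vC; have [h2 _ _ _] := poisson_window s0 st tT vD.
have m1 := (window_jump s0 tT vC).1.1; have m2 := (window_jump s0 tT vD).1.1.
move: h1 h2; apply: filterS2 => w /= h1 h2; rewrite /compensated.
rewrite (_ : `]s, t] `*` (C `|` D) = (`]s, t] `*` C) `|` (`]s, t] `*` D)); last first.
  by apply/seteqP; split => -[x e] /=; tauto.
rewrite measureU//; last first.
  by apply/seteqP; split => // -[x e] [[/= _ a] [/= _ b]]; exact: (CD e (conj a b)).
rewrite measureU//; [|exact: vC.1|exact: vD.1|]; last by apply/seteqP; split => // e; exact: CD.
by rewrite !fineD ?lamC_fin//; ring.
Qed.

Let mulL2 i j s t : valid i -> valid j -> 0 <= s -> s <= t -> t <= T ->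
  intg P (fun w => incr i s t w * incr j s t w).
Proof.
move=> vi vj s0 st tT; apply: L2f_mul; exact: (incr_L2_mean _ _ _ _).1.
Qed.

(** Polarisation: the variance over the union is proportional to [lam C + lam D], which leaves
    nothing for the cross term. *)
Let incr_disjoint C D s t : valid (inr C) -> valid (inr D) -> [disjoint C & D] -> 0 <= s -> s <= t -> t <= T ->
  \int[P]_w (incr (inr C) s t w * incr (inr D) s t w) = 0.
Proof.
move=> vC vD CD s0 st tT.
have vU : valid (inr (C `|` D)).
  split; first by apply: measurableU; [exact: vC.1|exact: vD.1].
  by move=> e [/vC.2|/vD.2].
have hU := incr_jump_var vU s0 st tT; have hC := incr_jump_var vC s0 st tT; have hD := incr_jump_var vD s0 st tT.
have LC := (incr_L2_mean vC s0 st tT).1; have LD := (incr_L2_mean vD s0 st tT).1; have LU := (incr_L2_mean vU s0 st tT).1.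
have EU : \int[P]_w (incr (inr (C `|` D)) s t w ^+ 2) =
  \int[P]_w (incr (inr C) s t w ^+ 2 + 2 * (incr (inr C) s t w * incr (inr D) s t w) + incr (inr D) s t w ^+ 2).
  apply: Rint_ae_eq.
  - exact: measurable_funX LU.1.
  - apply: measurable_funD; [apply: measurable_funD|]; first exact: measurable_funX LC.1.
      by apply: measurable_funM => //; apply: measurable_funM; [exact: LC.1|exact: LD.1].
    exact: measurable_funX LD.1.
  - by move: (incr_markU vC vD CD s0 st tT); apply: filterS => w ->; ring.
have i2 := L2f_mul LC LD.
rewrite RintD in EU; [|apply: intgD; [exact: LC.2|exact: intgZ]|exact: LD.2].
rewrite RintD in EU; [|exact: LC.2|exact: intgZ].
rewrite RintZ// hU hC hD in EU.
have El : fine (lam (C `|` D)) = fine (lam C) + fine (lam D).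
  rewrite measureU ?fineD ?lamC_fin//; [exact: vC.1|exact: vD.1|].
  by apply/seteqP; split => // e; move/disj_setPS : CD; exact.
rewrite El in EU; lra.
Qed.

(** [C] and [D] are cut into their intersection and their differences; all cross terms are over
    disjoint sets, so the variance over the intersection remains. *)
Let incr_jump_cov C D s t : valid (inr C) -> valid (inr D) -> 0 <= s -> s <= t -> t <= T ->
  \int[P]_w (incr (inr C) s t w * incr (inr D) s t w) = fine (lam (C `&` D)) * (t - s).
Proof.
move=> vC vD s0 st tT.
have vI : valid (inr (C `&` D)).
  split; [apply: measurableI; [exact: vC.1|exact: vD.1]|by move=> e [/vC.2]].
have vC' : valid (inr (C `\` D)).
  split; [apply: measurableD; [exact: vC.1|exact: vD.1]|by move=> e [/vC.2]].
have vD' : valid (inr (D `\` C)).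
  split; [apply: measurableD; [exact: vD.1|exact: vC.1]|by move=> e [/vD.2]].
have dC : [disjoint C `&` D & C `\` D] by apply/disj_setPS => e [[_ a] [_ b]].
have dD : [disjoint C `&` D & D `\` C] by apply/disj_setPS => e [[a _] [_ b]].
have dCD : [disjoint C `\` D & D `\` C] by apply/disj_setPS => e [[_ a] [b _]].
have eC : (C `&` D) `|` (C `\` D) = C by rewrite setUIDK.
have eD : (C `&` D) `|` (D `\` C) = D by rewrite setIC setUIDK.
have aC := incr_markU vI vC' dC s0 st tT; have aD := incr_markU vI vD' dD s0 st tT.
rewrite eC in aC; rewrite eD in aD.
have LI := (incr_L2_mean vI s0 st tT).1; have LC' := (incr_L2_mean vC' s0 st tT).1; have LD' := (incr_L2_mean vD' s0 st tT).1.
set I := incr (inr (C `&` D)) s t in aC aD LI; set A := incr (inr (C `\` D)) s t in aC LC'; set A' := incr (inr (D `\` C)) s t in aD LD'.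
have i1 := L2f_mul LI LD'; have i2 := L2f_mul LI LC'; have i3 := L2f_mul LC' LD'.
transitivity (\int[P]_w (I w ^+ 2 + I w * A' w + I w * A w + A w * A' w)).
  apply: Rint_ae_eq.
  - exact: intg_meas (mulL2 vC vD s0 st tT).
  - apply: intg_meas; apply: intgD i3; apply: intgD i2; apply: intgD i1; exact: LI.2.
  - by move: aC aD; apply: filterS2 => w -> ->; ring.
rewrite RintD//; last by apply: intgD i2; apply: intgD i1; exact: LI.2.
rewrite RintD//; last by apply: intgD i1; exact: LI.2.
rewrite RintD//; last exact: LI.2.
rewrite (incr_disjoint vI vD' dD s0 st tT) (incr_disjoint vI vC' dC s0 st tT) (incr_disjoint vC' vD' dCD s0 st tT).
by rewrite (incr_jump_var vI s0 st tT) !addr0.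
Qed.

Let history_B_incr k s t : 0 <= s -> s <= t -> t <= T -> meas_wrt (history_B T B) (incr (inl k) s t).
Proof.
move=> s0 st tT; have sg : sigma_algebra setT (history_B T B) by exact: smallest_sigma_algebra.
have b r : 0 <= r -> r <= T -> meas_wrt (history_B T B) (fun w => B r w k 0).
  move=> r0 rT; apply: (meas_wrt_comp (measurable_coord k)) => U mU.
  by apply: sub_sigma_algebra; exists r, U; split => //; rewrite r0.
move/meas_wrtP : (b _ (le_trans s0 st) tT) => /(_ sg) b1.
move/meas_wrtP : (b _ s0 (le_trans st tT)) => /(_ sg) b2.
apply/meas_wrtP => //; exact: measurable_funB.
Qed.

Let history_N_incr C s t : valid (inr C) -> 0 <= s -> s <= t -> t <= T -> meas_wrt (history_N T N) (incr (inr C) s t).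
Proof.
move=> vC s0 st tT.
apply: (@meas_wrt_comp _ _ (history_N T N) _ _ _ _ (fun z : \bar R => fine z - fine (lam C) * (t - s)) (fun w => N w (`]s, t] `*` C))).
  by apply: measurable_funB.
move=> U mU; apply: sub_sigma_algebra; exists (`]s, t] `*` C), U; split => //.
by have [_ [_ ]] := window_jump s0 tT vC.
Qed.

Let L2_intg f : L2f P f -> intg P f.
Proof. by move=> h; have := L2f_mul h (cstL2 1); apply: eq_intg => w; rewrite mulr1. Qed.

Lemma incr_cov i j s t : valid i -> valid j -> 0 <= s -> s <= t -> t <= T ->
  \int[P]_w (incr i s t w * incr j s t w) = kap i j * (t - s).
Proof.
move=> vi vj s0; rewrite le_eqVlt => /orP[/eqP <- _|st tT].
  rewrite subrr mulr0 -[RHS](Rint0 P); apply: eq_Rintegral => w _.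
  by rewrite incr0 mul0r.
have st' := ltW st.
case: i j vi vj => [k|C] [l|D] vi vj /=.
- have [kl|kl] := eqVneq k l.
    subst l; have [_ [_]] := incr_gauss k s0 st tT => <-; rewrite mul1r.
    by apply: eq_Rintegral => w _; rewrite expr2.
  rewrite mul0r.
  have [L1 M1] := incr_L2_mean vi s0 st' tT; have [L2 M2] := incr_L2_mean vj s0 st' tT.
  (* Independence of two coordinates is read off the product formula for the whole vector, with the
     full line as the event for every other coordinate. *)
  pose GG (i : 'I_n) : set (set Omega) := [set A | exists2 U, measurable U & A = incr (inl i) s t @^-1` U].
  have ind : indep P (GG k) (GG l).
    move=> _ _ [U mU ->] [U' mU' ->].
    have g (V : 'I_n -> set R) : (forall i, measurable (V i)) -> _ := @bm_gauss _ _ _ _ _ _ _ _ (ns_brownian hn) s t V s0 st tT.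
    have key (V1 V2 : set R) : measurable V1 -> measurable V2 ->
      P (incr (inl k) s t @^-1` V1 `&` incr (inl l) s t @^-1` V2) = (normal_prob 0 (Num.sqrt (t - s)) V1 * normal_prob 0 (Num.sqrt (t - s)) V2)%E.
      move=> m1 m2.
      have mV (i : 'I_n) : measurable (if i == k then V1 else if i == l then V2 else setT).
        by case: ifP => // _; case: ifP.
      have := g _ mV.
      have lk : l != k by rewrite eq_sym.
      rewrite (bigD1 k)//= eqxx (bigD1 l lk)/= (negbTE lk) eqxx big1 ?mule1; last first.
        by move=> i /andP[ik il]; rewrite (negbTE ik) (negbTE il); exact: (@probability_setT _ _ _ (normal_prob 0 _)).
      move=> H; apply: etrans H; congr (P _); apply/seteqP; split => w /=.
        by move=> [h1 h2] i; case: ifPn => [/eqP ->|_]; [rewrite !mxE|case: ifPn => [/eqP ->|//]; rewrite !mxE].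
      by move=> h; split; [have := h k; rewrite eqxx !mxE|have := h l; rewrite (negbTE lk) eqxx !mxE].
    have k1 := key _ _ mU measurableT; have k2 := key _ _ measurableT mU'.
    rewrite preimage_setT setIT (@probability_setT _ _ _ (normal_prob 0 (Num.sqrt (t - s)))) mule1 in k1.
    rewrite preimage_setT setTI (@probability_setT _ _ _ (normal_prob 0 (Num.sqrt (t - s)))) mul1e in k2.
    by rewrite k1 k2 key.
  have m i : meas_wrt (GG i) (incr (inl i) s t) by move=> U mU; exists U.
  by have [_ ->] := indep_expectation ind (m k) (m l) (L2_intg L1) (L2_intg L2); rewrite M1 mul0r.
- have [L1 M1] := incr_L2_mean vi s0 st' tT; have [L2 M2] := incr_L2_mean vj s0 st' tT.
  have [_ ->] := indep_expectation (ns_indep hn) (history_B_incr k s0 st' tT) (history_N_incr vj s0 st' tT) (L2_intg L1) (L2_intg L2).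
  by rewrite M1 !mul0r.
- have [L1 M1] := incr_L2_mean vi s0 st' tT; have [L2 M2] := incr_L2_mean vj s0 st' tT.
  have [_ E0] := indep_expectation (ns_indep hn) (history_B_incr l s0 st' tT) (history_N_incr vi s0 st' tT) (L2_intg L2) (L2_intg L1).
  transitivity (\int[P]_w (incr (inl l) s t w * incr (inr C) s t w)).
    by apply: eq_Rintegral => w _; rewrite mulrC.
  by rewrite E0 M2 !mul0r.
- exact: incr_jump_cov.
Qed.

Lemma incr_martingale i s t (zeta : Omega -> R) : valid i -> 0 <= s -> s <= t -> t <= T ->
  L2f P zeta -> meas_wrt (F s) zeta -> \int[P]_w (zeta w * incr i s t w) = 0.
Proof.
move=> vi s0; rewrite le_eqVlt => /orP[/eqP <- _ _ _|st tT Lz mz].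
  by rewrite -[RHS](Rint0 P); apply: eq_Rintegral => w _; rewrite incr0 mulr0.
have [L1 M1] := incr_L2_mean vi s0 (ltW st) tT.
have [_ ->] := indep_expectation (ns_future hn s0 (lt_le_trans st tT)) mz (incr_future vi s0 (ltW st) tT) (L2_intg Lz) (L2_intg L1).
by rewrite M1 mulr0.
Qed.

Lemma incr_bracket i j s t (zeta : Omega -> R) : valid i -> valid j -> 0 <= s -> s <= t -> t <= T ->
  intg P zeta -> meas_wrt (F s) zeta ->
  \int[P]_w (zeta w * (incr i s t w * incr j s t w)) = kap i j * (t - s) * \int[P]_w zeta w.
Proof.
move=> vi vj s0; rewrite le_eqVlt => /orP[/eqP <- _ _ _|st tT Lz mz].
  by rewrite subrr mulr0 mul0r -[RHS](Rint0 P); apply: eq_Rintegral => w _; rewrite incr0 mul0r mulr0.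
have mf : meas_wrt (future T B N s) (fun w => incr i s t w * incr j s t w).
  apply: meas_wrtM; first exact: smallest_sigma_algebra.
  - exact: incr_future vi s0 (ltW st) tT.
  - exact: incr_future vj s0 (ltW st) tT.
have [_ ->] := indep_expectation (ns_future hn s0 (lt_le_trans st tT)) mz mf Lz (mulL2 vi vj s0 (ltW st) tT).
by rewrite incr_cov ?(ltW st)// mulrC.
Qed.

End noise_increments.

(** * Stochastic integrals *)

Section product_sigma_finite.
Context {R : realType} {d1 d2 : measure_display}.
Context {T1 : measurableType d1} {T2 : measurableType d2}.
Variables (m1 : {sigma_finite_measure set T1 -> \bar R}) (m2 : {sigma_finite_measure set T2 -> \bar R}).

(* The canonical s-finite structure of a library product requires finite factors. *)
Definition sfprod : set (T1 * T2) -> \bar R := (m1 \x m2)%E.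

HB.instance Definition _ := Measure.copy sfprod (m1 \x m2)%E.

Let product_sigma_finite : sigma_finite [set: T1 * T2] sfprod.
Proof.
have [G1 G1T hG1] := sigma_finiteT m1; have [G2 G2T hG2] := sigma_finiteT m2.
pose H := fun k => let: (i, j) := odflt (0%N, 0%N) (unpickle k : option (nat * nat)) in G1 i `*` G2 j.
exists H.
  apply/seteqP; split => // -[x y] _.
  have [i _ Gx] : (\bigcup_k G1 k) x by rewrite -G1T.
  have [j _ Gy] : (\bigcup_k G2 k) y by rewrite -G2T.
  by exists (pickle (i, j)) => //; rewrite /H pickleK.
move=> k; rewrite /H; case: (odflt _ _) => i j.
have [mi li] := hG1 i; have [mj lj] := hG2 j.
split; first exact: measurableX.
rewrite /sfprod product_measure1E//; apply: lte_mul_pinfty => //; rewrite ge0_fin_numE//.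
Qed.

HB.instance Definition _ := Measure_isSigmaFinite.Build _ _ _ sfprod product_sigma_finite.

End product_sigma_finite.

Definition dtP {R : realType} {d} {Omega : measurableType d} (P : probability Omega R) :
  {sigma_finite_measure set (measurableTypeR R * Omega)%type -> \bar R} := sfprod lebesgue_measure P.
Definition dtPl {R : realType} {d} {Omega : measurableType d} (P : probability Omega R)
  {d'} {S : measurableType d'} (lam : {sigma_finite_measure set S -> \bar R}) :
  {sigma_finite_measure set ((measurableTypeR R * Omega) * S)%type -> \bar R} := sfprod (dtP P) lam.

Lemma bounded_mulL2 {R : realType} {d} {Omega : measurableType d} (mu : {measure set Omega -> \bar R}) (h f : Omega -> R) :
  measurable_fun setT h -> (exists K : R, forall w, `|h w| <= K) -> L2f mu f -> L2f mu (fun w => h w * f w).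
Proof.
move=> mh [K hK] Lf; apply: (L2f_le _ _ (L2fZ K Lf)); first by apply: measurable_funM => //; exact: Lf.1.
move=> w; rewrite !normrM ler_wpM2r// (le_trans (hK w))//; exact: ler_norm.
Qed.

(** * Elementary integrals and their isometry *)

Section elementary.
Context {R : realType} {d : measure_display} {Omega : measurableType d}.
Context (P : probability Omega R) (T : R) (F : R -> set (set Omega)).
Context {n kappa : nat} (B : R -> Omega -> 'cV[R]_n).
Context (lam : {sigma_finite_measure set 'cV[R]_kappa -> \bar R}).
Context (N : Omega -> {measure set (R * 'cV[R]_kappa)%type -> \bar R}).
Hypothesis hn : noise_setting P T F B lam N.
Local Notation E := (jumpE R kappa).
Local Notation idx := (@idx R n kappa).
Local Notation incr := (incr B lam N).
Local Notation tw := (measurableTypeR R * Omega)%type.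

Let F_sigma t : 0 <= t <= T -> sigma_algebra setT (F t).
Proof. by case: (ns_filtration hn) => _ h _ _ _; exact: h. Qed.

(** Degenerate windows [s = t] are allowed, unlike in the simple integrands of the definitions, so
    that a window stays admissible after it is clamped to an interval. *)
Definition elem_ok (s t : R) (i : idx) (h : Omega -> R) :=
  [/\ [/\ 0 <= s, s <= t & t <= T], valid i, meas_wrt (F s) h &
      exists K : R, forall w, `|h w| <= K].

(* the integrand h 1_(s, t] against the i-th noise *)
Record elem := Elem { e_s : R; e_t : R; e_i : idx; e_h : Omega -> R;
  e_ok : elem_ok e_s e_t e_i e_h }.

(* Writing windows as factors turns every time integral into one over the whole line. *)
Definition win (s t r : R) : R := ((s < r <= t)%R)%:R.
Definition eB (j : 'I_n) (c : elem) (z : tw) : R :=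
  win (e_s c) (e_t c) z.1 * (e_h c z.2 * (if e_i c is inl k then (k == j)%:R else 0)).
Definition eN (c : elem) (z : (tw * 'cV[R]_kappa)%type) : R :=
  win (e_s c) (e_t c) z.1.1 * e_h c z.1.2 * (if e_i c is inr C then \1_C z.2 else 0).
Definition eI (c : elem) (w : Omega) : R := e_h c w * incr (e_i c) (e_s c) (e_t c) w.

(** The length of the intersection of the windows []s, t]] and []s', t']]. *)
Definition overlap (s t s' t' : R) : R := Num.max 0 (Num.min t t' - Num.max s s').

Let cstL2 (c : R) : L2f P (fun=> c).
Proof. by split => //; exact: finite_measure_integrable_cst. Qed.

Let L2_intg f : L2f P f -> intg P f.
Proof. by move=> h; have := L2f_mul h (cstL2 1); apply: eq_intg => w; rewrite mulr1. Qed.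

Let bndM (f g : Omega -> R) : (exists K : R, forall w, `|f w| <= K) -> (exists K : R, forall w, `|g w| <= K) ->
  exists K : R, forall w, `|f w * g w| <= K.
Proof. by move=> [K1 h1] [K2 h2]; exists (K1 * K2) => w; rewrite normrM ler_pM. Qed.

Let bndL2 (f : Omega -> R) : measurable_fun setT f -> (exists K : R, forall w, `|f w| <= K) -> L2f P f.
Proof.
move=> mf hf; have := bounded_mulL2 mf hf (cstL2 1).
by rewrite (_ : (fun w => f w * 1) = f)//; apply/funext => w; rewrite mulr1.
Qed.

Lemma kapC (i j : idx) : kap lam i j = kap lam j i.
Proof. by case: i j => [k|C] [l|D] //=; [rewrite eq_sym|rewrite setIC]. Qed.

Section same_start.
Variables (s : R) (h : Omega -> R).
Hypotheses (s0 : 0 <= s) (sT : s <= T) (mh : meas_wrt (F s) h) (bh : exists K : R, forall w, `|h w| <= K).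

Let hm : measurable_fun setT h.
Proof. by apply: (meas_F_measurable hn _ mh); rewrite s0. Qed.

Let wrt t (g : Omega -> R) : s <= t -> t <= T -> meas_wrt (F s) g -> meas_wrt (F t) g.
Proof. by move=> st tT; apply: meas_wrt_sub; exact: (F_mono hn). Qed.

(** The part of the longer increment after [t] has mean zero given [F t], so only the bracket over
    the common window survives. *)
Let same_le (i j : idx) t t' : valid i -> valid j -> s <= t -> t <= t' -> t' <= T ->
  \int[P]_w (h w * (incr i s t w * incr j s t' w)) = kap lam i j * (t - s) * \int[P]_w h w.
Proof.
move=> vi vj st tt' t'T; have tT := le_trans tt' t'T; have t0 := le_trans s0 st.
have [Li _] := incr_L2_mean hn vi s0 st tT.
have [Lj _] := incr_L2_mean hn vj s0 st tT; have [Lj' _] := incr_L2_mean hn vj t0 tt' t'T.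
have [Lj2 _] := incr_L2_mean hn vj s0 (le_trans st tt') t'T.
have hi := bounded_mulL2 hm bh Li.
have I1 := L2f_mul hi Lj; have I2 := L2f_mul hi Lj'; have I3 := L2f_mul hi Lj2.
transitivity (\int[P]_w (h w * incr i s t w * incr j s t w + h w * incr i s t w * incr j t t' w)).
  apply: Rint_ae_eq.
  - by apply: intg_meas; apply: eq_intg I3 => w; rewrite mulrA.
  - exact: intg_meas (intgD I1 I2).
  - by move: (incr_add hn vj s0 st tt' t'T); apply: filterS => w ->; rewrite mulrA mulrDr.
rewrite RintD// [X in _ + X](incr_martingale hn)//; last first.
  by apply: meas_wrtM; [apply: F_sigma; rewrite t0|exact: wrt|exact: (incr_meas hn)].
rewrite addr0 -(@incr_bracket _ _ _ _ _ _ _ _ _ _ _ hn i j s t h)//; last exact: L2_intg (bndL2 hm bh).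
by apply: eq_Rintegral => w _; rewrite mulrA.
Qed.

Lemma cov_same_start (i j : idx) t t' : valid i -> valid j -> s <= t -> s <= t' -> t <= T -> t' <= T ->
  \int[P]_w (h w * (incr i s t w * incr j s t' w)) = kap lam i j * (Num.min t t' - s) * \int[P]_w h w.
Proof.
move=> vi vj st st' tT t'T; case: (leP t t') => tt'; first exact: same_le.
rewrite kapC -(@same_le j i t' t)// ?(ltW tt')//; apply: eq_Rintegral => w _; congr (_ * _); exact: mulrC.
Qed.

End same_start.

(** The earlier increment is cut at [s2]. Its part before [s2] belongs to [F s2] and is orthogonal
    to the later increment; the rest starts at [s2] as well, and [cov_same_start] applies. If
    [t1 <= s2], nothing is left and the overlap is 0. *)
Let pair_cov s1 t1 (i : idx) h1 s2 t2 (j : idx) h2 : elem_ok s1 t1 i h1 -> elem_ok s2 t2 j h2 -> s1 <= s2 ->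
  \int[P]_w ((h1 w * incr i s1 t1 w) * (h2 w * incr j s2 t2 w))
  = kap lam i j * overlap s1 t1 s2 t2 * \int[P]_w (h1 w * h2 w).
Proof.
move=> [[s10 st1 t1T] vi m1 b1] [[s20 st2 t2T] vj m2 b2] s12.
have s2T := le_trans st2 t2T; have s20T : 0 <= s2 <= T by rewrite s20 s2T.
have s10T : 0 <= s1 <= T by rewrite s10 (le_trans s12 s2T).
have mm1 := meas_F_measurable hn s10T m1; have mm2 := meas_F_measurable hn s20T m2.
have m1' : meas_wrt (F s2) h1 by apply: meas_wrt_sub m1; exact: (F_mono hn).
have m12 : meas_wrt (F s2) (fun w => h1 w * h2 w) by apply: meas_wrtM => //; exact: F_sigma.
have b12 := bndM b1 b2.
have [Lj _] := incr_L2_mean hn vj s20 st2 t2T.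
have key t : s1 <= t -> t <= s2 -> \int[P]_w ((h1 w * h2 w * incr i s1 t w) * incr j s2 t2 w) = 0.
  move=> s1t ts2; have tT := le_trans ts2 s2T.
  have [Li _] := incr_L2_mean hn vi s10 s1t tT.
  apply: (incr_martingale hn) => //; first exact: (bounded_mulL2 (measurable_funM mm1 mm2) b12 Li).
  apply: meas_wrtM => //; first exact: F_sigma.
  apply: (meas_wrt_sub _ (incr_meas hn vi s10 s1t tT)); apply: (F_mono hn) => //; exact: le_trans s10 s1t.
rewrite /overlap (max_r s12).
have [t1s2|s2t1] := leP t1 s2.
  rewrite (max_l _) ?mulr0 ?mul0r; last by rewrite subr_le0 ge_min t1s2.
  rewrite -(key _ st1 t1s2); apply: eq_Rintegral => w _; ring.
have s2t1' := ltW s2t1.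
have [Li1 _] := incr_L2_mean hn vi s10 s12 s2T; have [Li2 _] := incr_L2_mean hn vi s20 s2t1' t1T.
have [Li _] := incr_L2_mean hn vi s10 st1 t1T.
have mm := measurable_funM mm1 mm2.
have I1 := L2f_mul (bounded_mulL2 mm b12 Li1) Lj; have I2 := L2f_mul (bounded_mulL2 mm b12 Li2) Lj.
have I3 := L2f_mul (bounded_mulL2 mm1 b1 Li) (bounded_mulL2 mm2 b2 Lj).
transitivity (\int[P]_w ((h1 w * h2 w * incr i s1 s2 w) * incr j s2 t2 w + (h1 w * h2 w * incr i s2 t1 w) * incr j s2 t2 w)).
  apply: Rint_ae_eq.
  - exact: intg_meas I3.
  - by apply: intg_meas; exact: intgD I1 I2.
  - by move: (incr_add hn vi s10 s12 s2t1' t1T); apply: filterS => w ->; ring.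
rewrite RintD// key// add0r max_r; last by rewrite subr_ge0 le_min s2t1' st2.
rewrite -(@cov_same_start s2 (fun w => h1 w * h2 w))//.
by apply: eq_Rintegral => w _; rewrite mulrA.
Qed.

Lemma overlapC s t s' t' : overlap s t s' t' = overlap s' t' s t.
Proof. by rewrite /overlap minC (maxC s). Qed.

Lemma eI_cov c c' : \int[P]_w (eI c w * eI c' w)
  = kap lam (e_i c) (e_i c') * overlap (e_s c) (e_t c) (e_s c') (e_t c') * \int[P]_w (e_h c w * e_h c' w).
Proof.
case: (leP (e_s c) (e_s c')) => h; first exact: pair_cov (e_ok c) (e_ok c') h.
have := pair_cov (e_ok c') (e_ok c) (ltW h).
rewrite kapC overlapC (_ : \int[P]_w (e_h c' w * e_h c w) = \int[P]_w (e_h c w * e_h c' w)); last by apply: eq_Rintegral => w _; exact: mulrC.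
by move<-; apply: eq_Rintegral => w _; exact: mulrC.
Qed.

Lemma e_h_meas c : measurable_fun setT (e_h c).
Proof.
have [[a b e] _ m _] := e_ok c; apply: (meas_F_measurable hn _ m).
by rewrite a (le_trans b e).
Qed.

Lemma e_h_L2 c : L2f P (e_h c).
Proof. by apply: bndL2 (e_h_meas c) _; have [] := e_ok c. Qed.

Lemma eI_L2 c : L2f P (eI c).
Proof.
have [[a b e] vi _ bh] := e_ok c; apply: bounded_mulL2 => //; first exact: e_h_meas.
exact: (incr_L2_mean hn vi a b e).1.
Qed.

Lemma win_intg s t s' t' : intg (lebesgue_measure : {measure set (measurableTypeR R) -> \bar R}) (fun r => win s t r * win s' t' r) /\
  \int[lebesgue_measure]_r (win s t r * win s' t' r) = overlap s t s' t'.
Proof.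
have E1 r : win s t r * win s' t' r = \1_(`]Num.max s s', Num.min t t']) r.
  rewrite indicE mem_setE in_itv/= gt_max le_min /win -natrM mulnb; congr ((_ : bool)%:R).
  by case: (s < r); case: (s' < r); case: (r <= t); case: (r <= t').
have E2 : (\int[lebesgue_measure]_r (\1_(`]Num.max s s', Num.min t t']) r)%:E = (overlap s t s' t')%:E)%E.
  rewrite integral_indic// setIT; apply: etrans (lebesgue_measure_itv _) _; rewrite /= lte_fin /overlap.
  case: ifPn => [h|]; first by rewrite (@max_r _ _ 0) ?EFinB// subr_ge0 ltW.
  by rewrite -leNgt => h; rewrite (@max_l _ _ 0)// subr_le0.
split; last by transitivity (\int[lebesgue_measure]_r \1_(`]Num.max s s', Num.min t t']) r); [apply: eq_Rintegral => r _; exact: E1|rewrite /Rintegral E2].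
have I : intg (lebesgue_measure : {measure set (measurableTypeR R) -> \bar R}) (fun r : measurableTypeR R => \1_(`]Num.max s s', Num.min t t']) r).
  by apply: intg_lty => //; [exact: measurable_indic|rewrite E2 ltry].
by apply: eq_intg I => r; rewrite E1.
Qed.

Lemma eB_ip j c c' : intg (dtP P) (fun z => eB j c z * eB j c' z) /\
  \int[dtP P]_z (eB j c z * eB j c' z) =
  overlap (e_s c) (e_t c) (e_s c') (e_t c') * \int[P]_w (e_h c w * e_h c' w) *
   ((if e_i c is inl k then (k == j)%:R else 0) * (if e_i c' is inl k then (k == j)%:R else 0)).
Proof.
have [w1 w2] := win_intg (e_s c) (e_t c) (e_s c') (e_t c').
set k1 : R := if e_i c is inl k then _ else _; set k2 : R := if e_i c' is inl k then _ else _.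
have i2 : intg P (fun w => k1 * k2 * (e_h c w * e_h c' w)) by apply: intgZ; apply: L2f_mul; exact: e_h_L2.
have [p1 p2] := intg_prod_mul w1 i2.
have EE z : eB j c z * eB j c' z = (win (e_s c) (e_t c) z.1 * win (e_s c') (e_t c') z.1) * (k1 * k2 * (e_h c z.2 * e_h c' z.2)).
  by rewrite /eB -/k1 -/k2; ring.
split; first by apply: eq_intg p1 => z; rewrite EE.
transitivity (overlap (e_s c) (e_t c) (e_s c') (e_t c') * \int[P]_w (k1 * k2 * (e_h c w * e_h c' w))).
  by rewrite -w2; apply: etrans p2; apply: eq_Rintegral => z _; exact: EE.
rewrite RintZ; last by apply: L2f_mul; exact: e_h_L2.
by rewrite mulrA mulrAC.
Qed.

Let lamC_fin C : valid (inr C : idx) -> lam C \is a fin_num.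
Proof.
move=> [mC CE]; rewrite ge0_fin_numE ?measure_ge0//; apply: le_lt_trans (ns_finite hn).
by apply: le_measure; rewrite ?inE//; exact: measurable_jumpE.
Qed.

Let mark c : 'cV[R]_kappa -> R := if e_i c is inr C then \1_C else fun=> 0.

Let mark_ip c c' : intg lam (fun e => mark c e * mark c' e) /\
  \int[lam]_e (mark c e * mark c' e) =
  (if e_i c is inr C then if e_i c' is inr D then fine (lam (C `&` D)) else 0 else 0).
Proof.
have z0 : intg lam (fun=> 0) /\ \int[lam]_e (0 : R) = 0 by split; [exact: intg0|exact: Rint0].
rewrite /mark; have [_ vi _ _] := e_ok c; have [_ vj _ _] := e_ok c'.
case: (e_i c) (e_i c') vi vj => [k|C] [l|D] vi vj; do ?[by under eq_fun do rewrite ?mul0r ?mulr0; under eq_Rintegral do rewrite ?mul0r ?mulr0].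
have vCD : valid (inr (C `&` D) : idx).
  by split; [apply: measurableI; [exact: vi.1|exact: vj.1]|move=> e [/vi.2]].
have E1 e : \1_C e * \1_D e = \1_(C `&` D) e :> R by rewrite indicI.
have E2 : (\int[lam]_e (\1_(C `&` D) e)%:E = (fine (lam (C `&` D)))%:E)%E.
  rewrite integral_indic ?setIT//; [by rewrite fineK// lamC_fin|exact: vCD.1].
split; last by transitivity (\int[lam]_e \1_(C `&` D) e); [apply: eq_Rintegral => e _; exact: E1|rewrite /Rintegral E2].
apply: (@eq_intg _ _ _ _ (\1_(C `&` D))) => //; apply: intg_lty => //.
- by apply: measurable_indic; exact: vCD.1.
- by rewrite E2 ltry.
Qed.

Lemma eN_ip c c' : intg (dtPl P lam) (fun z => eN c z * eN c' z) /\
  \int[dtPl P lam]_z (eN c z * eN c' z) =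
  overlap (e_s c) (e_t c) (e_s c') (e_t c') * \int[P]_w (e_h c w * e_h c' w) *
  (if e_i c is inr C then if e_i c' is inr D then fine (lam (C `&` D)) else 0 else 0).
Proof.
have [w1 w2] := win_intg (e_s c) (e_t c) (e_s c') (e_t c').
have i2 : intg P (fun w => e_h c w * e_h c' w) by apply: L2f_mul; exact: e_h_L2.
have [p1 p2] := intg_prod_mul w1 i2.
have [l1 l2] := mark_ip c c'.
have [r1 r2] := intg_prod_mul (m := dtP P) p1 l1.
have EE z : eN c z * eN c' z = (win (e_s c) (e_t c) z.1.1 * win (e_s c') (e_t c') z.1.1 * (e_h c z.1.2 * e_h c' z.1.2)) * (mark c z.2 * mark c' z.2).
  rewrite /eN /mark; case: (e_i c) (e_i c') => [k|C] [l|D]; ring.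
split; first by apply: eq_intg r1 => z; rewrite EE.
rewrite -w2 -p2 -l2.
by apply: etrans r2; apply: eq_Rintegral => z _; exact: EE.
Qed.

Lemma eB_L2 j c : L2f (dtP P) (eB j c).
Proof.
have mw s t : measurable_fun setT (fun z : tw => win s t z.1).
  apply: (@measurableT_comp _ _ _ _ _ _ (win s t : measurableTypeR R -> R) _ fst) => //.
  rewrite (_ : win s t = \1_(`]s, t])); first exact: measurable_indic.
  by apply/funext => r; rewrite indicE mem_setE in_itv.
split; last by have := (eB_ip j c c).1; apply: eq_intg => z; rewrite expr2.
apply: measurable_funM => //; apply: measurable_funM => //.
exact: (measurableT_comp (e_h_meas c) measurable_snd).
Qed.

Lemma eN_L2 c : L2f (dtPl P lam) (eN c).
Proof.
have mw s t : measurable_fun setT (fun z : tw * 'cV[R]_kappa => win s t z.1.1).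
  apply: (@measurableT_comp _ _ _ _ _ _ (win s t : measurableTypeR R -> R) _ (fun z : tw * 'cV[R]_kappa => z.1.1)) => //; last exact: (measurableT_comp measurable_fst measurable_fst).
  rewrite (_ : win s t = \1_(`]s, t])); first exact: measurable_indic.
  by apply/funext => r; rewrite indicE mem_setE in_itv.
split; last by have := (eN_ip c c).1; apply: eq_intg => z; rewrite expr2.
apply: measurable_funM; first apply: measurable_funM => //.
  exact: (measurableT_comp (e_h_meas c) (measurableT_comp measurable_snd measurable_fst)).
have [_ vi _ _] := e_ok c; case: (e_i c) vi => [k|C] vi; first exact: measurable_cst.
by apply: (measurableT_comp (measurable_indic vi.1) measurable_snd).
Qed.

Lemma elem_isometry c c' : \int[P]_w (eI c w * eI c' w) =
  \sum_j \int[dtP P]_z (eB j c z * eB j c' z) + \int[dtPl P lam]_z (eN c z * eN c' z).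
Proof.
rewrite eI_cov (eN_ip c c').2 (eq_bigr _ (fun j _ => (eB_ip j c c').2)) -mulr_sumr -mulrDr.
rewrite -mulrA mulrC; congr (_ * _); case: (e_i c) (e_i c') => [k|C] [l|D] /=.
- rewrite addr0 (bigD1 k)//= eqxx mul1r big1 ?addr0 1?eq_sym//.
  by move=> j jk; rewrite eq_sym (negbTE jk) mul0r.
- by rewrite big1 ?addr0// => j _; rewrite mulr0.
- by rewrite big1 ?addr0// => j _; rewrite mul0r.
- by rewrite big1 ?add0r// => j _; rewrite mul0r.
Qed.

Definition valB (H : seq elem) (j : 'I_n) (z : tw) : R := \sum_(c <- H) eB j c z.
Definition valN (H : seq elem) (z : tw * 'cV[R]_kappa) : R := \sum_(c <- H) eN c z.
Definition elementary_integral (H : seq elem) (w : Omega) : R := \sum_(c <- H) eI c w.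

Lemma valB_L2 H j : L2f (dtP P) (valB H j).
Proof. by apply: L2f_sum => c; exact: eB_L2. Qed.

Lemma valN_L2 H : L2f (dtPl P lam) (valN H).
Proof. by apply: L2f_sum => c; exact: eN_L2. Qed.

Lemma valI_L2 H : L2f P (elementary_integral H).
Proof. by apply: L2f_sum => c; exact: eI_L2. Qed.

Let ip_sum d' (S : measurableType d') (mu : {measure set S -> \bar R}) (g : elem -> S -> R) (H H' : seq elem) :
  (forall c, L2f mu (g c)) ->
  \int[mu]_z ((\sum_(c <- H) g c z) * (\sum_(c <- H') g c z)) =
  \sum_(c <- H) \sum_(c' <- H') \int[mu]_z (g c z * g c' z).
Proof.
move=> Lg; transitivity (\int[mu]_z (\sum_(c <- H) \sum_(c' <- H') g c z * g c' z)).
  by apply: eq_Rintegral => z _; rewrite mulr_suml; apply: eq_bigr => c _; rewrite mulr_sumr.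
rewrite Rint_sum; last by move=> c; apply: intg_sum => c'; exact: L2f_mul.
by apply: eq_bigr => c _; rewrite Rint_sum// => c'; exact: L2f_mul.
Qed.

Lemma elementary_isometry H H' : \int[P]_w (elementary_integral H w * elementary_integral H' w) =
  \sum_j \int[dtP P]_z (valB H j z * valB H' j z) + \int[dtPl P lam]_z (valN H z * valN H' z).
Proof.
rewrite /elementary_integral /valN (ip_sum _ _ eI_L2) (ip_sum _ _ eN_L2).
under [in RHS]eq_bigr => j _ do rewrite /valB (ip_sum _ _ (eB_L2 j)).
rewrite [X in _ = X + _]exchange_big/= -big_split/=; apply: eq_bigr => c _.
rewrite [X in _ = X + _]exchange_big/= -big_split/=; apply: eq_bigr => c' _; exact: elem_isometry.
Qed.

End elementary.

(** Finitely many of the bounds may be infinite. One index with a finite bound is recorded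
    separately: an approximant at finite distance is what places the limit in L2. *)
Lemma n2_dominated_cvg {R : realType} {d} {S : measurableType d} (mu : {measure set S -> \bar R})
  (D : nat -> S -> R) (g : nat -> \bar R) :
  (forall k, measurable_fun setT (D k)) -> (forall k, (\int[mu]_z (D k z ^+ 2)%:E <= g k)%E) ->
  g k @[k --> \oo] --> 0%E ->
  (exists k0, L2f mu (D k0)) /\ n2 mu (D k) @[k --> \oo] --> 0.
Proof.
move=> mD Dg g0.
have D0 k : (0 <= \int[mu]_z (D k z ^+ 2)%:E)%E by apply: integral_ge0 => z _; rewrite lee_fin sqr_ge0.
have [g1 _] : (\forall k \near \oo, g k \is a fin_num) /\ (fine \o g) x @[x --> \oo] --> (0 : R) by apply/fine_cvgP.
split.
  have [k0 _ h] := g1; exists k0; split => //; apply: intg_lty.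
  - exact: measurable_funX.
  - by move=> z; exact: sqr_ge0.
  - by apply: le_lt_trans (Dg k0) _; have := h k0 (leqnn _); rewrite /= fin_numE => /andP[_]; rewrite ltey.
have e0 : (\int[mu]_z (D k z ^+ 2)%:E)%E @[k --> \oo] --> 0%E.
  apply: (@squeeze_cvge _ _ _ _ (fun=> 0%E) _ g) => //; last exact: cvg_cst.
  by apply: nearW => k; rewrite D0 Dg.
exact: (@fine_cvg _ _ _ _ _ 0 e0).
Qed.

Lemma measurable_indicM {R : realType} {d} {S : measurableType d} (D : set S) (f : S -> R) :
  measurable D -> measurable_fun D f -> measurable_fun setT (fun x => \1_D x * f x).
Proof.
move=> mD mf; have /(measurable_restrictT _ mD) := mf.
congr (measurable_fun _ _); apply/funext => x; rewrite /patch indicE.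
by case: (x \in D); rewrite ?mul1r ?mul0r.
Qed.

Section tonelli.
Context {R : realType} {d d' : measure_display} {Omega : measurableType d} {S : measurableType d'}.
Context (P : probability Omega R) (lam : {sigma_finite_measure set S -> \bar R}).
Local Notation tw := (measurableTypeR R * Omega)%type.

Lemma tonelli_dtP (g : tw -> \bar R) : measurable_fun setT g -> (forall z, 0 <= g z)%E ->
  (\int[P]_w \int[lebesgue_measure]_r g (r, w) = \int[dtP P]_z g z)%E.
Proof. by move=> mg g0; apply/esym; apply: fubini_tonelli2. Qed.

Lemma tonelli_dtPl (g : tw * S -> \bar R) : measurable_fun setT g -> (forall z, 0 <= g z)%E ->
  (\int[P]_w \int[lebesgue_measure]_r \int[lam]_e g ((r, w), e) = \int[dtPl P lam]_z g z)%E.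
Proof.
move=> mg g0; transitivity (\int[dtP P]_z \int[lam]_e g (z, e))%E.
  rewrite -tonelli_dtP//; first exact: measurable_fun_fubini_tonelli_F.
  by move=> z; apply: integral_ge0.
by apply/esym; apply: fubini_tonelli1.
Qed.

Lemma integral_indicM d1 (S1 : measurableType d1) (mu : {measure set S1 -> \bar R}) (D : set S1) (f : S1 -> \bar R) :
  (\int[mu]_(x in D) f x = \int[mu]_x ((\1_D x)%:E * f x))%E.
Proof.
rewrite integral_mkcond; apply: eq_integral => x _; rewrite /patch indicE.
by case: (x \in D); rewrite ?mul1e ?mul0e.
Qed.

Lemma iterated_dtP (D : set R) (f : R -> Omega -> R) : measurable D ->
  measurable_fun (D `*` setT) (fun z : R * Omega => f z.1 z.2) -> (forall r w, 0 <= f r w) ->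
  measurable_fun setT (fun z : tw => \1_D z.1 * f z.1 z.2) /\
  (\int[P]_w \int[lebesgue_measure]_(r in D) (f r w)%:E = \int[dtP P]_z (\1_D z.1 * f z.1 z.2)%:E)%E.
Proof.
move=> mD mf f0.
have m : measurable_fun setT (fun z : tw => \1_D z.1 * f z.1 z.2).
  have := @measurable_indicM _ _ _ (D `*` setT) (fun z : tw => f z.1 z.2) (measurableX mD measurableT) mf.
  congr (measurable_fun _ _); apply/funext => z; rewrite !indicE; congr ((_ : bool)%:R * _).
  by apply/idP/idP; rewrite !inE => // -[].
split => //; rewrite -(tonelli_dtP (g := fun z => (\1_D z.1 * f z.1 z.2)%:E)); first last.
- by move=> z; rewrite lee_fin mulr_ge0// indicE ler0n.
- exact/measurable_EFinP.
by apply: eq_integral => w _; rewrite integral_indicM; apply: eq_integral => r _; rewrite -EFinM.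
Qed.

Lemma iterated_dtPl (D : set R) (E : set S) (f : R -> Omega -> S -> R) : measurable D -> measurable E ->
  measurable_fun ((D `*` setT) `*` E) (fun z : (R * Omega) * S => f z.1.1 z.1.2 z.2) -> (forall r w e, 0 <= f r w e) ->
  measurable_fun setT (fun z : tw * S => \1_D z.1.1 * \1_E z.2 * f z.1.1 z.1.2 z.2) /\
  (\int[P]_w \int[lebesgue_measure]_(r in D) \int[lam]_(e in E) (f r w e)%:E =
   \int[dtPl P lam]_z (\1_D z.1.1 * \1_E z.2 * f z.1.1 z.1.2 z.2)%:E)%E.
Proof.
move=> mD mE mf f0.
have m : measurable_fun setT (fun z : tw * S => \1_D z.1.1 * \1_E z.2 * f z.1.1 z.1.2 z.2).
  have := @measurable_indicM _ _ _ ((D `*` setT) `*` E) (fun z : tw * S => f z.1.1 z.1.2 z.2)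
    (measurableX (measurableX mD measurableT) mE) mf.
  congr (measurable_fun _ _); apply/funext => z; rewrite !indicE -natrM mulnb; congr ((_ : bool)%:R * _).
  by apply/idP/andP; rewrite !inE => -[] // [].
split => //; rewrite -(tonelli_dtPl (g := fun z => (\1_D z.1.1 * \1_E z.2 * f z.1.1 z.1.2 z.2)%:E)); first last.
- by move=> z; rewrite lee_fin !mulr_ge0// indicE ler0n.
- exact/measurable_EFinP.
apply: eq_integral => w _; rewrite integral_indicM; apply: eq_integral => r _.
have mr : measurable_fun setT (fun e : S => \1_D r * \1_E e * f r w e).
  exact: (measurableT_comp m (measurable_pair1 (r, w))).
rewrite indicE; case: (r \in D); last by rewrite mul0e integral0_eq// => e _; rewrite !mul0r.
by rewrite mul1e integral_indicM; apply: eq_integral => e _; rewrite mul1r EFinM.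
Qed.

End tonelli.

(** * L2-limits of elementary integrals *)

Section stochastic_integral.
Context {R : realType} {d : measure_display} {Omega : measurableType d}.
Context (P : probability Omega R) (T : R) (F : R -> set (set Omega)).
Context {n kappa : nat} (B : R -> Omega -> 'cV[R]_n).
Context (lam : {sigma_finite_measure set 'cV[R]_kappa -> \bar R}).
Context (N : Omega -> {measure set (R * 'cV[R]_kappa)%type -> \bar R}).
Hypothesis hn : noise_setting P T F B lam N.
Local Notation E := (jumpE R kappa).
Local Notation idx := (@idx R n kappa).
Local Notation incr := (incr B lam N).
Local Notation tw := (measurableTypeR R * Omega)%type.
Local Notation elem := (@elem R _ Omega T F n kappa).
Local Notation elem_ok := (@elem_ok R _ Omega T F n kappa).
Local Notation valI := (@elementary_integral R d Omega T F n kappa B lam N).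
Implicit Types (H : seq elem) (Q : 'I_n -> tw -> R) (K : tw * 'cV[R]_kappa -> R) (I : Omega -> R).

(* [I] is the integral of [Q] against B plus that of [K] against the compensated
   jump measure. *)
Definition stint Q K I :=
  [/\ forall j, L2f (dtP P) (Q j), L2f (dtPl P lam) K, L2f P I &
      exists H : nat -> seq elem,
      [/\ forall j, n2 (dtP P) (fun z => valB (H k) j z - Q j z) @[k --> \oo] --> 0,
          n2 (dtPl P lam) (fun z => valN (H k) z - K z) @[k --> \oo] --> 0 &
          n2 P (fun w => valI (H k) w - I w) @[k --> \oo] --> 0]].

(** Inner products pass to the limit in the elementary isometry. The polarised form is the one that
    the product rule needs, for two different integrands. *)
Lemma stint_isometry Q K I Q' K' I' : stint Q K I -> stint Q' K' I' ->
  \int[P]_w (I w * I' w) =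
  \sum_j \int[dtP P]_z (Q j z * Q' j z) + \int[dtPl P lam]_z (K z * K' z).
Proof.
move=> [LQ LK LI [H [hB hN hI]]] [LQ' LK' LI' [H' [hB' hN' hI']]].
have c1 := ip_cvg (fun k => valI_L2 hn (H k)) (fun k => valI_L2 hn (H' k)) LI LI' hI hI'.
have c2 := ip_cvg (fun k => valN_L2 hn (H k)) (fun k => valN_L2 hn (H' k)) LK LK' hN hN'.
have c3 j := ip_cvg (fun k => valB_L2 hn (H k) j) (fun k => valB_L2 hn (H' k) j) (LQ j) (LQ' j) (hB j) (hB' j).
have c4 : \sum_j \int[dtP P]_z (valB (H k) j z * valB (H' k) j z) @[k --> \oo] --> \sum_j \int[dtP P]_z (Q j z * Q' j z).
  by apply: cvg_sumR => j; exact: c3.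
move: c1.
rewrite (funext (fun k => elementary_isometry hn (H k) (H' k))) => c1.
by apply: (cvg_unique (@Rhausdorff R) c1); exact: cvgD c4 c2.
Qed.

Let scale_ok (c : R) (x : elem) : elem_ok (e_s x) (e_t x) (e_i x) (fun w => c * e_h x w).
Proof.
have [[a b e] v m [K hK]] := e_ok x; split => //.
  exact: (meas_wrt_comp (measurable_funM (measurable_cst c) (@measurable_id _ _ setT)) m).
by exists (`|c| * K) => w; rewrite normrM ler_wpM2l.
Qed.

Let scale c x := Elem (scale_ok c x).

Let scaleB c j x z : eB j (scale c x) z = c * eB j x z.
Proof. by rewrite /eB /=; ring. Qed.
Let scaleN c x z : eN (scale c x) z = c * eN x z.
Proof. by rewrite /eN /=; ring. Qed.
Let scaleI c x w : eI B lam N (scale c x) w = c * eI B lam N x w.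
Proof. by rewrite /eI /= mulrA. Qed.

Let comb c H H' := H ++ map (scale c) H'.

Let combB c H H' j z : valB (comb c H H') j z = valB H j z + c * valB H' j z.
Proof. by rewrite /valB big_cat big_map mulr_sumr; congr (_ + _); apply: eq_bigr => x _; exact: scaleB. Qed.
Let combN c H H' z : valN (comb c H H') z = valN H z + c * valN H' z.
Proof. by rewrite /valN big_cat big_map mulr_sumr; congr (_ + _); apply: eq_bigr => x _; exact: scaleN. Qed.
Let combI c H H' w : valI (comb c H H') w = valI H w + c * valI H' w.
Proof. by rewrite /elementary_integral big_cat big_map mulr_sumr; congr (_ + _); apply: eq_bigr => x _; exact: scaleI. Qed.

Let n2_comb_cvg d' (S : measurableType d') (mu : {measure set S -> \bar R}) (c : R) (f g : nat -> S -> R) f0 g0 :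
  (forall k, L2f mu (f k)) -> (forall k, L2f mu (g k)) -> L2f mu f0 -> L2f mu g0 ->
  n2 mu (fun z => f k z - f0 z) @[k --> \oo] --> 0 -> n2 mu (fun z => g k z - g0 z) @[k --> \oo] --> 0 ->
  n2 mu (fun z => (f k z + c * g k z) - (f0 z + c * g0 z)) @[k --> \oo] --> 0.
Proof.
move=> Lf Lg Lf0 Lg0 hf hg.
have h : 2 * n2 mu (fun z => f k z - f0 z) + 2 * (c ^+ 2 * n2 mu (fun z => g k z - g0 z)) @[k --> \oo] --> (0 : R).
  have := cvgD (cvgM (cvg_cst (2 : R)) hf) (cvgM (cvg_cst (2 : R)) (cvgM (cvg_cst (c ^+ 2)) hg)).
  by rewrite !mulr0 addr0; apply.
apply: (squeeze_cvgr _ (cvg_cst 0) h); apply: nearW => k; rewrite n2_ge0/=.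
have L1 := L2fB (Lf k) Lf0; have L2 := L2fB (Lg k) Lg0.
have -> : c ^+ 2 * n2 mu (fun z => g k z - g0 z) = n2 mu (fun z => c * (g k z - g0 z)).
  by rewrite /n2 -RintZ; [apply: eq_Rintegral => z _; ring|exact: L2.2].
apply: le_trans (n2D L1 (L2fZ c L2)); rewrite le_eqVlt; apply/orP; left; apply/eqP.
by apply: eq_Rintegral => z _; ring.
Qed.

Lemma stint_comb c Q K I Q' K' I' : stint Q K I -> stint Q' K' I' ->
  stint (fun j z => Q j z + c * Q' j z) (fun z => K z + c * K' z) (fun w => I w + c * I' w).
Proof.
move=> [LQ LK LI [H [hB hN hI]]] [LQ' LK' LI' [H' [hB' hN' hI']]]; split.
- by move=> j; apply: L2fD => //; exact: L2fZ.
- by apply: L2fD => //; exact: L2fZ.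
- by apply: L2fD => //; exact: L2fZ.
exists (fun k => comb c (H k) (H' k)); split.
- move=> j; rewrite (funext (fun k => congr1 (n2 _) (funext (fun z => congr1 (fun a => a - _) (combB c (H k) (H' k) j z))))).
  by apply: n2_comb_cvg => // k; exact: (valB_L2 hn).
- rewrite (funext (fun k => congr1 (n2 _) (funext (fun z => congr1 (fun a => a - _) (combN c (H k) (H' k) z))))).
  by apply: n2_comb_cvg => // k; exact: (valN_L2 hn).
- rewrite (funext (fun k => congr1 (n2 _) (funext (fun z => congr1 (fun a => a - _) (combI c (H k) (H' k) z))))).
  by apply: n2_comb_cvg => // k; exact: (valI_L2 hn).
Qed.

(* an elementary integrand, dropped when it is not adapted *)
Let mk (s t : R) (i : idx) (h : Omega -> R) : seq elem :=
  if pselect (elem_ok s t i h) is left H then [:: Elem H] else [::].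

Lemma win_clamp a b s t r : s <= t -> win (clamp a b s) (clamp a b t) r = win s t r * win a b r :> R.
Proof.
move=> st; rewrite /win -natrM mulnb; congr ((_ : bool)%:R).
rewrite /clamp !gt_min !le_min gt_max le_max.
by case: (ltP b r); case: (ltP a r); case: (ltP s r); case: (leP r t).
Qed.

Lemma clamp_bounds (a b s t : R) : a <= b -> s <= t ->
  [/\ a <= clamp a b s, clamp a b s <= clamp a b t & clamp a b t <= b].
Proof.
move=> ab st; rewrite /clamp; split; last by rewrite ge_min lexx.
- by rewrite le_min ab le_max lexx.
- by rewrite le_min !ge_min lexx/= ge_max !le_max lexx st !orbT.
Qed.

(** Clamping moves the start of a window forward as long as [s <= b], which keeps [h] measurable at
    the new start; for [s > b] both ends are sent to [b] and the term is worth nothing, whether kept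
    or dropped. *)
Let mkP a b s t i h : 0 <= a -> a <= b -> b <= T -> elem_ok s t i h ->
  elem_ok (clamp a b s) (clamp a b t) i h \/
  (clamp a b s = clamp a b t /\ mk (clamp a b s) (clamp a b t) i h = [::]).
Proof.
move=> a0 ab bT [[s0 st tT] vi mh bh]; have [c1 c2 c3] := clamp_bounds ab st.
have [sb|bs] := leP s b.
  left; split => //; first by split => //; [exact: le_trans a0 c1|exact: le_trans c3 bT].
  have cs : s <= clamp a b s by rewrite /clamp le_min sb le_max lexx orbT.
  by apply: meas_wrt_sub mh; apply: (F_mono hn) => //; apply: le_trans c2 _; exact: le_trans c3 bT.
have e r : b < r -> clamp a b r = b.
  by move=> br; rewrite /clamp min_l// le_max (ltW br) orbT.
have [ok|nok] := pselect (elem_ok (clamp a b s) (clamp a b t) i h); [by left|right].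
split; last by rewrite /mk; case: pselect.
by rewrite !e// (lt_le_trans bs st).
Qed.

Let win0 s r : win s s r = 0 :> R.
Proof. by rewrite /win; case: (ltP s r). Qed.

Let mkB a b s t i h j z : 0 <= a -> a <= b -> b <= T -> elem_ok s t i h ->
  valB (mk (clamp a b s) (clamp a b t) i h) j z =
  win a b z.1 * (win s t z.1 * (h z.2 * (if i is inl k then (k == j)%:R else 0))).
Proof.
move=> a0 ab bT ok; have [[_ st _] _ _ _] := ok.
rewrite mulrA (mulrC (win a b _)) -win_clamp//.
case: (mkP a0 ab bT ok) => [ok'|[-> ->]]; last by rewrite win0 mul0r /valB big_nil.
rewrite /mk; case: pselect => // H; by rewrite /valB big_seq1.
Qed.

Let mkN a b s t i h z : 0 <= a -> a <= b -> b <= T -> elem_ok s t i h ->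
  valN (mk (clamp a b s) (clamp a b t) i h) z =
  win a b z.1.1 * (win s t z.1.1 * h z.1.2 * (if i is inr C then \1_C z.2 else 0)).
Proof.
move=> a0 ab bT ok; have [[_ st _] _ _ _] := ok.
rewrite !mulrA (mulrC (win a b _)) -win_clamp//.
case: (mkP a0 ab bT ok) => [ok'|[-> ->]]; last by rewrite win0 !mul0r /valN big_nil.
rewrite /mk; case: pselect => // H; by rewrite /valN big_seq1.
Qed.

Let mkI a b s t i h w : 0 <= a -> a <= b -> b <= T -> elem_ok s t i h ->
  valI (mk (clamp a b s) (clamp a b t) i h) w = h w * incr i (clamp a b s) (clamp a b t) w.
Proof.
move=> a0 ab bT ok.
case: (mkP a0 ab bT ok) => [ok'|[-> ->]]; last by rewrite incr0 mulr0 /elementary_integral big_nil.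
rewrite /mk; case: pselect => // H; by rewrite /elementary_integral big_seq1.
Qed.

Section adapted_past.
Variables (t : R) (zeta : Omega -> R).
Hypotheses (t0 : 0 <= t) (tT : t <= T) (mz : meas_wrt (F t) zeta) (Lz : L2f P zeta).

Let tr (x : elem) := mk (clamp t T (e_s x)) (clamp t T (e_t x)) (e_i x) (e_h x).
Let trunc H := flatten (map tr H).

Let wtT (x : elem) r : win t T r * win (e_s x) (e_t x) r = (t < r)%R%:R * win (e_s x) (e_t x) r :> R.
Proof.
have [[_ _ b] _ _ _] := e_ok x; rewrite /win -!natrM !mulnb; congr ((_ : bool)%:R).
case: (ltP t r) => //= _; case: (leP r T) => //= rT.
by rewrite [_ <= e_t x]leNgt (le_lt_trans b rT)/= andbF.
Qed.

Let truncB H j z : valB (trunc H) j z = (t < z.1)%R%:R * valB H j z.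
Proof.
rewrite /trunc /valB big_flatten big_map mulr_sumr; apply: eq_bigr => x _.
rewrite -/(valB (tr x) j z) mkB//; last exact: e_ok.
by rewrite /eB [LHS]mulrA wtT [RHS]mulrA.
Qed.

Let truncN H z : valN (trunc H) z = (t < z.1.1)%R%:R * valN H z.
Proof.
rewrite /trunc /valN big_flatten big_map mulr_sumr; apply: eq_bigr => x _.
rewrite -/(valN (tr x) z) mkN//; last exact: e_ok.
by rewrite /eN !mulrA wtT.
Qed.

Let zeta_elem (x : elem) : t <= e_s x -> \int[P]_w (zeta w * eI B lam N x w) = 0.
Proof.
move=> tx; have [[a b e] vi mh bh] := e_ok x.
rewrite -[RHS](@incr_martingale _ _ _ _ _ _ _ _ _ _ _ hn (e_i x) (e_s x) (e_t x) (fun w => e_h x w * zeta w))//.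
- by apply: eq_Rintegral => w _; rewrite /eI; ring.
- exact: (bounded_mulL2 (e_h_meas hn x) bh Lz).
- apply: meas_wrtM => //.
    by case: (ns_filtration hn) => _ h _ _ _; apply: h; rewrite a (le_trans b e).
  by apply: meas_wrt_sub mz; apply: (F_mono hn) => //; exact: le_trans b e.
Qed.

Let zeta_trunc H : \int[P]_w (zeta w * valI (trunc H) w) = 0.
Proof.
transitivity (\int[P]_w (\sum_(x <- trunc H) zeta w * eI B lam N x w)).
  by apply: eq_Rintegral => w _; rewrite mulr_sumr.
rewrite Rint_sum; last by move=> x; apply: L2f_mul => //; exact: eI_L2.
rewrite /trunc big_flatten/= big_map big1// => x _.
have [[_ st _] _ _ _] := e_ok x; have [c1 _ _] := clamp_bounds tT st.
rewrite /tr /mk; case: pselect => [ok|_]; last by rewrite big_nil.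
by rewrite big_seq1 zeta_elem.
Qed.

(** The approximating sums may still charge times before [t], so they are truncated to []t, T]]. As
    [Q] and [K] vanish up to [t], the change made by truncation is at most the approximation error
    itself; by the isometry the truncated integrals have the same limit, and each of them is
    orthogonal to [zeta]. *)
Lemma stint_past_orthogonal Q K I : stint Q K I ->
  (forall j z, z.1 <= t -> Q j z = 0) -> (forall z, z.1.1 <= t -> K z = 0) ->
  \int[P]_w (zeta w * I w) = 0.
Proof.
move=> [LQ LK LI [H [hB hN hI]]] Q0 K0.
have LH k := valI_L2 hn (H k); have LT k := valI_L2 hn (trunc (H k)).
have iso k : n2 P (fun w => valI (trunc (H k)) w - valI (H k) w) =
   \sum_j n2 (dtP P) (fun z => valB (trunc (H k)) j z - valB (H k) j z) +
   n2 (dtPl P lam) (fun z => valN (trunc (H k)) z - valN (H k) z).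
  have := elementary_isometry hn (comb (-1) (trunc (H k)) (H k)) (comb (-1) (trunc (H k)) (H k)).
  rewrite /n2 => E1; apply: etrans (etrans _ E1) _.
  - by apply: eq_Rintegral => w _; rewrite combI; ring.
  - congr (_ + _); first by apply: eq_bigr => j _; apply: eq_Rintegral => z _; rewrite combB; ring.
    by apply: eq_Rintegral => z _; rewrite combN; ring.
have bB j k : n2 (dtP P) (fun z => valB (trunc (H k)) j z - valB (H k) j z) <= n2 (dtP P) (fun z => valB (H k) j z - Q j z).
  apply: n2_le.
  - by apply: L2fB; exact: (valB_L2 hn).
  - by apply: L2fB => //; exact: (valB_L2 hn).
  - move=> z; rewrite truncB; case: ltP => tz; first by rewrite mul1r subrr normr0.
    by rewrite Q0// mul0r sub0r subr0 normrN.
have bN k : n2 (dtPl P lam) (fun z => valN (trunc (H k)) z - valN (H k) z) <= n2 (dtPl P lam) (fun z => valN (H k) z - K z).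
  apply: n2_le.
  - by apply: L2fB; exact: (valN_L2 hn).
  - by apply: L2fB => //; exact: (valN_L2 hn).
  - move=> z; rewrite truncN; case: ltP => tz; first by rewrite mul1r subrr normr0.
    by rewrite K0// mul0r sub0r subr0 normrN.
have hT : n2 P (fun w => valI (trunc (H k)) w - valI (H k) w) @[k --> \oo] --> 0.
  have h0 : \sum_j n2 (dtP P) (fun z => valB (H k) j z - Q j z) + n2 (dtPl P lam) (fun z => valN (H k) z - K z) @[k --> \oo] --> (0 : R).
    have h1 : \sum_j n2 (dtP P) (fun z => valB (H k) j z - Q j z) @[k --> \oo] --> \sum_(j < n) (0 : R) by apply: cvg_sumR.
    by have := cvgD h1 hN; rewrite big1// addr0; apply.
  apply: (squeeze_cvgr _ (cvg_cst 0) h0); apply: nearW => k; rewrite n2_ge0/= iso.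
  by apply: lerD => //; apply: ler_sum.
have hTI : n2 P (fun w => valI (trunc (H k)) w - I w) @[k --> \oo] --> 0.
  have h0 : 2 * n2 P (fun w => valI (trunc (H k)) w - valI (H k) w) + 2 * n2 P (fun w => valI (H k) w - I w) @[k --> \oo] --> (0 : R).
    by have := cvgD (cvgM (cvg_cst (2 : R)) hT) (cvgM (cvg_cst (2 : R)) hI); rewrite !mulr0 addr0; apply.
  apply: (squeeze_cvgr _ (cvg_cst 0) h0); apply: nearW => k; rewrite n2_ge0/=.
  apply: le_trans (n2D (L2fB (LT k) (LH k)) (L2fB (LH k) LI)).
  by rewrite le_eqVlt; apply/orP; left; apply/eqP; apply: eq_Rintegral => w _; ring.
have z0 : n2 P (fun w => zeta w - zeta w) @[_ --> \oo] --> 0.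
  rewrite (_ : (fun _ => _) = fun=> 0); first exact: cvg_cst.
  by apply/funext => k; rewrite /n2 -[RHS](Rint0 P); apply: eq_Rintegral => w _; rewrite subrr expr0n.
have := ip_cvg (fun=> Lz) LT Lz LI z0 hTI.
rewrite (funext (fun k => zeta_trunc (H k))) => h; exact: (cvg_unique (@Rhausdorff R) h (cvg_cst 0)).
Qed.

End adapted_past.

Let itvT : set R := `[0, T].

Let mitvT : measurable (itvT : set (measurableTypeR R)).
Proof. exact: measurable_itv. Qed.

Let win01 a b r : 0 <= a -> b <= T -> win a b r = win a b r * \1_itvT r :> R.
Proof.
move=> a0 bT; rewrite /win indicE mem_setE in_itv/= -natrM mulnb; congr ((_ : bool)%:R).
case: (ltP a r) => //= ar; case: (leP r b) => //= rb.
by rewrite (ltW (le_lt_trans a0 ar)) (le_trans rb bT).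
Qed.

Let winle a b r : win a b r <= 1 :> R.
Proof. by rewrite /win; case: (_ && _); rewrite ?ler01. Qed.

Let win_sqr a b r : win a b r ^+ 2 = win a b r :> R.
Proof. by rewrite /win; case: (_ && _); rewrite ?expr1n ?expr0n. Qed.

Let mwin a b : measurable_fun setT (win a b : measurableTypeR R -> R).
Proof.
rewrite (_ : win a b = \1_(`]a, b])); first exact: measurable_indic.
by apply/funext => r; rewrite indicE mem_setE in_itv.
Qed.

Lemma entry_sqr_le m k (A : 'M[R]_(m, k)) i j : A i j ^+ 2 <= sqn A.
Proof.
rewrite /sqn (bigD1 i)//= (bigD1 j)//= -addrA lerDl addr_ge0//.
  by apply: sumr_ge0 => *; exact: sqr_ge0.
by apply: sumr_ge0 => *; apply: sumr_ge0 => *; exact: sqr_ge0.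
Qed.

Let bnd_entry m k (h : Omega -> 'M[R]_(m, k)) (i : 'I_m) (j : 'I_k) : (exists C : R, forall w, sqn (h w) <= C) ->
  exists C : R, forall w, `|h w i j| <= C.
Proof.
move=> [C hC]; exists (Num.sqrt C) => w; rewrite -sqrtr_sqr ler_wsqrtr//.
exact: le_trans (entry_sqr_le _ _ _) (hC w).
Qed.

Let simple_elem (H : @simple R _ Omega n) c i j : simple_ok T F H -> c \in H ->
  elem_ok c.1.1 c.1.2 (inl j) (fun w => c.2 w i j).
Proof.
move=> ok /(nthP (0, 0, fun=> 0)) [k kH <-]; have := ok k kH.
case: (nth _ _ _) => [[s t] h] [s0 st tT mh bh] /=; split => //; first by rewrite s0 tT (ltW st).
- exact: (meas_wrt_comp (measurable_entry i j) mh).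
- exact: bnd_entry.
Qed.

Let jsimple_elem (H : @jsimple R _ Omega n kappa) c i : jsimple_ok T F H -> c \in H ->
  elem_ok c.1.1.1 c.1.1.2 (inr c.1.2) (fun w => c.2 w i 0).
Proof.
move=> ok /(nthP (0, 0, set0, fun=> 0)) [k kH <-]; have := ok k kH.
case: (nth _ _ _) => [[[s t] C] h] [[s0 st tT] mC CE mh bh] /=; split => //; first by rewrite s0 tT (ltW st).
- exact: (meas_wrt_comp (measurable_entry i 0) mh).
- exact: bnd_entry.
Qed.

Section window.
Variables (a b : R).
Hypotheses (a0 : 0 <= a) (ab : a <= b) (bT : b <= T).

Let simpleL (i : 'I_n) (H : @simple R _ Omega n) : seq elem :=
  flatten [seq flatten [seq mk (clamp a b c.1.1) (clamp a b c.1.2) (inl j) (fun w => c.2 w i j) | j <- enum 'I_n] | c : R * R * (Omega -> 'M[R]_n) <- H].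

Let simpleB (i : 'I_n) (H : @simple R _ Omega n) j z : simple_ok T F H ->
  valB (simpleL i H) j z = win a b z.1 * simple_val H z.1 z.2 i j.
Proof.
move=> ok; rewrite /valB /simpleL /simple_val big_flatten big_map summxE mulr_sumr big_seq [RHS]big_seq.
apply: eq_bigr => c cH; rewrite big_flatten big_map big_enum/= (bigD1 j)//= [X in _ + X]big1 ?addr0; last first.
  move=> j' jj'; rewrite -/(valB _ j z) mkB//; last exact: simple_elem ok cH.
  by rewrite (negbTE jj') !mulr0.
rewrite -/(valB _ j z) mkB//; last exact: simple_elem ok cH.
rewrite eqxx mulr1 /win; congr (_ * _).
by case: (_ && _); rewrite ?mul1r ?mul0r// mxE.
Qed.

Let simpleN (i : 'I_n) (H : @simple R _ Omega n) z : simple_ok T F H -> valN (simpleL i H) z = 0.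
Proof.
move=> ok; rewrite /valN /simpleL big_flatten big_map big_seq big1// => c cH.
rewrite big_flatten big_map big1// => j _; rewrite -/(valN _ z) mkN ?mulr0//.
exact: simple_elem ok cH.
Qed.

Let simpleI (i : 'I_n) (H : @simple R _ Omega n) w : simple_ok T F H -> valI (simpleL i H) w = simple_int B H a b w i 0.
Proof.
move=> ok; rewrite /elementary_integral /simpleL /simple_int big_flatten big_map summxE big_seq [RHS]big_seq.
apply: eq_bigr => c cH; rewrite big_flatten big_map big_enum/= mxE; apply: eq_bigr => j _.
rewrite -/(valI _ w) mkI//; last exact: simple_elem ok cH.
by rewrite /= !mxE.
Qed.

Let simple_val_meas (H : @simple R _ Omega n) : simple_ok T F H ->
  measurable_fun (itvT `*` setT) (fun z : tw => simple_val H z.1 z.2).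
Proof.
move=> ok; apply: measurable_mx => i j.
rewrite (_ : (fun z => _) = fun z => \sum_(c <- H) (win c.1.1 c.1.2 z.1 * (if c \in H then c.2 z.2 i j else 0))); last first.
  apply/funext => z; rewrite /simple_val summxE big_seq [RHS]big_seq; apply: eq_bigr => c ->.
  by rewrite /win; case: (_ && _); rewrite ?mul1r ?mul0r// mxE.
apply: measurable_funTS; apply: measurable_sum => c; apply: measurable_funM.
  exact: (measurableT_comp (mwin _ _) measurable_fst).
have [cH|cH] := boolP (c \in H); last exact: measurable_cst.
have [[s0 st tT] _ m _] := simple_elem i j ok cH.
have mm := meas_F_measurable hn (_ : 0 <= c.1.1 <= T) m.
by apply: (measurableT_comp (mm _) measurable_snd); rewrite s0 (le_trans st tT).
Qed.

(** Row [i] of a simple matrix integrand is a list of scalar terms, one for each Brownian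
    coordinate, clamped to [[a, b]]. The definition of the integral does not ask [Q] to be square
    integrable: this comes from one approximant at finite distance. *)
Lemma ito_stint (Q : R -> Omega -> 'M[R]_n) (I : Omega -> 'cV[R]_n) (i : 'I_n) : ito_integral P T F B Q a b I ->
  stint (fun j z => win a b z.1 * Q z.1 z.2 i j) (fun=> 0) (fun w => I w i 0).
Proof.
move=> [mQ mI [H [ok hV hI]]].
have mQij j : measurable_fun setT (fun z : tw => win a b z.1 * Q z.1 z.2 i j).
  have := measurable_funM (measurableT_comp (mwin a b) measurable_fst)
    (measurable_indicM (measurableX mitvT measurableT) (measurableT_comp (measurable_entry i j) mQ)).
  congr (measurable_fun _ _); apply/funext => z /=; rewrite mulrA; congr (_ * _).
  rewrite (win01 _ a0 bT) -mulrA; congr (_ * _); rewrite !indicE; case: (boolP (_ \in itvT)) => h.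
    by rewrite mul1r; apply/eqP; rewrite eqr_nat; apply/eqP; congr nat_of_bool; apply/idP; rewrite inE; split => //; rewrite inE in h.
  by rewrite (_ : (_ \in _) = false) ?mulr0//; apply/negbTE; apply: contra h; rewrite !inE => -[].
pose g k := (\int[P]_w \int[lebesgue_measure]_(r in itvT) (sqn (simple_val (H k) r w - Q r w))%:E)%E.
have gE k := @iterated_dtP R d Omega P itvT (fun r w => sqn (simple_val (H k) r w - Q r w)) mitvT.
have msq k : measurable_fun (itvT `*` setT) (fun z : R * Omega => sqn (simple_val (H k) z.1 z.2 - Q z.1 z.2)).
  rewrite /sqn; apply: measurable_sum => i'; apply: measurable_sum => j'; apply: measurable_funX.
  rewrite (_ : (fun x => _) = fun z : R * Omega => simple_val (H k) z.1 z.2 i' j' - Q z.1 z.2 i' j'); last first.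
    by apply/funext => z; rewrite !mxE.
  apply: measurable_funB.
    exact: (measurableT_comp (measurable_entry i' j') (simple_val_meas (ok k))).
  exact: (measurableT_comp (measurable_entry i' j') mQ).
have KB j := n2_dominated_cvg (mu := dtP P) (D := fun k z => valB (simpleL i (H k)) j z - win a b z.1 * Q z.1 z.2 i j) (g := g).
have {}KB j : (exists k0, L2f (dtP P) (fun z => valB (simpleL i (H k0)) j z - win a b z.1 * Q z.1 z.2 i j)) /\
   n2 (dtP P) (fun z => valB (simpleL i (H k)) j z - win a b z.1 * Q z.1 z.2 i j) @[k --> \oo] --> 0.
  apply: KB => //.
    by move=> k; apply: measurable_funB => //; exact: (valB_L2 hn _ _).1.
  move=> k; rewrite /g; have [m ->] := gE k (msq k) (fun r w => sqn_ge0 _).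
  apply: ge0_le_integral => //.
  - by move=> z _; rewrite lee_fin sqr_ge0.
  - apply/measurable_EFinP; apply: measurable_funX; apply: measurable_funB => //; exact: (valB_L2 hn _ _).1.
  - exact/measurable_EFinP.
  - move=> z _; rewrite lee_fin simpleB// -mulrBr exprMn win_sqr win01// -mulrA.
    have := entry_sqr_le (simple_val (H k) z.1 z.2 - Q z.1 z.2) i j; rewrite !mxE => h.
    apply: (@le_trans _ _ (1 * (\1_itvT z.1 * (simple_val (H k) z.1 z.2 i j - Q z.1 z.2 i j) ^+ 2))).
      by apply: ler_wpM2r => //; rewrite mulr_ge0 ?sqr_ge0// indicE ler0n.
    by rewrite mul1r ler_wpM2l// indicE ler0n.
have KI := n2_dominated_cvg (mu := P) (D := fun k w => valI (simpleL i (H k)) w - I w i 0) (g := fun k => (\int[P]_w (sqn (simple_int B (H k) a b w - I w))%:E)%E).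
have {}KI : (exists k0, L2f P (fun w => valI (simpleL i (H k0)) w - I w i 0)) /\
   n2 P (fun w => valI (simpleL i (H k)) w - I w i 0) @[k --> \oo] --> 0.
  apply: KI => //.
    move=> k; apply: measurable_funB; first exact: (valI_L2 hn _).1.
    exact: (measurableT_comp (measurable_coord i) mI).
  move=> k; apply: ge0_le_integral => //.
  - by move=> z _; rewrite lee_fin sqr_ge0.
  - apply/measurable_EFinP; apply: measurable_funX; apply: measurable_funB; first exact: (valI_L2 hn _).1.
    exact: (measurableT_comp (measurable_coord i) mI).
  - apply/measurable_EFinP; apply: (measurableT_comp (@measurable_sqn R n)).
    apply: measurable_mx => i' j'; rewrite (ord1 j').
    rewrite (_ : (fun _ => _) = fun w => valI (simpleL i' (H k)) w - I w i' 0); last first.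
      by apply/funext => w; rewrite simpleI// !mxE.
    apply: measurable_funB; first exact: (valI_L2 hn _).1.
    exact: (measurableT_comp (measurable_coord i') mI).
  - move=> w _; rewrite lee_fin simpleI//.
    by have := entry_sqr_le (simple_int B (H k) a b w - I w) i 0; rewrite !mxE.
split.
- move=> j; have [[k0 h] _] := KB j.
  have := L2fB (valB_L2 hn (simpleL i (H k0)) j) h.
  by congr (L2f _ _); apply/funext => z; rewrite subKr.
- exact: L2f0.
- have [[k0 h] _] := KI; have := L2fB (valI_L2 hn (simpleL i (H k0))) h.
  by congr (L2f _ _); apply/funext => z; rewrite subKr.
exists (fun k => simpleL i (H k)); split.
- by move=> j; exact: (KB j).2.
- rewrite (_ : (fun k => _) = fun=> 0); first exact: cvg_cst.
  apply/funext => k; rewrite /n2 -[RHS](Rint0 (dtPl P lam)); apply: eq_Rintegral => z _.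
  by rewrite simpleN// subrr expr0n.
- exact: KI.2.
Qed.

Let jsimpleL (i : 'I_n) (H : @jsimple R _ Omega n kappa) : seq elem :=
  flatten [seq mk (clamp a b c.1.1.1) (clamp a b c.1.1.2) (inr c.1.2) (fun w => c.2 w i 0) | c : R * R * set 'cV[R]_kappa * (Omega -> 'cV[R]_n) <- H].

Let jsimpleB (i : 'I_n) (H : @jsimple R _ Omega n kappa) j z : jsimple_ok T F H -> valB (jsimpleL i H) j z = 0.
Proof.
move=> ok; rewrite /valB /jsimpleL big_flatten big_map big_seq big1// => c cH.
rewrite -/(valB _ j z) mkB ?mulr0//; exact: jsimple_elem ok cH.
Qed.

Let jsimpleN (i : 'I_n) (H : @jsimple R _ Omega n kappa) z : jsimple_ok T F H ->
  valN (jsimpleL i H) z = win a b z.1.1 * jsimple_val H z.1.1 z.1.2 z.2 i 0.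
Proof.
move=> ok; rewrite /valN /jsimpleL /jsimple_val big_flatten big_map summxE mulr_sumr big_seq [RHS]big_seq.
apply: eq_bigr => c cH; rewrite -/(valN _ z) mkN//; last exact: jsimple_elem ok cH.
rewrite /win indicE; congr (_ * _).
by case: (_ <= _); case: (_ < _); case: (_ \in _); rewrite /= ?mul1r ?mul0r ?mulr1 ?mulr0// mxE.
Qed.

Let jsimpleI (i : 'I_n) (H : @jsimple R _ Omega n kappa) w : jsimple_ok T F H -> valI (jsimpleL i H) w = jsimple_int lam N H a b w i 0.
Proof.
move=> ok; rewrite /elementary_integral /jsimpleL /jsimple_int big_flatten big_map summxE big_seq [RHS]big_seq.
apply: eq_bigr => c cH; rewrite -/(valI _ w) mkI//; last exact: jsimple_elem ok cH.
by rewrite /= !mxE mulrC.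
Qed.

Let jsimple_val_meas (H : @jsimple R _ Omega n kappa) : jsimple_ok T F H ->
  measurable_fun ((itvT `*` setT) `*` E) (fun z : tw * 'cV[R]_kappa => jsimple_val H z.1.1 z.1.2 z.2).
Proof.
move=> ok; apply: measurable_mx => i j; rewrite (ord1 j).
rewrite (_ : (fun z => _) = fun z => \sum_(c <- H) (win c.1.1.1 c.1.1.2 z.1.1 * (if c \in H then c.2 z.1.2 i 0 * \1_(c.1.2) z.2 else 0))); last first.
  apply/funext => z; rewrite /jsimple_val summxE big_seq [RHS]big_seq; apply: eq_bigr => c ->.
  rewrite /win indicE.
  by case: (_ <= _); case: (_ < _); case: (_ \in _); rewrite /= ?mul1r ?mul0r ?mulr1 ?mulr0// mxE.
apply: measurable_funTS; apply: measurable_sum => c; apply: measurable_funM.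
  exact: (measurableT_comp (mwin _ _) (measurableT_comp measurable_fst measurable_fst)).
have [cH|cH] := boolP (c \in H); last exact: measurable_cst.
have [[s0 st tT] vC m _] := jsimple_elem i ok cH.
apply: measurable_funM; last exact: (measurableT_comp (measurable_indic vC.1) measurable_snd).
have mm := meas_F_measurable hn (_ : 0 <= c.1.1.1 <= T) m.
by apply: (measurableT_comp (mm _) (measurableT_comp measurable_snd measurable_fst)); rewrite s0 (le_trans st tT).
Qed.

Let jsimple_val_off (H : @jsimple R _ Omega n kappa) r w e i : jsimple_ok T F H -> e \notin E -> jsimple_val H r w e i 0 = 0.
Proof.
move=> ok eE; rewrite /jsimple_val summxE big_seq big1// => c cH.
have [_ [_ CE] _ _] := jsimple_elem i ok cH.
rewrite (_ : (e \in c.1.2) = false) ?andbF ?mxE//; apply/negbTE; apply: contra eE.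
by rewrite !inE => /CE.
Qed.

(** [K] is controlled on nonzero marks only; the indicator removes the other mark, where simple
    integrands vanish because their mark sets avoid it. *)
Lemma jump_stint (K : R -> Omega -> 'cV[R]_kappa -> 'cV[R]_n) (I : Omega -> 'cV[R]_n) (i : 'I_n) : jump_integral P T F lam N K a b I ->
  stint (fun _ => fun=> 0) (fun z => win a b z.1.1 * (\1_E z.2 * K z.1.1 z.1.2 z.2 i 0)) (fun w => I w i 0).
Proof.
move=> [mK mI [H [ok hV hI]]]; have mE := @measurable_jumpE R kappa.
have mD : measurable ((itvT `*` setT) `*` E : set (tw * 'cV[R]_kappa)).
  by apply: measurableX => //; apply: measurableX.
have mKi : measurable_fun setT (fun z : tw * 'cV[R]_kappa => win a b z.1.1 * (\1_E z.2 * K z.1.1 z.1.2 z.2 i 0)).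
  have := measurable_funM (measurableT_comp (mwin a b) (measurableT_comp measurable_fst measurable_fst))
    (measurable_indicM mD (measurableT_comp (measurable_coord i) mK)).
  congr (measurable_fun _ _); apply/funext => z /=; rewrite !mulrA; congr (_ * _).
  rewrite (win01 _ a0 bT) -!mulrA; congr (_ * _); rewrite !indicE -!natrM !mulnb; congr ((_ : bool)%:R).
  by apply/andP/andP => -[h1 h2]; split => //; move: h1 h2; rewrite !inE => h1; [case|move=> h2; split].
pose g k := (\int[P]_w \int[lebesgue_measure]_(r in itvT) \int[lam]_(e in E) (sqn (jsimple_val (H k) r w e - K r w e))%:E)%E.
have gE k := @iterated_dtPl R d _ Omega _ P lam itvT E (fun r w e => sqn (jsimple_val (H k) r w e - K r w e)) mitvT mE.
have msq k : measurable_fun ((itvT `*` setT) `*` E) (fun z : (R * Omega) * 'cV[R]_kappa => sqn (jsimple_val (H k) z.1.1 z.1.2 z.2 - K z.1.1 z.1.2 z.2)).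
  rewrite /sqn; apply: measurable_sum => i'; apply: measurable_sum => j'; apply: measurable_funX.
  rewrite (_ : (fun x => _) = fun z : (R * Omega) * 'cV[R]_kappa => jsimple_val (H k) z.1.1 z.1.2 z.2 i' j' - K z.1.1 z.1.2 z.2 i' j'); last first.
    by apply/funext => z; rewrite !mxE.
  apply: measurable_funB.
    exact: (measurableT_comp (measurable_entry i' j') (jsimple_val_meas (ok k))).
  exact: (measurableT_comp (measurable_entry i' j') mK).
have KN := n2_dominated_cvg (mu := dtPl P lam) (D := fun k z => valN (jsimpleL i (H k)) z - win a b z.1.1 * (\1_E z.2 * K z.1.1 z.1.2 z.2 i 0)) (g := g).
have {}KN : (exists k0, L2f (dtPl P lam) (fun z => valN (jsimpleL i (H k0)) z - win a b z.1.1 * (\1_E z.2 * K z.1.1 z.1.2 z.2 i 0))) /\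
   n2 (dtPl P lam) (fun z => valN (jsimpleL i (H k)) z - win a b z.1.1 * (\1_E z.2 * K z.1.1 z.1.2 z.2 i 0)) @[k --> \oo] --> 0.
  apply: KN => //.
    by move=> k; apply: measurable_funB => //; exact: (valN_L2 hn _).1.
  move=> k; rewrite /g; have [m ->] := gE k (msq k) (fun r w e => sqn_ge0 _).
  apply: ge0_le_integral => //.
  - by move=> z _; rewrite lee_fin sqr_ge0.
  - apply/measurable_EFinP; apply: measurable_funX; apply: measurable_funB => //; exact: (valN_L2 hn _).1.
  - exact/measurable_EFinP.
  - move=> z _; rewrite lee_fin jsimpleN//.
    have -> : jsimple_val (H k) z.1.1 z.1.2 z.2 i 0 = \1_E z.2 * jsimple_val (H k) z.1.1 z.1.2 z.2 i 0.
      by rewrite indicE; case: (boolP (_ \in _)) => h; rewrite ?mul1r// mul0r jsimple_val_off.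
    rewrite -mulrBr -mulrBr !exprMn win_sqr win01// -!mulrA.
    have -> (x : R) : \1_E z.2 * (\1_E z.2 * x) = \1_E z.2 * x.
      by rewrite indicE; case: (_ \in _); rewrite ?mul1r ?mul0r.
    have := entry_sqr_le (jsimple_val (H k) z.1.1 z.1.2 z.2 - K z.1.1 z.1.2 z.2) i 0; rewrite !mxE => h.
    apply: (@le_trans _ _ (1 * (\1_itvT z.1.1 * (\1_E z.2 * (jsimple_val (H k) z.1.1 z.1.2 z.2 i 0 - K z.1.1 z.1.2 z.2 i 0) ^+ 2)))).
      by apply: ler_wpM2r => //; do 2!(apply: mulr_ge0; first by rewrite indicE ler0n); exact: sqr_ge0.
    by rewrite mul1r; do 2!(apply: ler_wpM2l; first by rewrite indicE ler0n).
have KI := n2_dominated_cvg (mu := P) (D := fun k w => valI (jsimpleL i (H k)) w - I w i 0) (g := fun k => (\int[P]_w (sqn (jsimple_int lam N (H k) a b w - I w))%:E)%E).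
have {}KI : (exists k0, L2f P (fun w => valI (jsimpleL i (H k0)) w - I w i 0)) /\
   n2 P (fun w => valI (jsimpleL i (H k)) w - I w i 0) @[k --> \oo] --> 0.
  apply: KI => //.
    move=> k; apply: measurable_funB; first exact: (valI_L2 hn _).1.
    exact: (measurableT_comp (measurable_coord i) mI).
  move=> k; apply: ge0_le_integral => //.
  - by move=> z _; rewrite lee_fin sqr_ge0.
  - apply/measurable_EFinP; apply: measurable_funX; apply: measurable_funB; first exact: (valI_L2 hn _).1.
    exact: (measurableT_comp (measurable_coord i) mI).
  - apply/measurable_EFinP; apply: (measurableT_comp (@measurable_sqn R n)).
    apply: measurable_mx => i' j'; rewrite (ord1 j').
    rewrite (_ : (fun _ => _) = fun w => valI (jsimpleL i' (H k)) w - I w i' 0); last first.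
      by apply/funext => w; rewrite jsimpleI// !mxE.
    apply: measurable_funB; first exact: (valI_L2 hn _).1.
    exact: (measurableT_comp (measurable_coord i') mI).
  - move=> w _; rewrite lee_fin jsimpleI//.
    by have := entry_sqr_le (jsimple_int lam N (H k) a b w - I w) i 0; rewrite !mxE.
split.
- by move=> j; exact: L2f0.
- have [[k0 h] _] := KN; have := L2fB (valN_L2 hn (jsimpleL i (H k0))) h.
  by congr (L2f _ _); apply/funext => z; rewrite subKr.
- have [[k0 h] _] := KI; have := L2fB (valI_L2 hn (jsimpleL i (H k0))) h.
  by congr (L2f _ _); apply/funext => z; rewrite subKr.
exists (fun k => jsimpleL i (H k)); split.
- move=> j; rewrite (_ : (fun k => _) = fun=> 0); first exact: cvg_cst.
  apply/funext => k; rewrite /n2 -[RHS](Rint0 (dtP P)); apply: eq_Rintegral => z _.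
  by rewrite jsimpleB// subrr expr0n.
- exact: KN.2.
- exact: KI.2.
Qed.

End window.

End stochastic_integral.

(** * The product rule for Ito processes *)

Lemma Rint_dct {R : realType} {d} {S : measurableType d} (mu : {measure set S -> \bar R})
  (f_ : nat -> S -> R) (f g : S -> R) :
  (forall k, measurable_fun setT (f_ k)) -> measurable_fun setT f ->
  {ae mu, forall x, f_ k x @[k --> \oo] --> f x} -> intg mu g ->
  {ae mu, forall x, forall k, `|f_ k x| <= g x} ->
  intg mu f /\ \int[mu]_x f_ k x @[k --> \oo] --> \int[mu]_x f x.
Proof.
move=> mf_ mf fc Ig fg.
have [| | | | |i1 _ i2] := @dominated_convergence _ S R mu setT measurableT (fun k => EFin \o f_ k) (EFin \o f) (EFin \o g).
- by move=> k; exact/measurable_EFinP.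
- exact/measurable_EFinP.
- by move: fc; apply: filterS => x h _; apply: cvg_EFin h; exact: nearW.
- exact: Ig.
- by move: fg; apply: filterS => x h k _; rewrite lee_fin.
by split => //; apply: fine_cvg; rewrite EFin_Rint.
Qed.

(** Monotonicity for arbitrary nonnegative functions, measurable or not: the integral is a supremum
    over the simple functions below. It is applied to suprema over all times and to iterated
    integrals. *)
Lemma ge0_integral_mono {R : realType} {d} {S : measurableType d} (mu : {measure set S -> \bar R})
  (D : set S) (f g : S -> \bar R) : (forall x, D x -> 0 <= f x)%E -> (forall x, D x -> f x <= g x)%E ->
  (\int[mu]_(x in D) f x <= \int[mu]_(x in D) g x)%E.
Proof.
move=> f0 fg; rewrite !ge0_integralE//; last by move=> x Dx; exact: le_trans (f0 x Dx) (fg x Dx).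
apply: ereal_sup_le => _ [h hf <-]; exists h => // x.
apply: le_trans (hf x) _; rewrite /patch; case: ifPn => // xD; apply: fg; by rewrite inE in xD.
Qed.

Lemma sfprod_intg2 {R : realType} {d1 d2} {T1 : measurableType d1} {T2 : measurableType d2}
  (m1 : {sigma_finite_measure set T1 -> \bar R}) (m2 : {sigma_finite_measure set T2 -> \bar R}) (h : T1 * T2 -> R) :
  intg (sfprod m1 m2) h ->
  [/\ intg m2 (fun y => \int[m1]_x h (x, y)), \int[m2]_y \int[m1]_x h (x, y) = \int[sfprod m1 m2]_z h z &
      {ae m2, forall y, intg m1 (fun x => h (x, y))}].
Proof.
move=> Ih; have mh : measurable_fun setT h by exact: intg_meas Ih.
have mG : measurable_fun setT (fun y => \int[m1]_x (h (x, y))%:E)%E.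
  exact: (@measurable_fubini_G _ _ _ _ R m1 m2 (EFin \o h) Ih).
have mt : measurable_fun setT (fun y => \int[m1]_x h (x, y)) by exact: measurableT_comp mG.
have hae := @ae_integrable2 _ _ _ _ R m1 m2 (EFin \o h) Ih.
split => //.
  apply/integrableP; split; first exact/measurable_EFinP.
  apply: (@le_lt_trans _ _ (\int[m2]_y \int[m1]_x (`|h (x, y)|)%:E)%E).
    apply: ge0_integral_mono => y _ //; rewrite /Rintegral.
    apply: (@le_trans _ _ `|\int[m1]_x (h (x, y))%:E|%E).
      by rewrite /=; move: (\int[m1]_x _)%E => -[a| |] /=; rewrite ?lee_fin ?normr0 ?leey.
    apply: le_trans (le_abse_integral _ _ _) _ => //.
    by apply/measurable_EFinP; exact: (measurableT_comp mh (measurable_pair2 y)).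
  by have := (@integrable21ltyP _ _ _ _ R m1 m2 (EFin \o h) _).1 Ih; apply; exact/measurable_EFinP.
rewrite /Rintegral; congr fine.
rewrite -[RHS](@integral21_prod_meas1 _ _ _ _ R m1 m2 (EFin \o h) Ih).
apply: ae_eq_integral => //; first exact/measurable_EFinP.
move: hae; apply: filterS => y Iy _; rewrite EFin_Rint//; exact: Iy.
Qed.

Section time_integrals.
Context {R : realType} {d : measure_display} {Omega : measurableType d}.
Context (P : probability Omega R).
Local Notation tw := (measurableTypeR R * Omega)%type.
Local Notation leb := (lebesgue_measure : {measure set (measurableTypeR R) -> \bar R}).
Implicit Types f : tw -> R.

Definition tint f (w : Omega) : R := \int[leb]_r f (r, w).

Lemma tint_intg f : intg (dtP P) f ->
  intg P (tint f) /\ \int[P]_w tint f w = \int[dtP P]_z f z.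
Proof. by move=> If; have [] := @sfprod_intg2 _ _ _ _ _ lebesgue_measure P f If. Qed.

Lemma win_L2 s t : L2f leb (win s t : measurableTypeR R -> R) /\ n2 leb (win s t : measurableTypeR R -> R) = Num.max 0 (t - s).
Proof.
have [h1 h2] := win_intg s t s t.
split; last first.
  by rewrite /n2; have := h2; rewrite /overlap minxx maxxx => <-; apply: eq_Rintegral => r _; rewrite expr2.
split; last by apply: eq_intg h1 => r; rewrite expr2.
rewrite (_ : (win s t : measurableTypeR R -> R) = \1_(`]s, t])); first exact: measurable_indic.
by apply/funext => r; rewrite indicE mem_setE in_itv.
Qed.

Lemma measurable_win s t : measurable_fun setT (fun z : tw => win s t z.1).
Proof. exact: (measurableT_comp (win_L2 s t).1.1 measurable_fst). Qed.

Lemma win_prod_L2 s t (zeta : Omega -> R) : L2f P zeta -> L2f (dtP P) (fun z => win s t z.1 * zeta z.2).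
Proof.
move=> [mz Lz]; split.
  by apply: measurable_funM; [exact: measurable_win|exact: (measurableT_comp mz measurable_snd)].
have [h _] := intg_prod_mul (win_L2 s t).1.2 Lz.
by apply: eq_intg h => z; rewrite exprMn.
Qed.

Lemma winM s t r : win s t r * win s t r = win s t r :> R.
Proof. by rewrite /win; case: (_ && _); rewrite ?mul1r ?mul0r. Qed.

Lemma win_mul_L2 s t f : L2f (dtP P) f -> L2f (dtP P) (fun z => win s t z.1 * f z).
Proof.
move=> Lf; apply: (L2f_le _ _ Lf).
  by apply: measurable_funM; [exact: measurable_win|exact: Lf.1].
move=> z; rewrite normrM -[leRHS]mul1r ler_wpM2r// /win.
by case: (_ && _); rewrite ?normr1 ?normr0 ?ler01.
Qed.

(** Cauchy-Schwarz in time, path by path. The factor [t - s] is what makes products of two drift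
    increments negligible on a fine grid. *)
Lemma tint_L2 s t f : s <= t -> L2f (dtP P) f ->
  let A := tint (fun z => win s t z.1 * f z) in
  L2f P A /\ n2 P A <= (t - s) * n2 (dtP P) (fun z => win s t z.1 * f z).
Proof.
move=> st Lf A; have Lw := win_mul_L2 s t Lf.
pose g z := (win s t z.1 * f z) ^+ 2.
have Ig : intg (dtP P) g by exact: Lw.2.
have mg := intg_meas Ig.
have mA : measurable_fun setT A.
  have i1 : intg (dtP P) (fun z => win s t z.1 * f z).
    have L1 : L2f P (fun=> 1 : R) by split => //; exact: finite_measure_integrable_cst.
    have := L2f_mul (win_prod_L2 s t L1) Lf.
    by apply: eq_intg => z; rewrite mulr1.
  exact: intg_meas (tint_intg i1).1.
have mh : measurable_fun setT (fun w => \int[leb]_r (g (r, w))%:E)%E.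
  apply: (@measurable_fun_fubini_tonelli_G _ _ _ _ R lebesgue_measure (EFin \o g)); first exact/measurable_EFinP.
  by move=> z; rewrite lee_fin sqr_ge0.
have h0 w : (0 <= \int[leb]_r (g (r, w))%:E)%E by apply: integral_ge0 => r _; rewrite lee_fin sqr_ge0.
have CS w : ((A w ^+ 2)%:E <= (t - s)%:E * \int[leb]_r (g (r, w))%:E)%E.
  (* The case [s = t] is apart: there [0 * +oo = 0] would give no room on a path of infinite energy,
     but the integral itself is 0. For [s < t] such a path has an infinite bound. *)
  move: st; rewrite le_eqVlt => /orP[/eqP st|st].
    rewrite /A /tint (_ : (fun r => _) = fun=> 0) ?Rint0 ?expr0n.
      by rewrite -st subrr mul0e.
    by apply/funext => r; rewrite st /win; case: (ltP t r); rewrite ?mul0r.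
  have [hf|] := boolP (\int[leb]_r (g (r, w))%:E < +oo)%E; last first.
    by rewrite -leNgt leye_eq => /eqP ->; rewrite gt0_muley ?lte_fin ?subr_gt0// leey.
  have Lr : L2f leb (fun r : measurableTypeR R => win s t r * f (r, w)).
    split; first exact: (measurableT_comp Lw.1 (measurable_pair2 w)).
    by apply: intg_lty hf => [|r]; [exact: (measurableT_comp mg (measurable_pair2 w))|exact: sqr_ge0].
  rewrite -EFin_Rint; last exact: Lr.2.
  rewrite -EFinM lee_fin; have := CS_Rint (win_L2 s t).1 Lr; rewrite (win_L2 s t).2.
  rewrite max_r ?subr_ge0 ?(ltW st)//; congr (_ ^+ 2 <= _).
  by apply: eq_Rintegral => r _; rewrite mulrA winM.
have e1 : (\int[P]_w (A w ^+ 2)%:E <= (t - s)%:E * \int[dtP P]_z (g z)%:E)%E.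
  rewrite -tonelli_dtP//; first last.
  - by move=> z; rewrite lee_fin sqr_ge0.
  - exact/measurable_EFinP.
  rewrite -ge0_integralZl ?lee_fin ?subr_ge0//.
  apply: ge0_le_integral => //.
  - by move=> w _; rewrite lee_fin sqr_ge0.
  - by apply/measurable_EFinP; exact: measurable_funX.
  - exact: measurable_funeM.
have LA : L2f P A.
  split => //; apply: intg_lty => [|w|]; [exact: measurable_funX|exact: sqr_ge0|].
  by apply: le_lt_trans e1 _; rewrite -EFin_Rint// -EFinM ltry.
split => //; rewrite -lee_fin EFinM /n2 (EFin_Rint Ig) EFin_Rint//; exact: LA.2.
Qed.

Lemma tint_mul s t f (zeta : Omega -> R) : L2f (dtP P) f -> L2f P zeta ->
  intg (dtP P) (fun z => win s t z.1 * zeta z.2 * f z) /\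
  \int[P]_w (zeta w * tint (fun z => win s t z.1 * f z) w) = \int[dtP P]_z (win s t z.1 * zeta z.2 * f z).
Proof.
move=> Lf Lz; have I1 := L2f_mul (win_prod_L2 s t Lz) Lf.
split => //; have [t1 <-] := tint_intg I1.
have L1 : L2f P (fun=> 1 : R) by split => //; exact: finite_measure_integrable_cst.
have i1 : intg (dtP P) (fun z => win s t z.1 * f z).
  by have := L2f_mul (win_prod_L2 s t L1) Lf; apply: eq_intg => z; rewrite mulr1.
apply: Rint_ae_eq.
- apply: measurable_funM; [exact: Lz.1|exact: intg_meas (tint_intg i1).1].
- exact: intg_meas t1.
have := @ae_integrable2 _ _ _ _ R lebesgue_measure P _ i1.
apply: filterS => w Iw; rewrite /tint -RintZ; last exact: Iw.
by apply: eq_Rintegral => r _; ring.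
Qed.

Lemma tint_split s r t f w : s <= r -> r <= t -> intg leb (fun r' : measurableTypeR R => win s t r' * f (r', w)) ->
  tint (fun z => win s t z.1 * f z) w = tint (fun z => win s r z.1 * f z) w + tint (fun z => win r t z.1 * f z) w.
Proof.
move=> sr rt I0.
have E1 x : win s r x = win s r x * win s t x :> R.
  rewrite /win -natrM mulnb; congr ((_ : bool)%:R); case: (ltP s x) => //=; case: (leP x r) => //= h _.
  by rewrite (le_trans h rt).
have E2 x : win r t x = win r t x * win s t x :> R.
  rewrite /win -natrM mulnb; congr ((_ : bool)%:R); case: (ltP r x) => //= h; rewrite (le_lt_trans sr h).
  by case: (x <= t).
have mI := intg_meas I0.
have I1 a b : intg leb (fun x : measurableTypeR R => win a b x * (win s t x * f (x, w))).
  apply: (intg_le _ _ (intg_norm I0)); first by apply: measurable_funM => //; exact: (win_L2 a b).1.1.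
  move=> x; rewrite normrM -[leRHS]mul1r ler_wpM2r// /win.
  by case: (_ && _); rewrite ?normr1 ?normr0 ?ler01.
rewrite /tint -RintD.
- apply: eq_Rintegral => x _ /=; rewrite -mulrDl; congr (_ * _); rewrite /win.
  rewrite -natrD; case: (ltP s x) => sx /=; last by rewrite (ltNge r) (le_trans sx sr).
  by case: (leP x r) => xr /=; [rewrite (le_trans xr rt)|].
- by apply: eq_intg (I1 s r) => x; rewrite mulrA -E1.
- by apply: eq_intg (I1 r t) => x; rewrite mulrA -E2.
Qed.

Lemma ae_time_section f : intg (dtP P) f -> {ae P, forall w, intg leb (fun r : measurableTypeR R => f (r, w))}.
Proof. by move=> If; exact: (@ae_integrable2 _ _ _ _ R lebesgue_measure P (EFin \o f) If). Qed.

End time_integrals.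

(** * Uniform time grids *)

Section grid.
Context {R : realType} (T : R) (hT : 0 < T).

Definition grid (m i : nat) : R := T * i%:R / m.+1%:R.

Lemma grid0 m : grid m 0 = 0. Proof. by rewrite /grid mulr0 mul0r. Qed.
Lemma gridT m : grid m m.+1 = T. Proof. by rewrite /grid mulfK// pnatr_eq0. Qed.
Lemma grid_le m i j : (i <= j)%N -> grid m i <= grid m j.
Proof. by move=> ij; rewrite /grid ler_pM2r ?invr_gt0// ler_pM2l// ler_nat. Qed.
Lemma grid_ge0 m i : 0 <= grid m i. Proof. by rewrite -(grid0 m) grid_le. Qed.
Lemma grid_leT m i : (i <= m.+1)%N -> grid m i <= T. Proof. by move=> h; rewrite -[leRHS](gridT m) grid_le. Qed.
Lemma gridS m i : grid m i.+1 - grid m i = T / m.+1%:R.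
Proof. by rewrite /grid -mulrBl -mulrBr -natrB// subSnn mulr1. Qed.

Lemma win_grid m (i j : nat) r : win (grid m i) (grid m i.+1) r = 1 -> j != i ->
  win (grid m j) (grid m j.+1) r = 0 :> R.
Proof.
rewrite /win; case: (boolP (_ && _)) => [/andP[ir ri] _|_ /eqP]; last by rewrite eq_sym oner_eq0.
rewrite neq_ltn => /orP[ji|ij].
  by rewrite [_ <= grid m j.+1]leNgt (le_lt_trans (grid_le m ji) ir) andbF.
by rewrite [_ < r]ltNge (le_trans ri (grid_le m ij)).
Qed.

Lemma grid_cell m r : 0 < r <= T -> exists2 i, (i < m.+1)%N & win (grid m i) (grid m i.+1) r = 1 :> R.
Proof.
move=> /andP[r0 rT]; have ex : exists i, r <= grid m i by exists m.+1; rewrite gridT.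
case: (ex_minnP ex) => -[|i] ri imin; first by move: ri; rewrite grid0 leNgt r0.
exists i; first by apply: imin; rewrite gridT.
rewrite /win ri andbT; case: ltP => // h; by have := imin _ h; rewrite ltnn.
Qed.

Lemma sum_win_grid m r (g : nat -> R) :
  (0 < r <= T /\ exists2 i, (i < m.+1)%N & [/\ r <= grid m i.+1, grid m i.+1 - r <= T / m.+1%:R &
     \sum_(j < m.+1) win (grid m j) (grid m j.+1) r * g j = g i]) \/
  (~ 0 < r <= T /\ \sum_(j < m.+1) win (grid m j) (grid m j.+1) r * g j = 0).
Proof.
have [h|h] := boolP (0 < r <= T); [left|right]; split => //; last first.
  apply: big1 => j _; rewrite /win; case: (boolP (_ && _)) => [/andP[a b]|]; last by rewrite mul0r.
  by case/negP: h; rewrite (le_lt_trans (grid_ge0 m j) a) (le_trans b)// grid_leT.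
have [i im w1] := grid_cell m h; exists i => //.
have [ir ri] : grid m i < r /\ r <= grid m i.+1.
  by move: w1; rewrite /win; case: (boolP (_ && _)) => [/andP[]//|_ /eqP]; rewrite eq_sym oner_eq0.
split => //; first by rewrite -(gridS m i) lerD2l lerN2 ltW.
rewrite (bigD1 (Ordinal im))//= w1 mul1r big1 ?addr0// => j ji.
by rewrite (win_grid w1) ?mul0r.
Qed.

Lemma mesh_cvg0 : T / m.+1%:R @[m --> \oo] --> 0.
Proof.
rewrite -[X in _ --> X](mulr0 T); apply: cvgM; first exact: cvg_cst.
exact: cvg_harmonic.
Qed.

(** The sequence may touch [t], which the punctured right neighbourhood excludes; at [t = T] it is
    constant. *)
Lemma right_cvg_seq (h : R -> R) (t : R) (u : nat -> R) : (t < T -> h s @[s --> t^'+] --> h t) ->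
  (forall k, t <= u k <= T) -> u k @[k --> \oo] --> t -> h (u k) @[k --> \oo] --> h t.
Proof.
move=> ht ut uc; apply/cvgrPdist_le => e e0.
have [tT|] := ltP t T; last first.
  move=> Tt; apply: nearW => k; rewrite (_ : u k = t) ?subrr ?normr0 ?(ltW e0)//.
  by have /andP[a b] := ut k; apply/eqP; rewrite eq_le a (le_trans b Tt).
have /cvgrPdist_le /(_ e e0) := ht tT; rewrite near_withinE => -[del/= del0 hd].
have /cvgrPdist_lt /(_ del del0) := uc; apply: filterS => k hk.
have /andP[a _] := ut k; move: a; rewrite le_eqVlt => /orP[/eqP <-|a]; first by rewrite subrr normr0 ltW.
by apply: hd.
Qed.

End grid.

Section semimartingales.
Context {R : realType} {d : measure_display} {Omega : measurableType d}.
Context (P : probability Omega R) (T : R) (F : R -> set (set Omega)) (hT : 0 < T).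
Context {n kappa : nat} (B : R -> Omega -> 'cV[R]_n).
Context (lam : {sigma_finite_measure set 'cV[R]_kappa -> \bar R}).
Context (N : Omega -> {measure set (R * 'cV[R]_kappa)%type -> \bar R}).
Hypothesis hn : noise_setting P T F B lam N.
Local Notation tw := (measurableTypeR R * Omega)%type.
Local Notation stint := (stint P T F B lam N).
Local Notation grid := (grid T).

(** Scalar form of [S2] in which the supremum over all times is replaced by an integrable variable
    that dominates almost every path. *)
Record cadlag_S2 (x : R -> Omega -> R) : Prop := {
  cs_adapted : forall t, 0 <= t <= T -> meas_wrt (F t) (x t);
  cs_right : forall w t, 0 <= t -> t < T -> x s w @[s --> t^'+] --> x t w;
  cs_left : forall w t, 0 < t -> t <= T -> cvg (x s w @[s --> t^'-]);
  cs_max : exists2 G : Omega -> R, intg P G & {ae P, forall w, forall t, 0 <= t <= T -> x t w ^+ 2 <= G w} }.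

Let cell (m i : nat) (z : tw) := win (grid m i) (grid m i.+1) z.1.

(** Sampling at the right end of each cell converges by right-continuity. The samples anticipate,
    which is harmless because they are paired with drifts only. *)
Definition gridval (x : R -> Omega -> R) (m : nat) (z : tw) : R :=
  \sum_(i < m.+1) cell m i z * x (grid m i.+1) z.2.

Lemma grid_right x m z : 0 < z.1 <= T ->
  exists2 s, [/\ z.1 <= s, s <= T & s - z.1 <= T / m.+1%:R] & gridval x m z = x s z.2.
Proof.
move=> h; have [[_ [i im [h1 h2 h3]]]|[h' _]] := sum_win_grid hT m z.1 (fun i => x (grid m i.+1) z.2); last by [].
by exists (grid m i.+1) => //; split => //; exact: grid_leT.
Qed.

Lemma gridval0 x m z : ~ 0 < z.1 <= T -> gridval x m z = 0.
Proof.
move=> h; have [[h' _]|[_ E]] := sum_win_grid hT m z.1 (fun i => x (grid m i.+1) z.2); by [].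
Qed.

Lemma gridval_seq_cvg (x : R -> Omega -> R) (z : tw) (t := z.1 : R) :
  (forall u : nat -> R, (forall k, t <= u k <= T) -> u k @[k --> \oo] --> t -> x (u k) z.2 @[k --> \oo] --> x t z.2) ->
  gridval x m z @[m --> \oo] --> win 0 T z.1 * x z.1 z.2.
Proof.
move=> hx; have [h|h] := boolP (0 < z.1 <= T); last first.
  rewrite /win (negbTE h) mul0r (_ : (fun m => _) = fun=> 0); first exact: cvg_cst.
  by apply/funext => m; rewrite gridval0//; exact/negP.
rewrite /win h mul1r.
have /choice[u hu] m : exists s, [/\ z.1 <= s, s <= T & s - z.1 <= T / m.+1%:R] /\ gridval x m z = x s z.2.
  by have [s h1 h2] := grid_right x m h; exists s.
rewrite (_ : (fun m => _) = fun m => x (u m) z.2); last by apply/funext => m; exact: (hu m).2.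
apply: hx => [k|]; first by have [[-> -> _] _] := hu k.
apply: (@squeeze_cvgr _ _ _ _ (fun=> z.1) (fun k => z.1 + T / k.+1%:R)).
- by apply: nearW => k; have [[-> _ h3] _] := hu k; rewrite addrC -lerBlDr.
- exact: cvg_cst.
- by rewrite -[X in _ --> X]addr0; apply: cvgD; [exact: cvg_cst|exact: mesh_cvg0].
Qed.

Section path.
Variables (x : R -> Omega -> R) (hx : cadlag_S2 x).

Let gridval_win m z : gridval x m z = win 0 T z.1 * gridval x m z.
Proof.
have [h|h] := boolP (0 < z.1 <= T); first by rewrite /win h mul1r.
by rewrite gridval0 ?mulr0//; exact/negP.
Qed.

Lemma cs_meas t : 0 <= t <= T -> measurable_fun setT (x t).
Proof. by move=> t0T; apply: (meas_F_measurable hn t0T); exact: cs_adapted. Qed.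

Lemma gridval_meas m : measurable_fun setT (gridval x m).
Proof.
apply: measurable_sum => i; apply: measurable_funM; first exact: measurable_win.
apply: (measurableT_comp _ measurable_snd); apply: cs_meas; by rewrite grid_ge0// grid_leT.
Qed.

Lemma gridval_cvg z : gridval x m z @[m --> \oo] --> win 0 T z.1 * x z.1 z.2.
Proof.
have [h|h] := boolP (0 < z.1 <= T).
  apply: gridval_seq_cvg => u hu cu; apply: (@right_cvg_seq _ T (x ^~ z.2) z.1) => //.
  by move=> zT; apply: cs_right => //; have /andP[/ltW] := h.
rewrite /win (negbTE h) mul0r (_ : (fun m => _) = fun=> 0); first exact: cvg_cst.
by apply/funext => m; rewrite gridval0//; exact/negP.
Qed.

Lemma cs_jointly_measurable : measurable_fun setT (fun z : tw => win 0 T z.1 * x z.1 z.2).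
Proof.
apply: (measurable_fun_cvg (h := fun m z => gridval x m z)) => [m|z _]; first exact: gridval_meas.
exact: gridval_cvg.
Qed.

Lemma cs_L2 t : 0 <= t <= T -> L2f P (x t).
Proof.
move=> t0T; have [G IG hG] := cs_max hx; split; first exact: cs_meas.
apply/integrableP; split; first by apply/measurable_EFinP; apply: measurable_funX; exact: cs_meas.
apply: (@le_lt_trans _ _ (\int[P]_w (`|G w|)%:E)%E); last by have /integrableP[] := IG.
apply: ae_ge0_le_integral => //.
- by apply/measurable_EFinP; apply: measurableT_comp => //; apply: measurable_funX; exact: cs_meas.
- by apply/measurable_EFinP; apply: measurableT_comp => //; exact: intg_meas IG.
- move: hG; apply: filterS => w h _; rewrite lee_fin ger0_norm ?sqr_ge0//.
  by apply: le_trans (h t t0T) _; exact: ler_norm.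
Qed.

Lemma cs_max_prod : exists2 H : tw -> R, L2f (dtP P) H &
  {ae dtP P, forall z : tw, (forall m, `|gridval x m z| <= `|H z|) /\ `|win 0 T z.1 * x z.1 z.2| <= `|H z|}.
Proof.
have [G IG hG] := cs_max hx.
exists (fun z => win 0 T z.1 * Num.sqrt `|G z.2|).
  suff LG : L2f P (fun w => Num.sqrt `|G w|) by exact: (win_prod_L2 0 T LG).
  split.
    apply: (measurableT_comp (continuous_measurable_fun _)); first exact: sqrt_continuous.
    by apply: measurableT_comp => //; exact: intg_meas IG.
  by have := intg_norm IG; apply: eq_intg => w; rewrite sqr_sqrtr.
have [A [mA A0 hA]] := hG.
exists (setT `*` A); split.
- exact: measurableX.
- apply: etrans (product_measure1E lebesgue_measure P measurableT mA) _.
  exact: etrans (congr1 (fun a => _ * a)%E A0) (mule0 _).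
move=> z /= hz; split => //; apply: contra_notP hz => hz.
have {}hz t : 0 <= t <= T -> `|x t z.2| <= Num.sqrt `|G z.2|.
  move=> t0T; rewrite -sqrtr_sqr ler_wsqrtr//; apply: le_trans (ler_norm _).
  by apply: contrapT => h; apply: hz; apply: hA => h'; apply: h; exact: h'.
have e t : 0 <= t <= T -> `|win 0 T z.1 * x t z.2| <= `|win 0 T z.1 * Num.sqrt `|G z.2| |.
  by move=> t0T; rewrite !normrM ler_wpM2l// (le_trans (hz t t0T))// ler_norm.
have [h|h] := boolP (0 < z.1 <= T); last first.
  by split=> [m|]; [rewrite gridval0 ?normr0//; exact/negP|rewrite /win (negbTE h) mul0r normr0].
have /andP[z0 zT] := h; split; last by apply: e; rewrite ltW.
move=> m; rewrite gridval_win; have [s [h1 h2 h3] ->] := grid_right x m h.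
by apply: e; rewrite h2 (le_trans (ltW z0) h1).
Qed.

Lemma cs_L2_prod : L2f (dtP P) (fun z => win 0 T z.1 * x z.1 z.2).
Proof.
have [H LH hH] := cs_max_prod; split; first exact: cs_jointly_measurable.
apply/integrableP; split; first by apply/measurable_EFinP; apply: measurable_funX; exact: cs_jointly_measurable.
apply: (@le_lt_trans _ _ (\int[dtP P]_z (`|H z ^+ 2|)%:E)%E); last by have /integrableP[] := LH.2.
apply: ae_ge0_le_integral => //.
- apply/measurable_EFinP; apply: measurableT_comp => //; apply: measurable_funX; exact: cs_jointly_measurable.
- apply/measurable_EFinP; apply: measurableT_comp => //; exact: intg_meas LH.2.
- move: hH; apply: filterS => z [_ h] _; rewrite lee_fin !normrX.
  by apply: lerXn2r => //; rewrite nnegrE.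
Qed.

Lemma gridval_cvg_prod (f : tw -> R) : L2f (dtP P) f ->
  \int[dtP P]_z (gridval x m z * f z) @[m --> \oo] --> \int[dtP P]_z (win 0 T z.1 * x z.1 z.2 * f z).
Proof.
move=> Lf; have [H LH hH] := cs_max_prod.
have IH : intg (dtP P) (fun z => `|H z * f z|) by apply: intg_norm; exact: L2f_mul.
apply: (Rint_dct _ _ _ IH _).2.
- by move=> m; apply: measurable_funM; [exact: gridval_meas|exact: Lf.1].
- by apply: measurable_funM; [exact: cs_jointly_measurable|exact: Lf.1].
- by apply: aeW => z; apply: cvgM; [exact: gridval_cvg|exact: cvg_cst].
- by move: hH; apply: filterS => z [h _] m; rewrite !normrM ler_wpM2r.
Qed.

End path.

(* x is an Ito process with drift f and integrands Q (Brownian) and K (jumps) *)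
Record ito_process (x : R -> Omega -> R) (f : tw -> R) (Q : 'I_n -> tw -> R)
    (K : tw * 'cV[R]_kappa -> R) : Prop := {
  ip_cadlag : cadlag_S2 x;
  ip_drift : L2f (dtP P) f;
  ip_B : forall j, L2f (dtP P) (Q j);
  ip_N : L2f (dtPl P lam) K;
  ip_incr : forall s t, 0 <= s -> s <= t -> t <= T -> exists2 M,
    stint (fun j z => win s t z.1 * Q j z) (fun z => win s t z.1.1 * K z) M &
    {ae P, forall w, x t w - x s w = tint (fun z => win s t z.1 * f z) w + M w} }.

Section product_rule.
Variables (x y : R -> Omega -> R) (f g : tw -> R) (Q Q' : 'I_n -> tw -> R) (K K' : tw * 'cV[R]_kappa -> R).
Hypotheses (hx : ito_process x f Q K) (hy : ito_process y g Q' K').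

(** With increments [A + M] of [x] and [A' + W] of [y], the increment of the product is [x_t A' +
    y_t A - A A' + M W + x_s W + y_s M]. Taking [x] and [y] at the right end in the drift terms
    absorbs the mixed products [A W] and [M A']; the last two terms have mean zero, [M W] is given
    by the isometry, and [A A'] is the error. *)
Let cell_step s t : 0 <= s -> s <= t -> t <= T ->
  `|\int[P]_w (x t w * y t w) - \int[P]_w (x s w * y s w)
    - (\int[dtP P]_z (win s t z.1 * x t z.2 * g z) + \int[dtP P]_z (win s t z.1 * y t z.2 * f z)
       + (\sum_j \int[dtP P]_z (win s t z.1 * Q j z * (win s t z.1 * Q' j z))
          + \int[dtPl P lam]_z (win s t z.1.1 * K z * (win s t z.1.1 * K' z))))|
  <= (t - s) / 2 * (n2 (dtP P) (fun z => win s t z.1 * f z) + n2 (dtP P) (fun z => win s t z.1 * g z)).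
Proof.
move=> s0 st tT.
have s0T : 0 <= s <= T by rewrite s0 (le_trans st).
have t0T : 0 <= t <= T by rewrite tT (le_trans s0).
have [M sM xM] := ip_incr hx s0 st tT; have [W sW yW] := ip_incr hy s0 st tT.
set A := tint (fun z => win s t z.1 * f z) in xM; set A' := tint (fun z => win s t z.1 * g z) in yW.
have [LA nA] := tint_L2 st (ip_drift hx); have [LA' nA'] := tint_L2 st (ip_drift hy).
have Lxt := cs_L2 (ip_cadlag hx) t0T; have Lxs := cs_L2 (ip_cadlag hx) s0T.
have Lyt := cs_L2 (ip_cadlag hy) t0T; have Lys := cs_L2 (ip_cadlag hy) s0T.
have LM : L2f P M by case: sM. have LW : L2f P W by case: sW.
have [_ E1] := tint_mul s t (ip_drift hy) Lxt; have [_ E2] := tint_mul s t (ip_drift hx) Lyt.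
rewrite -E1 -E2 -(stint_isometry hn sM sW).
have past (h : R -> R -> R) a r : r <= s -> win s t r * a = 0 :> R by move=> rs; rewrite /win ltNge rs mul0r.
have z1 : \int[P]_w (x s w * W w) = 0.
  apply: (stint_past_orthogonal hn s0 _ _ Lxs sW) => [||j z|z]; first by have /andP[] := s0T.
  - exact: cs_adapted (ip_cadlag hx) _ s0T.
  - exact: (past (fun=> id)).
  - exact: (past (fun=> id)).
have z2 : \int[P]_w (y s w * M w) = 0.
  apply: (stint_past_orthogonal hn s0 _ _ Lys sM) => [||j z|z]; first by have /andP[] := s0T.
  - exact: cs_adapted (ip_cadlag hy) _ s0T.
  - exact: (past (fun=> id)).
  - exact: (past (fun=> id)).
have i1 := L2f_mul Lxt LA'; have i2 := L2f_mul Lyt LA; have i3 := L2f_mul LM LW.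
have i4 := L2f_mul LA LA'; have i5 := L2f_mul Lxs LW; have i6 := L2f_mul Lys LM.
have i7 := L2f_mul Lxt Lyt; have i8 := L2f_mul Lxs Lys.
have E : \int[P]_w (x t w * y t w) - \int[P]_w (x s w * y s w) =
  \int[P]_w (x t w * A' w + y t w * A w - A w * A' w + M w * W w + x s w * W w + y s w * M w).
  rewrite -RintB//; apply: Rint_ae_eq.
  - exact: intg_meas (intgB i7 i8).
  - exact: intg_meas (intgD (intgD (intgD (intgB (intgD i1 i2) i4) i3) i5) i6).
  - move: xM yW; apply: filterS2 => w e1 e2.
    have -> : x t w = x s w + A w + M w by move/eqP: e1; rewrite subr_eq => /eqP ->; ring.
    have -> : y t w = y s w + A' w + W w by move/eqP: e2; rewrite subr_eq => /eqP ->; ring.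
    by ring.
rewrite E RintD//; last exact: intgD (intgD (intgB (intgD i1 i2) i4) i3) i5.
rewrite RintD//; last exact: intgD (intgB (intgD i1 i2) i4) i3.
rewrite RintD//; last exact: intgB (intgD i1 i2) i4.
rewrite RintB//; last exact: intgD i1 i2.
rewrite RintD// z1 z2.
have -> (a b c e : R) : a + b - c + e + 0 + 0 - (a + b + e) = - c by ring.
rewrite normrN.
apply: le_trans (le_norm_Rint i4) _.
apply: (@le_trans _ _ (2^-1 * (n2 P A + n2 P A'))).
  rewrite -RintD; [|exact: LA.2|exact: LA'.2].
  rewrite -RintZ; last by apply: intgD; [exact: LA.2|exact: LA'.2].
  apply: Rint_le; [exact: intg_norm|apply: intgZ; apply: intgD; [exact: LA.2|exact: LA'.2]|].
  move=> w; rewrite ler_pdivlMl// normrM -(real_normK (num_real (A w))) -(real_normK (num_real (A' w))).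
  by rewrite -subr_ge0 (_ : _ - _ = (`|A w| - `|A' w|) ^+ 2) ?sqr_ge0//; ring.
rewrite mulrAC mulrC ler_pM2r ?invr_gt0// mulrDr; exact: lerD.
Qed.

Let sum_win_itv m z : \sum_(i < m.+1) cell m i z = win 0 T z.1.
Proof.
have := @gridval0 (fun _ _ => 1) m z; have := @grid_right (fun _ _ => 1) m z.
have -> : \sum_(i < m.+1) cell m i z = gridval (fun _ _ => 1) m z by apply: eq_bigr => i _; rewrite mulr1.
rewrite /win; case: (boolP (_ && _)) => [h /(_ isT) [s _ ->]//|h _ ->//]; exact/negP.
Qed.

Let sum_n2 m (h : tw -> R) : L2f (dtP P) h ->
  \sum_(i < m.+1) n2 (dtP P) (fun z => cell m i z * h z) <= n2 (dtP P) h.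
Proof.
move=> Lh; rewrite /n2 -Rint_sum; last by move=> i; exact: (win_mul_L2 _ _ Lh).2.
apply: Rint_le; [by apply: intg_sum => i; exact: (win_mul_L2 _ _ Lh).2|exact: Lh.2|].
move=> z; under eq_bigr do rewrite exprMn expr2 /cell winM.
rewrite -mulr_suml sum_win_itv -[leRHS]mul1r ler_wpM2r ?sqr_ge0// /win.
by case: (_ && _); rewrite ?ler01.
Qed.

Let sum_Rint_cell m d' (S : measurableType d') (mu : {measure set S -> \bar R}) (p : S -> tw) (a b : S -> R) :
  (forall i : 'I_m.+1, intg mu (fun z => cell m i (p z) * a z * b z)) ->
  \sum_(i < m.+1) \int[mu]_z (cell m i (p z) * a z * b z) = \int[mu]_z (win 0 T (p z).1 * a z * b z).
Proof.
move=> h; rewrite -Rint_sum//; apply: eq_Rintegral => z _.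
by under eq_bigr do rewrite -mulrA; rewrite -mulr_suml sum_win_itv mulrA.
Qed.

(** Summed over a grid, the cell errors amount to half the mesh times a fixed energy, while the
    sampled drift terms converge by domination. Working in expectation, with one isometry per cell,
    replaces the quadratic covariation process. *)
Theorem product_rule :
  \int[P]_w (x T w * y T w) - \int[P]_w (x 0 w * y 0 w) =
  \int[dtP P]_z (win 0 T z.1 * x z.1 z.2 * g z) + \int[dtP P]_z (win 0 T z.1 * y z.1 z.2 * f z)
   + (\sum_j \int[dtP P]_z (win 0 T z.1 * Q j z * Q' j z) + \int[dtPl P lam]_z (win 0 T z.1.1 * K z * K' z)).
Proof.
set lhs := LHS; set S2 := (\sum_j _ + _).
pose rhs m := \int[dtP P]_z (gridval x m z * g z) + \int[dtP P]_z (gridval y m z * f z) + S2.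
have bound m : `|lhs - rhs m| <= T / m.+1%:R / 2 * (n2 (dtP P) f + n2 (dtP P) g).
  pose lh (i : nat) := \int[P]_w (x (grid m i) w * y (grid m i) w).
  have -> : lhs = \sum_(i < m.+1) (lh i.+1 - lh i).
    rewrite -(big_mkord xpredT (fun i => lh i.+1 - lh i)) telescope_sumr// /lh gridT grid0.
    by [].
  have gi (i : 'I_m.+1) : [/\ 0 <= grid m i, grid m i <= grid m i.+1 & grid m i.+1 <= T].
    by split; [exact: grid_ge0|exact: grid_le|exact: grid_leT].
  have -> : rhs m = \sum_(i < m.+1)
     (\int[dtP P]_z (cell m i z * x (grid m i.+1) z.2 * g z) + \int[dtP P]_z (cell m i z * y (grid m i.+1) z.2 * f z)
       + (\sum_j \int[dtP P]_z (cell m i z * Q j z * (cell m i z * Q' j z))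
          + \int[dtPl P lam]_z (cell m i z.1 * K z * (cell m i z.1 * K' z)))).
    rewrite !big_split/= /rhs; congr (_ + _ + (_ + _)).
    - rewrite -Rint_sum; first by apply: eq_Rintegral => z _; rewrite mulr_suml.
      move=> i; have [a b c] := gi i; apply: (tint_mul _ _ (ip_drift hy) _).1.
      by apply: cs_L2 (ip_cadlag hx) _ _; rewrite c (le_trans a b).
    - rewrite -Rint_sum; first by apply: eq_Rintegral => z _; rewrite mulr_suml.
      move=> i; have [a b c] := gi i; apply: (tint_mul _ _ (ip_drift hx) _).1.
      by apply: cs_L2 (ip_cadlag hy) _ _; rewrite c (le_trans a b).
    - rewrite exchange_big/=; apply: eq_bigr => j _.
      rewrite -(@sum_Rint_cell m _ _ (dtP P) id).
        by apply: eq_bigr => i _; apply: eq_Rintegral => z _; rewrite /cell [RHS]mulrACA winM mulrA.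
      by move=> i; apply: L2f_mul (ip_B hy j); apply: win_mul_L2; exact: (ip_B hx j).
    - rewrite -(@sum_Rint_cell m _ _ (dtPl P lam) fst).
        by apply: eq_bigr => i _; apply: eq_Rintegral => z _; rewrite /cell [RHS]mulrACA winM mulrA.
      move=> i; apply: L2f_mul (ip_N hy); apply: (L2f_le _ _ (ip_N hx)).
        by apply: measurable_funM; [exact: (measurableT_comp (measurable_win _ _) measurable_fst)|exact: (ip_N hx).1].
      move=> z; rewrite normrM -[leRHS]mul1r ler_wpM2r// /cell /win.
      by case: (_ && _); rewrite ?normr1 ?normr0 ?ler01.
  rewrite -sumrB; apply: le_trans (ler_norm_sum _ _ _) _.
  apply: (@le_trans _ _ (\sum_(i < m.+1) T / m.+1%:R / 2 * (n2 (dtP P) (fun z => cell m i z * f z) + n2 (dtP P) (fun z => cell m i z * g z)))).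
    by apply: ler_sum => i _; have [a b c] := gi i; have := cell_step a b c; rewrite gridS.
  rewrite -mulr_sumr big_split/= ler_wpM2l//.
    by rewrite !divr_ge0// ltW.
  by apply: lerD; apply: sum_n2; [exact: ip_drift hx|exact: ip_drift hy].
have c1 : rhs m @[m --> \oo] --> lhs.
  have h : T / m.+1%:R / 2 * (n2 (dtP P) f + n2 (dtP P) g) @[m --> \oo] --> (0 : R).
    rewrite -[X in _ --> X](mul0r (n2 (dtP P) f + n2 (dtP P) g)); apply: cvgM; last exact: cvg_cst.
    rewrite -[X in _ --> X](mul0r 2^-1); apply: cvgM; [exact: mesh_cvg0|exact: cvg_cst].
  have h' : `|lhs - rhs m| @[m --> \oo] --> (0 : R).
    by apply: (squeeze_cvgr _ (cvg_cst 0) h); apply: nearW => m; rewrite normr_ge0 bound.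
  have h2 := @norm_cvg0 _ _ _ _ _ _ h'.
  rewrite -[X in _ --> X]subr0 (_ : rhs = fun m => lhs - (lhs - rhs m)); last by apply/funext => m; rewrite subKr.
  by apply: cvgB; [exact: cvg_cst|exact: h2].
have c2 : rhs m @[m --> \oo] --> \int[dtP P]_z (win 0 T z.1 * x z.1 z.2 * g z) + \int[dtP P]_z (win 0 T z.1 * y z.1 z.2 * f z) + S2.
  apply: cvgD; last exact: cvg_cst.
  by apply: cvgD; apply: gridval_cvg_prod; [exact: ip_cadlag hx|exact: ip_drift hy|exact: ip_cadlag hy|exact: ip_drift hx].
exact: (cvg_unique (@Rhausdorff R) c1 c2).
Qed.

End product_rule.
End semimartingales.

Lemma sfprod_ae_fst {R : realType} {d1 d2} {T1 : measurableType d1} {T2 : measurableType d2}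
  (m1 : {sigma_finite_measure set T1 -> \bar R}) (m2 : {sigma_finite_measure set T2 -> \bar R}) (p : T1 -> Prop) :
  {ae m1, forall x, p x} -> {ae sfprod m1 m2, forall z : T1 * T2, p z.1}.
Proof.
move=> [A [mA A0 hA]]; exists (A `*` setT); split.
- exact: measurableX.
- apply: etrans (product_measure1E m1 m2 mA measurableT) _.
  exact: etrans (congr1 (fun a => a * _)%E A0) (mul0e _).
by move=> z /= hz; split => //; exact: hA.
Qed.

(** * Left limits of Ito processes *)

Section left_limits.
Context {R : realType} {d : measure_display} {Omega : measurableType d}.
Context (P : probability Omega R) (T : R) (F : R -> set (set Omega)) (hT : 0 < T).
Context {n kappa : nat} (B : R -> Omega -> 'cV[R]_n).
Context (lam : {sigma_finite_measure set 'cV[R]_kappa -> \bar R}).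
Context (N : Omega -> {measure set (R * 'cV[R]_kappa)%type -> \bar R}).
Hypothesis hn : noise_setting P T F B lam N.
Local Notation tw := (measurableTypeR R * Omega)%type.
Local Notation cadlag_S2 := (cadlag_S2 P T F).
Local Notation ito_process := (ito_process P T F B lam N).

(** The offset 2 keeps the point strictly between 0 and [t] even for [m = 0]. *)
Definition leftpt (m : nat) (t : R) : R := t - t / m.+2%:R.

Lemma leftpt_bounds m t : 0 < t -> 0 < leftpt m t < t.
Proof.
move=> t0; rewrite /leftpt subr_gt0 ltrBlDr ltrDl divr_gt0// andbT.
by rewrite ltr_pdivrMr// ltr_pMr// ltr1n.
Qed.

Lemma leftpt_cvg t : leftpt m t @[m --> \oo] --> t.
Proof.
rewrite -[X in _ --> X]subr0; apply: cvgB; first exact: cvg_cst.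
rewrite -[X in _ --> X](mulr0 t); apply: cvgM; first exact: cvg_cst.
have h := @cvg_harmonic R; rewrite -(cvg_shiftn 1) /harmonic in h.
by rewrite (_ : (fun m => _) = (fun m => (m + 1).+1%:R^-1))//; apply/funext => m; rewrite addn1.
Qed.

Lemma cvg_leftpt (U : topologicalType) (h : R -> U) (t : R) (l : U) : 0 < t -> h s @[s --> t^'-] --> l -> h (leftpt m t) @[m --> \oo] --> l.
Proof.
move=> t0 hl; apply: cvg_trans hl => A /= [e /= e0 hA].
have /cvgrPdist_lt /(_ e e0) := @leftpt_cvg t; apply: filterS => m hm.
by apply: hA => //; have /andP[] := leftpt_bounds m t0.
Qed.

Lemma lebesgue_ae_neq (t : R) : {ae (lebesgue_measure : {measure set (measurableTypeR R) -> \bar R}), forall r, r <> t}.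
Proof.
exists [set t]; split; [exact: measurable_set1|exact: lebesgue_measure_set1|].
by move=> r /= h; apply: contrapT => h'; apply: h => E; apply: h'.
Qed.

Section one_process.
Variables (x : R -> Omega -> R) (f : tw -> R) (Q : 'I_n -> tw -> R) (K : tw * 'cV[R]_kappa -> R).
Hypothesis hx : ito_process x f Q K.

Let window_n2_cvg0 d' (S : measurableType d') (mu : {measure set S -> \bar R}) (p : S -> R) (h : S -> R) t :
  0 < t -> measurable_fun setT p -> {ae mu, forall z, p z <> t} -> L2f mu h ->
  n2 mu (fun z => win (leftpt m t) t (p z) * h z) @[m --> \oo] --> 0.
Proof.
move=> t0 mp pt Lh; rewrite -[X in _ --> X](Rint0 mu).
have mw m : measurable_fun setT (fun z => win (leftpt m t) t (p z)).
  rewrite (_ : (fun z => _) = \1_(`](leftpt m t), t]) \o p).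
    by apply: (measurableT_comp _ mp); exact: measurable_indic.
  by apply/funext => r; rewrite /= indicE mem_setE in_itv.
apply: (Rint_dct _ _ _ Lh.2 _).2.
- by move=> m; apply: measurable_funX; apply: measurable_funM => //; exact: Lh.1.
- exact: measurable_cst.
- move: pt; apply: filterS => z ptz.
  have [tp|pt] := ltP t (p z).
    rewrite (_ : (fun m => _) = fun=> 0); first exact: cvg_cst.
    by apply/funext => m; rewrite /win [p z <= t]leNgt tp andbF mul0r expr0n.
  have ltpt : p z < t by rewrite lt_neqAle pt andbT; exact/eqP.
  have e0 : 0 < t - p z by rewrite subr_gt0.
  have /cvgrPdist_lt /(_ _ e0) := @leftpt_cvg t => hh.
  apply/cvgrPdist_lt => e e1; move: hh; apply: filterS => m.
  have /andP[_ l2] := leftpt_bounds m t0.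
  rewrite ger0_norm ?subr_ge0 ?(ltW l2)// ltrBlDr -ltrBlDl subKr => hlt.
  by rewrite /win [_ < p z]ltNge (ltW hlt) mul0r expr0n subrr normr0.
- apply: aeW => z m; rewrite exprMn normrM -[leRHS]mul1r [X in _ * X]ger0_norm ?sqr_ge0//.
  by rewrite ler_wpM2r ?sqr_ge0// /win; case: (_ && _); rewrite ?expr1n ?expr0n ?normr1 ?normr0 ?ler01.
Qed.

(** There is no jump at a fixed time: the increment over []leftpt m t, t]] is bounded in L2 by the
    energy of drift and integrands on windows that shrink to the single time [t], a null set. *)
Lemma left_limit_ae t : 0 < t -> t <= T -> {ae P, forall w, lim (x s w @[s --> t^'-]) = x t w}.
Proof.
move=> t0 tT; have hc := ip_cadlag hx.
have t0T : 0 <= t <= T by rewrite ltW.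
have lt0 m : 0 <= leftpt m t <= T.
  by have /andP[a b] := leftpt_bounds m t0; rewrite (ltW a) (le_trans (ltW b)).
pose J w := x t w - lim (x s w @[s --> t^'-]).
have cJ w : x t w - x (leftpt m t) w @[m --> \oo] --> J w.
  by apply: cvgB; [exact: cvg_cst|apply: (@cvg_leftpt _ (x ^~ w)) => //; exact: (cs_left hc)].
have mJ : measurable_fun setT J.
  apply: (measurable_fun_cvg (h := fun m w => x t w - x (leftpt m t) w)) => [m|w _]; last exact: cJ.
  by apply: measurable_funB; exact: (cs_meas hn hc).
have [G IG hG] := cs_max hc.
have [IJ c1] : intg P (fun w => J w ^+ 2) /\ n2 P (fun w => x t w - x (leftpt m t) w) @[m --> \oo] --> n2 P J.
  apply: (@Rint_dct _ _ _ P (fun m w => (x t w - x (leftpt m t) w) ^+ 2) _ (fun w => 4 * G w)).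
  - by move=> m; apply: measurable_funX; apply: measurable_funB; exact: (cs_meas hn hc).
  - exact: measurable_funX.
  - by apply: aeW => w; rewrite !expr2; apply: cvgM; exact: cJ.
  - exact: intgZ.
  - move: hG; apply: filterS => w h m; rewrite ger0_norm ?sqr_ge0//.
    have := h t t0T; have := h _ (lt0 m); move: (x t w) (x _ w) (G w) => a b c h1 h2.
    by have := sqr_ge0 (a + b); nra.
have c2 : n2 P (fun w => x t w - x (leftpt m t) w) @[m --> \oo] --> 0.
  have bound m : n2 P (fun w => x t w - x (leftpt m t) w) <= 2 * ((t - leftpt m t) * n2 (dtP P) f) +
     2 * (\sum_j n2 (dtP P) (fun z => win (leftpt m t) t z.1 * Q j z) + n2 (dtPl P lam) (fun z => win (leftpt m t) t z.1.1 * K z)).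
    have /andP[a b] := leftpt_bounds m t0.
    have [M sM xM] := ip_incr hx (ltW a) (ltW b) tT.
    have [LA nA] := tint_L2 (ltW b) (ip_drift hx).
    have LM : L2f P M by case: sM.
    have -> : n2 P (fun w => x t w - x (leftpt m t) w) = n2 P (fun w => tint (fun z => win (leftpt m t) t z.1 * f z) w + M w).
      apply: Rint_ae_eq.
      - by apply: measurable_funX; apply: measurable_funB; exact: (cs_meas hn hc).
      - by apply: measurable_funX; apply: measurable_funD; [exact: LA.1|exact: LM.1].
      - by move: xM; apply: filterS => w ->.
    apply: le_trans (n2D LA LM) _; apply: lerD; rewrite ler_pM2l//.
      apply: le_trans nA _; rewrite ler_wpM2l ?subr_ge0 ?(ltW b)//.
      apply: n2_le; [exact: win_mul_L2 (ip_drift hx)|exact: ip_drift hx|].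
      move=> z; rewrite normrM -[leRHS]mul1r ler_wpM2r// /win.
      by case: (_ && _); rewrite ?normr1 ?normr0 ?ler01.
    rewrite [n2 P M](_ : _ = \int[P]_w (M w * M w)); last by apply: eq_Rintegral => w _; rewrite expr2.
    rewrite (stint_isometry hn sM sM) le_eqVlt; apply/orP; left; apply/eqP; congr (_ + _).
  have cb : 2 * ((t - leftpt m t) * n2 (dtP P) f) +
     2 * (\sum_j n2 (dtP P) (fun z => win (leftpt m t) t z.1 * Q j z) + n2 (dtPl P lam) (fun z => win (leftpt m t) t z.1.1 * K z)) @[m --> \oo] --> (2 * ((t - t) * n2 (dtP P) f) + 2 * (\sum_(j < n) 0 + 0) : R).
    apply: cvgD; (apply: cvgM; first exact: cvg_cst).
      apply: cvgM; last exact: cvg_cst.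
      by apply: cvgB; [exact: cvg_cst|exact: leftpt_cvg].
    apply: cvgD.
      apply: cvg_sumR => j; apply: window_n2_cvg0 => //; last exact: (ip_B hx j).
      exact: (@sfprod_ae_fst _ _ _ _ _ lebesgue_measure P (fun r => r <> t) (lebesgue_ae_neq t)).
    apply: (@window_n2_cvg0 _ _ (dtPl P lam) (fun z => z.1.1)) => //; last exact: (ip_N hx).
      exact: (measurableT_comp measurable_fst measurable_fst).
    exact: (@sfprod_ae_fst _ _ _ _ _ (dtP P) lam (fun z => z.1 <> t) (@sfprod_ae_fst _ _ _ _ _ lebesgue_measure P (fun r => r <> t) (lebesgue_ae_neq t))).
  rewrite subrr mul0r mulr0 big1// addr0 mulr0 addr0 in cb.
  by apply: (squeeze_cvgr _ (cvg_cst 0) cb); apply: nearW => m; rewrite n2_ge0 bound.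
have J0 : n2 P J = 0 by exact: (cvg_unique (@Rhausdorff R) c1 c2).
have := n2_eq0 (conj mJ IJ) J0; apply: filterS => w /eqP; rewrite /J subr_eq0 => /eqP ->.
by [].
Qed.

Lemma left_limit_meas : measurable_fun setT (fun z : tw => win 0 T z.1 * lim (x s z.2 @[s --> z.1^'-])).
Proof.
have hc := ip_cadlag hx.
apply: (measurable_fun_cvg (h := fun m z => win 0 T z.1 * (win 0 T (leftpt m z.1) * x (leftpt m z.1) z.2))) => [m|z _].
  apply: measurable_funM; first exact: measurable_win.
  have mm : measurable_fun setT (fun z : tw => (leftpt m z.1, z.2) : tw).
    apply: measurable_fun_pair; last exact: measurable_snd.
    apply: (@measurableT_comp _ _ _ _ _ _ (leftpt m : measurableTypeR R -> measurableTypeR R) _ fst) => //.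
    by apply: measurable_funB => //; exact: measurable_funM.
  exact: (measurableT_comp (cs_jointly_measurable hT hn hc) mm).
have [h|h] := boolP (0 < z.1 <= T); last first.
  rewrite /win (negbTE h) mul0r (_ : (fun m => _) = fun=> 0); first exact: cvg_cst.
  by apply/funext => m; rewrite mul0r.
have /andP[z0 zT] := h.
apply: cvgM; first exact: cvg_cst.
rewrite (_ : (fun m => _) = fun m => x (leftpt m z.1) z.2); last first.
  apply/funext => m; have /andP[a b] := leftpt_bounds m z0.
  by rewrite /win a (le_trans (ltW b) zT) mul1r.
by apply: (@cvg_leftpt _ (x ^~ z.2)) => //; exact: (cs_left hc).
Qed.

(** Tonelli turns the statement at each fixed time into one for almost every pair of time and path;
    this is where joint measurability of the left limits is used. *)
Lemma left_limit_ae_prod : {ae dtP P, forall z : tw, 0 < z.1 <= T -> lim (x s z.2 @[s --> z.1^'-]) = x z.1 z.2}.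
Proof.
pose D (z : tw) : R := `|win 0 T z.1 * lim (x s z.2 @[s --> z.1^'-]) - win 0 T z.1 * x z.1 z.2|.
have mD : measurable_fun setT D.
  apply: measurableT_comp => //; apply: measurable_funB; first exact: left_limit_meas.
  exact: (cs_jointly_measurable hT hn (ip_cadlag hx)).
have D0 : (\int[dtP P]_z `|(D z)%:E| = 0)%E.
  rewrite (_ : (\int[dtP P]_z `|(D z)%:E| = \int[dtP P]_z (D z)%:E)%E); last first.
    by apply: eq_integral => z _; rewrite gee0_abs// lee_fin normr_ge0.
  apply: etrans (@fubini_tonelli1 _ _ _ _ R lebesgue_measure P (fun z : tw => (D z)%:E) _ _) _.
  - exact/measurable_EFinP.
  - by move=> z; rewrite lee_fin normr_ge0.
  apply: integral0_eq => r _; have [h|h] := boolP (0 < r <= T); last first.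
    by apply: integral0_eq => w _; rewrite /D /= /win (negbTE h) !mul0r subrr normr0.
  have /andP[r0 rT] := h; rewrite -[RHS](integral0 P setT); apply: ae_eq_integral => //.
  - by apply/measurable_EFinP; exact: (measurableT_comp mD (measurable_pair1 r)).
  - by move: (left_limit_ae r0 rT); apply: filterS => w e _; rewrite /D /= e subrr normr0.
have := (ae_eq_integral_abs (dtP P) measurableT ((measurable_EFinP _ _).2 mD)).1 D0.
apply: filterS => z /(_ I) [] /eqP; rewrite normr_eq0 subr_eq0 /win => /eqP + h.
by rewrite h !mul1r.
Qed.

End one_process.
End left_limits.

(** * Expansion of the controlled coefficients *)

(** The difference quotients coincide, so the equality also covers the default value of a derivative
    that does not exist. *)
Lemma derive_eq_incr {R : realType} n k (h : 'cV[R]_n -> R) (h' : 'cV[R]_k -> R) x e x' e' :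
  (forall t, h (t *: e + x) - h x = h' (t *: e' + x') - h' x') -> 'D_e h x = 'D_e' h' x'.
Proof.
move=> E; rewrite /derive.
have -> : (fun t => t^-1 *: ((h \o shift x) (t *: e) - h x)) = (fun t => t^-1 *: ((h' \o shift x') (t *: e') - h' x')).
  by apply/funext => t /=; rewrite E.
by [].
Qed.

Section blocks.
Context {R : realType} {I : nat} (p_ : 'I_I -> nat).
Local Notation V := 'cV[R]_(\sum_j p_ j).

Lemma dot_blocks (x y : V) : dot x y = \sum_i dot (submxcol x i) (submxcol y i).
Proof.
rewrite {1}/dot -{1}(submxcolK x) -{1}(submxcolK y) tr_mxcol mul_mxrow_mxcol summxE.
by apply: eq_bigr => i _.
Qed.

Lemma sqn_blocks (x : V) : sqn x = \sum_i sqn (submxcol x i).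
Proof. by rewrite -dotxx dot_blocks; apply: eq_bigr => i _; rewrite dotxx. Qed.

(** A coordinate of block [i] perturbs the [i]-th summand only; the others and [c] cancel in the
    difference quotient. *)
Lemma grad_blocks (phi : forall i, 'cV[R]_(p_ i) -> R) c (v : V) i :
  submxcol (grad (fun v => \sum_i phi i (submxcol v i) + c) v) i = grad (phi i) (submxcol v i).
Proof.
have Rinj : injective (@tagnat.Rank _ p_ i) by move=> a b /tagnat.rank_inj /eqP; rewrite eq_Tagged => /eqP.
apply/matrixP => k b; rewrite ord1 !mxE; apply: derive_eq_incr => h.
transitivity (\sum_j (phi j (submxcol (h *: delta_mx (tagnat.Rank i k) 0 + v) j) - phi j (submxcol v j))).
  by rewrite [RHS]sumrB opprD addrACA subrr addr0.
rewrite [LHS](bigD1 i)//= [X in _ + X = _]big1 ?addr0.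
  congr (phi i _ - _); rewrite submxcolD; congr (_ + _).
  apply/matrixP => a b'; rewrite ord1 !mxE eqxx !andbT; congr (_ * (_ : bool)%:R).
  exact: (inj_eq Rinj).
move=> j ji; rewrite (_ : submxcol _ j = submxcol v j) ?subrr//.
apply/matrixP => a b'; rewrite ord1 !mxE eqxx andbT (_ : _ == _ = false) ?mulr0 ?add0r//.
apply/eqP => E; move/eqP: ji; apply.
by rewrite -(tagnat.Rank1K a) E tagnat.Rank1K.
Qed.

End blocks.

Section derivative_shift.
Context {R : realType}.

Lemma jac_addc n k (h h' : 'cV[R]_n -> 'cV[R]_k) c x : (forall z, h z = h' z + c) -> jac h x = jac h' x.
Proof.
move=> E; apply/matrixP => i j; rewrite !mxE; apply: derive_eq_incr => t.
by rewrite !E !mxE opprD addrACA subrr addr0.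
Qed.

Lemma jac_mulmx n k (A : 'M[R]_(k, n)) (x : 'cV[R]_n) (c : 'cV[R]_k) : jac (fun z => c + A *m z) x = A.
Proof.
apply/matrixP => i j.
have [_ h2] := grad_affine (c i 0) (row i A)^T x.
transitivity ((row i A)^T j 0); last by rewrite !mxE.
rewrite -h2 /jac /grad [LHS]mxE [RHS]mxE; apply: derive_eq_incr => t.
have E z : (c + A *m z) i 0 = c i 0 + dot (row i A)^T z.
  by rewrite /dot trmxK -row_mul [LHS]mxE; congr (_ + _); rewrite [RHS]mxE.
by rewrite !E.
Qed.

End derivative_shift.

Section lfd_algebra.
Context {R : realType} {n : nat}.
Local Notation X := 'cV[R]_n.

Lemma is_lfd_dot l (k : P2 R n -> 'cV[R]_l) (dk : P2 R n -> X -> 'cV[R]_l) (p : 'cV[R]_l) :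
  is_lfdv k dk -> (forall (mu m : P2 R n) i, intg mu (fun y => dk m y i 0)) ->
  is_lfd (fun m => dot (k m) p) (fun m y => dot (dk m y) p).
Proof.
move=> h Idk; split.
- move=> xs ms x m _ _ hx hm; rewrite dotE.
  rewrite (_ : (fun k => _) = fun k => \sum_i dk (ms k) (xs k) i 0 * p i 0); last by apply/funext => k'; rewrite dotE.
  apply: cvg_sumR => i; apply: cvgM; last exact: cvg_cst.
  by case: (h i) => c _ _; exact: (c _ _ _ _ (fun=> I) I hx hm).
- have /choice[c hc] i : exists c, bounded_on_bounded c /\ forall m : P2 R n, (\int[m]_y ((dk m y i 0) ^+ 2)%:E <= (c m)%:E)%E.
    by case: (h i) => _ [c c1 c2] _; exists c.
  exists (fun m => sqn p * \sum_i c i m).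
    move=> Kb; have /choice[C hC] i : exists C, forall m, mom2 m <= Kb -> c i m <= C by exact: (hc i).1.
    exists (sqn p * \sum_i C i) => m hm; rewrite ler_wpM2l ?sqn_ge0//.
    by apply: ler_sum => i _; exact: hC.
  move=> m; have mdk i : measurable_fun setT (fun y => dk m y i 0) by exact: lfd_measurable (h i) m.
  apply: (@le_trans _ _ (\int[m]_y ((sqn p)%:E * \sum_(i < l) ((dk m y i 0) ^+ 2)%:E))%E).
    apply: ge0_integral_mono => [y _|y _]; first by rewrite lee_fin sqr_ge0.
    by rewrite sumEFin -EFinM lee_fin mulrC -sqnE dot_sqr.
  rewrite ge0_integralZl ?lee_fin ?sqn_ge0//; last 2 first.
  + by apply: emeasurable_sum => i; apply/measurable_EFinP; exact: measurable_funX.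
  + by move=> y _; apply: sume_ge0 => i _; rewrite lee_fin sqr_ge0.
  rewrite ge0_integral_sum//; last 2 first.
  + by move=> i; apply/measurable_EFinP; exact: measurable_funX.
  + by move=> i y _; rewrite lee_fin sqr_ge0.
  apply: (@le_trans _ _ ((sqn p)%:E * (\sum_i c i m)%:E)%E); last by rewrite EFinM.
  apply: lee_wpmul2l; first by rewrite lee_fin sqn_ge0.
  by rewrite -sumEFin; apply: lee_sum => i _; exact: (hc i).2.
move=> m m' es ms he he0 hms.
have E (mu : P2 R n) : \int[mu]_y dot (dk m y) p = \sum_i p i 0 * \int[mu]_y dk m y i 0.
  transitivity (\int[mu]_y \sum_i p i 0 * dk m y i 0).
    by apply: eq_Rintegral => y _; rewrite dotE; apply: eq_bigr => i _; rewrite mulrC.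
  rewrite Rint_sum => [|i]; last exact: intgZ.
  by apply: eq_bigr => i _; rewrite RintZ.
rewrite !E -sumrB.
rewrite (_ : (fun i => _) = fun i => \sum_j p j 0 * ((es i)^-1 * (k (ms i) j 0 - k m j 0))); last first.
  apply/funext => i; rewrite !dotE -sumrB mulr_sumr; apply: eq_bigr => j _; ring.
apply: cvg_sumR => j; rewrite -mulrBr; apply: cvgM; first exact: cvg_cst.
by case: (h j) => _ _; apply.
Qed.

Lemma lin_growth_intg (mu : P2 R n) (h : X -> R) a b : measurable_fun setT h ->
  (forall y, `|h y| <= a + b * enorm y) -> intg mu h.
Proof.
move=> mh hb; apply: (@intg_le _ _ _ _ _ (fun y => (`|a| + `|b|) + `|b| * sqn y)) => //.
  move=> y; apply: le_trans (hb y) _; rewrite -addrA; apply: lerD; first exact: ler_norm.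
  have b0 := normr_ge0 b; have e0 := enorm_ge0 y.
  apply: (@le_trans _ _ (`|b| * enorm y)); first by rewrite ler_wpM2r// ler_norm.
  rewrite -enorm_sqr -[X in _ <= X + _]mulr1 -mulrDr ler_wpM2l//; move: (enorm y) e0 => e e0; have := sqr_ge0 (e - 1); nra.
by apply: intgD; [exact: finite_measure_integrable_cst|apply: intgZ; exact: P2_intg].
Qed.

Lemma coord_intg (mu : P2 R n) i : intg mu (fun y : X => y i 0).
Proof.
apply: (@lin_growth_intg _ _ 0 1); first exact: measurable_coord.
by move=> y; rewrite add0r mul1r coord_le.
Qed.

Lemma dot_mean (mu : P2 R n) a : \int[mu]_y dot a y = dot a (mean mu).
Proof.
rewrite dotE; transitivity (\int[mu]_y \sum_i a i 0 * y i 0).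
  by apply: eq_Rintegral => y _; rewrite dotE.
rewrite Rint_sum => [|i]; last by apply: intgZ; exact: coord_intg.
by apply: eq_bigr => i _; rewrite RintZ ?mxE//; exact: coord_intg.
Qed.

Lemma dot_cvg (a : X) (xs : nat -> X) x : xs k @[k --> \oo] --> x -> dot a (xs k) @[k --> \oo] --> dot a x.
Proof.
move=> hx; rewrite dotE (_ : (fun k => _) = fun k => \sum_i a i 0 * xs k i 0); last by apply/funext => k; rewrite dotE.
by apply: cvg_sumR => i; apply: cvgM; [exact: cvg_cst|exact: coord_cvg].
Qed.

Lemma mixture_mean e (m m' me : P2 R n) : 0 < e <= 1 -> mixture e m m' me ->
  mean me = (1 - e) *: mean m + e *: mean m'.
Proof.
move=> /andP[e0 e1] h; apply/matrixP => i j; rewrite ord1 !mxE.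
have e01 : 0 <= e <= 1 by rewrite (ltW e0).
transitivity (\int[mixm e m m']_y (y i 0)).
  rewrite /Rintegral; congr fine; apply: eq_measure_integral => A mA _.
  exact: etrans (h A mA) (esym (mixP2E m m' A e01)).
rewrite Rint_mixm; [|exact: coord_intg|exact: coord_intg].
by rewrite clamp01E.
Qed.

(** The mean is affine along mixtures, so the difference quotient is constant. By uniqueness this
    identifies the derivatives of the coefficients that are affine in the mean. *)
Lemma is_lfd_mean c (a : X) : is_lfd (fun m : P2 R n => c + dot a (mean m)) (fun _ y => dot a y).
Proof.
split.
- by move=> xs ms x m _ _ hx _; exact: dot_cvg.
- exists (fun m => sqn a * mom2 m ^+ 2).
    move=> Kb; exists (sqn a * Kb ^+ 2) => m hm; rewrite ler_wpM2l ?sqn_ge0//.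
    have h0 : 0 <= mom2 m by exact: sqrtr_ge0.
    by apply: lerXn2r => //; rewrite nnegrE// (le_trans h0).
  move=> m; rewrite /mom2 sqr_sqrtr; last by apply: Rint_ge0 => y; exact: sqn_ge0.
  rewrite EFinM EFin_Rint; last exact: P2_intg.
  rewrite -ge0_integralZl ?lee_fin ?sqn_ge0//; last 2 first.
  + exact: measurable_sqnE.
  + by move=> y _; rewrite lee_fin sqn_ge0.
  apply: ge0_integral_mono => y _; first by rewrite lee_fin sqr_ge0.
  by rewrite -EFinM lee_fin dot_sqr.
move=> m m' es ms he he0 hms; rewrite !dot_mean.
rewrite (_ : (fun i => _) = fun=> dot a (mean m') - dot a (mean m)); first exact: cvg_cst.
apply/funext => i; have /andP[e0 _] := he i.
rewrite (mixture_mean (he i) (hms i)) dotDr !dotZr.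
have := mulVf (lt0r_neq0 e0); move: (es i)^-1 (es i) => a' b' ab.
have -> : c + ((1 - b') * dot a (mean m) + b' * dot a (mean m')) - (c + dot a (mean m)) = b' * (dot a (mean m') - dot a (mean m)) by ring.
by rewrite mulrA ab mul1r.
Qed.

End lfd_algebra.

Section coefficient.
Context {R : realType} {T L : R} {n k : nat}.
Local Notation X := 'cV[R]_n.
Local Notation V := 'cV[R]_k.
Context (A : R -> X -> P2 R n -> V -> X) (dA : R -> X -> P2 R n -> V -> X -> X).
Hypothesis hA : A1_coef T L A dA.
Variables (t : R) (ht : 0 <= t <= T).

(** A bounded Jacobian in [y] gives linear growth, hence integrability under every law with finite
    second moment. *)
Lemma A1_coord_intg x v (mu m : P2 R n) i : intg mu (fun y => dA t x m v y i 0).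
Proof.
have dl := A1_lfd hA x v ht i.
have L0 : 0 <= L by apply: le_trans (opnorm_ge0 _) (A1_bndy hA x m v 0 ht).
apply: (@lin_growth_intg _ _ _ _ `|dA t x m v 0 i 0| L); first exact: lfd_measurable dl m.
apply: (@dK_growth _ _ k (fun x m v y => dA t x m v y i 0) _ L _ x m v).
- by move=> x' m' v' y; apply: differentiable_entry; exact: (A1_diffy hA).
move=> x' m' v' y; rewrite (_ : grad _ y = (jac (dA t x' m' v') y)^T *m delta_mx i 0); last first.
  by rewrite -colE; apply/matrixP => j b; rewrite ord1 !mxE.
have d1 : enorm (delta_mx i 0 : X) <= 1.
  apply: enorm_le => //; rewrite sqnE (bigD1 i)//= big1 ?mxE ?eqxx ?addr0 ?expr1n// => j ji.
  by rewrite mxE (negbTE ji) expr0n.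
apply: le_trans (opnorm_tr_mulmx _ _) _; rewrite -[leRHS]mulr1.
by apply: ler_pM => //; [exact: opnorm_ge0|exact: enorm_ge0|exact: (A1_bndy hA)].
Qed.

Lemma A1_is_lfd x v p : is_lfd (fun m => dot (A t x m v) p) (fun m y => dot (dA t x m v y) p).
Proof. by apply: is_lfd_dot; [exact: (A1_lfd hA)|move=> mu m i; exact: A1_coord_intg]. Qed.

Lemma A1_W2continuous x v p : W2continuous (fun m => dot (A t x m v) p).
Proof.
move=> ms m hm; rewrite dotC (_ : (fun i => _) = fun i => dot p (A t x (ms i) v)); last by apply/funext => i; rewrite dotC.
apply: dot_cvg.
exact: (A1_cont hA (xs := fun=> (t, (x, v))) (x := (t, (x, v))) (fun=> ht) ht (cvg_cst _) hm).
Qed.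

Lemma A1_grad_x x m v p : grad (fun x => dot (A t x m v) p) x = (jac (fun x => A t x m v) x)^T *m p.
Proof. by apply: grad_dotl; exact: (differentiable_pair1 (A1_diff hA x m v ht)).1. Qed.

Lemma A1_grad_v x m v p : grad (fun v => dot (A t x m v) p) v = (jac (A t x m) v)^T *m p.
Proof. by apply: grad_dotl; exact: (differentiable_pair2 (A1_diff hA x m v ht)).1. Qed.

Lemma A1_grad_y x m v y p : grad (fun y => dot (dA t x m v y) p) y = (jac (dA t x m v) y)^T *m p.
Proof. by apply: grad_dotl; exact: (A1_diffy hA). Qed.

End coefficient.

Section controlled.
Context {R : realType} {d : measure_display} {Omega : measurableType d}.
Context (P : probability Omega R).
Context {T L L0 L1 L2 lam0 : R} {n k : nat}.
Local Notation X := 'cV[R]_n.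
Local Notation V := 'cV[R]_k.
Context (A : R -> X -> P2 R n -> V -> X) (dA : R -> X -> P2 R n -> V -> X -> X).
Context (h : R -> X -> P2 R n -> V -> R) (dh : R -> X -> P2 R n -> V -> X -> R).
Hypothesis hA : A3_coef T L L0 L1 L2 lam0 A dA.
Hypothesis hh : A3_cost T L h dh.
Hypotheses (hL : 0 < L) (hL0 : 0 <= L0 <= L) (hL1 : 0 <= L1 <= L) (hL2 : 0 <= L2 <= L) (hl : 0 < lam0).
Variables (t : R) (ht : 0 <= t <= T).
Let hA1 := A3_A1 hA.

Lemma mom1_ge0 (m : P2 R n) : 0 <= mom1 m.
Proof. by apply: Rint_ge0 => y; exact: enorm_ge0. Qed.

(** The first-order condition is substituted in the coercivity inequality tested at [p]. One factor
    [L] bounds the control Jacobian, the other the growth of the control gradient of the cost; then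
    one factor [|p|] is divided out. *)
Lemma adjoint_bound x m v p : grad (h t x m) v + (jac (A t x m) v)^T *m p = 0 ->
  lam0 * enorm p <= L ^+ 2 * (1 + enorm x + mom1 m + enorm v).
Proof.
move=> foc; set D := 1 + _ + _ + _.
have D0 : 0 <= D by rewrite !addr_ge0 ?enorm_ge0// mom1_ge0.
have gl : enorm (grad (h t x m) v) <= L * D.
  apply: le_trans (A3f_bndxv hh x m v ht); apply: ler_wsqrtr.
  by rewrite lerDr sqn_ge0.
have := A3_coercive hA x m v p ht.
rewrite -mulmxA (_ : _ *m p = - grad (h t x m) v); last by move/eqP: foc; rewrite addrC addr_eq0 => /eqP.
move=> h1; have h2 := le_trans h1 (ler_norm _); have {}h2 := le_trans h2 (dot_opnorm _ _ _).
rewrite enormN in h2.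
have {}h2 : lam0 * sqn p <= L * enorm p * (L * D).
  apply: le_trans h2 _; apply: ler_pM => //; [by rewrite mulr_ge0 ?opnorm_ge0 ?enorm_ge0|exact: enorm_ge0|].
  by rewrite ler_wpM2r ?enorm_ge0//; exact: (A1_bndv hA1).
have [->|p0] := eqVneq (enorm p) 0; first by rewrite mulr0 mulr_ge0// sqr_ge0.
have {}p0 : 0 < enorm p by rewrite lt_neqAle eq_sym p0 enorm_ge0.
rewrite -(ler_pM2r p0) -mulrA -expr2 enorm_sqr; apply: le_trans h2 _.
by rewrite le_eqVlt; apply/orP; left; apply/eqP; ring.
Qed.

Lemma Delta_ge1 x x' (m m' : P2 R n) (v v' : V) : 1 <= Delta x x' m m' v v'.
Proof.
by rewrite /Delta -!addrA lerDl !addr_ge0// le_max ?enorm_ge0 ?mom1_ge0.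
Qed.

Lemma Delta_ge x x' (m m' : P2 R n) (v v' : V) : 1 + enorm x + mom1 m + enorm v <= Delta x x' m m' v v'.
Proof. by rewrite /Delta !lerD// le_max lexx. Qed.

Variables (x0 x1 : X) (v0 v1 : V) (xi xi' : Omega -> X) (p : X).
Hypothesis (hxi : sq_integrable P xi) (hxi' : sq_integrable P xi').
Hypothesis foc : grad (h t x0 (law P xi)) v0 + (jac (A t x0 (law P xi)) v0)^T *m p = 0.
Let a := nrmL2 P (fun w => xi' w - xi w).

Lemma controlled_expansion :
  `|dot (A t x1 (law P xi') v1) p - dot (A t x0 (law P xi) v0) p
    - dot ((jac (fun x => A t x (law P xi) v0) x0)^T *m p) (x1 - x0)
    - dot ((jac (A t x0 (law P xi)) v0)^T *m p) (v1 - v0)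
    - \int[P]_w dot ((jac (dA t x0 (law P xi) v0) (xi w))^T *m p) (xi' w - xi w)| <=
  L ^+ 2 / lam0 / 2 * (L0 * (sqn (x1 - x0) + 2 * a * enorm (x1 - x0) + 2 * a ^+ 2)
    + L1 * (2 * enorm (x1 - x0) * enorm (v1 - v0) + 2 * a * enorm (v1 - v0)) + L2 * sqn (v1 - v0)).
Proof.
have wt0 : 0 <= L ^+ 2 / lam0 by rewrite divr_ge0 ?sqr_ge0// ltW.
have /andP[L00 L0L] := hL0; have /andP[L10 L1L] := hL1; have /andP[L20 L2L] := hL2.
(* As [Delta >= 1], the weighted bounds imply global Lipschitz bounds with constant [L]; they serve
   only as the crude constant of the telescoping. *)
have lip (l b c e f : R) (x x' : X) m m' (v v' : V) : 0 <= l <= L -> 0 <= b <= L -> 0 <= c -> 0 <= e -> 0 <= f ->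
  (Delta x x' m m' v v')^-1 * (l * c + l * e + b * f) <= L * (c + e + f).
  move=> /andP[l0 lL] /andP[b0 bL] c0 e0 f0.
  apply: (@le_trans _ _ (1 * (l * c + l * e + b * f))).
    rewrite ler_wpM2r ?addr_ge0 ?mulr_ge0// invf_le1 ?Delta_ge1//.
    by apply: lt_le_trans (Delta_ge1 _ _ _ _ _ _).
  by rewrite mul1r !mulrDr !lerD// ler_wpM2r.
(* One argument of [Delta] is the base point, so [Delta] dominates the growth factor in the bound on
   [p]: their ratio leaves the constant weight [L^2 / lam0]. *)
have wtD (z : R) x m v : 0 <= z -> (Delta x0 x (law P xi) m v0 v)^-1 * z * enorm p <= L ^+ 2 / lam0 * z.
  move=> z0; have D0 : 0 < Delta x0 x (law P xi) m v0 v by apply: lt_le_trans (Delta_ge1 _ _ _ _ _ _).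
  rewrite mulrAC mulrC [leRHS]mulrC ler_wpM2l// ler_pdivrMl// mulrA ler_pdivlMr// mulrC.
  apply: le_trans (adjoint_bound foc) _; rewrite mulrC ler_wpM2r ?sqr_ge0//; exact: Delta_ge.
have W0 (m m' : P2 R n) : 0 <= W2 m m' by exact: W2_ge0.
have e0 l (z : 'cV[R]_l) := enorm_ge0 z.
have tr (l : nat) (M M' : 'M[R]_(n, l)) : enorm (M^T *m p - M'^T *m p) <= opnorm (M - M') * enorm p.
  by rewrite -mulmxBl -linearB/=; exact: opnorm_tr_mulmx.
rewrite -(A1_grad_x hA1 ht x0 (law P xi) v0 p) -(A1_grad_v hA1 ht x0 (law P xi) v0 p).
have -> : \int[P]_w dot ((jac (dA t x0 (law P xi) v0) (xi w))^T *m p) (xi' w - xi w) =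
   \int[P]_w dot (grad (fun y => dot (dA t x0 (law P xi) v0 y) p) (xi w)) (xi' w - xi w).
  by apply: eq_Rintegral => w _; rewrite (A1_grad_y hA1).
apply: (@second_order_remainder _ _ _ P n k (fun x m v => dot (A t x m v) p) (fun x m v y => dot (dA t x m v y) p)
  _ _ _ _ (L * enorm p) (L * enorm p)) => //.
- move=> x m v; apply: (@differentiable_dotl _ _ _ (fun z : X * V => A t z.1 m z.2)); exact: (A1_diff hA1).
- by move=> x v; exact: (A1_is_lfd hA1).
- by move=> x v; exact: (A1_W2continuous hA1).
- by move=> x m v y; apply: differentiable_dotl; exact: (A1_diffy hA1).
- move=> x m v y; rewrite (A1_grad_y hA1)//; apply: le_trans (opnorm_tr_mulmx _ _) _.
  by rewrite ler_wpM2r//; exact: (A1_bndy hA1).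
- by rewrite mulr_ge0// ltW.
- move=> x x' m m' v v'; rewrite !(A1_grad_x hA1)//; apply: le_trans (tr _ _ _) _.
  rewrite mulrAC; apply: ler_wpM2r => //; apply: le_trans (A3_x hA _ _ _ _ _ _ ht) _; exact: lip.
- move=> x x' m m' v v'; rewrite !(A1_grad_v hA1)//; apply: le_trans (tr _ _ _) _.
  rewrite mulrAC; apply: ler_wpM2r => //; apply: le_trans (A3_v hA _ _ _ _ _ _ ht) _; exact: lip.
- move=> x x' m m' v v' y y'; rewrite !(A1_grad_y hA1)//; apply: le_trans (tr _ _ _) _.
  rewrite mulrAC; apply: ler_wpM2r => //; apply: le_trans (A3_y hA _ _ _ _ _ _ _ _ ht) _.
  have -> : L0 * enorm (x' - x) + L0 * W2 m m' + L0 * enorm (y' - y) + L1 * enorm (v' - v) =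
    L0 * (enorm (x' - x) + enorm (y' - y)) + L0 * W2 m m' + L1 * enorm (v' - v) by ring.
  apply: le_trans (lip _ _ _ _ _ _ _ _ _ _ _ hL0 hL1 _ _ _) _ => //; first by rewrite addr_ge0.
  by rewrite le_eqVlt; apply/orP; left; apply/eqP; ring.
- move=> x m v; rewrite !(A1_grad_x hA1)//; apply: le_trans (tr _ _ _) _.
  apply: le_trans (ler_wpM2r (e0 _ _) (A3_x hA _ _ _ _ _ _ ht)) _; apply: wtD.
  by rewrite !addr_ge0// mulr_ge0.
- move=> x m v; rewrite !(A1_grad_v hA1)//; apply: le_trans (tr _ _ _) _.
  apply: le_trans (ler_wpM2r (e0 _ _) (A3_v hA _ _ _ _ _ _ ht)) _; apply: wtD.
  by rewrite !addr_ge0// mulr_ge0.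
- move=> x m v y y'; rewrite !(A1_grad_y hA1)//; apply: le_trans (tr _ _ _) _.
  apply: le_trans (ler_wpM2r (e0 _ _) (A3_y hA _ _ _ _ _ _ _ _ ht)) _; apply: wtD.
  by rewrite !addr_ge0// mulr_ge0.
Qed.

End controlled.

Lemma cvg_pair_seq (U V : topologicalType) (us : nat -> U) (vs : nat -> V) (u : U) (v : V) :
  us k @[k --> \oo] --> u -> vs k @[k --> \oo] --> v -> (us k, vs k) @[k --> \oo] --> (u, v).
Proof. by move=> cu cv; apply: cvg_pair. Qed.

Lemma L2f_cst {R : realType} {d} {S : measurableType d} (P : probability S R) (c : R) : L2f P (fun=> c).
Proof. by split => //; exact: finite_measure_integrable_cst. Qed.

Lemma L2f_intg {R : realType} {d} {S : measurableType d} (P : probability S R) (f : S -> R) : L2f P f -> intg P f.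
Proof.
by move=> hf; have := L2f_mul hf (L2f_cst P 1); apply: eq_intg => x; rewrite mulr1.
Qed.

Lemma intg_ltpinfty {R : realType} {d} {S : measurableType d} (mu : {measure set S -> \bar R}) (f : S -> R) :
  (forall x, 0 <= f x) -> intg mu f -> (\int[mu]_x (f x)%:E < +oo)%E.
Proof.
move=> f0 /integrableP[_]; apply: le_lt_trans; apply: ge0_integral_mono => x _; first by rewrite lee_fin.
by rewrite /= ger0_norm.
Qed.

Section vector_integrals.
Context {R : realType} {d : measure_display} {Omega : measurableType d}.
Context (P : probability Omega R) {n : nat}.
Local Notation X := 'cV[R]_n.

Lemma sqi_dot_intg (a b : Omega -> X) : sq_integrable P a -> sq_integrable P b -> intg P (fun w => dot (a w) (b w)).
Proof.
move=> ha hb; have : intg P (fun w => \sum_i a w i 0 * b w i 0).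
  by apply: intg_sum => i; apply: L2f_mul; exact: sqi_L2f.
by apply: eq_intg => w; rewrite dotE.
Qed.

Lemma mean_law (xi : Omega -> X) i : sq_integrable P xi -> mean (law P xi) i 0 = \int[P]_w xi w i 0.
Proof.
move=> hxi; rewrite mxE (law_Rint hxi (h := fun x => x i 0))//; first exact: measurable_coord.
exact/L2f_intg/sqi_L2f.
Qed.

Lemma Rint_dot_mean (xi xi' : Omega -> X) c : sq_integrable P xi -> sq_integrable P xi' ->
  intg P (fun w => dot c (xi' w - xi w)) /\
  \int[P]_w dot c (xi' w - xi w) = dot c (mean (law P xi') - mean (law P xi)).
Proof.
move=> hxi hxi'.
have I (z : Omega -> X) i : sq_integrable P z -> intg P (fun w => z w i 0) by move=> hz; exact/L2f_intg/sqi_L2f.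
have Ii i : intg P (fun w => c i 0 * (xi' w i 0 - xi w i 0)) by apply/intgZ/intgB; exact: I.
have E w : dot c (xi' w - xi w) = \sum_i c i 0 * (xi' w i 0 - xi w i 0).
  by rewrite dotE; apply: eq_bigr => i _; rewrite !mxE.
split; first by apply: (eq_intg (f := fun w => \sum_i c i 0 * (xi' w i 0 - xi w i 0))) => [w|]; [rewrite E|exact: intg_sum].
transitivity (\int[P]_w \sum_i c i 0 * (xi' w i 0 - xi w i 0)); first by apply: eq_Rintegral => w _; exact: E.
rewrite Rint_sum// dotE; apply: eq_bigr => i _; rewrite RintZ; last by apply: intgB; exact: I.
by congr (_ * _); rewrite RintB ?mxE; [rewrite -!mean_law// !mxE|exact: I|exact: I].
Qed.

Lemma sqi_seqcont (h : X -> X) (xi : Omega -> X) (A C : R) : sq_integrable P xi ->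
  (forall (ys : nat -> 'cV[R]_n) (y : 'cV[R]_n), ys k @[k --> \oo] --> y -> forall i, h (ys k) i 0 @[k --> \oo] --> h y i 0) ->
  (forall y, enorm (h y) <= A + C * enorm y) -> sq_integrable P (fun w => h (xi w)).
Proof.
move=> hxi hc hb; apply: (sqi_enorm (f := fun w => A + C * enorm (xi w))) => [||w]; last exact: hb.
  apply: measurable_mx => i j; rewrite ord1; apply: (measurableT_comp (f := fun y => h y i 0)); last exact: hxi.1.
  by apply: seqcont_measurable => ys y cy; exact: hc.
by apply: L2fD; [exact: L2f_cst|exact/L2fZ/sqi_L2f_enorm].
Qed.

End vector_integrals.

Lemma enorm_cvg0 {R : realType} n (xs : nat -> 'cV[R]_n) (x : 'cV[R]_n) : xs k @[k --> \oo] --> x -> enorm (xs k - x) @[k --> \oo] --> 0.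
Proof. by move=> cx; have := cvg_comp _ _ (sqn_cvg0 cx) (@sqrt_continuous R 0); rewrite sqrtr0; exact. Qed.

Lemma enorm_cvg_coord {R : realType} n (xs : nat -> 'cV[R]_n) (x : 'cV[R]_n) i : enorm (xs k - x) @[k --> \oo] --> 0 -> xs k i 0 @[k --> \oo] --> x i 0.
Proof.
move=> cx; apply/cvgrPdist_le => e e0; move/cvgrPdist_le: cx => /(_ _ e0); apply: filterS => k.
rewrite sub0r normrN ger0_norm ?enorm_ge0//; apply: le_trans; rewrite distrC.
by have := coord_le (xs k - x) i; rewrite !mxE.
Qed.

Lemma seqcont_lipschitz {R : realType} n k (h : 'cV[R]_n -> 'cV[R]_k) (C : R) :
  (forall y y', enorm (h y' - h y) <= C * enorm (y' - y)) ->
  forall (ys : nat -> 'cV[R]_n) (y : 'cV[R]_n), ys k @[k --> \oo] --> y -> forall i, h (ys k) i 0 @[k --> \oo] --> h y i 0.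
Proof.
move=> hC ys y cy i; apply: (@enorm_cvg_coord _ _ (fun k => h (ys k))).
apply: (@squeeze_cvgr _ _ _ _ (fun=> 0) (fun k => C * enorm (ys k - y))).
- by apply: nearW => m; rewrite enorm_ge0 hC.
- exact: cvg_cst.
- by rewrite -[X in _ --> X](mulr0 C); apply: cvgM; [exact: cvg_cst|exact: enorm_cvg0].
Qed.

(** The subtracted [0] holds the place of the control derivative, absent from an uncontrolled
    column, so that the expression matches the one in [coef_expansion]. *)
Lemma affine_dot_diff {R : realType} n (s0 x0 x1 y0 y1 p : 'cV[R]_n) (s1 s2 : 'M[R]_n) :
  dot (s0 + s1 *m x1 + s2 *m y1) p - dot (s0 + s1 *m x0 + s2 *m y0) p
  - dot (s1^T *m p) (x1 - x0) - 0 - dot (s2^T *m p) (y1 - y0) = 0.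
Proof. rewrite -!dot_mulmx !mulmxBr !dotBr !dotDl !(dotC p). ring. Qed.

(** * Pairing of affine jump coefficients with square-integrable marks *)

Section jump_pairing.
Context {R : realType} {n kappa : nat} (lam : {sigma_finite_measure set 'cV[R]_kappa -> \bar R}).
Local Notation E := (jumpE R kappa).
Local Notation X := 'cV[R]_n.

Let mE : measurable E := @measurable_jumpE R kappa.

Definition sqE l k (h : 'cV[R]_kappa -> 'M[R]_(l, k)) :=
  measurable_fun E h /\ (\int[lam]_(e in E) (sqn (h e))%:E < +oo)%E.

Lemma Rint_indic (h : 'cV[R]_kappa -> R) : \int[lam]_(e in E) h e = \int[lam]_e (\1_E e * h e).
Proof. by rewrite /Rintegral integral_indicM; congr fine; apply: eq_integral => e _; rewrite EFinM. Qed.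

Lemma indicM_sqr (x : 'cV[R]_kappa) (a b : R) : \1_E x * (a * b) = (\1_E x * a) * (\1_E x * b).
Proof. by rewrite indicE; case: (_ \in _); rewrite ?mul1r ?mul0r. Qed.

Lemma sqE_L2 l k (h : 'cV[R]_kappa -> 'M[R]_(l, k)) i j : sqE h -> L2f lam (fun e => \1_E e * h e i j).
Proof.
move=> [mh ih]; have mc : measurable_fun setT (fun e => \1_E e * h e i j).
  by apply: measurable_indicM => //; exact: (measurableT_comp (measurable_entry i j) mh).
split => //; apply: intg_lty; first exact: measurable_funX.
  by move=> e; exact: sqr_ge0.
apply: le_lt_trans ih; rewrite [leRHS]integral_indicM; apply: ge0_integral_mono => e _; first by rewrite lee_fin sqr_ge0.
rewrite -EFinM lee_fin exprMn indicE; case: (_ \in _); rewrite ?expr1n ?expr0n ?mul1r ?mul0r//.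
exact: entry_sqr_le.
Qed.

Lemma sqE_opnorm l k (h : 'cV[R]_kappa -> 'M[R]_(l, k)) : measurable_fun E h ->
  (\int[lam]_(e in E) (opnorm (h e) ^+ 2)%:E < +oo)%E -> sqE h.
Proof.
move=> mh ih; split => //; rewrite integral_indicM.
have : intg lam (fun e => \sum_i \sum_j \1_E e * h e i j ^+ 2).
  apply: intg_sum => i; apply: intg_sum => j; apply: intg_lty => [|e|].
  - by apply: measurable_indicM => //; apply: measurable_funX; exact: (measurableT_comp (measurable_entry i j) mh).
  - by rewrite mulr_ge0// sqr_ge0.
  apply: le_lt_trans ih; rewrite [leRHS]integral_indicM; apply: ge0_integral_mono => e _.
    by rewrite lee_fin mulr_ge0// sqr_ge0.
  rewrite -EFinM lee_fin ler_wpM2l// -(real_normK (num_real (h e i j))) lerXn2r ?nnegrE ?opnorm_ge0//.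
  exact: entry_opnorm.
move/intg_ltpinfty => H; apply: le_lt_trans (H _) => [|e]; last first.
  by do 2 apply: sumr_ge0 => ? _; rewrite mulr_ge0// sqr_ge0.
 rewrite le_eqVlt; apply/orP; left; apply/eqP; apply: eq_integral => e _.
by rewrite -EFinM /sqn mulr_sumr; congr EFin; apply: eq_bigr => i _; rewrite mulr_sumr.
Qed.

Lemma sqE0 l k : @sqE l k (fun=> 0).
Proof.
split; first exact: measurable_cst.
by rewrite integral0_eq ?ltry// => e _; rewrite sqn0.
Qed.

Lemma sqE_affine (c : 'cV[R]_kappa -> X) (g : 'cV[R]_kappa -> 'M[R]_n) (y : X) : sqE c -> sqE g -> sqE (fun e => c e + g e *m y).
Proof.
move=> hc hg; have me i : measurable_fun E (fun e => (c e + g e *m y) i 0).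
  rewrite (_ : (fun e => _) = fun e => c e i 0 + \sum_k g e i k * y k 0); last by apply/funext => e; rewrite !mxE.
  apply: measurable_funD; first exact: (measurableT_comp (measurable_entry i 0) hc.1).
  apply: measurable_sum => k; apply: measurable_funM => //; exact: (measurableT_comp (measurable_entry i k) hg.1).
have Ic : intg lam (fun e => \1_E e * sqn (c e)).
  have : intg lam (fun e => \sum_i (\1_E e * c e i 0) * (\1_E e * c e i 0)).
    by apply: intg_sum => i; apply: L2f_mul; exact: sqE_L2.
  by apply: eq_intg => e; rewrite sqnE mulr_sumr; apply: eq_bigr => i _; rewrite -indicM_sqr.
have Ig : intg lam (fun e => \1_E e * sqn (g e)).
  have : intg lam (fun e => \sum_i \sum_k (\1_E e * g e i k) * (\1_E e * g e i k)).
    by apply: intg_sum => i; apply: intg_sum => k; apply: L2f_mul; exact: sqE_L2.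
  apply: eq_intg => e; rewrite /sqn mulr_sumr; apply: eq_bigr => i _; rewrite mulr_sumr; apply: eq_bigr => k _.
  by rewrite -indicM_sqr.
split; first by apply: measurable_mx => i j; rewrite ord1.
rewrite integral_indicM.
apply: (@le_lt_trans _ _ (\int[lam]_e (2 * (\1_E e * sqn (c e)) + 2 * sqn y * (\1_E e * sqn (g e)))%:E)%E).
  apply: ge0_integral_mono => e _; rewrite -EFinM lee_fin; first by rewrite mulr_ge0// sqn_ge0.
  rewrite [leRHS](_ : _ = \1_E e * (2 * sqn (c e) + 2 * (sqn (g e) * sqn y))); last by ring.
  rewrite ler_wpM2l// (le_trans (sqnD_le _ _))// lerD2l ler_wpM2l//; exact: sqn_mulmx_le.
apply: intg_ltpinfty => [e|]; last by apply: intgD; exact: intgZ.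
by rewrite addr_ge0// !mulr_ge0// sqn_ge0.
Qed.

Lemma sqE_dot_intg (c r : 'cV[R]_kappa -> X) : sqE c -> sqE r -> intg lam (fun e => \1_E e * dot (c e) (r e)).
Proof.
move=> hc hr; have : intg lam (fun e => \sum_i (\1_E e * c e i 0) * (\1_E e * r e i 0)).
  by apply: intg_sum => i; apply: L2f_mul; exact: sqE_L2.
by apply: eq_intg => e; rewrite dotE mulr_sumr; apply: eq_bigr => i _; rewrite indicM_sqr.
Qed.

(** The adjoint of the map that sends a vector [y] to the function [g(e) y] of the mark, for the
    scalar product of the L2-space of [lam] on nonzero marks. *)
Definition jadj (g : 'cV[R]_kappa -> 'M[R]_n) (r : 'cV[R]_kappa -> X) : X :=
  vint lam E (fun e => (g e)^T *m r e).

Lemma jump_pairing (g : 'cV[R]_kappa -> 'M[R]_n) (r : 'cV[R]_kappa -> X) y : sqE g -> sqE r ->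
  intg lam (fun e => \1_E e * dot (g e *m y) (r e)) /\
  \int[lam]_(e in E) dot (g e *m y) (r e) = dot (jadj g r) y.
Proof.
move=> hg hr.
have Ii i : intg lam (fun e => \1_E e * ((g e)^T *m r e) i 0).
  have : intg lam (fun e => \sum_k (\1_E e * g e k i) * (\1_E e * r e k 0)).
    by apply: intg_sum => k; apply: L2f_mul; exact: sqE_L2.
  by apply: eq_intg => e; rewrite mxE mulr_sumr; apply: eq_bigr => k _; rewrite mxE indicM_sqr.
have EE e : \1_E e * dot (g e *m y) (r e) = \sum_i y i 0 * (\1_E e * ((g e)^T *m r e) i 0).
  by rewrite dotC dot_mulmx dotE mulr_sumr; apply: eq_bigr => i _; ring.
split; first by apply: (eq_intg (f := fun e => \sum_i y i 0 * (\1_E e * ((g e)^T *m r e) i 0))) => [e|]; [rewrite EE|apply: intg_sum => i; exact: intgZ].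
rewrite Rint_indic; transitivity (\int[lam]_e \sum_i y i 0 * (\1_E e * ((g e)^T *m r e) i 0)).
  by apply: eq_Rintegral => e _; exact: EE.
rewrite Rint_sum => [|i]; last exact: intgZ.
rewrite dotE; apply: eq_bigr => i _; rewrite RintZ// mulrC; congr (_ * _).
by rewrite mxE Rint_indic.
Qed.

Lemma jump_pairing_affine (c : 'cV[R]_kappa -> X) (g : 'cV[R]_kappa -> 'M[R]_n) (r : 'cV[R]_kappa -> X) y :
  sqE c -> sqE g -> sqE r ->
  \int[lam]_(e in E) dot (c e + g e *m y) (r e) = \int[lam]_(e in E) dot (c e) (r e) + dot (jadj g r) y.
Proof.
move=> hc hg hr; have [I2 <-] := jump_pairing y hg hr; rewrite !Rint_indic -RintD//; last exact: sqE_dot_intg.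
by apply: eq_Rintegral => e _; rewrite dotDl mulrDr.
Qed.

End jump_pairing.

(** * Derivatives and expansion of the Lagrangian *)

Section lagrangian.
Context {R : realType} {disp : measure_display} {Omega : measurableType disp}.
Context (P : probability Omega R).
Context {T L L0 L1 L2 lam0 : R} {n kappa : nat}.
Context (lam : {sigma_finite_measure set 'cV[R]_kappa -> \bar R}).
Context {dj : 'I_n.+1 -> nat}.
Local Notation X := 'cV[R]_n.
Local Notation V := 'cV[R]_(\sum_j dj j).
Local Notation E := (jumpE R kappa).
Context (b : R -> X -> P2 R n -> V -> X) (db : R -> X -> P2 R n -> V -> X -> X).
Context (sigma : R -> X -> P2 R n -> V -> 'M[R]_n) (dsigma : R -> X -> P2 R n -> V -> X -> 'M[R]_n).
Context (gamma : R -> X -> P2 R n -> V -> 'cV[R]_kappa -> X) (dgamma : R -> X -> P2 R n -> V -> X -> 'cV[R]_kappa -> X).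
Context (f : R -> X -> P2 R n -> V -> R) (df : R -> X -> P2 R n -> V -> X -> R).
Context (g : X -> P2 R n -> R) (dg : X -> P2 R n -> X -> R).
Hypothesis hL : 0 < L.
Hypothesis hA1 : assumption_A1 T L lam b db sigma dsigma gamma dgamma.
Hypothesis hA2 : assumption_A2 T L f df g dg.
Hypothesis hA3 : assumption_A3 T L L0 L1 L2 lam0 lam b sigma gamma f.
Variables (A : forall j, R -> X -> P2 R n -> 'cV[R]_(dj j) -> X)
  (dA : forall j, R -> X -> P2 R n -> 'cV[R]_(dj j) -> X -> X).
Hypothesis hA : forall j, (0 < dj j)%N -> A3_coef T L L0 L1 L2 lam0 (@A j) (@dA j).
Hypothesis hb : forall t x m v, 0 <= t <= T -> b t x m v = A t x m (submxcol v ord0).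
Hypothesis hs : forall (j : 'I_n) t x m v, (0 < dj (lift ord0 j))%N -> 0 <= t <= T ->
  col j (sigma t x m v) = A t x m (submxcol v (lift ord0 j)).
Variables (g0 : R -> 'cV[R]_kappa -> X) (g1 g2 : R -> 'cV[R]_kappa -> 'M[R]_n).
Hypothesis hg : forall t, 0 <= t <= T ->
    [/\ [/\ measurable_fun E (g0 t), measurable_fun E (g1 t) & measurable_fun E (g2 t)],
        (\int[lam]_(e in E) (sqn (g0 t e))%:E <= (L ^+ 2)%:E)%E,
        (\int[lam]_(e in E) (opnorm (g1 t e) ^+ 2)%:E <= (L ^+ 2)%:E)%E,
        (\int[lam]_(e in E) (opnorm (g2 t e) ^+ 2)%:E <= (L ^+ 2)%:E)%E &
        forall x m v e, E e -> gamma t x m v e = g0 t e + g1 t e *m x + g2 t e *m mean m].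
Variables (fj : forall j, R -> X -> P2 R n -> 'cV[R]_(dj j) -> R)
  (dfj : forall j, R -> X -> P2 R n -> 'cV[R]_(dj j) -> X -> R).
Hypothesis hfj : forall j, A3_cost T L (@fj j) (@dfj j).
Hypothesis hf : forall t x m v, 0 <= t <= T -> f t x m v = \sum_j fj t x m (submxcol v j).

(* drift (index 0) and volatility columns, with their adjoints *)
Definition coef (i : 'I_n.+1) t x m v : X := if unlift ord0 i is Some j then col j (sigma t x m v) else b t x m v.
Definition dcoef (i : 'I_n.+1) t x m v y : X := if unlift ord0 i is Some j then col j (dsigma t x m v y) else db t x m v y.
Definition adj (p : X) (q : 'M[R]_n) (i : 'I_n.+1) : X := if unlift ord0 i is Some j then col j q else p.

Lemma coef_A1 i : A1_coef T L (coef i) (dcoef i).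
Proof.
case: hA1 => h1 h2 _; rewrite /coef /dcoef; case: unliftP => [j _|_]; [exact: h2|exact: h1].
Qed.

Lemma sum_coef (F : 'I_n.+1 -> R) (F0 : R) (F1 : 'I_n -> R) : F ord0 = F0 -> (forall j, F (lift ord0 j) = F1 j) ->
  \sum_i F i = F0 + \sum_j F1 j.
Proof. by move=> e0 e1; rewrite big_ord_recl e0; congr (_ + _); apply: eq_bigr => j _. Qed.

Lemma coef0 t x m v : coef ord0 t x m v = b t x m v. Proof. by rewrite /coef unlift_none. Qed.
Lemma coefS j t x m v : coef (lift ord0 j) t x m v = col j (sigma t x m v). Proof. by rewrite /coef liftK. Qed.
Lemma dcoef0 t x m v y : dcoef ord0 t x m v y = db t x m v y. Proof. by rewrite /dcoef unlift_none. Qed.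
Lemma dcoefS j t x m v y : dcoef (lift ord0 j) t x m v y = col j (dsigma t x m v y). Proof. by rewrite /dcoef liftK. Qed.
Lemma adj0 p q : adj p q ord0 = p. Proof. by rewrite /adj unlift_none. Qed.
Lemma adjS p q j : adj p q (lift ord0 j) = col j q. Proof. by rewrite /adj liftK. Qed.

Lemma coef_controlled i t x m v : (0 < dj i)%N -> 0 <= t <= T -> coef i t x m v = A t x m (submxcol v i).
Proof.
by move=> di ht; move: di; rewrite /coef; case: unliftP => [j ->|->] di; [exact: hs|exact: hb].
Qed.

Lemma coef_uncontrolled i : dj i = 0%N -> exists (s0 : R -> X) (s1 s2 : R -> 'M[R]_n),
  forall t, 0 <= t <= T -> forall x m v, coef i t x m v = s0 t + s1 t *m x + s2 t *m mean m.
Proof.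
rewrite /coef; case: unliftP => [j ->|->] di.
  have [s0 [s1 [s2 h]]] := A3_uncontrolled hA3 di; exists s0, s1, s2 => t ht x m v.
  by have [_ _ _ ->] := h t ht.
by have := A3_d0 hA3; rewrite di.
Qed.

Section fixed_time.
Variables (t : R) (ht : 0 <= t <= T).

Definition jadj1 (r : 'cV[R]_kappa -> X) : X := jadj lam (g1 t) r.
Definition jadj2 (r : 'cV[R]_kappa -> X) : X := jadj lam (g2 t) r.

(** Explicit candidates for the gradient of the Lagrangian in the state and of its
    functional-derivative in [y]. They are shown equal to these gradients when [r] is square
    integrable in the mark, and unlike them they are assembled from terms that are easily seen to be
    measurable along processes. *)
Definition Gx x m v p q r : X := grad (fun x => f t x m v) x
  + \sum_i (jac (fun x => coef i t x m v) x)^T *m adj p q i + jadj1 r.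
Definition Gm x m v p q r y : X := grad (df t x m v) y
  + \sum_i (jac (dcoef i t x m v) y)^T *m adj p q i + jadj2 r.

Let sq0 : sqE lam (g0 t).
Proof. by have [[m0 _ _] h0 _ _ _] := hg ht; split => //; apply: le_lt_trans h0 _; exact: ltry. Qed.
Let sq1 : sqE lam (g1 t).
Proof. by have [[_ m1 _] _ h1 _ _] := hg ht; apply: sqE_opnorm => //; apply: le_lt_trans h1 _; exact: ltry. Qed.
Let sq2 : sqE lam (g2 t).
Proof. by have [[_ _ m2] _ _ h2 _] := hg ht; apply: sqE_opnorm => //; apply: le_lt_trans h2 _; exact: ltry. Qed.

Lemma LagrangianE x m v p q r : sqE lam r -> Lagrangian lam b sigma gamma f t x m v p q r =
  f t x m v + \sum_i dot (coef i t x m v) (adj p q i) +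
  (\int[lam]_(e in E) dot (g0 t e) (r e) + dot (jadj1 r) x + dot (jadj2 r) (mean m)).
Proof.
move=> hr; rewrite /Lagrangian; congr (_ + _).
  rewrite (sum_coef (F0 := dot (b t x m v) p) (F1 := fun j => dot (col j (sigma t x m v)) (col j q))).
  - by rewrite addrA.
  - by rewrite coef0 adj0.
  - by move=> j; rewrite coefS adjS.
rewrite -(jump_pairing_affine x sq0 sq1 hr) -(jump_pairing_affine _ (sqE_affine x sq0 sq1) sq2 hr).
apply: eq_Rintegral => e; rewrite inE => eE; have [_ _ _ _ h] := hg ht.
by rewrite h.
Qed.

Lemma grad_Lagrangian_x x m v p q r : sqE lam r ->
  grad (fun x => Lagrangian lam b sigma gamma f t x m v p q r) x = Gx x m v p q r.
Proof.
move=> hr; have E1 : (fun x => Lagrangian lam b sigma gamma f t x m v p q r) =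
  fun x => f t x m v + \sum_i dot (coef i t x m v) (adj p q i) +
  ((\int[lam]_(e in E) dot (g0 t e) (r e) + dot (jadj2 r) (mean m)) + dot (jadj1 r) x).
  by apply/funext => x'; rewrite LagrangianE//; ring.
have df1 : differentiable (fun x => f t x m v : R^o) x := (differentiable_pair1 (A2_diff hA2 x m v ht)).1.
have dc i : differentiable (fun x => coef i t x m v) x := (differentiable_pair1 (A1_diff (coef_A1 i) x m v ht)).1.
have dci i : differentiable (fun x => dot (coef i t x m v) (adj p q i) : R^o) x by exact: differentiable_dotl.
have [da ga] := grad_affine (\int[lam]_(e in E) dot (g0 t e) (r e) + dot (jadj2 r) (mean m)) (jadj1 r) x.
rewrite E1 gradD//; last first.
  by apply: differentiableD => //; exact: differentiable_sumR.
rewrite gradD//; last exact: differentiable_sumR.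
rewrite ga grad_sum// /Gx; congr (_ + _ + _); apply: eq_bigr => i _; exact: grad_dotl.
Qed.

(** For each mark the derivative is determined up to a constant in [y], and [g2 t e *m y] is one
    version. That the constant, as a function of the mark, is square integrable is seen at one well
    chosen point [y0]. *)
Lemma dgamma_affine x m v : exists2 c, sqE lam c & forall y e, E e -> dgamma t x m v y e = c e + g2 t e *m y.
Proof.
have [_ _ hj] := hA1; have [_ _ _ _ hgE] := hg ht.
have [c0 _ hc0] := A1j_lfd2 hj x v ht.
(* If every [y] gave an infinite mark integral, its mean under [m] would be infinite, against the
   bound on the functional-derivative. *)
have [y0 hy0] : exists y0, (\int[lam]_(e in E) (sqn (dgamma t x m v y0 e))%:E < +oo)%E.
  apply: contrapT => /forallNP hN; have := hc0 m.
  rewrite (_ : (fun y => _) = cst +oo%E); last first.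
    by apply/funext => y; apply/eqP; have /negP := hN y; rewrite -leNgt leye_eq.
  by rewrite integral_cst// [X in (_ * X)%E](@probability_setT _ _ _ (P2_prob m)) mule1 leye_eq.
have sqy : sqE lam (dgamma t x m v y0) by split => //; exact: (A1j_dmeas hj x m v y0 ht).
exists (fun e => dgamma t x m v y0 e + g2 t e *m (- y0)); first exact: sqE_affine.
move=> y e eE.
have H i : exists c, forall y, dgamma t x m v y e i 0 = dot (row i (g2 t e))^T y + c.
  apply: (lfd_unique (A1j_lfd hj x v ht eE i) (is_lfd_mean ((g0 t e + g1 t e *m x) i 0) (row i (g2 t e))^T)) => m'.
  by rewrite hgE// [LHS]mxE; congr (_ + _); rewrite /dot trmxK -row_mul [RHS]mxE.
apply/matrixP => i j; rewrite ord1 !mxE; have [c hc] := H i.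
have S (z : X) : \sum_j g2 t e i j * z j 0 = dot (row i (g2 t e))^T z by rewrite dotE; apply: eq_bigr => k _; rewrite !mxE.
by rewrite !hc !S dotNr; ring.
Qed.

Lemma grad_dLagrangian x m v p q r y : sqE lam r ->
  grad (dLagrangian lam db dsigma dgamma df t x m v p q r) y = Gm x m v p q r y.
Proof.
move=> hr; have [c hc dE] := dgamma_affine x m v.
have E1 : dLagrangian lam db dsigma dgamma df t x m v p q r =
  fun y => df t x m v y + \sum_i dot (dcoef i t x m v y) (adj p q i) +
  (\int[lam]_(e in E) dot (c e) (r e) + dot (jadj2 r) y).
  apply/funext => y'; rewrite /dLagrangian; congr (_ + _).
    rewrite (sum_coef (F0 := dot (db t x m v y') p) (F1 := fun j => dot (col j (dsigma t x m v y')) (col j q))).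
    - by rewrite addrA.
    - by rewrite dcoef0 adj0.
    - by move=> j; rewrite dcoefS adjS.
  rewrite -(jump_pairing_affine y' hc sq2 hr).
  by apply: eq_Rintegral => e; rewrite inE => eE; rewrite dE.
have df1 : differentiable (df t x m v : X -> R^o) y := A2_diffy hA2 x m v y ht.
have dc i : differentiable (dcoef i t x m v) y := A1_diffy (coef_A1 i) x m v y ht.
have dci i : differentiable (fun y => dot (dcoef i t x m v y) (adj p q i) : R^o) y by exact: differentiable_dotl.
have [da ga] := grad_affine (\int[lam]_(e in E) dot (c e) (r e)) (jadj2 r) y.
rewrite E1 gradD//; last first.
  by apply: differentiableD => //; exact: differentiable_sumR.
rewrite gradD//; last exact: differentiable_sumR.
rewrite ga grad_sum// /Gm; congr (_ + _ + _); apply: eq_bigr => i _; exact: grad_dotl.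
Qed.

(* the block form of the first-order condition *)
Lemma foc_blocks x m v p q r i : sqE lam r -> (0 < dj i)%N ->
  grad (fun v => Lagrangian lam b sigma gamma f t x m v p q r) v = 0 ->
  grad (fj t x m) (submxcol v i) + (jac (A t x m) (submxcol v i))^T *m adj p q i = 0.
Proof.
move=> hr di foc.
(* An uncontrolled coefficient does not depend on the control, so it is frozen at [v = 0] and the
   Lagrangian becomes a sum over blocks. *)
pose phi j (z : 'cV[R]_(dj j)) : R := fj t x m z + (if (0 < dj j)%N then dot (A t x m z) (adj p q j) else dot (coef j t x m 0) (adj p q j)).
pose c := \int[lam]_(e in E) dot (g0 t e) (r e) + dot (jadj1 r) x + dot (jadj2 r) (mean m).
have E1 : (fun v => Lagrangian lam b sigma gamma f t x m v p q r) = fun v => \sum_j phi j (submxcol v j) + c.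
  apply/funext => v'; rewrite LagrangianE// hf// big_split/=; congr (_ + _ + _); apply: eq_bigr => j _.
  case: ifPn => dj0; first by rewrite coef_controlled.
  have {}dj0 : dj j = 0%N by apply/eqP; rewrite -leqn0 leqNgt.
  by have [s0 [s1 [s2 h]]] := coef_uncontrolled dj0; rewrite !h.
have := congr1 (fun M => submxcol M i) foc; rewrite E1 grad_blocks submxcol0 => <-.
rewrite /phi di gradD//; last 2 first.
- exact: (differentiable_pair2 (A3f_diff (hfj i) x m (submxcol v i) ht)).1.
- apply: differentiable_dotl; exact: (differentiable_pair2 (A1_diff (A3_A1 (hA di)) x m (submxcol v i) ht)).1.
by rewrite (A1_grad_v (A3_A1 (hA di)) ht).
Qed.

Lemma grad_f_dot x m v (dv : V) : dot (grad (f t x m) v) dv = \sum_i dot (grad (fj t x m) (submxcol v i)) (submxcol dv i).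
Proof.
rewrite dot_blocks; apply: eq_bigr => i _; congr (dot _ _).
rewrite (_ : f t x m = fun v' => \sum_j fj t x m (submxcol v' j) + 0); last first.
  by apply/funext => v'; rewrite hf// addr0.
exact: (grad_blocks (fun j => @fj j t x m)).
Qed.

Variables (x0 x1 : X) (v0 v1 : V) (p : X) (q : 'M[R]_n) (r : 'cV[R]_kappa -> X) (xi xi' : Omega -> X).
Hypotheses (hxi : sq_integrable P xi) (hxi' : sq_integrable P xi') (hr : sqE lam r).
Hypothesis foc : grad (fun v => Lagrangian lam b sigma gamma f t x0 (law P xi) v p q r) v0 = 0.
Hypothesis hlam0 : 0 < lam0.
Let a := nrmL2 P (fun w => xi' w - xi w).
Let m0 := law P xi.
Let m1 := law P xi'.
Let dx := x1 - x0.
Let dv := v1 - v0.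

(** The bound of [controlled_expansion] with [u] the state difference, [w] the L2-norm of [xi' - xi]
    and [z] the difference of one control block. *)
Definition remainder (u w z : R) : R := L ^+ 2 / lam0 / 2 *
  (L0 * (u ^+ 2 + 2 * w * u + 2 * w ^+ 2) + L1 * (2 * u * z + 2 * w * z) + L2 * z ^+ 2).

(** [D] is the control derivative of the coefficient, which the first-order condition cancels
    against that of the cost. For an uncontrolled block [D = 0]: the block has no coordinates, so
    its scalar product is an empty sum, and an affine coefficient has no remainder. *)
Lemma coef_expansion i : exists2 D, D + dot (grad (fj t x0 m0) (submxcol v0 i)) (submxcol dv i) = 0 &
  `|dot (coef i t x1 m1 v1) (adj p q i) - dot (coef i t x0 m0 v0) (adj p q i)
    - dot ((jac (fun x => coef i t x m0 v0) x0)^T *m adj p q i) dx - D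
    - \int[P]_w dot ((jac (dcoef i t x0 m0 v0) (xi w))^T *m adj p q i) (xi' w - xi w)|
  <= if (0 < dj i)%N then remainder (enorm dx) a (enorm (submxcol dv i)) else 0.
Proof.
case: ifPn => di.
  have fi := foc_blocks hr di foc.
  exists (dot ((jac (A t x0 m0) (submxcol v0 i))^T *m adj p q i) (submxcol dv i)).
    by rewrite -dotDl addrC fi dot0l.
  have h := controlled_expansion (hA di) (hfj i) hL (A3_L0 hA3) (A3_L1 hA3) (A3_L2 hA3) hlam0 ht x1 (submxcol v1 i) hxi hxi' fi.
  have Ec x m v : coef i t x m v = A t x m (submxcol v i) by exact: coef_controlled.
  (* [dcoef] and [dA] are derivatives of the same function of the law; a constant between them does
     not change the Jacobian in [y]. *)
  have [c0 hc0] : exists c, forall y, dcoef i t x0 m0 v0 y = dA t x0 m0 (submxcol v0 i) y + c.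
    have /choice[c hc] k : exists c, forall y, dcoef i t x0 m0 v0 y k 0 = dA t x0 m0 (submxcol v0 i) y k 0 + c.
      apply: (lfd_unique (A1_lfd (coef_A1 i) x0 v0 ht k) (A1_lfd (A3_A1 (hA di)) x0 (submxcol v0 i) ht k)) => m.
      by rewrite Ec.
    by exists (\col_k c k) => y; apply/matrixP => k b'; rewrite ord1 hc !mxE.
  rewrite !Ec (_ : (fun x => coef i t x m0 v0) = fun x => A t x m0 (submxcol v0 i)); last by apply/funext => x; exact: Ec.
  rewrite (_ : \int[P]_w _ = \int[P]_w dot ((jac (dA t x0 m0 (submxcol v0 i)) (xi w))^T *m adj p q i) (xi' w - xi w)).
    by move: h; rewrite /remainder !enorm_sqr -linearB/=.
  by apply: eq_Rintegral => w _; rewrite (jac_addc _ hc0).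
have {}di : dj i = 0%N by apply/eqP; rewrite -leqn0 leqNgt.
exists 0.
  rewrite add0r dotE big1// => k _; exfalso; have := ltn_ord k; by rewrite {2}di.
have [s0 [s1 [s2 h]]] := coef_uncontrolled di; have {}h := h t ht.
rewrite (_ : (fun x => coef i t x m0 v0) = fun x => (s0 t + s2 t *m mean m0) + s1 t *m x); last first.
  by apply/funext => x; rewrite h addrAC.
rewrite jac_mulmx.
have [c0 hc0] : exists c, forall y, dcoef i t x0 m0 v0 y = c + s2 t *m y.
  have /choice[c hc] k : exists c, forall y, dcoef i t x0 m0 v0 y k 0 = dot (row k (s2 t))^T y + c.
    apply: (lfd_unique (A1_lfd (coef_A1 i) x0 v0 ht k) (is_lfd_mean ((s0 t + s1 t *m x0) k 0) (row k (s2 t))^T)) => m.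
    by rewrite h [LHS]mxE; congr (_ + _); rewrite /dot trmxK -row_mul [RHS]mxE.
  exists (\col_k c k) => y; apply/matrixP => k b'; rewrite ord1 hc [RHS]mxE [X in _ = X + _]mxE addrC; congr (_ + _).
  by rewrite /dot trmxK -row_mul [LHS]mxE.
rewrite (_ : \int[P]_w _ = \int[P]_w dot ((s2 t)^T *m adj p q i) (xi' w - xi w)); last first.
  apply: eq_Rintegral => w _; congr (dot (_ ^T *m _) _).
  by rewrite (_ : dcoef i t x0 m0 v0 = fun y => c0 + s2 t *m y) ?jac_mulmx//; apply/funext.
by rewrite (Rint_dot_mean _ hxi hxi').2 !h -/m0 -/m1 /dx affine_dot_diff normr0 lexx.
Qed.

Let hdxi : sq_integrable P (fun w => xi' w - xi w). Proof. exact: sqiB. Qed.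

Lemma sqi_grad_df : sq_integrable P (fun w => grad (df t x0 m0 v0) (xi w)).
Proof.
apply: (@sqi_seqcont _ _ _ _ _ (grad (df t x0 m0 v0)) xi (L * (1 + enorm x0 + mom2 m0 + enorm v0)) L) => //.
  apply: (@seqcont_lipschitz _ _ _ _ L) => y y'; apply: le_trans (A2_lipy hA2 _ _ _ _ _ _ _ _ ht) _.
  by rewrite !subrr W2_refl !enorm0 !add0r.
by move=> y; rewrite -mulrDr; exact: (A2_bndy hA2).
Qed.

Lemma sqi_jac_dcoef i : sq_integrable P (fun w => (jac (dcoef i t x0 m0 v0) (xi w))^T *m adj p q i).
Proof.
apply: (@sqi_seqcont _ _ _ _ _ (fun y => (jac (dcoef i t x0 m0 v0) y)^T *m adj p q i) xi (L * enorm (adj p q i)) 0) => //.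
  move=> ys y cy k.
  have cj k1 k2 : jac (dcoef i t x0 m0 v0) (ys m) k1 k2 @[m --> \oo] --> jac (dcoef i t x0 m0 v0) y k1 k2.
    apply: coord_cvg; apply: (A1_conty (coef_A1 i) (xs := fun m => (t, (x0, v0, ys m))) (ms := fun=> m0) (x := (t, (x0, v0, y)))) => //.
      by apply: cvg_pair_seq; [exact: cvg_cst|apply: cvg_pair_seq; [exact: cvg_cst|exact: cy]].
    by rewrite W2_refl; exact: cvg_cst.
  rewrite mxE (_ : (fun m => _) = fun m => \sum_j jac (dcoef i t x0 m0 v0) (ys m) j k * adj p q i j 0); last first.
    by apply/funext => m; rewrite mxE; apply: eq_bigr => j _; rewrite mxE.
  by apply: cvg_sumR => j; apply: cvgM; [rewrite mxE; exact: cj|exact: cvg_cst].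
move=> y; rewrite mul0r addr0; apply: le_trans (opnorm_tr_mulmx _ _) _.
by rewrite ler_wpM2r ?enorm_ge0// (A1_bndy (coef_A1 i)).
Qed.

Lemma Gm_integral : intg P (fun w => dot (Gm x0 m0 v0 p q r (xi w)) (xi' w - xi w)) /\
  \int[P]_w dot (Gm x0 m0 v0 p q r (xi w)) (xi' w - xi w) =
  \int[P]_w dot (grad (df t x0 m0 v0) (xi w)) (xi' w - xi w) +
  \sum_i \int[P]_w dot ((jac (dcoef i t x0 m0 v0) (xi w))^T *m adj p q i) (xi' w - xi w) +
  dot (jadj2 r) (mean m1 - mean m0).
Proof.
have I1 := sqi_dot_intg sqi_grad_df hdxi.
have I2 i := sqi_dot_intg (sqi_jac_dcoef i) hdxi.
have [I3 E3] := Rint_dot_mean (jadj2 r) hxi hxi'.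
have I2s : intg P (fun w => \sum_i dot ((jac (dcoef i t x0 m0 v0) (xi w))^T *m adj p q i) (xi' w - xi w)) by exact: intg_sum.
have E w : dot (Gm x0 m0 v0 p q r (xi w)) (xi' w - xi w) = dot (grad (df t x0 m0 v0) (xi w)) (xi' w - xi w) +
  \sum_i dot ((jac (dcoef i t x0 m0 v0) (xi w))^T *m adj p q i) (xi' w - xi w) + dot (jadj2 r) (xi' w - xi w).
  by rewrite /Gm !dotDl dot_suml.
split; first by apply: (eq_intg (fun w => esym (E w))); apply: intgD => //; exact: intgD.
rewrite -E3 -Rint_sum// -RintD// -RintD//; last exact: intgD.
by apply: eq_Rintegral => w _; exact: E.
Qed.

(** Convexity of [f] is added to the expansions of the coefficients. The control gradient of [f]
    equals minus the sum of the terms [D], so all first-order control terms disappear; what is left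
    is a convexity inequality for the Lagrangian in state and law, up to the remainders. *)
Lemma pointwise_expansion (lamv lamx lamm : R) (hA4 : assumption_A4 P T lamv lamx lamm f df g dg) :
  dot (Gx x0 m0 v0 p q r) dx + \int[P]_w dot (Gm x0 m0 v0 p q r (xi w)) (xi' w - xi w)
  + lamv * sqn dv + lamx * sqn dx + lamm * a ^+ 2
  - \sum_(i | (0 < dj i)%N) remainder (enorm dx) a (enorm (submxcol dv i)) <=
  f t x1 m1 v1 - f t x0 m0 v0 + \sum_i dot (coef i t x1 m1 v1 - coef i t x0 m0 v0) (adj p q i)
  + \int[lam]_(e in E) dot (gamma t x1 m1 v1 e - gamma t x0 m0 v0 e) (r e).
Proof.
have hF := A4_f hA4 x0 x1 v0 v1 ht hxi hxi'.
have /choice[D hD] i : exists D, [/\ D + dot (grad (fj t x0 m0) (submxcol v0 i)) (submxcol dv i) = 0 &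
  dot ((jac (fun x => coef i t x m0 v0) x0)^T *m adj p q i) dx + D
    + \int[P]_w dot ((jac (dcoef i t x0 m0 v0) (xi w))^T *m adj p q i) (xi' w - xi w)
    - (if (0 < dj i)%N then remainder (enorm dx) a (enorm (submxcol dv i)) else 0) <=
  dot (coef i t x1 m1 v1 - coef i t x0 m0 v0) (adj p q i)].
  have [D D0 hD] := coef_expansion i; exists D; split => //.
  move: hD; rewrite ler_norml dotBl => /andP[hD _]; move: hD; lra.
have HS : \sum_i (dot ((jac (fun x => coef i t x m0 v0) x0)^T *m adj p q i) dx + D i
    + \int[P]_w dot ((jac (dcoef i t x0 m0 v0) (xi w))^T *m adj p q i) (xi' w - xi w)
    - (if (0 < dj i)%N then remainder (enorm dx) a (enorm (submxcol dv i)) else 0)) <=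
    \sum_i dot (coef i t x1 m1 v1 - coef i t x0 m0 v0) (adj p q i).
  by apply: ler_sum => i _; have [_] := hD i.
have HG : dot (grad (f t x0 m0) v0) dv = - \sum_i D i.
  rewrite grad_f_dot -sumrN; apply: eq_bigr => i _; have [+ _] := hD i.
  by move/eqP; rewrite addrC addr_eq0 => /eqP.
have HJ : \int[lam]_(e in E) dot (gamma t x1 m1 v1 e - gamma t x0 m0 v0 e) (r e) =
  dot (jadj1 r) dx + dot (jadj2 r) (mean m1 - mean m0).
  have [_ _ _ _ hgE] := hg ht.
  rewrite -[dot _ dx]add0r -[X in X + dot _ dx](_ : \int[lam]_(e in E) dot 0 (r e) = 0); last first.
    by rewrite /Rintegral integral0_eq// => e _; rewrite dot0l.
  rewrite -(jump_pairing_affine dx (sqE0 _ _ _) sq1 hr) -(jump_pairing_affine _ (sqE_affine dx (sqE0 _ _ _) sq1) sq2 hr).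
  apply: eq_Rintegral => e; rewrite inE => eE; rewrite !hgE// add0r; congr (dot _ _).
  by rewrite !mulmxBr; apply/matrixP => i j; rewrite !mxE; ring.
rewrite (Gm_integral).2 HJ /Gx !dotDl dot_suml.
move: HS; rewrite !big_split/= sumrN -big_mkcond/=.
rewrite HG in hF; move: hF; rewrite -nrmL2_sqr -/a -/m0 -/m1 -/dx -/dv.
lra.
Qed.

End fixed_time.
End lagrangian.

(** * Independent copies and measurability along processes *)

Lemma measurable_carath {R : realType} {d} {S : measurableType d} n (h : S -> 'cV[R]_n -> R) (phi : S -> 'cV[R]_n) :
  (forall y, measurable_fun setT (h^~ y)) ->
  (forall s (ys : nat -> 'cV[R]_n) (y : 'cV[R]_n), ys k @[k --> \oo] --> y -> h s (ys k) @[k --> \oo] --> h s y) ->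
  measurable_fun setT phi -> measurable_fun setT (fun s => h s (phi s)).
Proof.
move=> mh ch mphi; apply: (measurable_fun_cvg (h := fun k s => h s (dyav k (phi s)))) => [k|s _].
  by apply: (@ctb_meas _ _ _ _ h setT (fun s => dyav k (phi s))) => //; exact: ctb_dyav.
by apply: ch; exact: cvg_dyav.
Qed.

Lemma measurable_right_limit {R : realType} {d} {S : measurableType d} (T : R) (phi : R -> S -> R) : 0 < T ->
  (forall t, 0 <= t <= T -> measurable_fun setT (phi t)) ->
  (forall s t (u : nat -> R), 0 <= t <= T -> (forall k, t <= u k <= T) -> u k @[k --> \oo] --> t -> phi (u k) s @[k --> \oo] --> phi t s) ->
  measurable_fun setT (fun z : measurableTypeR R * S => win 0 T z.1 * phi z.1 z.2).
Proof.
move=> hT mphi cphi; apply: (measurable_fun_cvg (h := fun m z => gridval T phi m z)) => [m|z _].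
  apply: measurable_sum => i; apply: measurable_funM.
    exact: (measurableT_comp (win_L2 _ _).1.1 measurable_fst).
  by apply: (measurableT_comp _ measurable_snd); apply: mphi; rewrite grid_ge0// grid_leT.
have [h|h] := boolP (0 < z.1 <= T).
  by apply: gridval_seq_cvg => // u; apply: cphi; have /andP[/ltW -> ->] := h.
rewrite /win (negbTE h) mul0r (_ : (fun m => _) = fun=> 0); first exact: cvg_cst.
by apply/funext => m; rewrite gridval0//; exact/negP.
Qed.

(** [f] may fail to be measurable, as with the driver of the backward equation before it is put in
    explicit form. Its positive and negative parts are squeezed between those of [g] altered to 0
    and to [+oo] on a null set. *)
Lemma Rint_ae_eq_left {R : realType} {d} {S : measurableType d} (mu : {measure set S -> \bar R}) (f g : S -> R) :
  measurable_fun setT g -> {ae mu, forall x, f x = g x} ->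
  (\int[mu]_x (f x)%:E = \int[mu]_x (g x)%:E)%E.
Proof.
move=> mg [A [mA A0 hA]].
have mmem : measurable_fun setT (fun x => x \in A).
  apply: (measurable_fun_bool true); rewrite setTI (_ : _ @^-1` _ = A)//.
  by apply/seteqP; split => x /= h; [exact: set_mem|exact: mem_set].
have pos (h k : S -> \bar R) : measurable_fun setT k -> (forall x, 0 <= h x)%E -> (forall x, 0 <= k x)%E ->
    (forall x, ~ A x -> h x = k x) -> (\int[mu]_x h x = \int[mu]_x k x)%E.
  move=> mk h0 k0 hk; apply/eqP; rewrite eq_le; apply/andP; split.
    apply: (@le_trans _ _ (\int[mu]_x (if x \in A then +oo else k x))%E).
      apply: ge0_integral_mono => x _; first exact: h0.
      by case: ifPn => [_|/negP]; rewrite ?leey ?inE => // /hk ->.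
    rewrite le_eqVlt; apply/orP; left; apply/eqP; apply: ae_eq_integral => //.
      by apply: measurable_fun_ifT => //; exact: mmem.
    exists A; split => // x /= hx; apply: contrapT => xA; apply: hx => _.
    by rewrite memNset.
  apply: (@le_trans _ _ (\int[mu]_x (if x \in A then 0 else k x))%E).
    rewrite le_eqVlt; apply/orP; left; apply/eqP; apply: ae_eq_integral => //.
      by apply: measurable_fun_ifT => //; exact: mmem.
    exists A; split => // x /= hx; apply: contrapT => xA; apply: hx => _.
    by rewrite memNset.
  apply: ge0_integral_mono => x _; first by case: ifP.
  by case: ifPn => [_|/negP]; rewrite ?inE => // /hk ->.
have E x : ~ A x -> f x = g x by move=> xA; apply: contrapT => h; exact/xA/hA.
rewrite integralE [RHS]integralE; congr (_ - _)%E; apply: pos => //.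
- by apply: measurable_funepos; exact/measurable_EFinP.
- by move=> x xA; rewrite !funeposE E.
- by apply: measurable_funeneg; exact/measurable_EFinP.
- by move=> x xA; rewrite !funenegE E.
Qed.

Section sigma_finite_fubini.
Context {R : realType} {d1 d2 : measure_display} {T1 : measurableType d1} {T2 : measurableType d2}.
Variables (m1 : {sigma_finite_measure set T1 -> \bar R}) (m2 : {sigma_finite_measure set T2 -> \bar R}).
Local Notation m := (sfprod m1 m2).

Lemma sfprod_intg (h : T1 * T2 -> R) : intg m h ->
  [/\ intg m1 (fun x => \int[m2]_y h (x, y)), \int[m1]_x \int[m2]_y h (x, y) = \int[m]_z h z &
      {ae m1, forall x, intg m2 (fun y => h (x, y))}].
Proof.
move=> Ih; have mh : measurable_fun setT h by exact: intg_meas Ih.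
have mG : measurable_fun setT (fun x => \int[m2]_y (h (x, y))%:E)%E.
  exact: (@measurable_fubini_F _ _ _ _ R m1 m2 (EFin \o h) Ih).
have mt : measurable_fun setT (fun x => \int[m2]_y h (x, y)) by exact: measurableT_comp mG.
have hae := @ae_integrable1 _ _ _ _ R m1 m2 (EFin \o h) Ih.
split => //.
  apply/integrableP; split; first exact/measurable_EFinP.
  apply: (@le_lt_trans _ _ (\int[m1]_x \int[m2]_y (`|h (x, y)|)%:E)%E).
    apply: ge0_integral_mono => x _ //; rewrite /Rintegral.
    apply: (@le_trans _ _ `|\int[m2]_y (h (x, y))%:E|%E).
      by rewrite /=; move: (\int[m2]_y _)%E => -[a| |] /=; rewrite ?lee_fin ?normr0 ?leey.
    apply: le_trans (le_abse_integral _ _ _) _ => //.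
    by apply/measurable_EFinP; exact: (measurableT_comp mh (measurable_pair1 x)).
  by have := (@integrable12ltyP _ _ _ _ R m1 m2 (EFin \o h) _).1 Ih; apply; exact/measurable_EFinP.
rewrite /Rintegral; congr fine.
rewrite -[RHS](@integral12_prod_meas1 _ _ _ _ R m1 m2 (EFin \o h) Ih).
apply: ae_eq_integral => //; first exact/measurable_EFinP.
move: hae; apply: filterS => x Ix _; rewrite EFin_Rint//; exact: Ix.
Qed.

Lemma ae_section (p : T1 * T2 -> Prop) : {ae m, forall z, p z} -> {ae m1, forall x, {ae m2, forall y, p (x, y)}}.
Proof.
move=> [A [mA A0 hA]].
have mx : measurable_fun setT (fun x => m2 (xsection A x)) by exact: measurable_fun_xsection.
have h0 : (\int[m1]_x `|m2 (xsection A x)| = 0)%E.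
  by rewrite (eq_integral (fun x => m2 (xsection A x))) => [|x _]; [exact: A0|rewrite gee0_abs].
have := (ae_eq_integral_abs m1 measurableT mx).1 h0.
apply: filterS => x /(_ I) hx; exists (xsection A x); split => //; first exact: measurable_xsection.
by move=> y /= hy; rewrite /xsection/= inE; exact: hA.
Qed.

Lemma ae_section2 (p : T1 * T2 -> Prop) : {ae m, forall z, p z} -> {ae m2, forall y, {ae m1, forall x, p (x, y)}}.
Proof.
move=> [A [mA A0 hA]].
have mx : measurable_fun setT (fun y => m1 (ysection A y)) by exact: measurable_fun_ysection.
have h0 : (\int[m2]_y `|m1 (ysection A y)| = 0)%E.
  rewrite (eq_integral (fun y => m1 (ysection A y))) => [|y _]; last by rewrite gee0_abs.
  rewrite -[LHS]/((m1 \x^ m2)%E A) -[RHS]A0; apply/esym/(@product_measure_unique _ _ _ _ _ m1 m2 (m1 \x^ m2)%E) => // A1 A2 mA1 mA2.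
  exact: product_measure2E.
have := (ae_eq_integral_abs m2 measurableT mx).1 h0.
apply: filterS => y /(_ I) hy; exists (ysection A y); split => //; first exact: measurable_ysection.
by move=> x /= hx; rewrite /ysection/= inE; exact: hA.
Qed.

End sigma_finite_fubini.

(** For almost every [x], Cauchy-Schwarz against the constant 1 bounds the square of the inner mean
    by the mean of the square. *)
Lemma marginal_L2 {R : realType} {d1 d2} {T1 : measurableType d1} {T2 : measurableType d2}
  (m1 : {sigma_finite_measure set T1 -> \bar R}) (P : probability T2 R) (f : T1 * T2 -> R) :
  intg (sfprod m1 P) f -> L2f (sfprod m1 P) f -> L2f m1 (fun x => \int[P]_y f (x, y)).
Proof.
move=> I1 [mf I2]; have [J1 _ _] := sfprod_intg I1; have [J2 _ A2] := sfprod_intg I2.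
have mF := intg_meas J1; split => //.
apply: intg_lty => [|x|]; [exact: measurable_funX|exact: sqr_ge0|].
apply: le_lt_trans (intg_ltpinfty _ J2) => [|x]; last by apply: Rint_ge0 => y; exact: sqr_ge0.
apply: ae_ge0_le_integral => //.
- by move=> x _; rewrite lee_fin sqr_ge0.
- by apply/measurable_EFinP; exact: measurable_funX.
- by move=> x _; rewrite lee_fin; apply: Rint_ge0 => y; exact: sqr_ge0.
- by apply/measurable_EFinP; exact: intg_meas J2.
move: A2; apply: filterS => x Ix _; rewrite lee_fin.
have Lx : L2f P (fun y => f (x, y)) by split => //; exact: (measurableT_comp mf (measurable_pair1 x)).
have := CS_Rint Lx (L2f_cst P 1); rewrite (_ : n2 P (fun=> 1) = 1) ?mulr1.
  by congr (_ ^+ 2 <= _); apply: eq_Rintegral => y _; rewrite mulr1.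
rewrite /n2 /Rintegral (_ : (fun _ => _) = cst 1%E); last by apply/funext => y; rewrite expr1n.
by rewrite integral_cst// mul1e [X in fine X](@probability_setT _ _ _ P).
Qed.

(** * The independent copy *)

Section independent_copy.
Context {R : realType} {d : measure_display} {Omega : measurableType d} (P : probability Omega R).
Local Notation tw := (measurableTypeR R * Omega)%type.
Definition dtPP : {sigma_finite_measure set (tw * Omega)%type -> \bar R} := sfprod (dtP P) P.

(** Exchanges a path with its copy at the same time. It preserves the product measure, which allows
    the increment of the state to be moved onto the copy in the mean-field terms. *)
Definition swap_copy (y : tw * Omega) : tw * Omega := ((y.1.1, y.2), y.1.2).

Lemma measurable_swap : measurable_fun setT swap_copy.
Proof.
apply: measurable_fun_pair; last exact: (measurableT_comp measurable_snd measurable_fst).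
by apply: measurable_fun_pair; [exact: (measurableT_comp measurable_fst measurable_fst)|exact: measurable_snd].
Qed.

Lemma ge0_integral_swap (k : tw * Omega -> \bar R) : measurable_fun setT k -> (forall y, 0 <= k y)%E ->
  (\int[dtPP]_y k (swap_copy y) = \int[dtPP]_y k y)%E.
Proof.
move=> mk k0.
have E (h : tw * Omega -> \bar R) : measurable_fun setT h -> (forall y, 0 <= h y)%E ->
    (\int[dtPP]_y h y = \int[lebesgue_measure]_s \int[P]_w \int[P]_w' h ((s, w), w'))%E.
  move=> mh h0; apply: etrans (@fubini_tonelli1 _ _ _ _ R (dtP P) P h mh h0) _.
  apply: (@fubini_tonelli1 _ _ _ _ R lebesgue_measure P).
    by apply: measurable_fun_fubini_tonelli_F.
  by move=> z; apply: integral_ge0.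
apply: etrans (E (k \o swap_copy) (measurableT_comp mk measurable_swap) (fun y => k0 _)) _.
apply/esym/(etrans (E k mk k0)); apply: eq_integral => s _.
have mp : measurable_fun setT (fun z : Omega * Omega => ((s : measurableTypeR R, z.1), z.2) : tw * Omega).
  by apply: measurable_fun_pair => //; apply: measurable_fun_pair.
exact: (@fubini_tonelli _ _ _ _ R P P (fun z => k ((s, z.1), z.2)) (measurableT_comp mk mp) (fun z => k0 _)).
Qed.

Lemma Rint_swap (h : tw * Omega -> R) : measurable_fun setT h ->
  \int[dtPP]_y h (swap_copy y) = \int[dtPP]_y h y.
Proof.
move=> mh; rewrite /Rintegral; congr fine; rewrite integralE [RHS]integralE; congr (_ - _)%E.
- rewrite -(ge0_integral_swap (k := (EFin \o h)^\+%E))//.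
    by apply: eq_integral => y _; rewrite !funeposE.
  by apply: measurable_funepos; exact/measurable_EFinP.
- rewrite -(ge0_integral_swap (k := (EFin \o h)^\-%E))//.
    by apply: eq_integral => y _; rewrite !funenegE.
  by apply: measurable_funeneg; exact/measurable_EFinP.
Qed.

Lemma L2f_swap (h : tw * Omega -> R) : L2f dtPP h -> L2f dtPP (h \o swap_copy).
Proof.
move=> [mh Ih]; have ms := measurableT_comp mh measurable_swap; split => //.
apply: intg_lty => [|y|]; [exact: measurable_funX|exact: sqr_ge0|].
rewrite (ge0_integral_swap (k := fun y => (h y ^+ 2)%:E)); last first.
- by move=> y; rewrite lee_fin sqr_ge0.
- by apply/measurable_EFinP; exact: measurable_funX.
by apply: intg_ltpinfty => // y; exact: sqr_ge0.
Qed.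

Lemma L2f_lift (f : tw -> R) : L2f (dtP P) f -> L2f dtPP (fun y => f y.1).
Proof.
move=> [mf If]; split; first exact: (measurableT_comp mf measurable_fst).
have [h _] := intg_prod_mul If (L2f_intg (L2f_cst P 1)).
by apply: eq_intg h => y; rewrite mulr1.
Qed.

End independent_copy.

Section S2_coordinates.
Context {R : realType} {d : measure_display} {Omega : measurableType d}.
Context (P : probability Omega R) (T : R) (F : R -> set (set Omega)) (hT : 0 < T).
Context {n0 kappa : nat} (B : R -> Omega -> 'cV[R]_n0).
Context (lam : {sigma_finite_measure set 'cV[R]_kappa -> \bar R}).
Context (N : Omega -> {measure set (R * 'cV[R]_kappa)%type -> \bar R}).
Hypothesis hn : noise_setting P T F B lam N.
Context {k : nat} (a : R -> Omega -> 'cV[R]_k) (ha : S2 P T F a).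

(** An enumeration of all grid points, capped at [T]. Every time in [[0, T]] is approached by them
    from the right, so by right-continuity the supremum of a path is a countable one, hence
    measurable. *)
Let nu (j : nat) : R := let z := odflt (0%N, 0%N) (unpickle j : option (nat * nat)) in grid T z.1 (minn z.2 z.1.+1).

Let nu_itv j : 0 <= nu j <= T.
Proof. by rewrite /nu grid_ge0// grid_leT// geq_minr. Qed.

Let Ssup w : \bar R := esups (fun j => (sqn (a (nu j) w))%:E) 0.

Let mSsup : measurable_fun setT Ssup.
Proof.
have [had _ _ _] := ha.
apply: measurable_fun_esups => j; apply/measurable_EFinP.
apply: (measurableT_comp (@measurable_sqn R k)).
exact: (meas_F_measurable hn (nu_itv j) (had _ (nu_itv j))).
Qed.

Let nu_le j w : ((sqn (a (nu j) w))%:E <= Ssup w)%E.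
Proof. by apply: ereal_sup_ubound; exists j. Qed.

Let right_seq w t (u : nat -> R) i : 0 <= t <= T -> (forall k, t <= u k <= T) -> u k @[k --> \oo] --> t ->
  a (u k) w i 0 @[k --> \oo] --> a t w i 0.
Proof.
move=> /andP[t0 tT] hu cu; have [_ hr _ _] := ha.
apply: (@right_cvg_seq _ T (fun s => a s w i 0) t) => // tlt.
by apply: coord_cvg; exact: hr.
Qed.

Let nu_right t m : 0 <= t <= T -> exists j, t <= nu j <= T /\ nu j - t <= T / m.+1%:R.
Proof.
move=> ht; have nuE i : (i <= m.+1)%N -> nu (pickle (m, i)) = grid T m i.
  by move=> im; rewrite /nu pickleK /= (minn_idPl im).
have [t0|t0] := boolP (0 < t).
  have [[_ [i im [h1 h2 _]]]|[h _]] := sum_win_grid hT m t (fun=> 0); last by exfalso; apply: h; rewrite t0; have /andP[] := ht.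
  by exists (pickle (m, i.+1)); rewrite nuE// h1 h2 grid_leT.
have -> : t = 0 by apply/eqP; rewrite eq_le leNgt t0; have /andP[] := ht.
by exists (pickle (m, 0%N)); rewrite nuE// grid0 lexx subr0 (ltW hT) divr_ge0// ltW.
Qed.

Let sup_le w t : 0 <= t <= T -> ((sqn (a t w))%:E <= Ssup w)%E.
Proof.
move=> ht; case E : (Ssup w) => [x| |]; last 2 first.
- by rewrite leey.
- by have := nu_le 0 w; rewrite E.
have /choice[j hj] m := nu_right m ht.
have cu : nu (j m) @[m --> \oo] --> t.
  apply: (@squeeze_cvgr _ _ _ _ (fun=> t) (fun m => t + T / m.+1%:R)); last 2 first.
  - exact: cvg_cst.
  - by rewrite -[X in _ --> X]addr0; apply: cvgD; [exact: cvg_cst|exact: mesh_cvg0].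
  by apply: nearW => m; have [/andP[-> _] h] := hj m; rewrite addrC -lerBlDr.
have cs : sqn (a (nu (j m)) w) @[m --> \oo] --> sqn (a t w).
  rewrite sqnE (_ : (fun m => _) = fun m => \sum_i a (nu (j m)) w i 0 ^+ 2); last by apply/funext => m; rewrite sqnE.
  have hu m : t <= nu (j m) <= T := (hj m).1.
  apply: cvg_sumR => i; have c := right_seq (w := w) (i := i) ht hu cu.
  by rewrite expr2; exact: (cvgM c c).
rewrite lee_fin; apply: (ler_cvg_to cs (cvg_cst x)); apply: nearW => m.
by rewrite -lee_fin -E; exact: nu_le.
Qed.

Lemma S2_cadlag i : cadlag_S2 P T F (fun t w => a t w i 0).
Proof.
have [had hr hl hs] := ha; split.
- by move=> t ht; apply: (meas_wrt_comp (measurable_coord i)); exact: had.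
- by move=> w t t0 tT; apply: coord_cvg; exact: hr.
- move=> w t t0 tT; have /cvg_ex[l cl] := hl w t t0 tT.
  by apply/cvg_ex; exists (l i 0); exact: coord_cvg cl.
have S0 w : (0 <= Ssup w)%E by apply: le_trans (nu_le 0 w); rewrite lee_fin sqn_ge0.
have Sfin : (\int[P]_w Ssup w < +oo)%E.
  apply: le_lt_trans hs; apply: ge0_integral_mono => w _ //.
  apply: ub_ereal_sup => _ [j _ <-]; apply: ereal_sup_ubound; exists (nu j) => //.
  by rewrite /= in_itv; exact: nu_itv.
have IS : P.-integrable setT Ssup.
  apply/integrableP; split => //; apply: le_lt_trans Sfin; apply: ge0_integral_mono => w _ //.
  by rewrite gee0_abs.
exists (fine \o Ssup).
  apply: intg_lty => [|w|]; [exact: measurableT_comp mSsup|exact: fine_ge0|].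
  apply: le_lt_trans Sfin; apply: ge0_integral_mono => w _; first by rewrite lee_fin fine_ge0.
  by have := S0 w; rewrite /=; case: (Ssup w) => // x; rewrite leey.
move: (integrable_ae measurableT IS); apply: filterS => w /(_ I) fw t ht.
by apply: le_trans (coord_sqr_le _ _) _; rewrite -lee_fin /= fineK// sup_le.
Qed.

End S2_coordinates.

(** The common Dirac mass stays in place: the coupling is mixed with the Dirac mass at [(y, y)],
    which has no cost. *)
Lemma W2_mix_dirac {R : realType} n (m m' : P2 R n) c K e (y : 'cV[R]_n) : coupling m m' c ->
  (costm c <= K%:E)%E -> 0 <= K -> W2 (mixP2 e m (diracP2 y)) (mixP2 e m' (diracP2 y)) <= Num.sqrt K.
Proof.
move=> hc cK K0; apply: (@W2_le _ _ _ _ (mixm e c (dirac (y, y)))) => //.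
  move=> A mA; have [h1 h2] := hc A mA.
  have d1 : \d_(y, y) (A `*` setT) = \d_y A :> \bar R.
    by rewrite !diracE; congr ((_ : bool)%:R%:E); apply/idP/idP; rewrite !inE => // -[].
  have d2 : \d_(y, y) (setT `*` A) = \d_y A :> \bar R.
    by rewrite !diracE; congr ((_ : bool)%:R%:E); apply/idP/idP; rewrite !inE => // -[].
  split; rewrite /= !mixmE; [rewrite h1|rewrite h2]; congr (_ + _ * _)%E; [exact: d1|exact: d2].
rewrite /costm ge0_integral_mixm; last 2 first.
- exact: measurable_cost.
- by move=> z; rewrite lee_fin sqn_ge0.
rewrite integral_dirac//; last exact: measurable_cost.
rewrite diracT mul1e /= subrr sqn0 mule0 adde0.
apply: le_trans (_ : (1 * K%:E <= _)%E); last by rewrite mul1e.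
apply: lee_pmul => //; [by rewrite lee_fin clamp01_le1|by apply: integral_ge0 => z _; rewrite lee_fin sqn_ge0|].
by rewrite lee_fin lerBlDr lerDl clamp01_ge0.
Qed.

Lemma harmonic_dnbhs (R : realType) : (@harmonic R) @ \oo --> (0 : R)^'.
Proof.
move=> A; rewrite /dnbhs/= => -[e /= e0 eA]; have := @cvg_harmonic R => /cvgrPdist_lt /(_ e e0).
by apply: filterS => k hk; apply: eA => //; rewrite /harmonic/= invr_eq0 pnatr_eq0.
Qed.

Lemma grad_quotient {R : realType} n (h : 'cV[R]_n -> R) x i : differentiable (h : _ -> R^o) x ->
  (harmonic k)^-1 * (h (x + harmonic k *: delta_mx i 0) - h x) @[k --> \oo] --> grad h x i 0.
Proof.
move=> dh; have := cvg_comp _ _ (@harmonic_dnbhs R) (@diff_derivable _ _ _ h x (delta_mx i 0) dh).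
rewrite mxE /derive => c; apply: cvg_trans c; apply: near_eq_cvg; apply: nearW => k.
by rewrite [x + _]addrC.
Qed.

Lemma win_cvg {R : realType} (T c : R) (a : nat -> R) (b : R) : (0 <= c <= T -> a k @[k --> \oo] --> b) ->
  win 0 T c * a k @[k --> \oo] --> win 0 T c * b.
Proof.
move=> H; have [c0|c0] := boolP (0 < c <= T).
  by apply: cvgM; [exact: cvg_cst|apply: H; have /andP[/ltW -> ->] := c0].
rewrite /win (negbTE c0) mul0r (_ : (fun k => _) = fun=> 0); first exact: cvg_cst.
by apply/funext => m; rewrite mul0r.
Qed.

(** * Joint measurability of fields along a process and its laws *)

Section along_process.
Context {R : realType} {d : measure_display} {Omega : measurableType d} (T : R) (hT : 0 < T).
Local Notation tw := (measurableTypeR R * Omega)%type.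
Context {n k : nat}.
Local Notation X := 'cV[R]_n.
Local Notation V := 'cV[R]_k.

Definition right_law (mu : R -> P2 R n) := forall t (u : nat -> R), 0 <= t <= T ->
  (forall k, t <= u k <= T) -> u k @[k --> \oo] --> t -> W2 (mu (u k)) (mu t) @[k --> \oo] --> 0.

Definition pcont (h : R -> X -> P2 R n -> V -> R) := forall (ts : nat -> R) (xs : nat -> X) (ms : nat -> P2 R n) (vs : nat -> V) t x m v,
  (forall k, 0 <= ts k <= T) -> 0 <= t <= T -> ts k @[k --> \oo] --> t -> xs k @[k --> \oo] --> x ->
  W2 (ms k) m @[k --> \oo] --> 0 -> vs k @[k --> \oo] --> v -> h (ts k) (xs k) (ms k) (vs k) @[k --> \oo] --> h t x m v.

Lemma P2continuous_pcont (W : topologicalType) (H : R * (X * V) -> P2 R n -> W) (pr : W -> R) :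
  P2continuous (@timeU R T (X * V)) H ->
  (forall (ws : nat -> W) w, ws k @[k --> \oo] --> w -> pr (ws k) @[k --> \oo] --> pr w) ->
  pcont (fun t x m v => pr (H (t, (x, v)) m)).
Proof.
move=> hH hpr ts xs ms vs t x m v hts ht ct cx cm cv; apply: hpr.
apply: (hH (fun k => (ts k, (xs k, vs k))) ms (t, (x, v)) m) => //.
by apply: cvg_pair_seq => //; exact: cvg_pair_seq.
Qed.

Variables (mu : R -> P2 R n) (hmu : right_law mu).
Variables (x : tw -> X) (v : tw -> V) (mx : measurable_fun setT x) (mv : measurable_fun setT v).

Let along (h : R -> X -> P2 R n -> V -> R) (x : tw -> X) := fun z : tw => win 0 T z.1 * h z.1 (x z) (mu z.1) (v z).

(** The arguments are substituted one at a time. With frozen state and control the field is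
    right-continuous in time, since the laws are; the state and then the control enter by
    continuity, as in a Caratheodory function. *)
Lemma along_meas h (x' : tw -> X) : measurable_fun setT x' -> pcont h -> measurable_fun setT (along h x').
Proof.
move=> mx' hc; have cW m : W2 m m @[_ --> \oo] --> 0 by rewrite W2_refl; exact: cvg_cst.
apply: (@measurable_carath _ _ _ _ (fun z y => win 0 T z.1 * h z.1 (x' z) (mu z.1) y) v) => // [y|z ys y cy]; last first.
  apply: win_cvg => zT; apply: (hc (fun=> z.1 : R) (fun=> x' z) (fun=> mu z.1) ys) => //; exact: cvg_cst.
apply: (@measurable_carath _ _ _ _ (fun z x => win 0 T z.1 * h z.1 x (mu z.1) y) x') => // [y'|z ys y' cy]; last first.
  apply: win_cvg => zT; apply: (hc (fun=> z.1 : R) ys (fun=> mu z.1) (fun=> y)) => //; exact: cvg_cst.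
apply: (@measurable_right_limit _ _ _ T (fun t w => h t y' (mu t) y)) => // s t u ht hu cu.
apply: (hc u (fun=> y') (fun k => mu (u k)) (fun=> y)) => //; [|exact: cvg_cst|exact: hmu|exact: cvg_cst].
by move=> j; have /andP[a ->] := hu j; rewrite andbT; apply: le_trans a; case/andP: ht.
Qed.

Lemma grad_x_meas (h : R -> X -> P2 R n -> V -> R) i : pcont h ->
  (forall t x m v, 0 <= t <= T -> differentiable (fun x => h t x m v : R^o) x) ->
  measurable_fun setT (along (fun t x m v => grad (fun x => h t x m v) x i 0) x).
Proof.
move=> hc hd; apply: (measurable_fun_cvg (h := fun k z => (harmonic k)^-1 * (along h (fun z => x z + harmonic k *: delta_mx i 0) z - along h x z))) => [j|z _].
  apply: measurable_funM => //; apply: measurable_funB; last exact: along_meas.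
  apply: along_meas => //; apply: measurable_mx => a b; rewrite ord1.
  rewrite (_ : (fun z => _) = fun z => x z a 0 + (harmonic j *: delta_mx i 0 : X) a 0); last by apply/funext => z; rewrite !mxE.
  by apply: measurable_funD => //; exact: (measurableT_comp (measurable_coord a) mx).
rewrite (_ : (fun k => _) = fun k => win 0 T z.1 * ((harmonic k)^-1 * (h z.1 (x z + harmonic k *: delta_mx i 0) (mu z.1) (v z) - h z.1 (x z) (mu z.1) (v z)))); last first.
  by apply/funext => j; rewrite /along -mulrBr mulrCA.
by apply: win_cvg => zT; apply: (grad_quotient (h := fun x => h z.1 x (mu z.1) (v z))); apply: hd.
Qed.

End along_process.

Section along_lfd.
Context {R : realType} {d : measure_display} {Omega : measurableType d} (T : R) (hT : 0 < T).
Local Notation tw := (measurableTypeR R * Omega)%type.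
Context {n k : nat}.
Local Notation X := 'cV[R]_n.
Local Notation V := 'cV[R]_k.
Variables (mu : R -> P2 R n) (hmu : right_law T mu) (hmix : forall e y, right_law T (fun t => mixP2 e (mu t) (diracP2 y))).
Variables (x : tw -> X) (v : tw -> V) (mx : measurable_fun setT x) (mv : measurable_fun setT v).

(* the derivative in the measure is recovered from [h] along dirac perturbations of the law *)
Lemma grad_lfd_meas (h : R -> X -> P2 R n -> V -> R) dh y i : pcont T h ->
  (forall t x v, 0 <= t <= T -> is_lfd (fun m => h t x m v) (fun m => dh t x m v)) ->
  (forall t x m v y, 0 <= t <= T -> differentiable (dh t x m v : X -> R^o) y) ->
  measurable_fun setT (fun z : tw => win 0 T z.1 * grad (dh z.1 (x z) (mu z.1) (v z)) y i 0).
Proof.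
move=> hc hl hd.
(* Dirac perturbations only yield the derivative minus its mean; the mean is constant in [y] and
   drops out of the gradient. *)
pose D (z : tw) y := dh z.1 (x z) (mu z.1) (v z) y - \int[mu z.1]_y dh z.1 (x z) (mu z.1) (v z) y.
have mD y' : measurable_fun setT (fun z => win 0 T z.1 * D z y').
  apply: (measurable_fun_cvg (h := fun k z => (harmonic k)^-1 * (win 0 T z.1 * h z.1 (x z) (mixP2 (harmonic k) (mu z.1) (diracP2 y')) (v z) - win 0 T z.1 * h z.1 (x z) (mu z.1) (v z)))) => [j|z _].
    apply: measurable_funM => //; apply: measurable_funB.
      exact: (along_meas hT (hmix (harmonic j) y') mv mx hc).
    exact: (along_meas hT hmu mv mx hc).
  rewrite (_ : (fun k => _) = fun k => win 0 T z.1 * ((harmonic k)^-1 * (h z.1 (x z) (mixP2 (harmonic k) (mu z.1) (diracP2 y')) (v z) - h z.1 (x z) (mu z.1) (v z)))); last first.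
    by apply/funext => j; rewrite -mulrBr mulrCA.
  by apply: win_cvg => zT; exact: (lfd_diracP2 (hl _ _ _ zT)).
apply: (measurable_fun_cvg (h := fun k z => (harmonic k)^-1 * (win 0 T z.1 * D z (y + harmonic k *: delta_mx i 0) - win 0 T z.1 * D z y))) => [j|z _].
  by apply: measurable_funM => //; apply: measurable_funB.
rewrite (_ : (fun k => _) = fun k => win 0 T z.1 * ((harmonic k)^-1 * (dh z.1 (x z) (mu z.1) (v z) (y + harmonic k *: delta_mx i 0) - dh z.1 (x z) (mu z.1) (v z) y))); last first.
  by apply/funext => j; rewrite -mulrBr mulrCA /D; congr (_ * (_ * _)); ring.
by apply: win_cvg => zT; apply: grad_quotient; exact: hd.
Qed.

End along_lfd.

Section laws_of_process.
Context {R : realType} {d : measure_display} {Omega : measurableType d}.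
Context (P : probability Omega R) (T : R) (F : R -> set (set Omega)) (hT : 0 < T).
Context {n0 kappa : nat} (B : R -> Omega -> 'cV[R]_n0).
Context (lam : {sigma_finite_measure set 'cV[R]_kappa -> \bar R}).
Context (N : Omega -> {measure set (R * 'cV[R]_kappa)%type -> \bar R}).
Hypothesis hn : noise_setting P T F B lam N.
Context {n : nat} (Y : R -> Omega -> 'cV[R]_n) (hY : forall i, cadlag_S2 P T F (fun t w => Y t w i 0)).
Local Notation tw := (measurableTypeR R * Omega)%type.

Lemma cadlag_sqi t : 0 <= t <= T -> sq_integrable P (Y t).
Proof. by move=> ht; apply: L2f_sqi => i; exact: (cs_L2 hn (hY i)). Qed.

Lemma cadlag_bound : exists2 C, 0 <= C & forall t, 0 <= t <= T -> \int[P]_w sqn (Y t w) <= C.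
Proof.
have /choice[G hG] i : exists G : Omega -> R, intg P G /\ {ae P, forall w, forall t, 0 <= t <= T -> Y t w i 0 ^+ 2 <= G w}.
  by have [G h1 h2] := cs_max (hY i); exists G.
have bd t : 0 <= t <= T -> \int[P]_w sqn (Y t w) <= \sum_i \int[P]_w G i w.
  move=> ht; have LY i := cs_L2 hn (hY i) ht.
  rewrite (_ : \int[P]_w sqn (Y t w) = \int[P]_w \sum_i Y t w i 0 ^+ 2); last by apply: eq_Rintegral => w _; rewrite sqnE.
  rewrite Rint_sum => [|i]; last exact: (LY i).2.
  apply: ler_sum => i _; apply: Rint_ae_le; [exact: (LY i).2|exact: (hG i).1|].
  by move: (hG i).2; apply: filterS => w; apply.
exists (\sum_i \int[P]_w G i w) => //.
have t0 : 0 <= (0 : R) <= T by rewrite lexx ltW.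
by apply: le_trans (bd 0 t0); apply: Rint_ge0 => w; exact: sqn_ge0.
Qed.

Let increment_cvg0 t (u : nat -> R) : 0 <= t <= T -> (forall k, t <= u k <= T) -> u k @[k --> \oo] --> t ->
  \int[P]_w sqn (Y (u k) w - Y t w) @[k --> \oo] --> 0.
Proof.
move=> ht hu cu; have hu0 k : 0 <= u k <= T.
  by have /andP[a ->] := hu k; rewrite andbT; apply: le_trans a; case/andP: ht.
have LD k i : L2f P (fun w => Y (u k) w i 0 - Y t w i 0) by apply: L2fB; exact: (cs_L2 hn (hY i)).
rewrite (_ : (fun k => _) = fun k => \sum_i \int[P]_w (Y (u k) w i 0 - Y t w i 0) ^+ 2); last first.
  apply/funext => k; rewrite -Rint_sum => [|i]; last exact: (LD k i).2.
  by apply: eq_Rintegral => w _; rewrite sqnE; apply: eq_bigr => i _; rewrite !mxE.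
rewrite [X in _ --> X](_ : 0 = \sum_(i < n) 0); last by rewrite big1.
apply: cvg_sumR => i; have [G IG hG] := cs_max (hY i).
rewrite -[X in _ --> X](Rint0 P); apply: (@Rint_dct _ _ _ P (fun k w => (Y (u k) w i 0 - Y t w i 0) ^+ 2) (fun=> 0) (fun w => 4 * G w) _ _ _ _ _).2.
- by move=> k; apply: measurable_funX; exact: (LD k i).1.
- exact: measurable_cst.
- apply: aeW => w; have c : Y (u k) w i 0 - Y t w i 0 @[k --> \oo] --> 0.
    rewrite -(subrr (Y t w i 0)); apply: cvgB; last exact: cvg_cst.
    apply: (@right_cvg_seq _ T (fun s => Y s w i 0) t) => // tT.
    by apply: (cs_right (hY i)) => //; case/andP: ht.
  by rewrite -[X in _ --> X](mulr0 0); exact: (cvgM c c).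
- exact: intgZ.
- move: hG; apply: filterS => w h k; rewrite ger0_norm ?sqr_ge0//.
  have := h t ht; have := h _ (hu0 k); move: (Y t w i 0) (Y (u k) w i 0) (G w) => a b c h1 h2.
  by have := sqr_ge0 (a + b); nra.
Qed.

Let sqrt_cvg0 (a : nat -> R) : a k @[k --> \oo] --> 0 -> Num.sqrt (a k) @[k --> \oo] --> 0.
Proof. by move=> ca; have := cvg_comp _ _ ca (@sqrt_continuous R 0); rewrite sqrtr0; exact. Qed.

Lemma right_law_process : right_law T (fun t => law P (Y t)).
Proof.
move=> t u ht hu cu; have hu0 k : 0 <= u k <= T.
  by have /andP[a ->] := hu k; rewrite andbT; apply: le_trans a; case/andP: ht.
apply: (@squeeze_cvgr _ _ _ _ (fun=> 0) (fun k => nrmL2 P (fun w => Y (u k) w - Y t w))).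
- by apply: nearW => k; rewrite W2_ge0 W2_law//; exact: cadlag_sqi.
- exact: cvg_cst.
- by apply: sqrt_cvg0; exact: increment_cvg0.
Qed.

Lemma right_law_mix e y : right_law T (fun t => mixP2 e (law P (Y t)) (diracP2 y)).
Proof.
move=> t u ht hu cu; have hu0 k : 0 <= u k <= T.
  by have /andP[a ->] := hu k; rewrite andbT; apply: le_trans a; case/andP: ht.
apply: (@squeeze_cvgr _ _ _ _ (fun=> 0) (fun k => nrmL2 P (fun w => Y (u k) w - Y t w))).
- apply: nearW => k; rewrite W2_ge0/=; have [c hc cc] := joint_coupling (cadlag_sqi (hu0 k)) (cadlag_sqi ht).
  by apply: W2_mix_dirac hc cc _; apply: Rint_ge0 => w; exact: sqn_ge0.
- exact: cvg_cst.
- by apply: sqrt_cvg0; exact: increment_cvg0.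
Qed.

Lemma process_meas : measurable_fun setT (fun z : tw => win 0 T z.1 *: Y z.1 z.2).
Proof.
apply: measurable_mx => i j; rewrite ord1; have := cs_jointly_measurable hT hn (hY i).
by congr (measurable_fun _ _); apply/funext => z; rewrite mxE.
Qed.

Lemma mom2_law t : 0 <= t <= T -> mom2 (law P (Y t)) = Num.sqrt (\int[P]_w sqn (Y t w)).
Proof.
move=> ht; rewrite /mom2 (law_Rint (cadlag_sqi ht) (h := @sqn R n 1))//; first exact: measurable_sqn.
exact: sqi_intg (cadlag_sqi ht).
Qed.

End laws_of_process.

Lemma L2f_enorm {R : realType} {d} {S : measurableType d} (mu : {measure set S -> \bar R}) n (a : S -> 'cV[R]_n) :
  (forall i, L2f mu (fun s => a s i 0)) -> L2f mu (fun s => enorm (a s)).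
Proof.
move=> La; have ma : measurable_fun setT a by apply: measurable_mx => i j; rewrite ord1; exact: (La i).1.
split; first exact: measurable_enorm.
have : intg mu (fun s => \sum_i a s i 0 ^+ 2) by apply: intg_sum => i; exact: (La i).2.
by apply: eq_intg => s; rewrite enorm_sqr sqnE.
Qed.

(** * State equations as Ito processes *)

Section processes.
Context {R : realType} {d : measure_display} {Omega : measurableType d}.
Context (P : probability Omega R) (T : R) (F : R -> set (set Omega)) (hT : 0 < T).
Context {n kappa : nat} (B : R -> Omega -> 'cV[R]_n).
Context (lam : {sigma_finite_measure set 'cV[R]_kappa -> \bar R}).
Context (N : Omega -> {measure set (R * 'cV[R]_kappa)%type -> \bar R}).
Hypothesis hn : noise_setting P T F B lam N.
Local Notation tw := (measurableTypeR R * Omega)%type.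
Local Notation E := (jumpE R kappa).
Local Notation X := 'cV[R]_n.
Local Notation leb := (lebesgue_measure : {measure set (measurableTypeR R) -> \bar R}).
Local Notation ito_process := (ito_process P T F B lam N).
Local Notation stint := (stint P T F B lam N).

Let itvT : set R := `[0, T].
Let mitvT : measurable (itvT : set (measurableTypeR R)). Proof. exact: measurable_itv. Qed.

Lemma predictable_measurable (D : set (R * Omega)) : predictable_sets T F D -> measurable D.
Proof.
apply: smallest_sub; first split.
- exact: measurable0.
- by move=> A mA; apply: measurableD => //; exact: measurableX.
- by move=> A mA; exact: bigcup_measurable.
have h0 : 0 <= (0 : R) <= T by rewrite lexx ltW.
move=> A [[C FC ->]|[s [t [C [s0 st tT FC ->]]]]].
  apply: measurableX; first exact: measurable_set1.
  exact: (filt_sub (ns_filtration hn) h0 FC).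
have hs : 0 <= s <= T by rewrite s0 (le_trans (ltW st) tT).
apply: measurableX; first exact: measurable_itv.
exact: (filt_sub (ns_filtration hn) hs FC).
Qed.

Lemma win_itv a b r : 0 <= a -> b <= T -> win a b r = win a b r * \1_itvT r :> R.
Proof.
move=> a0 bT; rewrite /win indicE; case: (boolP (_ && _)) => [/andP[ar rb]|]; last by rewrite mul0r.
by rewrite mem_set ?mulr1// /itvT/= in_itv/= (le_trans a0 (ltW ar)) (le_trans rb bT).
Qed.

Lemma win_win s t r : 0 <= s -> t <= T -> win s t r * win 0 T r = win s t r :> R.
Proof.
move=> s0 tT; rewrite /win; case: (boolP (s < r <= t)) => [/andP[sr rt]|]; last by rewrite mul0r.
by rewrite (le_lt_trans s0 sr) (le_trans rt tT) mulr1.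
Qed.

Lemma M2_L2 k l (a : R -> Omega -> 'M[R]_(k, l)) i j : M2 P T F a -> L2f (dtP P) (fun z : tw => win 0 T z.1 * a z.1 z.2 i j).
Proof.
move=> [ma ia].
have mD : measurable_fun (itvT `*` setT) (fun z : R * Omega => a z.1 z.2).
  by move=> _ U mU; apply: predictable_measurable; exact: ma.
have [m1 e1] := @iterated_dtP _ _ _ P itvT (fun r w => a r w i j ^+ 2) mitvT
   (measurable_funX 2 (measurableT_comp (measurable_entry i j) mD)) (fun r w => sqr_ge0 _).
have mij : measurable_fun setT (fun z : tw => \1_itvT z.1 * a z.1 z.2 i j).
  have := @measurable_indicM _ _ _ (itvT `*` setT) (fun z : tw => a z.1 z.2 i j) (measurableX mitvT measurableT)
     (measurableT_comp (measurable_entry i j) mD).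
  congr (measurable_fun _ _); apply/funext => z; rewrite !indicE; congr ((_ : bool)%:R * _).
  by apply/idP/idP; rewrite !inE => // -[].
suff L : L2f (dtP P) (fun z : tw => \1_itvT z.1 * a z.1 z.2 i j).
  have := win_mul_L2 0 T L; congr (L2f _ _); apply/funext => z.
  by rewrite mulrA -win_itv.
split => //; apply: intg_lty => [|z|]; [exact: measurable_funX|exact: sqr_ge0|].
rewrite (_ : (fun z : tw => _) = fun z : tw => (\1_itvT z.1 * a z.1 z.2 i j ^+ 2)%:E); last first.
  apply/funext => z; congr EFin; rewrite exprMn; congr (_ * _).
  by rewrite indicE; case: (_ \in _); rewrite ?expr1n ?expr0n.
rewrite -e1; apply: le_lt_trans ia; apply: ge0_integral_mono => w _.
  by apply: integral_ge0 => r _; rewrite lee_fin sqr_ge0.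
by apply: ge0_integral_mono => r _; rewrite lee_fin ?sqr_ge0// entry_sqr_le.
Qed.

(** A closed interval and the half-open window differ by the left endpoint, a null set.
    Measurability is asked of [k] only, so [h] can be the driver as it is written in the
    equation. *)
Lemma integral_itv_ae (a b : R) (h k : R -> R) : measurable_fun setT (fun r : measurableTypeR R => win a b r * k r) ->
  {ae leb, forall r, a < r <= b -> h r = k r} ->
  (\int[lebesgue_measure]_(r in `[a, b]) (h r)%:E = \int[leb]_r (win a b r * k r)%:E)%E.
Proof.
move=> mh [A' [mA' A0' hA']]; rewrite integral_indicM.
apply: (@Rint_ae_eq_left _ _ _ leb (fun r => \1_(`[a, b]) r * h r)) => //.
have [A [mA A0 hA]] := lebesgue_ae_neq a; exists (A `|` A'); split => [||r /= hr]; first exact: measurableU.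
  exact: (etrans (measureU0 mA mA' A0') A0).
apply: contrapT => /not_orP[nA nA']; have ra : r <> a by apply: contrapT => h'; exact/nA/hA.
have hk : a < r <= b -> h r = k r by apply: contrapT => h'; exact/nA'/hA'.
apply: hr; rewrite /win indicE mem_setE in_itv/= le_eqVlt eq_sym (introF eqP ra)/=.
by case: (boolP (_ && _)) => [/hk ->|_]; rewrite ?mul0r.
Qed.

Lemma Rint_itv_ae (a b : R) (h k : R -> R) : measurable_fun setT (fun r : measurableTypeR R => win a b r * k r) ->
  {ae leb, forall r, a < r <= b -> h r = k r} ->
  \int[lebesgue_measure]_(r in `[a, b]) h r = \int[leb]_r (win a b r * k r).
Proof. by move=> mh hk; rewrite /Rintegral (integral_itv_ae mh hk). Qed.

Lemma Rint_itv (a b : R) (h : R -> R) : measurable_fun setT (fun r : measurableTypeR R => win a b r * h r) ->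
  \int[lebesgue_measure]_(r in `[a, b]) h r = \int[leb]_r (win a b r * h r).
Proof. by move=> mh; apply: Rint_itv_ae => //; apply: aeW. Qed.

Lemma stint_ext Q K I Q' K' I' : stint Q K I -> (forall j z, Q j z = Q' j z) -> (forall z, K z = K' z) ->
  (forall w, I w = I' w) -> stint Q' K' I'.
Proof.
move=> h hQ hK hI; have <- : Q = Q' by apply/funext => j; apply/funext => z; exact: hQ.
have <- : K = K' by apply/funext => z; exact: hK.
by have <- : I = I' by apply/funext => w; exact: hI.
Qed.

Lemma stint_null I : stint (fun _ => fun=> 0) (fun=> 0) I -> {ae P, forall w, I w = 0}.
Proof.
move=> sI; have [_ _ LI _] := sI; apply: n2_eq0 => //.
rewrite /n2 (_ : \int[P]_w _ = \int[P]_w (I w * I w)); last by apply: eq_Rintegral => w _; rewrite expr2.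
rewrite (stint_isometry hn sI sI) big1 => [|j _].
  by rewrite add0r (_ : (fun _ => _) = fun=> 0) ?Rint0//; apply/funext => z; rewrite mulr0.
by rewrite (_ : (fun _ => _) = fun=> 0) ?Rint0//; apply/funext => z; rewrite mulr0.
Qed.

Lemma win_same t r : win t t r = 0 :> R.
Proof. by rewrite /win; case: (ltP t r) => // h; rewrite leNgt h. Qed.

Section state.
Context {k : nat}.
Local Notation V := 'cV[R]_k.
Context (b : R -> X -> P2 R n -> V -> X) (db : R -> X -> P2 R n -> V -> X -> X) (L : R).
Hypothesis hb : A1_coef T L b db.
Variables (Z : R -> Omega -> X) (v : R -> Omega -> V) (hZ : S2 P T F Z) (hv : M2 P T F v).

Let cZ i := S2_cadlag hT hn hZ i.

Definition drift i (z : tw) := win 0 T z.1 * b z.1 (Z z.1 z.2) (law P (Z z.1)) (v z.1 z.2) i 0.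

Lemma M2_meas : measurable_fun setT (fun z : tw => win 0 T z.1 *: v z.1 z.2).
Proof.
apply: measurable_mx => i j; rewrite ord1; have := (M2_L2 i 0 hv).1.
by congr (measurable_fun _ _); apply/funext => z; rewrite mxE.
Qed.

Lemma along_coef_meas (h : R -> X -> P2 R n -> V -> R) : pcont T h ->
  measurable_fun setT (fun z : tw => win 0 T z.1 * h z.1 (Z z.1 z.2) (law P (Z z.1)) (v z.1 z.2)).
Proof.
move=> hc; have := along_meas hT (right_law_process hn cZ) M2_meas (process_meas hT hn cZ) hc.
congr (measurable_fun _ _); apply/funext => z; rewrite /win; case: (boolP (_ && _)) => // _; first by rewrite !scale1r.
by rewrite !mul0r.
Qed.

Lemma mom2_bound : exists2 M, 0 <= M & forall t, 0 <= t <= T -> mom2 (law P (Z t)) <= M.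
Proof.
have [C C0 hC] := cadlag_bound hT hn cZ; exists (Num.sqrt C) => [|t ht]; first exact: sqrtr_ge0.
by rewrite (mom2_law hn cZ ht) ler_wsqrtr// hC.
Qed.

Lemma win_enorm_L2 l (a : tw -> 'cV[R]_l) : (forall i, L2f (dtP P) (fun z => win 0 T z.1 * a z i 0)) ->
  L2f (dtP P) (fun z => win 0 T z.1 * enorm (a z)).
Proof.
move=> La; have : L2f (dtP P) (fun z => enorm (win 0 T z.1 *: a z)).
  by apply: L2f_enorm => i; have := La i; congr (L2f _ _); apply/funext => z; rewrite mxE.
congr (L2f _ _); apply/funext => z; rewrite enormZ; congr (_ * _).
by rewrite ger0_norm// /win; case: (_ && _).
Qed.

Lemma win_cst_L2 (C : R) : L2f (dtP P) (fun z => win 0 T z.1 * C).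
Proof. exact: (win_prod_L2 0 T (L2f_cst P C)). Qed.

Lemma linear_growth_L2 (C M : R) :
  L2f (dtP P) (fun z : tw => win 0 T z.1 * (C * (1 + enorm (Z z.1 z.2) + M + enorm (v z.1 z.2)))) .
Proof.
have LZ : L2f (dtP P) (fun z : tw => win 0 T z.1 * enorm (Z z.1 z.2)).
  by apply: (win_enorm_L2 (a := fun z => Z z.1 z.2)) => i; exact: (cs_L2_prod hT hn (cZ i)).
have Lv : L2f (dtP P) (fun z : tw => win 0 T z.1 * enorm (v z.1 z.2)).
  by apply: (win_enorm_L2 (a := fun z => v z.1 z.2)) => i; exact: M2_L2.
have := L2fD (win_cst_L2 (C * (1 + M))) (L2fZ C (L2fD LZ Lv)).
by congr (L2f _ _); apply/funext => z; ring.
Qed.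

Lemma drift_L2 i : L2f (dtP P) (drift i).
Proof.
have [M M0 hM] := mom2_bound; apply: (L2f_le _ _ (linear_growth_L2 `|L| M)).
  apply: (along_coef_meas (h := fun t x m v => b t x m v i 0)); apply: (P2continuous_pcont (A1_cont hb) (pr := fun x : X => x i 0)) => ws w; exact: coord_cvg.
move=> z; rewrite /drift !normrM; have [h|h] := boolP (0 < z.1 <= T); last by rewrite /win (negbTE h) normr0 !mul0r.
rewrite ler_wpM2l// -normrM; apply: le_trans (coord_le _ _) _; apply: le_trans (ler_norm _).
have ht : 0 <= (z.1 : R) <= T by have /andP[/ltW -> ->] := h.
apply: le_trans (A1_growth hb _ _ _ ht) _; have := hM _ ht; have := sqrtr_ge0 (\int[law P (Z z.1)]_x sqn x).
rewrite -/(mom2 (law P (Z z.1))); move: (enorm_ge0 (Z z.1 z.2)) (enorm_ge0 (v z.1 z.2)).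
move: (enorm _) (enorm _) (mom2 _) => e1 e2 m2 h1 h2 h3 h4.
by apply: le_trans (ler_wpM2r _ (ler_norm L)) _; [lra|rewrite ler_wpM2l//; lra].
Qed.

Variables (xi : Omega -> X) (sg : R -> Omega -> 'M[R]_n) (G : R -> Omega -> 'cV[R]_kappa -> X).
Hypothesis eqZ : forall t, 0 <= t <= T -> exists I K,
  [/\ ito_integral P T F B sg 0 t I, jump_integral P T F lam N G 0 t K &
      {ae P, forall w, Z t w = xi w + vint lebesgue_measure `[0, t]
            (fun s => b s (Z s w) (law P (Z s)) (v s w)) + I w + K w}].

(** At time 0 both stochastic integrals run over an empty window and vanish by the isometry. *)
Lemma state_start : {ae P, forall w, Z 0 w = xi w}.
Proof.
have h0 : 0 <= (0 : R) <= T by rewrite lexx ltW.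
have [I [K [hI hK e]]] := eqZ h0.
have sI i : stint (fun _ => fun=> 0) (fun=> 0) (fun w => I w i 0 + 1 * K w i 0).
  apply: (stint_ext (stint_comb hn 1 (ito_stint hn (lexx 0) (lexx 0) (ltW hT) i hI) (jump_stint hn (lexx 0) (lexx 0) (ltW hT) i hK))) => [j z|z|//].
  - by rewrite win_same; ring.
  - by rewrite win_same; ring.
have I0 : {ae P, forall w i, I w i 0 + 1 * K w i 0 = 0}.
  by apply: filter_forall => i; exact: stint_null.
move: e I0; apply: filterS2 => w -> I0; apply/matrixP => i j; rewrite (ord1 j).
have c4 (x1 x2 x3 x4 : X) : (x1 + x2 + x3 + x4) i 0 = x1 i 0 + x2 i 0 + x3 i 0 + x4 i 0 by rewrite !mxE.
rewrite c4 [X in _ + X + _ + _](_ : _ = 0); first by have := I0 i; lra.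
rewrite mxE (Rint_itv_ae (k := fun=> 0)).
- by rewrite -[RHS](Rint0 leb); apply: eq_Rintegral => r _; rewrite mulr0.
- rewrite (_ : (fun r => _) = fun=> 0); first exact: measurable_cst.
  by apply/funext => r; rewrite mulr0.
by apply: aeW => r /andP[r0]; rewrite leNgt r0.
Qed.

(** For each time the equation supplies its own versions of the integrals from 0. The martingale
    part of an increment is the difference of the versions at [t] and at [s], an integral over []s,
    t]] by linearity. *)
Lemma state_ito i : ito_process (fun t w => Z t w i 0) (drift i)
  (fun j z => win 0 T z.1 * sg z.1 z.2 i j) (fun z => win 0 T z.1.1 * (\1_E z.2 * G z.1.1 z.1.2 z.2 i 0)).
Proof.
have hTT : 0 <= T <= T by rewrite lexx (ltW hT).
split; first exact: cZ.
- exact: drift_L2.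
- move=> j; have [I [K [hI _ _]]] := eqZ hTT.
  by have [LQ _ _ _] := ito_stint hn (lexx 0) (ltW hT) (lexx T) i hI; exact: LQ.
- have [I [K [_ hK _]]] := eqZ hTT.
  by have [_ LK _ _] := jump_stint hn (lexx 0) (ltW hT) (lexx T) i hK.
move=> s t s0 st tT; have t0 := le_trans s0 st; have sT := le_trans st tT.
have [Is [Ks [hIs hKs es]]] := eqZ (introT andP (conj s0 sT)).
have [It [Kt [hIt hKt et]]] := eqZ (introT andP (conj t0 tT)).
have sIs := ito_stint hn (lexx 0) s0 sT i hIs; have sIt := ito_stint hn (lexx 0) t0 tT i hIt.
have sKs := jump_stint hn (lexx 0) s0 sT i hKs; have sKt := jump_stint hn (lexx 0) t0 tT i hKt.
have dw r : win 0 t r + -1 * win 0 s r = win s t r :> R.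
  rewrite /win mulN1r; case: (ltP 0 r) => r0 /=; last by rewrite ltNge (le_trans r0 s0) subrr.
  by rewrite ltNge; case: (leP r s) => rs /=; [rewrite (le_trans rs st) subrr|rewrite subr0].
exists (fun w => (It w i 0 + Kt w i 0) - (Is w i 0 + Ks w i 0)).
  apply: (stint_ext (stint_comb hn (-1) (stint_comb hn 1 sIt sKt) (stint_comb hn 1 sIs sKs))) => [j z|z|w].
  - by rewrite mulrA win_win// -dw; ring.
  - by rewrite [RHS]mulrA win_win// -dw; ring.
  - by ring.
have dE w a c : 0 <= a -> c <= T -> \int[lebesgue_measure]_(r in `[a, c]) b r (Z r w) (law P (Z r)) (v r w) i 0
    = tint (fun z => win a c z.1 * drift i z) w.
  move=> a0 cT; have e r : win a c r * b r (Z r w) (law P (Z r)) (v r w) i 0 = win a c r * drift i (r, w).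
    by rewrite /drift/= mulrA win_win.
  rewrite Rint_itv; first by apply: eq_Rintegral => r _; exact: e.
  rewrite (_ : (fun r => _) = fun r => win a c r * drift i (r, w)); last by apply/funext => r; exact: e.
  apply: measurable_funM; first exact: (win_L2 a c).1.1.
  exact: (measurableT_comp (drift_L2 i).1 (measurable_pair2 w)).
have hint := ae_time_section (P := P) (f := fun z => win 0 t z.1 * drift i z).
have {hint} : {ae P, forall w, intg leb (fun r : measurableTypeR R => win 0 t r * drift i (r, w))}.
  apply: hint; have := L2f_mul (win_prod_L2 0 t (L2f_cst P 1)) (drift_L2 i).
  by apply: eq_intg => z; rewrite mulr1.
apply: filterS3 es et => w Zs Zt hw; rewrite Zs Zt !mxE (dE w 0 t)// (dE w 0 s)//.
by rewrite (tint_split s0 st hw); ring.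
Qed.

End state.
End processes.

Lemma L2f_ae_le {R : realType} {d} {S : measurableType d} (mu : {measure set S -> \bar R}) (f g : S -> R) :
  measurable_fun setT f -> L2f mu g -> {ae mu, forall x, `|f x| <= `|g x|} -> L2f mu f.
Proof.
move=> mf [mg Ig] fg; split => //.
apply: intg_lty => [|x|]; [exact: measurable_funX|exact: sqr_ge0|].
apply: le_lt_trans (intg_ltpinfty _ Ig) => [|x]; last exact: sqr_ge0.
apply: ae_ge0_le_integral => //.
- by move=> x _; rewrite lee_fin sqr_ge0.
- by apply/measurable_EFinP; exact: measurable_funX.
- by move=> x _; rewrite lee_fin sqr_ge0.
- by apply/measurable_EFinP; exact: measurable_funX.
move: fg; apply: filterS => x h _; rewrite lee_fin -(real_normK (num_real (f x))) -(real_normK (num_real (g x))).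
by rewrite lerXn2r ?nnegrE.
Qed.

Section jump_adjoint.
Context {R : realType} {d : measure_display} {Omega : measurableType d}.
Context (P : probability Omega R) (T : R) (hT : 0 < T) {n kappa : nat}.
Context (lam : {sigma_finite_measure set 'cV[R]_kappa -> \bar R}).
Local Notation tw := (measurableTypeR R * Omega)%type.
Local Notation E := (jumpE R kappa).
Local Notation X := 'cV[R]_n.

Let win01 t : win 0 T t = 0 :> R \/ win 0 T t = 1 :> R /\ 0 <= t <= T.
Proof.
rewrite /win; case: (boolP (_ && _)) => [/andP[/ltW -> ->]|_]; by [right|left].
Qed.

Variables (r : R -> Omega -> 'cV[R]_kappa -> X).
Hypothesis Lr : forall k, L2f (dtPl P lam) (fun z : tw * 'cV[R]_kappa => win 0 T z.1.1 * (\1_E z.2 * r z.1.1 z.1.2 z.2 k 0)).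

Variables (gg : R -> 'cV[R]_kappa -> 'M[R]_n) (L : R).
Hypothesis mg : forall i j, measurable_fun setT (fun z : measurableTypeR R * 'cV[R]_kappa => win 0 T z.1 * (\1_E z.2 * gg z.1 z.2 i j)).
Hypothesis bg : forall t, 0 <= t <= T -> (\int[lam]_(e in E) (opnorm (gg t e) ^+ 2)%:E <= (L ^+ 2)%:E)%E.

Let f1 k i (z : tw * 'cV[R]_kappa) := win 0 T z.1.1 * (\1_E z.2 * gg z.1.1 z.2 k i).
Let f2 k (z : tw * 'cV[R]_kappa) := win 0 T z.1.1 * (\1_E z.2 * r z.1.1 z.1.2 z.2 k 0).

Let f1_bound k i (z : tw) : (\int[lam]_e (f1 k i (z, e) ^+ 2)%:E <= (win 0 T z.1 * L ^+ 2)%:E)%E.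
Proof.
have [w0|[w1 hz]] := win01 z.1.
  by rewrite integral0_eq => [|e _]; rewrite /f1/= w0 !mul0r ?expr0n.
rewrite w1 mul1r; apply: le_trans (bg hz); rewrite [leRHS]integral_indicM; apply: ge0_integral_mono => e _.
  by rewrite lee_fin sqr_ge0.
rewrite -EFinM lee_fin /f1/= w1 mul1r exprMn indicE; case: (_ \in _); rewrite ?expr1n ?expr0n ?mul1r ?mul0r//.
by rewrite -(real_normK (num_real (gg _ _ _ _))) lerXn2r ?nnegrE ?opnorm_ge0// entry_opnorm.
Qed.

Let mf1 k i : measurable_fun setT (f1 k i).
Proof.
have m2 : measurable_fun setT (fun z : tw * 'cV[R]_kappa => (z.1.1, z.2) : measurableTypeR R * 'cV[R]_kappa).
  by apply: measurable_fun_pair => //; exact: (measurableT_comp measurable_fst measurable_fst).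
exact: (measurableT_comp (mg k i) m2).
Qed.

Let Lf1 k i : L2f (dtPl P lam) (f1 k i).
Proof.
split => //; apply: intg_lty => [|z|]; [exact: measurable_funX|exact: sqr_ge0|].
have mE2 : measurable_fun setT (fun z => (f1 k i z ^+ 2)%:E) by apply/measurable_EFinP; exact: measurable_funX.
rewrite [ltLHS](@fubini_tonelli1 _ _ _ _ R (dtP P) lam _ mE2); last by move=> z; rewrite lee_fin sqr_ge0.
apply: (@le_lt_trans _ _ (\int[dtP P]_z (win 0 T z.1 * L ^+ 2)%:E)%E).
  apply: ge0_integral_mono => z _; last exact: f1_bound.
  by apply: integral_ge0 => e _; rewrite lee_fin sqr_ge0.
apply: intg_ltpinfty => [z|]; first by rewrite mulr_ge0// ?sqr_ge0// /win; case: (_ && _).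
have := L2f_mul (win_prod_L2 0 T (L2f_cst P 1)) (win_prod_L2 0 T (L2f_cst P (L ^+ 2))).
by apply: eq_intg => z; rewrite mulr1 mulrA winM.
Qed.

(** Cauchy-Schwarz in the mark: the square mark norm of [gg] is at most [L^2] at every time, so each
    entry contributes at most [L^2] times the square mark norm of [r]. *)
Lemma jadj_L2 i : L2f (dtP P) (fun z : tw => win 0 T z.1 * jadj lam (gg z.1) (r z.1 z.2) i 0).
Proof.
have I12 k : intg (dtPl P lam) (fun z => f1 k i z * f2 k z) by apply: L2f_mul; [exact: Lf1|exact: Lr].
have Is : intg (dtPl P lam) (fun z => \sum_k f1 k i z * f2 k z) by exact: intg_sum.
have Ef z : win 0 T z.1 * jadj lam (gg z.1) (r z.1 z.2) i 0 = \int[lam]_e \sum_k f1 k i (z, e) * f2 k (z, e).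
  have [w0|[w1 hz]] := win01 z.1.
    rewrite w0 mul0r -[LHS](Rint0 lam); apply/esym.
    by apply: eq_Rintegral => e _; apply: big1 => k _; rewrite /f1/= w0 !mul0r.
  rewrite w1 mul1r mxE Rint_indic; apply: eq_Rintegral => e _.
  rewrite mxE mulr_sumr; apply: eq_bigr => k _; rewrite /f1 /f2/= w1 !mul1r mxE.
  by rewrite indicM_sqr.
rewrite (_ : (fun z => _) = fun z => \int[lam]_e \sum_k f1 k i (z, e) * f2 k (z, e)); last by apply/funext => z; exact: Ef.
have [J1 _ A1] := @sfprod_intg _ _ _ _ _ (dtP P) lam _ Is.
have /choice[rho hrho] k : exists rho : tw -> R, [/\ intg (dtP P) rho, (forall z, 0 <= rho z) & {ae dtP P, forall z, (\int[lam]_e (f1 k i (z, e) * f2 k (z, e))) ^+ 2 <= L ^+ 2 * rho z /\ intg lam (fun e => f1 k i (z, e) * f2 k (z, e))}].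
  have [K1 _ B1] := @sfprod_intg _ _ _ _ _ (dtP P) lam _ (Lf1 k i).2.
  have [K2 _ B2] := @sfprod_intg _ _ _ _ _ (dtP P) lam _ (Lr k).2.
  exists (fun z => \int[lam]_e f2 k (z, e) ^+ 2); split => // [z|]; first by apply: Rint_ge0 => e; exact: sqr_ge0.
  move: B1 B2; apply: filterS2 => z b1 b2.
  have l1 : L2f lam (fun e => f1 k i (z, e)) by split => //; exact: (measurableT_comp (mf1 k i) (measurable_pair1 z)).
  have l2 : L2f lam (fun e => f2 k (z, e)) by split => //; exact: (measurableT_comp (Lr k).1 (measurable_pair1 z)).
  split; last exact: L2f_mul.
  apply: le_trans (CS_Rint l1 l2) _; rewrite ler_wpM2r ?n2_ge0//.
  have := f1_bound k i z; rewrite -EFin_Rint// lee_fin => /le_trans; apply.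
  by have [->|[-> _]] := win01 z.1; rewrite ?mul0r ?mul1r ?sqr_ge0.
apply: (@L2f_ae_le _ _ _ _ _ (fun z => \sum_k `|L| * Num.sqrt (rho k z))).
- exact: intg_meas J1.
- apply: L2f_sum => k; apply: L2fZ; have [rI r0 _] := hrho k; split.
    by apply: (measurableT_comp (continuous_measurable_fun _)); [exact: sqrt_continuous|exact: intg_meas rI].
  by apply: eq_intg rI => z; rewrite sqr_sqrtr.
have : {ae dtP P, forall z k, (\int[lam]_e (f1 k i (z, e) * f2 k (z, e))) ^+ 2 <= L ^+ 2 * rho k z /\ intg lam (fun e => f1 k i (z, e) * f2 k (z, e))}.
  apply: filter_forall => k; by have [_ _] := hrho k.
apply: filterS => z hz; rewrite Rint_sum => [|k]; last exact: (hz k).2.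
apply: le_trans (ler_norm_sum _ _ _) _; apply: le_trans (ler_norm _).
apply: ler_sum => k _; rewrite -sqrtr_sqr; have [h _] := hz k; have [_ r0 _] := hrho k.
apply: le_trans (ler_wsqrtr h) _; by rewrite sqrtrM ?sqr_ge0// sqrtr_sqr.
Qed.

End jump_adjoint.

Section jump_coefficients.
Context {R : realType} {T L : R} (hT : 0 < T) {n k kappa : nat}.
Context (lam : {sigma_finite_measure set 'cV[R]_kappa -> \bar R}).
Local Notation E := (jumpE R kappa).
Local Notation X := 'cV[R]_n.
Local Notation V := 'cV[R]_k.
Context (gamma : R -> X -> P2 R n -> V -> 'cV[R]_kappa -> X) (dgamma : R -> X -> P2 R n -> V -> X -> 'cV[R]_kappa -> X).
Hypothesis hj : A1_jump T L lam gamma dgamma.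
Variables (g0 : R -> 'cV[R]_kappa -> X) (g1 g2 : R -> 'cV[R]_kappa -> 'M[R]_n).
Hypothesis mg : forall t, 0 <= t <= T -> measurable_fun E (g1 t) /\ measurable_fun E (g2 t).
Hypothesis hg : forall t, 0 <= t <= T -> forall x m v e, E e -> gamma t x m v e = g0 t e + g1 t e *m x + g2 t e *m mean m.

Let mE : measurable E := @measurable_jumpE R kappa.

(** The slopes are only assumed measurable in the mark at each time. Joint measurability is
    recovered by writing their entries as differences of values of [gamma], which is continuous in
    time: between a basis vector and 0 for [g1], between the Dirac laws at these points for [g2]. *)
Let meas_aux (g : R -> 'cV[R]_kappa -> 'M[R]_n) x x' m m' i j : (forall t, 0 <= t <= T -> measurable_fun E (g t)) ->
  (forall t e, 0 <= t <= T -> E e -> g t e i j = gamma t x m 0 e i 0 - gamma t x' m' 0 e i 0) ->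
  measurable_fun setT (fun z : measurableTypeR R * 'cV[R]_kappa => win 0 T z.1 * (\1_E z.2 * g z.1 z.2 i j)).
Proof.
move=> mgg gE; apply: (@measurable_right_limit _ _ _ T (fun t e => \1_E e * g t e i j) hT) => [t ht|e t u ht hu cu].
  by apply: measurable_indicM => //; exact: (measurableT_comp (measurable_entry i j) (mgg t ht)).
have hu0 l : 0 <= u l <= T.
  by have /andP[a ->] := hu l; rewrite andbT; apply: le_trans a; case/andP: ht.
have [eE|eE] := pselect (E e); last first.
  rewrite indicE memNset// mul0r (_ : (fun l => _) = fun=> 0); first exact: cvg_cst.
  by apply/funext => l; rewrite mul0r.
apply: cvgM; first exact: cvg_cst.
rewrite gE// (_ : (fun l => _) = fun l => gamma (u l) x m 0 e i 0 - gamma (u l) x' m' 0 e i 0); last first.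
  by apply/funext => l; rewrite gE.
have c y mm : gamma (u l) y mm 0 e i 0 @[l --> \oo] --> gamma t y mm 0 e i 0.
  apply: coord_cvg; apply: (A1j_cont hj eE (xs := fun l => (u l, (y, 0))) (ms := fun=> mm) (x := (t, (y, 0)))) => //.
    by apply: cvg_pair_seq; [exact: cu|exact: cvg_cst].
  by rewrite W2_refl; exact: cvg_cst.
by apply: cvgB; exact: c.
Qed.

Let mulmx_delta (A : 'M[R]_n) (i j : 'I_n) : (A *m (delta_mx j 0 : X)) i 0 = A i j.
Proof. by rewrite -colE mxE. Qed.

Let mean_dirac (y : X) : mean (diracP2 y) = y.
Proof. by apply/matrixP => i j; rewrite ord1 mxE Rint_diracP2//; exact: measurable_coord. Qed.

Lemma g1_meas i j : measurable_fun setT (fun z : measurableTypeR R * 'cV[R]_kappa => win 0 T z.1 * (\1_E z.2 * g1 z.1 z.2 i j)).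
Proof.
apply: (meas_aux (x := delta_mx j 0) (x' := 0) (m := diracP2 0) (m' := diracP2 0)) => [t ht|t e ht eE]; first exact: (mg ht).1.
by rewrite !hg// !mean_dirac !mulmx0 !addr0 [X in X - _]mxE mulmx_delta [RHS]addrAC subrr add0r.
Qed.

Lemma g2_meas i j : measurable_fun setT (fun z : measurableTypeR R * 'cV[R]_kappa => win 0 T z.1 * (\1_E z.2 * g2 z.1 z.2 i j)).
Proof.
apply: (meas_aux (x := 0) (x' := 0) (m := diracP2 (delta_mx j 0)) (m' := diracP2 0)) => [t ht|t e ht eE]; first exact: (mg ht).2.
by rewrite !hg// !mean_dirac !mulmx0 !addr0 [X in X - _]mxE mulmx_delta [RHS]addrAC subrr add0r.
Qed.

End jump_coefficients.

(** * Duality and comparison of costs *)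

Section left_limit_process.
Context {R : realType} {d : measure_display} {Omega : measurableType d}.
Context (P : probability Omega R) (T : R) (F : R -> set (set Omega)) (hT : 0 < T).
Context {n kappa : nat} (B : R -> Omega -> 'cV[R]_n).
Context (lam : {sigma_finite_measure set 'cV[R]_kappa -> \bar R}).
Context (N : Omega -> {measure set (R * 'cV[R]_kappa)%type -> \bar R}).
Hypothesis hn : noise_setting P T F B lam N.
Local Notation tw := (measurableTypeR R * Omega)%type.
Local Notation E := (jumpE R kappa).
Local Notation ito_process := (ito_process P T F B lam N).

Variables (Y : R -> Omega -> 'cV[R]_n) (hY : S2 P T F Y).
Variables (f : 'I_n -> tw -> R) (Q : 'I_n -> 'I_n -> tw -> R) (K : 'I_n -> tw * 'cV[R]_kappa -> R).
Hypothesis iY : forall i, ito_process (fun t w => Y t w i 0) (f i) (Q i) (K i).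

Lemma leftlim_coord t w i : 0 < t -> t <= T -> leftlim Y t w i 0 = lim (Y s w i 0 @[s --> t^'-]).
Proof.
move=> t0 tT; have [_ _ hl _] := hY; rewrite /leftlim t0; apply/esym/cvg_lim => //.
by apply: coord_cvg; exact: hl.
Qed.

Lemma leftlim_ae_prod : {ae dtP P, forall z : tw, 0 < (z.1 : R) <= T -> leftlim Y z.1 z.2 = Y z.1 z.2}.
Proof.
have : {ae dtP P, forall (z : tw) i, 0 < (z.1 : R) <= T -> lim (Y s z.2 i 0 @[s --> z.1^'-]) = Y z.1 z.2 i 0}.
  by apply: filter_forall => i; exact: (left_limit_ae_prod hT hn (iY i)).
apply: filterS => z hz zT; apply/matrixP => i j; rewrite (ord1 j).
by have /andP[z0 z1] := zT; rewrite leftlim_coord// hz.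
Qed.

(** The state equation of a control takes the law of the left limit in the jump term, the forward
    equation the law of the current value. Almost surely there is no jump at a given time; equality
    of means suffices because [gamma] depends on the law through its mean. *)
Lemma leftlim_mean t : 0 <= t <= T -> mean (law P (leftlim Y t)) = mean (law P (Y t)).
Proof.
move=> ht; have /andP[t0 tT] := ht.
have LY i := cs_L2 hn (ip_cadlag (iY i)) ht.
move: t0; rewrite le_eqVlt => /orP[/eqP t0|t0].
  by congr (mean (law P _)); apply/funext => w; rewrite /leftlim -t0 ltxx.
have hae i : {ae P, forall w, leftlim Y t w i 0 = Y t w i 0}.
  by apply: filterS (left_limit_ae hn (iY i) t0 tT) => w <-; rewrite leftlim_coord.
have ml i : measurable_fun setT (fun w => leftlim Y t w i 0).
  apply: (measurable_fun_cvg (h := fun m w => Y (leftpt m t) w i 0)) => [m|w _].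
    apply: (cs_meas hn (ip_cadlag (iY i))).
    by have /andP[a b] := leftpt_bounds m t0; rewrite (ltW a) (le_trans (ltW b)).
  have [_ _ hl _] := hY; apply: (@cvg_leftpt _ _ (fun s => Y s w i 0)) => //.
  by rewrite /leftlim t0; apply: coord_cvg; exact: hl.
have Ll i : L2f P (fun w => leftlim Y t w i 0).
  have [_ IY] := LY i; split => //.
  apply/integrableP; split; first by apply/measurable_EFinP; exact: measurable_funX.
  have /integrableP[mI iI] := IY; apply: le_lt_trans iI; rewrite le_eqVlt; apply/orP; left; apply/eqP.
  apply: ae_eq_integral => //.
  - by apply: measurableT_comp => //; apply/measurable_EFinP; exact: measurable_funX.
  - by apply: measurableT_comp => //.
  by apply: filterS (hae i) => w /= ->.
have sl : sq_integrable P (leftlim Y t) by exact: L2f_sqi.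
have sY : sq_integrable P (Y t) by exact: L2f_sqi.
apply/matrixP => i j; rewrite (ord1 j) !mean_law//.
by apply: Rint_ae_eq => //; exact: (LY i).1.
Qed.

Lemma jump_integral_ext (G G' : R -> Omega -> 'cV[R]_kappa -> 'cV[R]_n) a b I : jump_integral P T F lam N G a b I ->
  (forall s w e, 0 <= s <= T -> E e -> G s w e = G' s w e) -> jump_integral P T F lam N G' a b I.
Proof.
move=> [mG mI [H [h1 h2 h3]]] GG; split => //.
  apply: eq_measurable_fun mG => -[[s w] e]; rewrite inE => -[[/= hs _] he]; exact: GG.
exists H; split; [exact: h1| |exact: h3].
apply: cvg_trans h2; apply: near_eq_cvg; apply: nearW => k.
apply: eq_integral => w _; apply: eq_integral => s; rewrite inE /= in_itv/= => hs.
by apply: eq_integral => e; rewrite inE => he; rewrite GG.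
Qed.

End left_limit_process.

(** The difference of the two sides is [((eta z - (u + w))^2 + (u - w)^2) / eta]. *)
Lemma weighted_young (R : realType) (u w z eta : R) : 0 < eta -> 2 * (u + w) * z <= eta * z ^+ 2 + 2 * (u ^+ 2 + w ^+ 2) / eta.
Proof.
move=> e0; have h1 : 0 <= (eta * z - (u + w)) ^+ 2 / eta by rewrite divr_ge0 ?sqr_ge0 ?ltW.
have h2 : 0 <= (u - w) ^+ 2 / eta by rewrite divr_ge0 ?sqr_ge0 ?ltW.
rewrite -subr_ge0 (_ : _ - _ = (eta * z - (u + w)) ^+ 2 / eta + (u - w) ^+ 2 / eta) ?addr_ge0//.
by field; rewrite gt_eqF.
Qed.

(** * Absorbing the remainders: the role of (C-i) and (C-ii) *)

Section remainder_estimate.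
Context {R : realType} {L L0 L1 L2 lam0 : R} {n : nat} (dj : 'I_n.+1 -> nat).
Hypotheses (hlam0 : 0 < lam0) (h0 : 0 <= L0) (h1 : 0 <= L1) (h2 : 0 <= L2) (d0 : (0 < dj ord0)%N).
Local Notation NN := (nctrl dj).+1%:R.
Let C := L ^+ 2 / lam0.

Lemma card_controlled (c : R) : \sum_(i | (0 < dj i)%N) c = NN * c.
Proof.
rewrite big_mkcond big_ord_recl d0 -big_mkcond/= sumr_const -natr1 mulrDl mul1r addrC mulr_natl; congr (_ *+ _ + _).
by apply: eq_card => j; apply/idP/idP => [h|/set_mem h]; [exact: mem_set|exact: h].
Qed.

(** The state and law terms do not depend on the block and are counted once for each controlled
    block; the control terms of the blocks add up to at most [|dv|^2]. *)
Lemma remainder_sum (eta u w : R) (dv : 'cV[R]_(\sum_j dj j)) : 0 < eta ->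
  \sum_(i | (0 < dj i)%N) remainder (L := L) (L0 := L0) (L1 := L1) (L2 := L2) (lam0 := lam0) u w (enorm (submxcol dv i)) <=
  C / 2 * (NN * (L0 * (2 * u ^+ 2 + 3 * w ^+ 2) + L1 * (2 * (u ^+ 2 + w ^+ 2) / eta)) + (L1 * eta + L2) * sqn dv).
Proof.
move=> e0; have C0 : 0 <= C / 2 by rewrite !divr_ge0 ?sqr_ge0 ?ltW.
pose k := L0 * (2 * u ^+ 2 + 3 * w ^+ 2) + L1 * (2 * (u ^+ 2 + w ^+ 2) / eta).
apply: (@le_trans _ _ (\sum_(i | (0 < dj i)%N) C / 2 * (k + (L1 * eta + L2) * sqn (submxcol dv i)))).
  apply: ler_sum => i _; rewrite /remainder -/C ler_wpM2l//.
  have y := weighted_young u w (enorm (submxcol dv i)) e0; rewrite -enorm_sqr /k.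
  move: (enorm _) y => z y.
  have h : 2 * w * u <= u ^+ 2 + w ^+ 2 by have := sqr_ge0 (u - w); nra.
  have hh := ler_wpM2l h0 h; have yy := ler_wpM2l h1 y.
  by move: hh yy; move: (_ / eta) => q; nra.
rewrite -mulr_sumr ler_wpM2l// big_split/= card_controlled lerD2l -mulr_sumr ler_wpM2l//.
  by rewrite addr_ge0// mulr_ge0// ltW.
rewrite sqn_blocks [leRHS](bigID (fun i => (0 < dj i)%N))/= lerDl.
by apply: sumr_ge0 => i _; exact: sqn_ge0.
Qed.

(** With [a = 2 lamv - C L2] and [b = 2 lx - 5 NN C L0], the weight must satisfy
    [4 NN C L1 / b <= eta < a / (C L1)], an interval that is nonempty exactly when
    [4 NN C^2 L1^2 < a b]. The left end is taken; if [C L1 = 0] the weight 1 does. *)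
Lemma young_weight (lamv lx : R) : C * L2 < 2 * lamv ->
  4 * NN * C ^+ 2 * L1 ^+ 2 < (2 * lamv - C * L2) * (2 * lx - 5 * NN * C * L0) ->
  exists2 eta, 0 < eta & C * L1 * eta < 2 * lamv - C * L2 /\ 4 * NN * C * L1 / eta <= 2 * lx - 5 * NN * C * L0.
Proof.
move=> hi hii; have A0 : 0 < 2 * lamv - C * L2 by rewrite subr_gt0.
have C0 : 0 <= C by rewrite divr_ge0 ?sqr_ge0 ?ltW.
have N0 : 0 < NN :> R by [].
have B0 : 0 < 2 * lx - 5 * NN * C * L0.
  rewrite -(pmulr_rgt0 _ A0); apply: le_lt_trans hii.
  by do 2 (apply: mulr_ge0; last exact: sqr_ge0); exact: mulr_ge0.
move: (2 * lx - _) B0 hii => b B0 hii; move: (2 * lamv - _) A0 hii => a A0 hii.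
have [/eqP p0|p0] := boolP (C * L1 == 0).
  exists 1 => //; rewrite p0 mul0r; split => //.
  by rewrite -(mulrA _ C) p0 mulr0 mul0r ltW.
have p1 : 0 < C * L1 by rewrite lt_neqAle eq_sym p0 mulr_ge0.
exists (4 * NN * (C * L1) / b); first by rewrite divr_gt0// mulr_gt0// mulr_gt0.
have e c : 0 < c -> 4 * NN * c / (4 * NN * c / b) = b.
  by move=> c0; field; rewrite ?pnatr_eq0 !gt_eqF.
split; last by rewrite -(mulrA _ C) e.
rewrite mulrA ltr_pdivrMr//; move: hii; congr (_ < _); ring.
Qed.

End remainder_estimate.

Lemma tr_mulmx_L2 {R : realType} {d} {S : measurableType d} (mu : {measure set S -> \bar R}) n m
  (om : S -> R) (J : S -> 'M[R]_(m, n)) (a : S -> 'cV[R]_m) (C : R) :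
  (forall s, om s * om s = om s) -> (forall k i, measurable_fun setT (fun s => om s * J s k i)) ->
  (forall s k i, `|om s * J s k i| <= C) -> (forall k, L2f mu (fun s => om s * a s k 0)) ->
  forall i, L2f mu (fun s => om s * ((J s)^T *m a s) i 0).
Proof.
move=> omM mJ bJ La i.
have : L2f mu (fun s => \sum_k (om s * J s k i) * (om s * a s k 0)).
  by apply: L2f_sum => k; apply: bounded_mulL2 => //; exists C => s; exact: bJ.
congr (L2f _ _); apply/funext => s; rewrite mxE mulr_sumr; apply: eq_bigr => k _; rewrite mxE.
by rewrite mulrACA omM.
Qed.

Lemma rearrange_integrated {R : realDomainType} (k0 k1 k2 x1 x2 x3 x4 x5 x6 x7 x8 : R) :
  x5 + x6 + k0 * x1 + k1 * x2 + k2 * x2 <= x3 - x4 + x7 + x8 ->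
  k0 * x1 + (k1 + k2) * x2 <= x3 - x4 + (x7 - (x5 + x6) + x8).
Proof. lra. Qed.

Lemma rearrange_costs {R : realDomainType} (x r1 r2 s t1 t2 : R) :
  x <= r1 - r2 + s -> s <= t1 - t2 -> x <= (r1 + t1) - (r2 + t2).
Proof. lra. Qed.

Lemma win_cases {R : realType} (T t : R) : win 0 T t = 0 :> R \/ win 0 T t = 1 :> R /\ 0 < t <= T.
Proof. by rewrite /win; case: (boolP (_ && _)) => h; [right|left]. Qed.

(** Only windowed processes are known to be jointly measurable, so the window is also put inside the
    arguments; this changes nothing under the window outside. *)
Lemma win_scale {R : realType} (T t : R) n k (phi : 'cV[R]_n -> 'cV[R]_k -> R) x v :
  win 0 T t * phi (win 0 T t *: x) (win 0 T t *: v) = win 0 T t * phi x v.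
Proof. by have [->|[-> _]] := win_cases T t; rewrite ?mul0r// !scale1r. Qed.

(** * Integrability along the solution, and the adjoint equation *)

Section solution.
Context {R : realType} {disp : measure_display} {Omega : measurableType disp}.
Context (P : probability Omega R) (T : R) (F : R -> set (set Omega)) (hT : 0 < T).
Context {L : R} {n kappa : nat} (B : R -> Omega -> 'cV[R]_n).
Context (lam : {sigma_finite_measure set 'cV[R]_kappa -> \bar R}).
Context (N : Omega -> {measure set (R * 'cV[R]_kappa)%type -> \bar R}).
Hypothesis hn : noise_setting P T F B lam N.
Context {dj : 'I_n.+1 -> nat}.
Local Notation X := 'cV[R]_n.
Local Notation V := 'cV[R]_(\sum_j dj j).
Local Notation E := (jumpE R kappa).
Local Notation tw := (measurableTypeR R * Omega)%type.
Context (b : R -> X -> P2 R n -> V -> X) (db : R -> X -> P2 R n -> V -> X -> X).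
Context (sigma : R -> X -> P2 R n -> V -> 'M[R]_n) (dsigma : R -> X -> P2 R n -> V -> X -> 'M[R]_n).
Context (gamma : R -> X -> P2 R n -> V -> 'cV[R]_kappa -> X) (dgamma : R -> X -> P2 R n -> V -> X -> 'cV[R]_kappa -> X).
Context (f : R -> X -> P2 R n -> V -> R) (df : R -> X -> P2 R n -> V -> X -> R).
Context (g : X -> P2 R n -> R) (dg : X -> P2 R n -> X -> R).
Hypothesis hL : 0 < L.
Hypothesis hA1 : assumption_A1 T L lam b db sigma dsigma gamma dgamma.
Hypothesis hA2 : assumption_A2 T L f df g dg.
Variables (g0 : R -> 'cV[R]_kappa -> X) (g1 g2 : R -> 'cV[R]_kappa -> 'M[R]_n).
Hypothesis hg : forall t, 0 <= t <= T ->
    [/\ [/\ measurable_fun E (g0 t), measurable_fun E (g1 t) & measurable_fun E (g2 t)],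
        (\int[lam]_(e in E) (sqn (g0 t e))%:E <= (L ^+ 2)%:E)%E,
        (\int[lam]_(e in E) (opnorm (g1 t e) ^+ 2)%:E <= (L ^+ 2)%:E)%E,
        (\int[lam]_(e in E) (opnorm (g2 t e) ^+ 2)%:E <= (L ^+ 2)%:E)%E &
        forall x m v e, E e -> gamma t x m v e = g0 t e + g1 t e *m x + g2 t e *m mean m].
Variables (Y p : R -> Omega -> X) (q : R -> Omega -> 'M[R]_n) (r : R -> Omega -> 'cV[R]_kappa -> X) (u : R -> Omega -> V).
Hypotheses (hY : S2 P T F Y) (hp : S2 P T F p) (hu : M2 P T F u).
Hypothesis Lq : forall i j, L2f (dtP P) (fun z : tw => win 0 T z.1 * q z.1 z.2 i j).
Hypothesis Lr : forall k, L2f (dtPl P lam) (fun z : tw * 'cV[R]_kappa => win 0 T z.1.1 * (\1_E z.2 * r z.1.1 z.1.2 z.2 k 0)).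

Let cY i := S2_cadlag hT hn hY i.
Let cp i := S2_cadlag hT hn hp i.

Let GX s w := Gx lam b sigma f g1 s (Y s w) (law P (Y s)) (u s w) (p s w) (q s w) (r s w).
Let GM s w y := Gm lam db dsigma df g2 s (Y s w) (law P (Y s)) (u s w) (p s w) (q s w) (r s w) y.

Lemma jump_slopes_measurable t (ht : 0 <= t <= T) : measurable_fun E (g1 t) /\ measurable_fun E (g2 t).
Proof. by have [[_ m1 m2] _ _ _ _] := hg ht. Qed.
Lemma gamma_affine t (ht : 0 <= t <= T) : forall x m v e, E e -> gamma t x m v e = g0 t e + g1 t e *m x + g2 t e *m mean m.
Proof. by have [_ _ _ _ h] := hg ht. Qed.
Let hj : A1_jump T L lam gamma dgamma. Proof. by case: hA1. Qed.

Lemma jadj1_L2 i : L2f (dtP P) (fun z : tw => win 0 T z.1 * jadj1 lam g1 z.1 (r z.1 z.2) i 0).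
Proof. by apply: (jadj_L2 Lr (g1_meas hT hj jump_slopes_measurable gamma_affine) (L := L)) => t ht; have [_ _ h _ _] := hg ht. Qed.

Lemma jadj2_L2 i : L2f (dtP P) (fun z : tw => win 0 T z.1 * jadj2 lam g2 z.1 (r z.1 z.2) i 0).
Proof. by apply: (jadj_L2 Lr (g2_meas hT hj jump_slopes_measurable gamma_affine) (L := L)) => t ht; have [_ _ _ h _] := hg ht. Qed.

Lemma adj_L2 j i : L2f (dtP P) (fun z : tw => win 0 T z.1 * adj (p z.1 z.2) (q z.1 z.2) j i 0).
Proof.
rewrite /adj; case: unliftP => [k _|_]; last exact: (cs_L2_prod hT hn (cp i)).
by have := Lq i k; congr (L2f _ _); apply/funext => z; rewrite mxE.
Qed.

Let mY := process_meas hT hn cY.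
Let mu := M2_meas hT hn hu.
Let law_r := right_law_process hn cY.

Lemma win_jac_bound n' (J : R -> 'M[R]_(n', n)) t k i : (0 <= t <= T -> opnorm (J t) <= L) -> `|win 0 T t * J t k i| <= L.
Proof.
move=> h; have [->|[-> /andP[t0 tT]]] := win_cases T t; first by rewrite mul0r normr0 ltW.
by rewrite mul1r; apply: le_trans (entry_opnorm _ _ _) (h _); rewrite tT ltW.
Qed.

Lemma running_cost_pcont : pcont T f.
Proof. by apply: (P2continuous_pcont (A2_cont hA2) (pr := id)). Qed.

Lemma Gx_L2 i : L2f (dtP P) (fun z : tw => win 0 T z.1 * GX z.1 z.2 i 0).
Proof.
have L1 : L2f (dtP P) (fun z : tw => win 0 T z.1 * grad (fun x => f z.1 x (law P (Y z.1)) (u z.1 z.2)) (Y z.1 z.2) i 0).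
  have [M M0 hM] := mom2_bound hT hn hY; apply: (L2f_le _ _ (linear_growth_L2 hT hn hY hu L M)).
    have := @grad_x_meas _ _ _ _ hT _ _ _ law_r _ _ mY mu f i.
    move/(_ running_cost_pcont (fun t x m v ht => (differentiable_pair1 (A2_diff hA2 x m v ht)).1)).
    rewrite (_ : (fun z => _) = fun z : tw => win 0 T z.1 * grad (fun x => f z.1 x (law P (Y z.1)) (u z.1 z.2)) (Y z.1 z.2) i 0); first by apply.
    apply/funext => z; exact: (win_scale T z.1 (fun x v => grad (fun x => f z.1 x (law P (Y z.1)) v) x i 0)).
  move=> z; have [->|[-> /andP[z0 zT]]] := win_cases T z.1; first by rewrite !mul0r.
  have ht : 0 <= (z.1 : R) <= T by rewrite zT ltW.
  rewrite !mul1r; apply: le_trans (coord_le _ _) _; apply: le_trans (ler_norm _).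
  apply: le_trans (_ : _ <= L * (1 + enorm (Y z.1 z.2) + mom2 (law P (Y z.1)) + enorm (u z.1 z.2))) _.
    apply: le_trans (A2_bndxv hA2 _ _ _ ht); rewrite ler_wsqrtr// lerDl; exact: sqn_ge0.
  by apply: ler_wpM2l; [exact: ltW|rewrite lerD2r lerD2l; exact: hM].
have L2 j : L2f (dtP P) (fun z : tw => win 0 T z.1 * ((jac (fun x => coef b sigma j z.1 x (law P (Y z.1)) (u z.1 z.2)) (Y z.1 z.2))^T *m adj (p z.1 z.2) (q z.1 z.2) j) i 0).
  apply: (tr_mulmx_L2 (C := L)) => [z|k l|z k l|k]; [exact: winM| | |exact: adj_L2].
    apply: (along_coef_meas hT hn hY hu (h := fun t x m v => jac (fun x => coef b sigma j t x m v) x k l)).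
    by apply: (P2continuous_pcont (A1_contx (coef_A1 hA1 j)) (pr := fun M : 'M[R]_n => M k l)) => ws w; exact: coord_cvg.
  apply: (win_jac_bound (J := fun t => jac (fun x => coef b sigma j t x (law P (Y z.1)) (u z.1 z.2)) (Y z.1 z.2))) => ht.
  exact: (A1_bndx (coef_A1 hA1 j)).
have := L2fD (L2fD L1 (L2f_sum (index_enum 'I_n.+1) (fun j => L2 j))) (jadj1_L2 i).
congr (L2f _ _); apply/funext => z; rewrite /GX /Gx [in RHS]mxE [in RHS](mxE _ _ i) summxE.
by rewrite -mulr_sumr -!mulrDr.
Qed.

Lemma copy_process_meas : measurable_fun setT (fun y : tw * Omega => win 0 T y.1.1 *: Y y.1.1 y.2).
Proof. exact: (measurableT_comp mY (measurableT_comp measurable_fst (@measurable_swap _ _ Omega))). Qed.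

Lemma seqcont_jac j s (x : X) (m : P2 R n) (v : V) (ys : nat -> X) (y : X) k l : 0 <= s <= T -> ys i @[i --> \oo] --> y ->
  jac (dcoef db dsigma j s x m v) (ys i) k l @[i --> \oo] --> jac (dcoef db dsigma j s x m v) y k l.
Proof.
move=> hs cy; apply: coord_cvg.
apply: (A1_conty (coef_A1 hA1 j) (xs := fun i => (s, (x, v, ys i))) (ms := fun=> m) (x := (s, (x, v, y)))) => //.
  by apply: cvg_pair_seq; [exact: cvg_cst|apply: cvg_pair_seq; [exact: cvg_cst|exact: cy]].
by rewrite W2_refl; exact: cvg_cst.
Qed.

(** In [dtPP] the first path carries the coefficients and the adjoint processes, that is the hatted
    variables, and the second path the point at which the gradient in [y] is taken. *)
Lemma Gm_L2 i : L2f (dtPP P) (fun y : tw * Omega => win 0 T y.1.1 * GM y.1.1 y.1.2 (Y y.1.1 y.2) i 0).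
Proof.
have carath (h : tw -> X -> R) :
    (forall y, measurable_fun setT (fun z => win 0 T z.1 * h z y)) ->
    (forall z (ys : nat -> X) (y : X), 0 <= (z.1 : R) <= T -> ys i @[i --> \oo] --> y -> h z (ys i) @[i --> \oo] --> h z y) ->
    measurable_fun setT (fun y : tw * Omega => win 0 T y.1.1 * h y.1 (Y y.1.1 y.2)).
  move=> mh ch; rewrite (_ : (fun y => _) = fun y : tw * Omega => win 0 T y.1.1 * h y.1 (win 0 T y.1.1 *: Y y.1.1 y.2)); last first.
    by apply/funext => y; exact: (esym (win_scale T y.1.1 (fun x _ => h y.1 x) _ (0 : X))).
  apply: (@measurable_carath _ _ _ _ (fun (y : tw * Omega) x => win 0 T y.1.1 * h y.1 x)) => [x|s ys y cy|].
  - exact: (measurableT_comp (mh x) measurable_fst).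
  - by apply: win_cvg => zT; exact: ch.
  - exact: copy_process_meas.
have L1 : L2f (dtPP P) (fun y : tw * Omega => win 0 T y.1.1 * grad (df y.1.1 (Y y.1.1 y.1.2) (law P (Y y.1.1)) (u y.1.1 y.1.2)) (Y y.1.1 y.2) i 0).
  have [M M0 hM] := mom2_bound hT hn hY.
  have LY : L2f (dtP P) (fun z : tw => win 0 T z.1 * enorm (Y z.1 z.2)).
    by apply: (win_enorm_L2 (a := fun z => Y z.1 z.2)) => k; exact: (cs_L2_prod hT hn (cY k)).
  have LB := L2fD (L2f_lift (linear_growth_L2 hT hn hY hu L M)) (L2fZ L (L2f_swap (L2f_lift LY))).
  apply: (L2f_le _ _ LB).
    apply: (carath (fun z x => grad (df z.1 (Y z.1 z.2) (law P (Y z.1)) (u z.1 z.2)) x i 0)) => [y|z ys y zT cy].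
      have := @grad_lfd_meas _ _ _ _ hT _ _ _ law_r (right_law_mix hn cY) _ _ mY mu f df y i.
      move/(_ running_cost_pcont (fun t x v ht => A2_lfd hA2 x v ht) (fun t x m v y ht => A2_diffy hA2 x m v y ht)).
      rewrite (_ : (fun z => _) = fun z : tw => win 0 T z.1 * grad (df z.1 (Y z.1 z.2) (law P (Y z.1)) (u z.1 z.2)) y i 0); first by apply.
      apply/funext => z; exact: (win_scale T z.1 (fun x v => grad (df z.1 x (law P (Y z.1)) v) y i 0)).
    apply: (@seqcont_lipschitz _ _ _ (grad (df z.1 (Y z.1 z.2) (law P (Y z.1)) (u z.1 z.2))) L) => // y1 y2.
    by apply: le_trans (A2_lipy hA2 _ _ _ _ _ _ _ _ zT) _; rewrite !subrr W2_refl !enorm0 !add0r.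
  move=> y; rewrite /swap_copy/=; have [->|[-> /andP[z0 zT]]] := win_cases T y.1.1; first by rewrite !mul0r mulr0 addr0.
  have ht : 0 <= (y.1.1 : R) <= T by rewrite zT ltW.
  rewrite !mul1r -mulrDr; apply: le_trans (coord_le _ _) _; apply: le_trans (ler_norm _).
  apply: le_trans (A2_bndy hA2 _ _ _ _ ht) _.
  by apply: ler_wpM2l; [exact: ltW|rewrite !lerD2r lerD2l; exact: hM].
have L2 j : L2f (dtPP P) (fun y : tw * Omega => win 0 T y.1.1 * ((jac (dcoef db dsigma j y.1.1 (Y y.1.1 y.1.2) (law P (Y y.1.1)) (u y.1.1 y.1.2)) (Y y.1.1 y.2))^T *m adj (p y.1.1 y.1.2) (q y.1.1 y.1.2) j) i 0).
  apply: (tr_mulmx_L2 (C := L)) => [z|k l|y k l|k]; [exact: winM| | |exact: (L2f_lift (adj_L2 j k))].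
    apply: (carath (fun z x => jac (dcoef db dsigma j z.1 (Y z.1 z.2) (law P (Y z.1)) (u z.1 z.2)) x k l)) => [y|z ys y zT cy].
      apply: (along_coef_meas hT hn hY hu (h := fun t x m v => jac (dcoef db dsigma j t x m v) y k l)).
      move=> ts xs ms vs t x m v hts ht ct cx cm cv; apply: coord_cvg.
      apply: (A1_conty (coef_A1 hA1 j) (xs := fun i => (ts i, (xs i, vs i, y))) (ms := ms) (x := (t, (x, v, y)))) => //.
      by apply: cvg_pair_seq; [exact: ct|apply: cvg_pair_seq; [exact: cvg_pair_seq|exact: cvg_cst]].
    exact: seqcont_jac.
  apply: (win_jac_bound (J := fun t => jac (dcoef db dsigma j t (Y y.1.1 y.1.2) (law P (Y y.1.1)) (u y.1.1 y.1.2)) (Y y.1.1 y.2))) => ht.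
  exact: (A1_bndy (coef_A1 hA1 j)).
have := L2fD (L2fD L1 (L2f_sum (index_enum 'I_n.+1) (fun j => L2 j))) (L2f_lift (jadj2_L2 i)).
congr (L2f _ _); apply/funext => y; rewrite /GM /Gm [in RHS]mxE [in RHS](mxE _ _ i) summxE.
by rewrite -mulr_sumr -!mulrDr.
Qed.

Lemma sqE_ae : {ae dtP P, forall z : tw, 0 < (z.1 : R) <= T -> sqE lam (r z.1 z.2)}.
Proof.
have : {ae dtP P, forall (z : tw) k, intg lam (fun e => (win 0 T z.1 * (\1_E e * r z.1 z.2 e k 0)) ^+ 2)}.
  by apply: filter_forall => k; have [_ _] := @sfprod_intg _ _ _ _ _ (dtP P) lam _ (Lr k).2.
apply: filterS => z hz h.
have w1 : win 0 T z.1 = 1 :> R by rewrite /win h.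
have mE : measurable E := @measurable_jumpE R kappa.
split.
  apply: measurable_mx => k l; rewrite ord1; apply/(measurable_restrictT _ mE).
  have := measurableT_comp (Lr k).1 (measurable_pair1 z); congr (measurable_fun _ _).
  by apply/funext => e; rewrite /patch/= w1 mul1r indicE; case: (_ \in _); rewrite ?mul1r ?mul0r.
have Is := intg_sum (index_enum 'I_n) hz; rewrite integral_indicM.
rewrite (eq_integral (fun e => (\sum_k (win 0 T z.1 * (\1_E e * r z.1 z.2 e k 0)) ^+ 2)%:E)); last first.
  move=> e _; rewrite -EFinM sqnE mulr_sumr; congr EFin; apply: eq_bigr => k _.
  by rewrite w1 mul1r indicE; case: (_ \in _); rewrite ?mul1r ?mul0r ?expr0n.
by apply: intg_ltpinfty Is => e; apply: sumr_ge0 => k _; exact: sqr_ge0.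
Qed.

Section cost.
Variables (Z : R -> Omega -> X) (v : R -> Omega -> V) (hZ : S2 P T F Z) (hv : M2 P T F v).
Let hTT : 0 <= T <= T. Proof. by rewrite lexx ltW. Qed.
Let cZ i := S2_cadlag hT hn hZ i.

Definition running (z : tw) : R := win 0 T z.1 * f z.1 (Z z.1 z.2) (law P (Z z.1)) (v z.1 z.2).
Definition terminal (w : Omega) : R := g (Z T w) (law P (Z T)).

Lemma running_intg : intg (dtP P) running.
Proof.
have [M M0 hM] := mom2_bound hT hn hZ; have [C hC] := A2_growth hA2.
have LZ : L2f (dtP P) (fun z : tw => win 0 T z.1 * enorm (Z z.1 z.2)).
  by apply: (win_enorm_L2 (a := fun z => Z z.1 z.2)) => k; exact: (cs_L2_prod hT hn (cZ k)).
have Lv : L2f (dtP P) (fun z : tw => win 0 T z.1 * enorm (v z.1 z.2)).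
  by apply: (win_enorm_L2 (a := fun z => v z.1 z.2)) => i; exact: (M2_L2 hT hn).
have L1 := win_cst_L2 P T (Num.sqrt (1 + M ^+ 2)).
apply: (intg_le _ _ (intgZ `|C| (intgD (intgD L1.2 LZ.2) Lv.2))).
  exact: (along_coef_meas hT hn hZ hv running_cost_pcont).
move=> z; rewrite /running; have [->|[-> /andP[z0 zT]]] := win_cases T z.1.
  by rewrite !mul0r expr0n normr0 !addr0 mulr0.
have ht : 0 <= (z.1 : R) <= T by rewrite zT ltW.
rewrite !mul1r sqr_sqrtr ?addr_ge0 ?sqr_ge0// !enorm_sqr; apply: le_trans (hC _ _ _ _ ht) _.
have m2 : mom2 (law P (Z z.1)) ^+ 2 <= M ^+ 2 by rewrite lerXn2r ?nnegrE ?hM ?sqrtr_ge0.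
have := sqn_ge0 (Z z.1 z.2); have := sqn_ge0 (v z.1 z.2); have := sqr_ge0 (mom2 (law P (Z z.1))).
move: (sqn _) (sqn _) (mom2 _ ^+ 2) m2 => a1 a2 a3 h1 h2 h3 h4.
by apply: le_trans (ler_wpM2r _ (ler_norm C)) _; [lra|rewrite ler_wpM2l//; lra].
Qed.

Lemma terminal_intg : intg P terminal.
Proof.
have [C hC] := A2_growthg hA2; have sZ := cadlag_sqi hn cZ hTT.
have I1 : intg P (fun w => `|C| * (1 + mom2 (law P (Z T)) ^+ 2 + sqn (Z T w))).
  by apply/intgZ/intgD; [exact/L2f_intg/L2f_cst|exact: sqi_intg].
apply: (intg_le _ _ I1) => [|w].
  apply: (measurableT_comp (f := fun x => g x (law P (Z T)))); last exact: sZ.1.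
  apply: seqcont_measurable => xs x cx; apply: (A2_contg hA2 (xs := xs) (ms := fun=> law P (Z T))) => //.
  by rewrite W2_refl; exact: cvg_cst.
apply: le_trans (hC _ _) _; have := sqn_ge0 (Z T w); have := sqr_ge0 (mom2 (law P (Z T))).
move: (sqn _) (mom2 _ ^+ 2) => a1 a2 h1 h2.
by apply: le_trans (ler_wpM2r _ (ler_norm C)) _; [lra|rewrite ler_wpM2l//; lra].
Qed.

Lemma costE : cost P T f g Z v = (\int[dtP P]_z running z + \int[P]_w terminal w)%:E.
Proof.
have [It Et] := tint_intg running_intg.
rewrite -Et -RintD//; last exact: terminal_intg.
rewrite EFin_Rint; last by apply: intgD => //; exact: terminal_intg.
have E1 w : (\int[lebesgue_measure]_(t in `[0%R, T]) (f t (Z t w) (law P (Z t)) (v t w))%:E =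
    \int[lebesgue_measure]_(r in [set: measurableTypeR R]) (running (r, w))%:E)%E.
  apply: (integral_itv_ae (k := fun t => f t (Z t w) (law P (Z t)) (v t w))); last exact: aeW.
  exact: (measurableT_comp (intg_meas running_intg) (measurable_pair2 w)).
transitivity (\int[P]_w ((\int[lebesgue_measure]_(r in [set: measurableTypeR R]) (running (r, w))%:E) + (terminal w)%:E))%E.
  by apply: eq_integral => w _; rewrite -E1.
apply: ae_eq_integral => //.
- apply: emeasurable_funD; last by apply/measurable_EFinP; exact: intg_meas terminal_intg.
  exact: (@measurable_fubini_G _ _ _ _ R lebesgue_measure P (EFin \o running) running_intg).
- by apply/measurable_EFinP; apply: measurable_funD; [exact: intg_meas It|exact: intg_meas terminal_intg].
have := @ae_integrable2 _ _ _ _ R lebesgue_measure P (EFin \o running) running_intg.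
by apply: filterS => w Iw _; rewrite /tint EFinD EFin_Rint//; exact: Iw.
Qed.

End cost.

(** The driver of the backward equation in explicit, windowed form. The driver as it is written in
    the equation is matched with it almost everywhere, where [r] is square integrable in the mark
    both on the path and on almost every copy. *)
Definition adjoint_drift i (z : tw) : R :=
  win 0 T z.1 * GX z.1 z.2 i 0 + \int[P]_w' (win 0 T z.1 * GM z.1 w' (Y z.1 z.2) i 0).

Let GM_swap i (y : tw * Omega) := win 0 T y.1.1 * GM y.1.1 y.2 (Y y.1.1 y.1.2) i 0.

Lemma Gm_swap_L2 i : L2f (dtPP P) (GM_swap i).
Proof. exact: (L2f_swap (Gm_L2 i)). Qed.

Lemma win_copy_intg (h : tw * Omega -> R) : L2f (dtPP P) (fun y => win 0 T y.1.1 * h y) -> intg (dtPP P) (fun y => win 0 T y.1.1 * h y).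
Proof.
move=> Lh; have := L2f_mul (L2f_lift (win_cst_L2 P T 1)) Lh.
by apply: eq_intg => y; rewrite mulr1 mulrA winM.
Qed.

Lemma adjoint_drift_L2 i : L2f (dtP P) (adjoint_drift i).
Proof.
apply: L2fD; first exact: Gx_L2.
by apply: (@marginal_L2 _ _ _ _ _ (dtP P) P (GM_swap i)); [apply: win_copy_intg; exact: Gm_swap_L2|exact: Gm_swap_L2].
Qed.

Let H s w : X := grad (fun x => Lagrangian lam b sigma gamma f s x (law P (Y s)) (u s w) (p s w) (q s w) (r s w)) (Y s w)
  + vint P setT (fun w' => grad (dLagrangian lam db dsigma dgamma df s (Y s w') (law P (Y s)) (u s w') (p s w') (q s w') (r s w')) (Y s w)).

Lemma adjoint_drift_ae i : {ae dtP P, forall z : tw, 0 < (z.1 : R) <= T -> H z.1 z.2 i 0 = adjoint_drift i z}.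
Proof.
have A2 := @sfprod_ae_fst _ _ _ _ _ lebesgue_measure P _ (@ae_section _ _ _ _ _ lebesgue_measure P _ sqE_ae).
move: sqE_ae A2; apply: filterS2 => z h1 h2 zT.
have ht : 0 <= (z.1 : R) <= T by have /andP[/ltW -> ->] := zT.
rewrite /adjoint_drift /H mxE; congr (_ + _).
  by rewrite (grad_Lagrangian_x hA1 hA2 hg ht _ _ _ _ _ (h1 zT)) /win zT mul1r.
rewrite mxE /Rintegral; congr fine; apply: (@Rint_ae_eq_left _ _ _ P).
  have mw : measurable_fun setT (fun w' : Omega => ((z.1, w'), z.2) : tw * Omega).
    by apply: measurable_fun_pair => //; exact: measurable_fun_pair.
  exact: (measurableT_comp (Gm_L2 i).1 mw).
move: h2; apply: filterS => w' h2.
by rewrite (grad_dLagrangian hA1 hA2 hg ht _ _ _ _ _ _ (h2 zT)) /win zT mul1r.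
Qed.

Hypothesis hback : backward_equation P T F B lam N b db sigma dsigma gamma dgamma f df g dg Y p q r u.

Local Notation ito_process := (ito_process P T F B lam N).
Local Notation leb := (lebesgue_measure : {measure set (measurableTypeR R) -> \bar R}).

(** One null set of paths serves all [t]: on almost every path the two drivers agree at almost every
    time. *)
Lemma drift_int i : {ae P, forall w, forall t, 0 <= t <= T ->
  (vint lebesgue_measure `[t, T] (fun s => H s w)) i 0 = tint (fun z => win t T z.1 * adjoint_drift i z) w}.
Proof.
have := @ae_section2 _ _ _ _ _ lebesgue_measure P _ (adjoint_drift_ae i).
apply: filterS => w hw t /andP[t0 tT]; rewrite mxE.
apply: (Rint_itv_ae (k := fun s => adjoint_drift i (s, w))).
  apply: measurable_funM; first exact: (win_L2 t T).1.1.
  exact: (measurableT_comp (adjoint_drift_L2 i).1 (measurable_pair2 w)).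
move: hw; apply: filterS => s h /andP[ts sT]; apply: h.
by rewrite sT andbT; exact: le_lt_trans ts.
Qed.

Lemma adjoint_ito i : ito_process (fun t w => p t w i 0) (fun z => - adjoint_drift i z)
  (fun j z => win 0 T z.1 * q z.1 z.2 i j) (fun z => win 0 T z.1.1 * (\1_E z.2 * r z.1.1 z.1.2 z.2 i 0)).
Proof.
split; [exact: cp|exact/L2fN/adjoint_drift_L2|exact: Lq|exact: Lr|].
move=> s t s0 st tT; have t0 := le_trans s0 st; have sT := le_trans st tT.
have [Is [Ks [hIs hKs es]]] := hback (introT andP (conj s0 sT)).
have [It [Kt [hIt hKt et]]] := hback (introT andP (conj t0 tT)).
have sIs := ito_stint hn s0 sT (lexx T) i hIs; have sIt := ito_stint hn t0 tT (lexx T) i hIt.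
have sKs := jump_stint hn s0 sT (lexx T) i hKs; have sKt := jump_stint hn t0 tT (lexx T) i hKt.
have dw x : win s T x + -1 * win t T x = win s t x :> R.
  rewrite /win mulN1r; case: (ltP s x) => sx; case: (ltP t x) => tx; case: (leP x T) => xT /=; rewrite ?subrr ?subr0//; exfalso; lra.
exists (fun w => (Is w i 0 + Ks w i 0) - (It w i 0 + Kt w i 0)).
  apply: (stint_ext (stint_comb hn (-1) (stint_comb hn 1 sIs sKs) (stint_comb hn 1 sIt sKt))) => [j z|z|w].
  - by rewrite mulrA win_win// -dw; ring.
  - by rewrite [RHS]mulrA win_win// -dw; ring.
  - by ring.
have : {ae P, forall w, intg leb (fun x : measurableTypeR R => win s T x * adjoint_drift i (x, w))}.
  apply: (ae_time_section (P := P) (f := fun z => win s T z.1 * adjoint_drift i z)).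
  have := L2f_mul (win_prod_L2 s T (L2f_cst P 1)) (adjoint_drift_L2 i).
  by apply: eq_intg => z; rewrite mulr1.
move=> hw0; apply: filterS3 es et (filterI (drift_int i) hw0) => w es et [dI hw].
have c5 (x1 x2 x3 x4 x5 : X) : (x1 + x2 + x3 - x4 - x5) i 0 = x1 i 0 + x2 i 0 + x3 i 0 - x4 i 0 - x5 i 0 by rewrite !mxE.
have hs : 0 <= s <= T by rewrite s0.
have ht : 0 <= t <= T by rewrite t0.
rewrite et es !c5.
have -> : tint (fun z => win s t z.1 * - adjoint_drift i z) w = - tint (fun z => win s t z.1 * adjoint_drift i z) w.
  rewrite /tint -RintN; first by apply: eq_Rintegral => x _; rewrite mulrN.
  apply: intg_le (intg_norm hw) => [|x].
    apply: measurable_funM; first exact: (win_L2 s t).1.1.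
    exact: (measurableT_comp (adjoint_drift_L2 i).1 (measurable_pair2 w)).
  rewrite !normrM ler_wpM2r// /win; case: (boolP (s < x <= t)) => [/andP[-> xt]|_]; last by rewrite normr0.
  by rewrite (le_trans xt tT).
have := tint_split st tT hw; rewrite -(dI s hs) -(dI t ht) /H => ->.
ring.
Qed.

Lemma adjoint_terminal : {ae P, forall w, p T w = grad (fun x => g x (law P (Y T))) (Y T w)
   + vint P setT (fun w' => grad (dg (Y T w') (law P (Y T))) (Y T w))}.
Proof.
have hTT : 0 <= T <= T by rewrite lexx ltW.
have [I [K [hI hK e]]] := hback hTT.
have sI i : stint P T F B lam N (fun _ => fun=> 0) (fun=> 0) (fun w => I w i 0 + 1 * K w i 0).
  apply: (stint_ext (stint_comb hn 1 (ito_stint hn (ltW hT) (lexx T) (lexx T) i hI) (jump_stint hn (ltW hT) (lexx T) (lexx T) i hK))) => [j z|z|//].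
  - by rewrite win_same; ring.
  - by rewrite win_same; ring.
have I0 : {ae P, forall w i, I w i 0 + 1 * K w i 0 = 0}.
  by apply: filter_forall => i; exact: (stint_null hn).
have dI : {ae P, forall w i, (vint lebesgue_measure `[T, T] (fun s => H s w)) i 0 = 0}.
  apply: filter_forall => i; move: (drift_int i); apply: filterS => w ->//; rewrite /tint -[RHS](Rint0 leb).
  by apply: eq_Rintegral => x _; rewrite win_same mul0r.
move: e I0 dI; apply: filterS3 => w -> I0 dI; apply/matrixP => i j; rewrite (ord1 j).
have c5 (x1 x2 x3 x4 x5 : X) : (x1 + x2 + x3 - x4 - x5) i 0 = x1 i 0 + x2 i 0 + x3 i 0 - x4 i 0 - x5 i 0 by rewrite !mxE.
rewrite c5 [RHS]mxE; have := dI i; rewrite /H => ->; have := I0 i; lra.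
Qed.

(** * Comparison with a competing control *)

Section comparison.
Context {L0 L1 L2 lam0 lamv lamx lamm : R}.
Hypothesis hA3 : assumption_A3 T L L0 L1 L2 lam0 lam b sigma gamma f.
Variables (A : forall j, R -> X -> P2 R n -> 'cV[R]_(dj j) -> X)
  (dA : forall j, R -> X -> P2 R n -> 'cV[R]_(dj j) -> X -> X).
Hypothesis hA : forall j, (0 < dj j)%N -> A3_coef T L L0 L1 L2 lam0 (@A j) (@dA j).
Hypothesis hbA : forall t x m v, 0 <= t <= T -> b t x m v = A t x m (submxcol v ord0).
Hypothesis hsA : forall (j : 'I_n) t x m v, (0 < dj (lift ord0 j))%N -> 0 <= t <= T ->
  col j (sigma t x m v) = A t x m (submxcol v (lift ord0 j)).
Variables (fj : forall j, R -> X -> P2 R n -> 'cV[R]_(dj j) -> R)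
  (dfj : forall j, R -> X -> P2 R n -> 'cV[R]_(dj j) -> X -> R).
Hypothesis hfj : forall j, A3_cost T L (@fj j) (@dfj j).
Hypothesis hf : forall t x m v, 0 <= t <= T -> f t x m v = \sum_j fj t x m (submxcol v j).
Hypothesis hlam0 : 0 < lam0.
Hypothesis hA4 : assumption_A4 P T lamv lamx lamm f df g dg.
Hypothesis hfoc : first_order_condition P T lam b sigma gamma f Y p q r u.
Variable xi : Omega -> X.
Hypothesis hfwd : forward_equation P T F B lam N b sigma gamma xi Y u.
Variables (Z : R -> Omega -> X) (v : R -> Omega -> V) (hv : M2 P T F v).
Hypothesis hst : state_process P T F B lam N b sigma gamma xi v Z.

Let hZ : S2 P T F Z. Proof. by case: hst. Qed.
Let cZ i := S2_cadlag hT hn hZ i.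
Let hb1 : A1_coef T L b db. Proof. by case: hA1. Qed.
Let GY s w e := gamma s (leftlim Y s w) (law P (Y s)) (u s w) e.
Let GZ s w e := gamma s (leftlim Z s w) (law P (leftlim Z s)) (v s w) e.
Let iY i := state_ito hT hn hb1 hY hu hfwd i.
Let iZ i := state_ito hT hn hb1 hZ hv hst.2 i.
Let h0T : 0 <= (0 : R) <= T. Proof. by rewrite lexx ltW. Qed.
Let hTT : 0 <= T <= T. Proof. by rewrite lexx ltW. Qed.

Lemma forward_state : state_process P T F B lam N b sigma gamma xi u Y.
Proof.
split; first exact: hY.
move=> t ht; have [I [K [hI hK e]]] := hfwd ht; exists I, K; split; [exact: hI| |exact: e].
apply: (jump_integral_ext hK) => s w e' hs eE.
rewrite (gamma_affine hs (leftlim Y s w) (law P (Y s)) (u s w) eE).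
rewrite (gamma_affine hs (leftlim Y s w) (law P (leftlim Y s)) (u s w) eE).
by rewrite (leftlim_mean hn hY iY hs).
Qed.

Let wr i (z : tw * 'cV[R]_kappa) : R := win 0 T z.1.1 * (\1_E z.2 * r z.1.1 z.1.2 z.2 i 0).

Lemma adjoint_product W be S KW i : ito_process W be S KW ->
  [/\ intg (dtP P) (fun z => win 0 T z.1 * p z.1 z.2 i 0 * be z),
      intg (dtP P) (fun z => win 0 T z.1 * W z.1 z.2 * adjoint_drift i z),
      forall j, intg (dtP P) (fun z => win 0 T z.1 * q z.1 z.2 i j * S j z),
      intg (dtPl P lam) (fun z => wr i z * KW z) &
  \int[P]_w (p T w i 0 * W T w) - \int[P]_w (p 0 w i 0 * W 0 w) =
  \int[dtP P]_z (win 0 T z.1 * p z.1 z.2 i 0 * be z) - \int[dtP P]_z (win 0 T z.1 * W z.1 z.2 * adjoint_drift i z)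
  + (\sum_j \int[dtP P]_z (win 0 T z.1 * q z.1 z.2 i j * S j z) + \int[dtPl P lam]_z (wr i z * KW z))].
Proof.
move=> iW; have I2 : intg (dtP P) (fun z => win 0 T z.1 * W z.1 z.2 * adjoint_drift i z).
  by apply: L2f_mul; [exact: (cs_L2_prod hT hn (ip_cadlag iW))|exact: adjoint_drift_L2].
split => //.
- by apply: L2f_mul; [exact: (cs_L2_prod hT hn (cp i))|exact: ip_drift iW].
- by move=> j; apply: L2f_mul; [exact: Lq|exact: ip_B iW j].
- by apply: L2f_mul; [exact: Lr|exact: ip_N iW].
rewrite (product_rule hT hn (adjoint_ito i) iW); congr (_ + _ + (_ + _)).
- by rewrite -RintN//; apply: eq_Rintegral => z _; rewrite mulrN.
- by apply: eq_bigr => j _; apply: eq_Rintegral => z _; rewrite mulrA winM.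
- by apply: eq_Rintegral => z _; rewrite /wr mulrA winM.
Qed.

Let Xd i (z : tw) : R := Z z.1 z.2 i 0 - Y z.1 z.2 i 0.
Let sY (z : tw) i j := win 0 T z.1 * sigma z.1 (Y z.1 z.2) (law P (Y z.1)) (u z.1 z.2) i j.
Let sZ (z : tw) i j := win 0 T z.1 * sigma z.1 (Z z.1 z.2) (law P (Z z.1)) (v z.1 z.2) i j.
(** Coordinate [i] of the pairing of the coefficient increments with the adjoint processes: drift
    with [p], volatility with row [i] of [q]. The jump part, with [r], is [kk]. *)
Let cc i (z : tw) := win 0 T z.1 * p z.1 z.2 i 0 * (drift P T b Z v i z - drift P T b Y u i z)
  + \sum_j win 0 T z.1 * q z.1 z.2 i j * (sZ z i j - sY z i j).
Let kk i (z : tw * 'cV[R]_kappa) := wr i z * (win 0 T z.1.1 * (\1_E z.2 * GZ z.1.1 z.1.2 z.2 i 0) - win 0 T z.1.1 * (\1_E z.2 * GY z.1.1 z.1.2 z.2 i 0)).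

Lemma state_diff_L2 i : L2f (dtP P) (fun z => win 0 T z.1 * Xd i z).
Proof.
have := L2fB (cs_L2_prod hT hn (cZ i)) (cs_L2_prod hT hn (cY i)).
by congr (L2f _ _); apply/funext => z; rewrite /Xd mulrBr.
Qed.

(** The product rules of [p] with [Z] and with [Y] are subtracted; the terms at time 0 cancel
    because both states start at [xi]. *)
Lemma pair_expansion i : [/\ intg (dtP P) (cc i), intg (dtP P) (fun z => win 0 T z.1 * Xd i z * adjoint_drift i z),
  intg (dtPl P lam) (kk i) &
  \int[P]_w (p T w i 0 * (Z T w i 0 - Y T w i 0)) =
  \int[dtP P]_z cc i z - \int[dtP P]_z (win 0 T z.1 * Xd i z * adjoint_drift i z) + \int[dtPl P lam]_z kk i z].
Proof.
have [z1 z2 z3 z4 Ez] := adjoint_product i (iZ i).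
have [y1 y2 y3 y4 Ey] := adjoint_product i (iY i).
have c1 j : intg (dtP P) (fun z => win 0 T z.1 * q z.1 z.2 i j * (sZ z i j - sY z i j)).
  by have := intgB (z3 j) (y3 j); apply: eq_intg => z; rewrite -mulrBr.
have c0 : intg (dtP P) (fun z => win 0 T z.1 * p z.1 z.2 i 0 * (drift P T b Z v i z - drift P T b Y u i z)).
  by have := intgB z1 y1; apply: eq_intg => z; rewrite -mulrBr.
have k1 : intg (dtPl P lam) (kk i) by have := intgB z4 y4; apply: eq_intg => z; rewrite -mulrBr.
have x1 : intg (dtP P) (fun z => win 0 T z.1 * Xd i z * adjoint_drift i z).
  by have := intgB z2 y2; apply: eq_intg => z; rewrite -mulrBl -mulrBr.
split => //; first by apply: intgD => //; exact: intg_sum.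
rewrite RintD//; last exact: intg_sum.
rewrite Rint_sum//.
have ipZ : intg P (fun w => p T w i 0 * Z T w i 0) by apply: L2f_mul; [exact: (cs_L2 hn (cp i))|exact: (cs_L2 hn (cZ i))].
have ipY : intg P (fun w => p T w i 0 * Y T w i 0) by apply: L2f_mul; [exact: (cs_L2 hn (cp i))|exact: (cs_L2 hn (cY i))].
have -> : \int[P]_w (p T w i 0 * (Z T w i 0 - Y T w i 0)) = \int[P]_w (p T w i 0 * Z T w i 0) - \int[P]_w (p T w i 0 * Y T w i 0).
  by rewrite -RintB//; apply: eq_Rintegral => w _; rewrite mulrBr.
have e0 : \int[P]_w (p 0 w i 0 * Z 0 w i 0) = \int[P]_w (p 0 w i 0 * Y 0 w i 0).
  apply: Rint_ae_eq.
  - by apply: measurable_funM; [exact: (cs_meas hn (cp i))|exact: (cs_meas hn (cZ i))].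
  - by apply: measurable_funM; [exact: (cs_meas hn (cp i))|exact: (cs_meas hn (cY i))].
  by apply: filterS2 (state_start hT hn hst.2) (state_start hT hn hfwd) => w -> ->.
have -> : \int[dtP P]_z (win 0 T z.1 * p z.1 z.2 i 0 * (drift P T b Z v i z - drift P T b Y u i z)) =
   \int[dtP P]_z (win 0 T z.1 * p z.1 z.2 i 0 * drift P T b Z v i z) - \int[dtP P]_z (win 0 T z.1 * p z.1 z.2 i 0 * drift P T b Y u i z).
  by rewrite -RintB//; apply: eq_Rintegral => z _; rewrite mulrBr.
have -> : \int[dtP P]_z (win 0 T z.1 * Xd i z * adjoint_drift i z) =
   \int[dtP P]_z (win 0 T z.1 * Z z.1 z.2 i 0 * adjoint_drift i z) - \int[dtP P]_z (win 0 T z.1 * Y z.1 z.2 i 0 * adjoint_drift i z).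
  by rewrite -RintB//; apply: eq_Rintegral => z _; rewrite /Xd; ring.
have -> : \int[dtPl P lam]_z kk i z = \int[dtPl P lam]_z (wr i z * (win 0 T z.1.1 * (\1_E z.2 * GZ z.1.1 z.1.2 z.2 i 0)))
   - \int[dtPl P lam]_z (wr i z * (win 0 T z.1.1 * (\1_E z.2 * GY z.1.1 z.1.2 z.2 i 0))).
  by rewrite -RintB//; apply: eq_Rintegral => z _; rewrite /kk mulrBr.
have -> : \sum_j \int[dtP P]_z (win 0 T z.1 * q z.1 z.2 i j * (sZ z i j - sY z i j)) =
   \sum_j \int[dtP P]_z (win 0 T z.1 * q z.1 z.2 i j * sZ z i j) - \sum_j \int[dtP P]_z (win 0 T z.1 * q z.1 z.2 i j * sY z i j).
  rewrite -sumrB; apply: eq_bigr => j _; rewrite -RintB//.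
  by apply: eq_Rintegral => z _; rewrite mulrBr.
move: Ez Ey; rewrite e0 -/sZ -/sY; lra.
Qed.

Lemma state_diff_copy_L2 i : L2f (dtPP P) (fun y : tw * Omega => win 0 T y.1.1 * Xd i (y.1.1, y.2)).
Proof. exact: (L2f_swap (L2f_lift (state_diff_L2 i))). Qed.

Lemma control_diff_L2 i : L2f (dtP P) (fun z => win 0 T z.1 * (v z.1 z.2 - u z.1 z.2) i 0).
Proof.
have := L2fB (M2_L2 hT hn i 0 hv) (M2_L2 hT hn i 0 hu).
by congr (L2f _ _); apply/funext => z; rewrite !mxE mulrBr.
Qed.

(** The first-order condition and the jump coefficients are written at left limits, the drivers and
    the pointwise expansion at current values; the two agree for almost every time and path. *)
Lemma leftlim_ae : {ae dtP P, forall z : tw, 0 < (z.1 : R) <= T ->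
  [/\ leftlim Y z.1 z.2 = Y z.1 z.2, leftlim Z z.1 z.2 = Z z.1 z.2 & leftlim p z.1 z.2 = p z.1 z.2]}.
Proof.
apply: filterS3 (leftlim_ae_prod hT hn hY iY) (leftlim_ae_prod hT hn hZ iZ) (leftlim_ae_prod hT hn hp adjoint_ito) => z h1 h2 h3 zT.
by split; [exact: h1|exact: h2|exact: h3].
Qed.

Lemma foc_ae : {ae dtP P, forall z : tw, 0 < (z.1 : R) <= T ->
  grad (fun v => Lagrangian lam b sigma gamma f z.1 (Y z.1 z.2) (law P (Y z.1)) v (p z.1 z.2) (q z.1 z.2) (r z.1 z.2)) (u z.1 z.2) = 0}.
Proof.
have hfoc' : {ae dtP P, forall z : tw, 0 <= (z.1 : R) <= T ->
    grad (fun v => Lagrangian lam b sigma gamma f z.1 (leftlim Y z.1 z.2) (law P (Y z.1)) v (leftlim p z.1 z.2) (q z.1 z.2) (r z.1 z.2)) (u z.1 z.2) = 0}.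
  exact: hfoc.
apply: filterS2 hfoc' leftlim_ae => z h1 h2 zT; have [e1 _ e2] := h2 zT.
by rewrite -e1 -e2; apply: h1; have /andP[/ltW -> ->] := zT.
Qed.

Let gamma_affine_at t (ht : 0 <= t <= T) x m v' e : E e -> gamma t x m v' e = g0 t e + g1 t e *m x + g2 t e *m mean m := gamma_affine ht x m v' (e := e).

Lemma jump_ae : {ae dtP P, forall z : tw, 0 < (z.1 : R) <= T ->
  \int[lam]_(e in E) dot (gamma z.1 (Z z.1 z.2) (law P (Z z.1)) (v z.1 z.2) e - gamma z.1 (Y z.1 z.2) (law P (Y z.1)) (u z.1 z.2) e) (r z.1 z.2 e)
  = \sum_i \int[lam]_e kk i (z, e)}.
Proof.
have hk : {ae dtP P, forall (z : tw) i, intg lam (fun e => kk i (z, e))}.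
  apply: filter_forall => i; have [_ _ k1 _] := pair_expansion i.
  by have [_ _] := @sfprod_intg _ _ _ _ _ (dtP P) lam _ k1.
apply: filterS2 leftlim_ae hk => z h1 h2 zT; have [eY eZ _] := h1 zT.
have ht : 0 <= (z.1 : R) <= T by have /andP[/ltW -> ->] := zT.
have w1 : win 0 T z.1 = 1 :> R by rewrite /win zT.
rewrite -Rint_sum// Rint_indic; apply: eq_Rintegral => e _.
rewrite /kk /wr /= w1; under eq_bigr do rewrite !mul1r.
rewrite indicE; case: (boolP (e \in E)) => [/set_mem eE|_]; last first.
  by rewrite mul0r big1// => i _; rewrite !mul0r.
rewrite mul1r dotE; apply: eq_bigr => i _; rewrite !mul1r mulrC; congr (_ * _).
by rewrite /GZ /GY eY eZ !(gamma_affine_at ht)// (leftlim_mean hn hZ iZ ht) [in LHS]mxE [X in _ + X = _]mxE.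
Qed.

Lemma coef_sum z : 0 < (z.1 : R) <= T ->
  \sum_j dot (coef b sigma j z.1 (Z z.1 z.2) (law P (Z z.1)) (v z.1 z.2) - coef b sigma j z.1 (Y z.1 z.2) (law P (Y z.1)) (u z.1 z.2)) (adj (p z.1 z.2) (q z.1 z.2) j)
  = \sum_i cc i z.
Proof.
move=> zT; have w1 : win 0 T z.1 = 1 :> R by rewrite /win zT.
rewrite big_ord_recl !coef0 adj0 /cc big_split/=; congr (_ + _).
  by rewrite dotE; apply: eq_bigr => i _; rewrite /drift w1 !mul1r !mxE mulrC.
rewrite exchange_big/=; apply: eq_bigr => j _; rewrite !coefS adjS dotE.
by apply: eq_bigr => i _; rewrite /sZ /sY w1 !mul1r !mxE mulrC.
Qed.

Variable eta : R.
Hypothesis eta0 : 0 < eta.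
Let C := L ^+ 2 / lam0.
Local Notation NN := (nctrl dj).+1%:R.
(** What remains of the three convexity constants once the bound of [remainder_sum] is
    subtracted. *)
Let cv := lamv - C / 2 * (L1 * eta + L2).
Let c1 := lamx - C / 2 * (NN * (L0 * 2 + L1 * (2 / eta))).
Let c2 := lamm - C / 2 * (NN * (L0 * 3 + L1 * (2 / eta))).

Let GXX (z : tw) := \sum_i (win 0 T z.1 * GX z.1 z.2 i 0) * (win 0 T z.1 * Xd i z).
Let GMX (y : tw * Omega) := \sum_i (win 0 T y.1.1 * GM y.1.1 y.1.2 (Y y.1.1 y.2) i 0) * (win 0 T y.1.1 * Xd i (y.1.1, y.2)).
Let XX (z : tw) := \sum_i (win 0 T z.1 * Xd i z) ^+ 2.
Let XXh (y : tw * Omega) := \sum_i (win 0 T y.1.1 * Xd i (y.1.1, y.2)) ^+ 2.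
Let VV (z : tw) := \sum_i (win 0 T z.1 * (v z.1 z.2 - u z.1 z.2) i 0) ^+ 2.

Let lower z := GXX z + \int[P]_w' GMX (z, w') + cv * VV z + c1 * XX z + c2 * \int[P]_w' XXh (z, w').
Let upper z := running Z v z - running Y u z + \sum_i cc i z + \sum_i \int[lam]_e kk i (z, e).

Lemma pointwise_comparison : {ae dtP P, forall z, lower z <= upper z}.
Proof.
apply: filterS3 jump_ae foc_ae sqE_ae => z hj1 hf1 hr1.
have [w0|[w1 zT]] := win_cases T z.1.
  rewrite /lower /upper /running /GXX /XX /VV w0 !mul0r.
  rewrite (_ : (fun w' => GMX (z, w')) = fun=> 0); last by apply/funext => w'; rewrite /GMX/= w0; apply: big1 => i _; rewrite !mul0r.
  rewrite (_ : (fun w' => XXh (z, w')) = fun=> 0); last by apply/funext => w'; rewrite /XXh/= w0; apply: big1 => i _; rewrite mul0r expr0n.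
  rewrite !Rint0 !big1 ?mulr0 ?subrr ?addr0// => i _; rewrite ?mul0r ?expr0n//.
  - by rewrite -[RHS](Rint0 lam); apply: eq_Rintegral => e _; rewrite /kk /wr/= w0 !mul0r.
  - by rewrite /cc w0 !mul0r add0r big1// => j _; rewrite !mul0r.
have ht : 0 <= (z.1 : R) <= T by have /andP[/ltW -> ->] := zT.
have := pointwise_expansion hL hA1 hA2 hA3 hA hbA hsA hg hfj hf ht (Z z.1 z.2) (v z.1 z.2)
   (cadlag_sqi hn cY ht) (cadlag_sqi hn cZ ht) (hr1 zT) (hf1 zT) hlam0 hA4.
rewrite (hj1 zT) (coef_sum zT).
have hrem := remainder_sum (L := L) hlam0 (andP (A3_L0 hA3)).1 (andP (A3_L1 hA3)).1 (andP (A3_L2 hA3)).1 (A3_d0 hA3)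
  (enorm (Z z.1 z.2 - Y z.1 z.2)) (nrmL2 P (fun w => Z z.1 w - Y z.1 w)) (v z.1 z.2 - u z.1 z.2) eta0.
move=> hpt; rewrite /lower /upper /running w1 !mul1r.
have eXX : XX z = sqn (Z z.1 z.2 - Y z.1 z.2).
  by rewrite /XX sqnE; apply: eq_bigr => i _; rewrite w1 mul1r !mxE.
have eVV : VV z = sqn (v z.1 z.2 - u z.1 z.2) by rewrite /VV sqnE; apply: eq_bigr => i _; rewrite w1 mul1r.
have eXXh : \int[P]_w' XXh (z, w') = nrmL2 P (fun w => Z z.1 w - Y z.1 w) ^+ 2.
  rewrite nrmL2_sqr; apply: eq_Rintegral => w _; rewrite /XXh/= sqnE; apply: eq_bigr => i _.
  by rewrite w1 mul1r !mxE.
have eGX : GXX z = dot (GX z.1 z.2) (Z z.1 z.2 - Y z.1 z.2).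
  by rewrite /GXX dotE; apply: eq_bigr => i _; rewrite w1 !mul1r !mxE.
have eGM : \int[P]_w' GMX (z, w') = \int[P]_w' dot (GM z.1 z.2 (Y z.1 w')) (Z z.1 w' - Y z.1 w').
  by apply: eq_Rintegral => w _; rewrite /GMX/= dotE; apply: eq_bigr => i _; rewrite w1 !mul1r !mxE.
rewrite eXX eVV eXXh eGX eGM.
apply: le_trans hpt; move: hrem; rewrite /cv /c1 /c2 -/C -/(GX _ _) enorm_sqr.
set S := \sum_(i | _) _; set I := \int[P]_w _; move: S I => S I hrem.
rewrite -subr_ge0; move: hrem; rewrite -subr_ge0 => hrem; apply: le_trans hrem _.
rewrite le_eqVlt; apply/orP; left; apply/eqP.
move: (sqn (Z _ _ - _)) (sqn (v _ _ - _)) (nrmL2 _ _ ^+ 2) (dot _ _) (NN) (C / 2) (eta^-1) => s1 s2 s3 s4 s5 s6 s7.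
ring.
Qed.

Lemma intg_GXX : intg (dtP P) GXX.
Proof. by apply: intg_sum => i; apply: L2f_mul; [exact: Gx_L2|exact: state_diff_L2]. Qed.
Lemma intg_GMX : intg (dtPP P) GMX.
Proof. by apply: intg_sum => i; apply: L2f_mul; [exact: Gm_L2|exact: state_diff_copy_L2]. Qed.
Lemma intg_XX : intg (dtP P) XX. Proof. by apply: intg_sum => i; exact: (state_diff_L2 i).2. Qed.
Lemma intg_XXh : intg (dtPP P) XXh. Proof. by apply: intg_sum => i; exact: (state_diff_copy_L2 i).2. Qed.
Lemma intg_VV : intg (dtP P) VV. Proof. by apply: intg_sum => i; exact: (control_diff_L2 i).2. Qed.

Lemma XX_copy : \int[dtPP P]_y XXh y = \int[dtP P]_z XX z.
Proof.
have I1 : intg (dtPP P) (fun y => XX y.1).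
  by apply: intg_sum => i; exact: (L2f_lift (state_diff_L2 i)).2.
transitivity (\int[dtPP P]_y XX y.1); first exact: (Rint_swap P (intg_meas I1)).
have [_ <- _] := @sfprod_intg _ _ _ _ _ (dtP P) P _ I1.
apply: eq_Rintegral => z _; rewrite /= Rintegral_cst// -[RHS]mulr1; congr (_ * _).
by rewrite -[RHS]/(fine 1%:E); congr fine; exact: probability_setT.
Qed.

(** In the driver the hatted variables are averaged out and the increment of the state sits on the
    original path. Exchanging path and copy puts the increment on the copy, where the law terms of
    the convexity assumption have it. *)
Lemma adjoint_pairing i : \int[dtP P]_z (win 0 T z.1 * Xd i z * adjoint_drift i z) =
  \int[dtP P]_z ((win 0 T z.1 * GX z.1 z.2 i 0) * (win 0 T z.1 * Xd i z)) +
  \int[dtPP P]_y ((win 0 T y.1.1 * GM y.1.1 y.1.2 (Y y.1.1 y.2) i 0) * (win 0 T y.1.1 * Xd i (y.1.1, y.2))).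
Proof.
have I1 : intg (dtP P) (fun z => (win 0 T z.1 * GX z.1 z.2 i 0) * (win 0 T z.1 * Xd i z)).
  by apply: L2f_mul; [exact: Gx_L2|exact: state_diff_L2].
have I2 : intg (dtPP P) (fun y => (win 0 T y.1.1 * GM y.1.1 y.1.2 (Y y.1.1 y.2) i 0) * (win 0 T y.1.1 * Xd i (y.1.1, y.2))).
  by apply: L2f_mul; [exact: Gm_L2|exact: state_diff_copy_L2].
have I3 : intg (dtPP P) (fun y => win 0 T y.1.1 * Xd i y.1 * GM_swap i y).
  by apply: L2f_mul; [exact: (L2f_lift (state_diff_L2 i))|exact: Gm_swap_L2].
have [J1 E1 _] := @sfprod_intg _ _ _ _ _ (dtP P) P _ I3.
have [_ _ A1] := @sfprod_intg _ _ _ _ _ (dtP P) P _ (win_copy_intg (Gm_swap_L2 i)).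
have LM : L2f (dtP P) (fun z => \int[P]_w' GM_swap i (z, w')).
  by apply: (@marginal_L2 _ _ _ _ _ (dtP P) P (GM_swap i)); [apply: win_copy_intg; exact: Gm_swap_L2|exact: Gm_swap_L2].
have I4 : intg (dtP P) (fun z => win 0 T z.1 * Xd i z * \int[P]_w' GM_swap i (z, w')) by apply: L2f_mul; [exact: state_diff_L2|exact: LM].
have E2 : \int[dtPP P]_y ((win 0 T y.1.1 * GM y.1.1 y.1.2 (Y y.1.1 y.2) i 0) * (win 0 T y.1.1 * Xd i (y.1.1, y.2))) =
    \int[dtPP P]_y (win 0 T y.1.1 * Xd i y.1 * GM_swap i y).
  rewrite -(Rint_swap P (intg_meas I2)); apply: eq_Rintegral => y _.
  by rewrite /swap_copy /GM_swap/= mulrC.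
rewrite E2 -E1.
transitivity (\int[dtP P]_z ((win 0 T z.1 * GX z.1 z.2 i 0) * (win 0 T z.1 * Xd i z) + win 0 T z.1 * Xd i z * \int[P]_w' GM_swap i (z, w'))).
  by apply: eq_Rintegral => z _; rewrite /adjoint_drift mulrDr; congr (_ + _); rewrite mulrC.
rewrite RintD//; congr (_ + _); apply: Rint_ae_eq; [exact: intg_meas I4|exact: intg_meas J1|].
by apply: filterS A1 => z hz; exact: (esym (RintZ _ hz)).
Qed.

(** After integration the mean-field square [XXh] has the same integral as [XX], so [c1] and [c2]
    only enter through their sum: this is why [lamx + lamm] is the constant that matters. *)
Lemma integrated_comparison : cv * \int[dtP P]_z VV z + (c1 + c2) * \int[dtP P]_z XX z <=
  \int[dtP P]_z running Z v z - \int[dtP P]_z running Y u z + \sum_i \int[P]_w (p T w i 0 * (Z T w i 0 - Y T w i 0)).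
Proof.
have [M1 e1 _] := @sfprod_intg _ _ _ _ _ (dtP P) P _ intg_GMX.
have [M2 e2 _] := @sfprod_intg _ _ _ _ _ (dtP P) P _ intg_XXh.
have IZ := running_intg hZ hv; have IY := running_intg hY hu.
have kI i : intg (dtP P) (fun z => \int[lam]_e kk i (z, e)) /\ \int[dtP P]_z (\int[lam]_e kk i (z, e)) = \int[dtPl P lam]_z kk i z.
  have [_ _ k1 _] := pair_expansion i.
  by have [k2 k3 _] := @sfprod_intg _ _ _ _ _ (dtP P) lam _ k1.
have cI i : intg (dtP P) (cc i) by have [] := pair_expansion i.
have Icc : intg (dtP P) (fun z => \sum_i cc i z) by exact: intg_sum.
have Ikk : intg (dtP P) (fun z => \sum_i \int[lam]_e kk i (z, e)) by apply: intg_sum => i; exact: (kI i).1.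
have IGs := intgD intg_GXX M1; have IGv := intgD IGs (intgZ cv intg_VV); have IGx := intgD IGv (intgZ c1 intg_XX).
have Il : intg (dtP P) lower by exact: intgD IGx (intgZ c2 M2).
have Irr := intgB IZ IY; have Irc := intgD Irr Icc.
have Iu : intg (dtP P) upper by exact: intgD Irc Ikk.
have := Rint_ae_le Il Iu pointwise_comparison; rewrite /lower /upper.
rewrite (RintD IGx (intgZ c2 M2)) (RintD IGv (intgZ c1 intg_XX)) (RintD IGs (intgZ cv intg_VV)) (RintD intg_GXX M1).
rewrite (RintZ c2 M2) (RintZ c1 intg_XX) (RintZ cv intg_VV) e1 e2 XX_copy.
rewrite (RintD Irc Ikk) (RintD Irr Icc) (RintB IZ IY) (Rint_sum _ cI) (Rint_sum _ (fun i => (kI i).1)).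
have -> : \sum_i \int[P]_w (p T w i 0 * (Z T w i 0 - Y T w i 0)) =
   \sum_i \int[dtP P]_z cc i z - (\int[dtP P]_z GXX z + \int[dtPP P]_y GMX y) + \sum_i \int[dtP P]_z \int[lam]_e kk i (z, e).
  rewrite /GXX /GMX !Rint_sum//; last 2 first.
  - by move=> i; apply: L2f_mul; [exact: Gm_L2|exact: state_diff_copy_L2].
  - by move=> i; apply: L2f_mul; [exact: Gx_L2|exact: state_diff_L2].
  rewrite -big_split/= -sumrB -big_split/=; apply: eq_bigr => i _.
  by have [_ _ _ ->] := pair_expansion i; rewrite adjoint_pairing (kI i).2.
exact: rearrange_integrated.
Qed.

(** Convexity of [g] at each path, then the terminal condition of [p]. The mean-field term again
    needs Fubini, here on two copies of [Omega], to put the increment on the path where [p] is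
    evaluated. *)
Lemma terminal_bound : \sum_i \int[P]_w (p T w i 0 * (Z T w i 0 - Y T w i 0)) <= \int[P]_w terminal Z w - \int[P]_w terminal Y w.
Proof.
have qY := cadlag_sqi hn cY hTT; have qZ := cadlag_sqi hn cZ hTT.
have sX : sq_integrable P (fun w => Z T w - Y T w) by exact: sqiB.
pose mT := law P (Y T); pose D i (s : Omega * Omega) := grad (dg (Y T s.1) mT) (Y T s.2) i 0.
have lip1 : forall y, forall xs (x : X), xs k @[k --> \oo] --> x -> forall i, grad (dg (xs k) mT) y i 0 @[k --> \oo] --> grad (dg x mT) y i 0.
  move=> y; apply: (@seqcont_lipschitz _ _ _ (fun x => grad (dg x mT) y) L) => x x'.
  by apply: le_trans (A2_lipgy hA2 _ _ _ _ _ _) _; rewrite subrr enorm0 W2_refl !addr0.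
have lip2 : forall x, forall ys (y : X), ys k @[k --> \oo] --> y -> forall i, grad (dg x mT) (ys k) i 0 @[k --> \oo] --> grad (dg x mT) y i 0.
  move=> x; apply: (@seqcont_lipschitz _ _ _ (grad (dg x mT)) L) => y y'.
  by apply: le_trans (A2_lipgy hA2 _ _ _ _ _ _) _; rewrite subrr enorm0 W2_refl !add0r.
have mD i : measurable_fun setT (D i).
  apply: (@measurable_carath _ _ _ _ (fun (s : Omega * Omega) y => grad (dg (Y T s.1) mT) y i 0) (fun s => Y T s.2)) => [y|s ys y cy|].
  - apply: (@measurable_carath _ _ _ _ (fun (s : Omega * Omega) x => grad (dg x mT) y i 0) (fun s => Y T s.1)) => [x|s xs x cx|].
    + exact: measurable_cst.
    + exact: lip1.
    + exact: (measurableT_comp qY.1 measurable_fst).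
  - exact: lip2.
  - exact: (measurableT_comp qY.1 measurable_snd).
have lift1 (h : Omega -> R) : L2f P h -> L2f (sfprod P P) (fun s => h s.1).
  move=> [mh Ih]; split; first exact: (measurableT_comp mh measurable_fst).
  by have [hh _] := intg_prod_mul Ih (L2f_intg (L2f_cst P 1)); apply: eq_intg hh => s; rewrite mulr1.
have lift2 (h : Omega -> R) : L2f P h -> L2f (sfprod P P) (fun s => h s.2).
  move=> [mh Ih]; split; first exact: (measurableT_comp mh measurable_snd).
  by have [hh _] := intg_prod_mul (L2f_intg (L2f_cst P 1)) Ih; apply: eq_intg hh => s; rewrite mul1r.
have LD i : L2f (sfprod P P) (D i).
  have LB : L2f (sfprod P P) (fun s => L * (1 + mom2 mT) + L * enorm (Y T s.1) + L * enorm (Y T s.2)).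
    apply: L2fD; last exact: (lift2 _ (L2fZ L (sqi_L2f_enorm qY))).
    apply: L2fD; last exact: (lift1 _ (L2fZ L (sqi_L2f_enorm qY))).
    exact: (lift1 _ (L2f_cst P (L * (1 + mom2 mT)))).
  apply: (L2f_le _ _ LB) => // s; apply: le_trans (coord_le _ _) _; apply: le_trans (ler_norm _).
  by apply: le_trans (A2_bndgy hA2 _ _ _) _; rewrite le_eqVlt; apply/orP; left; apply/eqP; ring.
have Lx i : L2f P (fun w => Z T w i 0 - Y T w i 0) by apply: L2fB; exact: sqi_L2f.
have Ih i : intg (sfprod P P) (fun s => D i s * (Z T s.2 i 0 - Y T s.2 i 0)).
  by apply: L2f_mul => //; exact: (lift2 _ (Lx i)).
have [J1 E1 B1] : [/\ intg P (fun w => \int[P]_w' \sum_i D i (w, w') * (Z T w' i 0 - Y T w' i 0)),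
    \int[P]_w \int[P]_w' \sum_i D i (w, w') * (Z T w' i 0 - Y T w' i 0) = \int[sfprod P P]_s \sum_i D i s * (Z T s.2 i 0 - Y T s.2 i 0)
    & {ae P, forall w, intg P (fun w' => \sum_i D i (w, w') * (Z T w' i 0 - Y T w' i 0))}].
  by apply: (@sfprod_intg _ _ _ _ _ P P); exact: intg_sum.
have sG : sq_integrable P (fun w => grad (fun x => g x mT) (Y T w)).
  apply: (@sqi_seqcont _ _ _ _ _ (grad (fun x => g x mT)) (Y T) (L * (1 + mom2 mT)) L) => //.
    apply: (@seqcont_lipschitz _ _ _ _ L) => y y'; apply: le_trans (A2_lipg hA2 _ _ _ _) _.
    by rewrite W2_refl addr0.
  by move=> y; apply: le_trans (A2_bndg hA2 _ _) _; rewrite le_eqVlt; apply/orP; left; apply/eqP; ring.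
have IG := sqi_dot_intg sG sX.
have low : \int[P]_w dot (grad (fun x => g x mT) (Y T w)) (Z T w - Y T w) + \int[P]_w \int[P]_w' \sum_i D i (w, w') * (Z T w' i 0 - Y T w' i 0)
    <= \int[P]_w terminal Z w - \int[P]_w terminal Y w.
  rewrite -RintD// -RintB; [|exact: (terminal_intg hZ)|exact: (terminal_intg hY)].
  apply: Rint_le => [||w]; [exact: intgD|by apply: intgB; [exact: (terminal_intg hZ)|exact: (terminal_intg hY)]|].
  have := A4_g hA4 (Y T w) (Z T w) qY qZ; rewrite /terminal -/mT; apply: le_trans; rewrite lerD2l.
  rewrite le_eqVlt; apply/orP; left; apply/eqP; apply: eq_Rintegral => w' _.
  by rewrite dotE; apply: eq_bigr => i _; congr (_ * _); rewrite !mxE.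
apply: le_trans low; rewrite le_eqVlt; apply/orP; left; apply/eqP.
have K i := @sfprod_intg2 _ _ _ _ _ P P _ (Ih i).
have KD i : {ae P, forall w, intg P (fun w' => D i (w', w))}.
  have ID : intg (sfprod P P) (D i).
    by have := L2f_mul (lift1 _ (L2f_cst P 1)) (LD i); apply: eq_intg => s; rewrite mul1r.
  by have [_ _] := @sfprod_intg2 _ _ _ _ _ P P _ ID.
rewrite E1 Rint_sum//.
have Ip i : intg P (fun w => p T w i 0 * (Z T w i 0 - Y T w i 0)).
  by apply: L2f_mul => //; exact: (cs_L2 hn (cp i)).
have Ig i : intg P (fun w => grad (fun x => g x mT) (Y T w) i 0 * (Z T w i 0 - Y T w i 0)).
  by apply: L2f_mul => //; exact: sqi_L2f.
have -> : \int[P]_w dot (grad (fun x => g x mT) (Y T w)) (Z T w - Y T w) = \sum_i \int[P]_w (grad (fun x => g x mT) (Y T w) i 0 * (Z T w i 0 - Y T w i 0)).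
  rewrite -Rint_sum//; apply: eq_Rintegral => w _; rewrite dotE; apply: eq_bigr => i _; congr (_ * _); by rewrite !mxE.
rewrite -big_split/=; apply: eq_bigr => i _.
have [K1 <- _] := K i.
rewrite -RintD//; apply: Rint_ae_eq; [exact: intg_meas (Ip i)|exact: intg_meas (intgD (Ig i) K1)|].
apply: filterS2 adjoint_terminal (KD i) => w -> hw.
rewrite mxE [X in _ + X]mxE mulrDl; congr (_ + _); rewrite mulrC -RintZ//.
by apply: eq_Rintegral => w' _; rewrite mulrC.
Qed.

Lemma cost_comparison : cv * \int[dtP P]_z VV z + (c1 + c2) * \int[dtP P]_z XX z <=
  (\int[dtP P]_z running Z v z + \int[P]_w terminal Z w) - (\int[dtP P]_z running Y u z + \int[P]_w terminal Y w).
Proof.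
exact: rearrange_costs integrated_comparison terminal_bound.
Qed.

End comparison.

End solution.

(** * Optimality and uniqueness *)

Section optimality.
Context {R : realType} {disp : measure_display} {Omega : measurableType disp}.
Context (P : probability Omega R) (T : R) (F : R -> set (set Omega)) (hT : 0 < T).
Context {n kappa : nat} (B : R -> Omega -> 'cV[R]_n).
Context (lam : {sigma_finite_measure set 'cV[R]_kappa -> \bar R}).
Context (N : Omega -> {measure set (R * 'cV[R]_kappa)%type -> \bar R}).
Hypothesis hn : noise_setting P T F B lam N.
Context {dj : 'I_n.+1 -> nat}.
Local Notation X := 'cV[R]_n.
Local Notation V := 'cV[R]_(\sum_j dj j).
Local Notation tw := (measurableTypeR R * Omega)%type.
Context (b : R -> X -> P2 R n -> V -> X) (db : R -> X -> P2 R n -> V -> X -> X).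
Context (sigma : R -> X -> P2 R n -> V -> 'M[R]_n) (dsigma : R -> X -> P2 R n -> V -> X -> 'M[R]_n).
Context (gamma : R -> X -> P2 R n -> V -> 'cV[R]_kappa -> X) (dgamma : R -> X -> P2 R n -> V -> X -> 'cV[R]_kappa -> X).
Context (f : R -> X -> P2 R n -> V -> R) (df : R -> X -> P2 R n -> V -> X -> R).
Context (g : X -> P2 R n -> R) (dg : X -> P2 R n -> X -> R).
Context (L L0 L1 L2 lam0 lamv lamx lamm : R) (hL : 0 < L).
Hypothesis hA1 : assumption_A1 T L lam b db sigma dsigma gamma dgamma.
Hypothesis hA2 : assumption_A2 T L f df g dg.
Hypothesis hA3 : assumption_A3 T L L0 L1 L2 lam0 lam b sigma gamma f.
Hypothesis hA4 : assumption_A4 P T lamv lamx lamm f df g dg.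
Hypothesis hCi : L ^+ 2 * L2 / lam0 < 2 * lamv.
Hypothesis hCii : 4 * (nctrl dj).+1%:R * L ^+ 4 * L1 ^+ 2 / lam0 ^+ 2 <
     (2 * lamv - L ^+ 2 * L2 / lam0) *
     (2 * lamx + 2 * lamm - 5 * (nctrl dj).+1%:R * L ^+ 2 * L0 / lam0).
Context (xi : Omega -> X) (Y p : R -> Omega -> X) (q : R -> Omega -> 'M[R]_n).
Context (r : R -> Omega -> 'cV[R]_kappa -> X) (u : R -> Omega -> V).
Hypothesis hsol : FBSDE_solution P T F B lam N b db sigma dsigma gamma dgamma f df g dg
     xi Y p q r u.

(** Keeping the gap as a real number [delta] bounded below by the squared distance of the controls
    serves both claims: a nonnegative distance gives optimality, a nonpositive gap gives
    uniqueness. *)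
Lemma optimality_gap : [/\ state_process P T F B lam N b sigma gamma xi u Y,
  cost P T f g Y u \is a fin_num & exists2 c : R, 0 < c &
  forall v Z, M2 P T F v -> state_process P T F B lam N b sigma gamma xi v Z ->
  exists2 delta : R, cost P T f g Z v = (cost P T f g Y u + delta%:E)%E &
  c * \int[dtP P]_z (\sum_i (win 0 T z.1 * (v z.1 z.2 - u z.1 z.2) i 0) ^+ 2) <= delta].
Proof.
have [hY hp _ _ hu hfwd hback hfoc] := hsol.
have [d0 /andP[hL0 _] /andP[hL1 _] /andP[hL2 _] hlam0 [A [dA [hA hbA hsA]]] _ [g0 [g1 [g2 hg]]] [fj [dfj [hfj hf]]]] := hA3.
have h0T : 0 <= (0 : R) <= T by rewrite lexx ltW.
have Lq i j : L2f (dtP P) (fun z => win 0 T z.1 * q z.1 z.2 i j).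
  have [I [K [hI _ _]]] := hback _ h0T.
  by have [+ _ _ _] := ito_stint hn (lexx 0) (ltW hT) (lexx T) i hI; apply.
have Lr k : L2f (dtPl P lam) (fun z => win 0 T z.1.1 * (\1_(jumpE R kappa) z.2 * r z.1.1 z.1.2 z.2 k 0)).
  have [I [K [_ hK _]]] := hback _ h0T.
  by have [_ + _ _] := jump_stint hn (lexx 0) (ltW hT) (lexx T) k hK; apply.
have eY := costE hT hn hA2 hY hu.
split.
- exact: (forward_state hT hn hA1 hg hY hu hfwd).
- by rewrite eY.
pose C := L ^+ 2 / lam0.
have hi : C * L2 < 2 * lamv by rewrite /C mulrAC.
(* (C-ii) with [C = L^2 / lam0], the constant of the adjoint bound. *)
have hii : 4 * (nctrl dj).+1%:R * C ^+ 2 * L1 ^+ 2 < (2 * lamv - C * L2) * (2 * (lamx + lamm) - 5 * (nctrl dj).+1%:R * C * L0).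
  move: hCii; congr (_ < _); rewrite /C; field; exact: lt0r_neq0.
have [eta eta0 [k1 k2]] := young_weight hlam0 hL1 hi hii.
(* Half of the slack that the Young weight leaves in (C-i). *)
exists (lamv - C / 2 * (L1 * eta + L2)).
  rewrite (_ : _ - _ = (2 * lamv - C * L2 - C * L1 * eta) / 2); last by field.
  by rewrite divr_gt0// subr_gt0.
move=> v Z hv hst.
have cmp := cost_comparison hT hn hL hA1 hA2 hg hY hp hu Lq Lr hback hA3 hA hbA hsA hfj hf hlam0 hA4 hfoc hfwd hv hst eta0.
have eZ := costE hT hn hA2 hst.1 hv.
rewrite eY eZ.
eexists; last first.
  apply: le_trans cmp; rewrite lerDl; apply: mulr_ge0; last first.
    by apply: Rint_ge0 => z; apply: sumr_ge0 => i _; exact: sqr_ge0.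
  (* The coefficient of the state term is half of [2 (lamx + lamm) - 5 NN C L0 - 4 NN C L1 / eta],
     nonnegative by the choice of [eta]; that term is dropped. *)
  move: k2; set NN : R := (nctrl dj).+1%:R => k2; have -> : 2 / eta = 2 * eta^-1 by [].
  move: k2; rewrite -/C; lra.
by rewrite -EFinD [X in _ = X%:E]addrC subrK.
Qed.

Lemma control_ae_eq (u' : R -> Omega -> V) : M2 P T F u -> M2 P T F u' ->
  \int[dtP P]_z (\sum_i (win 0 T z.1 * (u' z.1 z.2 - u z.1 z.2) i 0) ^+ 2) <= 0 ->
  {ae dtP P, forall z : tw, 0 <= (z.1 : R) <= T -> u' z.1 z.2 = u z.1 z.2}.
Proof.
move=> hu hu' h0.
have LD i : L2f (dtP P) (fun z => win 0 T z.1 * (u' z.1 z.2 - u z.1 z.2) i 0).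
  have := L2fB (M2_L2 hT hn i 0 hu') (M2_L2 hT hn i 0 hu).
  by congr (L2f _ _); apply/funext => z; rewrite !mxE mulrBr.
have zero i : {ae dtP P, forall z : tw, win 0 T z.1 * (u' z.1 z.2 - u z.1 z.2) i 0 = 0}.
  apply: n2_eq0; [exact: LD|apply/eqP; rewrite eq_le n2_ge0 andbT /n2].
  apply: le_trans h0; apply: Rint_le => [||z]; first exact: (LD i).2.
    by apply: intg_sum => k; exact: (LD k).2.
  by rewrite (bigD1 i)//= lerDl; apply: sumr_ge0 => k _; exact: sqr_ge0.
have zeros : {ae dtP P, forall (z : tw) i, win 0 T z.1 * (u' z.1 z.2 - u z.1 z.2) i 0 = 0} by exact: filter_forall.
(* The window excludes the time 0, which is discarded as a null set. *)
have pos : {ae dtP P, forall z : tw, (z.1 : R) <> 0} := @sfprod_ae_fst _ _ _ _ _ lebesgue_measure P (fun t => t <> 0) (lebesgue_ae_neq 0).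
move: zeros pos; apply: filterS2 => z hz z0 /andP[t0 tT]; apply/colP => i; have := hz i.
have [w0|[-> _]] := win_cases T z.1; last by rewrite mul1r !mxE => /eqP; rewrite subr_eq0 => /eqP.
have : win 0 T z.1 = 1 :> R; last by rewrite w0 => /esym/eqP; rewrite oner_eq0.
by rewrite /win lt_neqAle eq_sym (introF eqP z0) t0 tT.
Qed.

End optimality.

Theorem theorem4p2 (R : realType)
  (* horizon, probability space, filtration, noises *)
  (T : R) (hT : 0 < T)
  (disp : measure_display) (Omega : measurableType disp)
  (P : probability Omega R) (F : R -> set (set Omega))
  (n kappa : nat) (B : R -> Omega -> 'cV[R]_n)
  (lam : {sigma_finite_measure set 'cV[R]_kappa -> \bar R})
  (N : Omega -> {measure set (R * 'cV[R]_kappa)%type -> \bar R})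
  (hnoise : noise_setting P T F B lam N)
  (* coefficients and their linear functional-derivatives; d = \sum_j dj j *)
  (dj : 'I_n.+1 -> nat)
  (b : R -> 'cV[R]_n -> P2 R n -> 'cV[R]_(\sum_j dj j) -> 'cV[R]_n)
  (db : R -> 'cV[R]_n -> P2 R n -> 'cV[R]_(\sum_j dj j) -> 'cV[R]_n -> 'cV[R]_n)
  (sigma : R -> 'cV[R]_n -> P2 R n -> 'cV[R]_(\sum_j dj j) -> 'M[R]_n)
  (dsigma : R -> 'cV[R]_n -> P2 R n -> 'cV[R]_(\sum_j dj j) -> 'cV[R]_n ->
     'M[R]_n)
  (gamma : R -> 'cV[R]_n -> P2 R n -> 'cV[R]_(\sum_j dj j) -> 'cV[R]_kappa ->
     'cV[R]_n)
  (dgamma : R -> 'cV[R]_n -> P2 R n -> 'cV[R]_(\sum_j dj j) -> 'cV[R]_n ->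
     'cV[R]_kappa -> 'cV[R]_n)
  (f : R -> 'cV[R]_n -> P2 R n -> 'cV[R]_(\sum_j dj j) -> R)
  (df : R -> 'cV[R]_n -> P2 R n -> 'cV[R]_(\sum_j dj j) -> 'cV[R]_n -> R)
  (g : 'cV[R]_n -> P2 R n -> R)
  (dg : 'cV[R]_n -> P2 R n -> 'cV[R]_n -> R)
  (* constants and assumptions *)
  (L L0 L1 L2 lam0 lamv lamx lamm : R) (hL : 0 < L)
  (hA1 : assumption_A1 T L lam b db sigma dsigma gamma dgamma)
  (hA2 : assumption_A2 T L f df g dg)
  (hA3 : assumption_A3 T L L0 L1 L2 lam0 lam b sigma gamma f)
  (hA4 : assumption_A4 P T lamv lamx lamm f df g dg)
  (hCi : L ^+ 2 * L2 / lam0 < 2 * lamv)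
  (hCii : 4 * (nctrl dj).+1%:R * L ^+ 4 * L1 ^+ 2 / lam0 ^+ 2 <
     (2 * lamv - L ^+ 2 * L2 / lam0) *
     (2 * lamx + 2 * lamm - 5 * (nctrl dj).+1%:R * L ^+ 2 * L0 / lam0))
  (* initial condition and solution of the system *)
  (xi : Omega -> 'cV[R]_n)
  (hxi0 : meas_wrt (F 0) xi) (hxi : sq_integrable P xi)
  (Y p : R -> Omega -> 'cV[R]_n) (q : R -> Omega -> 'M[R]_n)
  (r : R -> Omega -> 'cV[R]_kappa -> 'cV[R]_n)
  (u : R -> Omega -> 'cV[R]_(\sum_j dj j))
  (hsol : FBSDE_solution P T F B lam N b db sigma dsigma gamma dgamma f df g dg
     xi Y p q r u) :
  optimal_control P T F B lam N b sigma gamma f g xi u /\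
  forall u' : R -> Omega -> 'cV[R]_(\sum_j dj j),
    optimal_control P T F B lam N b sigma gamma f g xi u' ->
    {ae (lebesgue_measure \x P)%E, forall z : R * Omega,
      0 <= z.1 <= T -> u' z.1 z.2 = u z.1 z.2}.
Proof.
have hu := sol_u hsol.
have [hst cfin [c c0 gap]] := optimality_gap hT hnoise hL hA1 hA2 hA3 hA4 hCi hCii hsol.
split.
  split; first exact: hu.
  exists Y; first exact: hst.
  move=> v Z hv hZ; have [delta -> hd] := gap v Z hv hZ.
  rewrite leeDl// lee_fin; apply: le_trans hd; rewrite pmulr_rge0//.
  by apply: Rint_ge0 => z; apply: sumr_ge0 => i _; exact: sqr_ge0.
move=> u' [hu' [Z hZ opt]]; have [delta e hd] := gap u' Z hu' hZ.
(* The control [u] is itself a competitor of the optimal [u'], so its cost is not smaller; the cost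
   of [u] is finite, so [delta] can be isolated. *)
have delta0 : delta <= 0.
  by have := opt u Y hu hst; rewrite e -(fineK cfin) -EFinD lee_fin gerDl.
suff h0 : \int[dtP P]_z (\sum_i (win 0 T z.1 * (u' z.1 z.2 - u z.1 z.2) i 0) ^+ 2) <= 0.
  exact: (control_ae_eq hT hnoise hu hu' h0).
have : c * \int[dtP P]_z (\sum_i (win 0 T z.1 * (u' z.1 z.2 - u z.1 z.2) i 0) ^+ 2) <= 0 by exact: le_trans hd delta0.
by rewrite pmulr_rle0.
Qed.
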